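(* Consider a transducer over alphabet $[0..\sigma)$ with set of states $[0..q)$, where $\sigma,q\in2^{O(w)}$, and $t=O(1)$ input streams. If the transition function can be evaluated in $O(1)$ time, then, for any $N\in[2..2^w]$, after an $O(qN)$-time preprocessing, the following holds. Let $S_1,\dots,S_t$ be input strings of common length $n\in2^{O(w)}$ for which the transducer produces output $T$. Then $\mathrm{senc}(T)$ can be computed from $\mathrm{senc}(S_1),\dots,\mathrm{senc}(S_t)$ in $O\left(1+\left(|\mathrm{senc}(T)|+\sum_{i=1}^t|\mathrm{senc}(S_i)|\right)/\lg N\right)$ time.
   Context: Model: word RAM with machine words of $w$ bits; bitmasks are stored packed. $[i..j]=\{h\in\mathbb Z:i\le h\le j\}$, $[i..j)=[i..j-1]$, $\lg x=\log_2\max(1,x)$. Transducer: a (deterministic finite-state) transducer with $t$ input streams consists of a finite set $Q$ of states, an initial state $s_0\in Q$, a finite alphabet $\Sigma$, and a transition function $\delta:Q\times\Sigma^t\to Q\times\Sigma$. Given input strings $S_1,\dots,S_t$ of common length $n$ over $\Sigma$, it produces an output string $T$ of length $n$ over $\Sigma$: for $i=0,\dots,n-1$, $\delta(s_i,S_1[i],\dots,S_t[i])=(s_{i+1},T[i])$. Elias-$\gamma$ code: for $x\in\mathbb Z_+$, $\gamma(x)=\mathtt0^{\ell}\cdot X$, where $\ell=\lfloor\log_2x\rfloor$ and $X$ is the $(\ell+1)$-bit binary representation of $x$ (most significant bit first). Sparse encoding: for a string $A$ of non-negative integers, $\mathrm{senc}(A)$ is the bitmask encoding $A$ from left to right as follows: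 each symbol $u>0$ is stored as a literal token $\mathtt1\cdot\gamma(u)$, and each inclusion-wise maximal fragment of the form $0^x$, $x\in\mathbb Z_+$, is stored as a zero-run token $\mathtt0\cdot\gamma(x)$. $|\mathrm{senc}(A)|$ is its length in bits. *)

(* Defs.v *)
From Stdlib Require Import NArith Reals List.
Import ListNotations.

Open Scope N_scope.

(** * Transducers *)

(* States are [0..q), the alphabet is [0..sigma), and there are [t] input
   streams.  [tr_step] is a total function on [N]; only its values on
   legal arguments are constrained (and relevant). *)
Record transducer (t : nat) (sigma q : N) := {
  tr_init : N;
  tr_step : N -> list N -> N * N;
  tr_init_lt : tr_init < q;
  tr_step_lt : forall s x,
    s < q -> length x = t -> Forall (fun a => a < sigma) x ->
    fst (tr_step s x) < q /\ snd (tr_step s x) < sigma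
}.
Arguments tr_init {t sigma q}.
Arguments tr_step {t sigma q}.

Definition produces {t : nat} {sigma q : N} (M : transducer t sigma q)
    (n : nat) (Ss : list (list N)) (T : list N) : Prop :=
  length T = n /\
  exists s : nat -> N,
    s 0%nat = tr_init M /\
    forall i, (i < n)%nat ->
      tr_step M (s i) (map (fun S => nth i S 0) Ss) = (s (S i), nth i T 0).

(** * Sparse encoding *)

Definition gamma (x : N) : list bool :=
  let l := N.to_nat (N.log2 x) in
  repeat false l ++ map (fun i => N.testbit x (N.of_nat i)) (rev (seq 0 (S l))).

Definition literal_token (u : N) : list bool := true :: gamma u.

(* [z = 0] means that there is no pending run, hence no token. *)
Definition zero_run_token (z : N) : list bool :=
  if z =? 0 then [] else false :: gamma z.

(* [z] is the number of zeros read since the last nonzero symbol. *)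
Fixpoint senc_from (z : N) (A : list N) : list bool :=
  match A with
  | [] => zero_run_token z
  | u :: A' =>
      if u =? 0 then senc_from (z + 1) A'
      else zero_run_token z ++ literal_token u ++ senc_from 0 A'
  end.

Definition senc (A : list N) : list bool := senc_from 0 A.

(** * Word RAM *)

(* Programs use finitely many registers and finitely many arrays; each register
   and each array cell is a word, i.e. a number below [2 ^ w].  (A fixed number
   of arrays can be interleaved in a single memory.)

   States and symbols of the transducer, string lengths and hence also memory
   addresses are in [2 ^ O(w)], so they occupy a constant number of words, not
   necessarily one.  Therefore the address of a memory access, and the operands
   and results of an evaluation of the transition function, are given by lists
   of registers, read as base-[2 ^ w] numbers, least significant word first.
   All arithmetic is on single words. *)

Definition reg := nat.
Definition arr := nat.

Record state := { regs : reg -> N; mem : arr -> N -> N }.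

Definition wf_state (w : N) (st : state) : Prop :=
  (forall r, regs st r < 2 ^ w) /\ (forall k a, mem st k a < 2 ^ w).

Definition set_reg (st : state) (d : reg) (v : N) : state :=
  {| regs := fun r => if Nat.eqb r d then v else regs st r;
     mem := mem st |}.

Definition set_mem (st : state) (k : arr) (a v : N) : state :=
  {| regs := regs st;
     mem := fun k' a' => if (Nat.eqb k' k && (a' =? a))%bool then v
                         else mem st k' a' |}.

Fixpoint get_num (w : N) (st : state) (rs : list reg) : N :=
  match rs with
  | [] => 0
  | r :: rs' => regs st r + 2 ^ w * get_num w st rs'
  end.

Fixpoint set_num (w : N) (st : state) (rs : list reg) (v : N) : state :=
  match rs with
  | [] => st
  | r :: rs' => set_num w (set_reg st r (v mod 2 ^ w)) rs' (v / 2 ^ w)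
  end.

Inductive binop :=
  | Add | Sub | Mul | Div | Mod | And | Or | Xor | Shl | Shr | Eq | Lt.

(* Subtraction wraps around; division by zero gives 0. *)
Definition eval_binop (w : N) (o : binop) (a b : N) : N :=
  match o with
  | Add => (a + b) mod 2 ^ w
  | Sub => (a + 2 ^ w - b) mod 2 ^ w
  | Mul => (a * b) mod 2 ^ w
  | Div => a / b
  | Mod => a mod b
  | And => N.land a b
  | Or => N.lor a b
  | Xor => N.lxor a b
  | Shl => N.shiftl a b mod 2 ^ w
  | Shr => N.shiftr a b
  | Eq => if a =? b then 1 else 0
  | Lt => if a <? b then 1 else 0
  end.

Inductive prog :=
  | Skip
  | Const (d : reg) (v : N)
  | Op (o : binop) (d a b : reg)
  | Read (d : reg) (k : arr) (addr : list reg)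
  | Write (k : arr) (addr : list reg) (a : reg)
  | Delta (s' y : list reg) (s : list reg) (xs : list (list reg))
      (* (s', y) := delta (s, xs) *)
  | Seq (p1 p2 : prog)
  | If (r : reg) (p1 p2 : prog)
  | While (r : reg) (p : prog).

(* [exec w delta tau p st T st']: on words of [w] bits, [p] started in [st]
   halts in [st'] after time [T].  Every instruction and every test takes unit
   time, except that an evaluation of [delta] takes time [tau]. *)
Inductive exec (w : N) (delta : N -> list N -> N * N) (tau : nat) :
    prog -> state -> nat -> state -> Prop :=
  | exec_Skip st : exec w delta tau Skip st 1 st
  | exec_Const d v st :
      exec w delta tau (Const d v) st 1 (set_reg st d (v mod 2 ^ w))
  | exec_Op o d a b st :
      exec w delta tau (Op o d a b) st 1
        (set_reg st d (eval_binop w o (regs st a) (regs st b)))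
  | exec_Read d k addr st :
      exec w delta tau (Read d k addr) st 1
        (set_reg st d (mem st k (get_num w st addr)))
  | exec_Write k addr a st :
      exec w delta tau (Write k addr a) st 1
        (set_mem st k (get_num w st addr) (regs st a))
  | exec_Delta s' y s xs st :
      let r := delta (get_num w st s) (map (get_num w st) xs) in
      exec w delta tau (Delta s' y s xs) st tau
        (set_num w (set_num w st s' (fst r)) y (snd r))
  | exec_Seq p1 p2 st st1 st2 T1 T2 :
      exec w delta tau p1 st T1 st1 ->
      exec w delta tau p2 st1 T2 st2 ->
      exec w delta tau (Seq p1 p2) st (T1 + T2) st2
  | exec_If_true r p1 p2 st st' T :
      regs st r <> 0 ->
      exec w delta tau p1 st T st' ->
      exec w delta tau (If r p1 p2) st (S T) st'
  | exec_If_false r p1 p2 st st' T :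
      regs st r = 0 ->
      exec w delta tau p2 st T st' ->
      exec w delta tau (If r p1 p2) st (S T) st'
  | exec_While_true r p st st1 st2 T1 T2 :
      regs st r <> 0 ->
      exec w delta tau p st T1 st1 ->
      exec w delta tau (While r p) st1 T2 st2 ->
      exec w delta tau (While r p) st (S (T1 + T2)) st2
  | exec_While_false r p st :
      regs st r = 0 ->
      exec w delta tau (While r p) st 1 st.

(** * Input and output conventions *)

(* If [sigma], [q] and [n] are at most [2 ^ (c * w)], then the lengths of the
   sparse encodings (and all other parameters) fit in this many words. *)
Definition num_words (c : nat) : nat := 2 * c + 2.

(* The [j]-th block of [num_words c] registers. *)
Definition block (c j : nat) : list reg :=
  seq (j * num_words c) (num_words c).

(* Array [k] holds the bitmask [B], packed [w] bits per word, most significant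
   bit of each word first; bits after the end of [B] are unconstrained. *)
Definition holds_bitmask (w : N) (st : state) (k : arr) (B : list bool) : Prop :=
  forall i, (i < length B)%nat ->
    N.testbit (mem st k (N.of_nat i / w)) (w - 1 - N.of_nat i mod w)
    = nth i B false.

(* Arrays [0 .. t-1] hold the inputs of a query, array [t] its output, array
   [t+1] is scratch space, and the remaining ones belong to the data structure
   built by the preprocessing. *)
Definition same_data (t : nat) (st st' : state) : Prop :=
  forall k a, (t + 2 <= k)%nat -> mem st' k a = mem st k a.

Definition preprocessing_input {t : nat} {sigma q : N} (c : nat) (w NN : N)
    (M : transducer t sigma q) (st : state) : Prop :=
  wf_state w st /\
  get_num w st (block c 0) = w /\
  get_num w st (block c 1) = NN /\
  get_num w st (block c 2) = sigma /\
  get_num w st (block c 3) = q /\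
  get_num w st (block c 4) = tr_init M.

(* Nothing is assumed about a query's initial registers and arrays apart from
   the inputs and the data structure, so that queries can be repeated. *)
Definition query_input (t c : nat) (w : N) (Bs : list (list bool))
    (st0 st : state) : Prop :=
  wf_state w st /\
  same_data t st0 st /\
  forall i, (i < t)%nat ->
    get_num w st (block c i) = N.of_nat (length (nth i Bs [])) /\
    holds_bitmask w st i (nth i Bs []).

Definition query_output (t c : nat) (w : N) (B : list bool)
    (st0 st : state) : Prop :=
  same_data t st0 st /\
  get_num w st (block c 0) = N.of_nat (length B) /\
  holds_bitmask w st t B.

Definition lg (x : R) : R := (ln (Rmax 1 x) / ln 2)%R.

Definition total_length (Bs : list (list bool)) : nat :=
  list_sum (map (@length bool) Bs).

(* Main.v *)
From Stdlib Require Import NArith Reals List Lia Psatz Cantor FinFun.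
Require Import Defs.
Import ListNotations.
Open Scope N_scope.

(** Choose [b] of order [lg NN], with [2 ^ b] a small power of [NN].  The preprocessing tabulates, for
  every state and every key consisting of the next [b] bits of each stream and the (truncated) lengths of
  the pending zero runs, what the transducer does until some window holds no complete token, the output
  reaches [b] bits, or all pending runs have become long.  A query repeats table look-ups; in between
  it performs single steps on windows that are long enough for every token, and skips stretches in which all
  inputs are zero and the output is zero: on zero inputs the transducer follows a functional graph, and
  ladders and cycle tables give its state after any number of steps up to the next nonzero output in
  constant time.  The potential "twice the number of bits read, minus the lengths of the tokens of the
  pending input runs, plus the number of bits written" grows by [b] in each round, so there are
  [O(1 + bits / b)] rounds.

  All this is programmed in a structured language of registers of [W = O(w)] bits, whose loops alone are
  counted, and which is compiled to the RAM by multiword arithmetic: a register is a block of constantly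
  many machine words. *)

(** The obstacle is that a run of zeros can be exponentially longer than its token, so neither step
    counts nor run lengths are bounded by the number of bits. In a table key a run is cut off at
    [2 ^ run_bits t b - 1]. This is harmless because a phase has fewer steps than that: a run that
    was cut off cannot become empty during the phase. Outside the table, skipping a stretch of [e]
    zeros costs about [log e / b], and this is charged to a token of about [2 log e] bits belonging
    to a run, of an input or of the output, that ends right after the stretch. Bits read count twice
    because reading a run token of [l] bits creates a pending run whose token has up to [l] bits;
    half of the gain must survive its subtraction. An output run may extend over several phases, so
    its token cannot be stored in the table: a phase keeps its leading and trailing zeros apart from
    the finished bits in between. A phase that gains less than [b] leaves a certificate (an overlong
    token, a large output symbol, or long runs everywhere) which forces the next single step,
    together with the skip before it, to gain the rest. *)

Definition var : Type := nat * nat.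
Definition darr : Type := nat * nat.

(** * Structured programs over wide registers *)

Inductive vop := VAdd | VSub | VLt | VShl | VShr.

Inductive expr :=
 | EV (v : var) | E0 | E1
 | EB (o : vop) (e1 e2 : expr)
 | ERd (A : darr) (e1 e2 : expr)
 | ECell (k : nat) (e : expr).

Inductive stmt :=
 | SSkip
 | SSet (v : var) (e : expr)
 | SSt (A : darr) (e1 e2 e : expr)
 | SCell (k : nat) (e1 e : expr)
 | SDelta (s y sv : var) (xs : list var)
 | SSeq (p1 p2 : stmt)
 | SIf (e : expr) (p1 p2 : stmt)
 | SWhile (e : expr) (p : stmt).

(** [dm] holds the arrays of the data structure, indexed by two wide numbers and with wide entries.
    [cm] holds the bitmasks of the streams, whose entries are single machine words. Names are pairs
    so that there can be one variable or array per stream. *)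
Record vst := { env : var -> N; dm : darr -> N -> N -> N; cm : nat -> N -> N }.

Definition peqb (u v : nat * nat) : bool := (Nat.eqb (fst u) (fst v) && Nat.eqb (snd u) (snd v))%bool.

Lemma peqb_spec u v : reflect (u = v) (peqb u v).
Proof.
 destruct u as [a b], v as [c d]; unfold peqb; simpl.
 destruct (Nat.eqb_spec a c), (Nat.eqb_spec b d); constructor; congruence.
Qed.

Definition upd (s : vst) (v : var) (x : N) : vst :=
 {| env := fun u => if peqb u v then x else env s u; dm := dm s; cm := cm s |}.
Definition updm (s : vst) (A : darr) (i j x : N) : vst :=
 {| env := env s;
   dm := fun A' i' j' => if (peqb A' A && (i' =? i) && (j' =? j))%bool then x else dm s A' i' j';
   cm := cm s |}.
Definition updc (s : vst) (k : nat) (a x : N) : vst :=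
 {| env := env s; dm := dm s;
   cm := fun k' a' => if (Nat.eqb k' k && (a' =? a))%bool then x else cm s k' a' |}.

(** Unlike on the RAM, subtraction is truncated at 0; thus [E1 -! e] is the logical negation of any
    [e]. *)
Definition eop (W : N) (o : vop) (a b : N) : N :=
 match o with
 | VAdd => (a + b) mod 2 ^ W
 | VSub => a - b
 | VLt => if a <? b then 1 else 0
 | VShl => (a * 2 ^ b) mod 2 ^ W
 | VShr => a / 2 ^ b
 end.

Fixpoint eval (W : N) (s : vst) (e : expr) : N :=
 match e with
 | EV v => env s v
 | E0 => 0
 | E1 => 1
 | EB o e1 e2 => eop W o (eval W s e1) (eval W s e2)
 | ERd A e1 e2 => dm s A (eval W s e1) (eval W s e2)
 | ECell k e => cm s k (eval W s e)
 end.

(* Only iterations of loops are counted: the rest of a program is straight-line code, whose running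
  time is bounded by a constant that depends on the program. *)
Inductive run (w W : N) (delta : N -> list N -> N * N) : stmt -> vst -> nat -> vst -> Prop :=
 | run_skip s : run w W delta SSkip s 0 s
 | run_set v e s : run w W delta (SSet v e) s 0 (upd s v (eval W s e))
 | run_st A e1 e2 e s :
   run w W delta (SSt A e1 e2 e) s 0 (updm s A (eval W s e1) (eval W s e2) (eval W s e))
 | run_cell k e1 e s :
   run w W delta (SCell k e1 e) s 0 (updc s k (eval W s e1) (eval W s e mod 2 ^ w))
 | run_delta s' y sv xs s :
   let r := delta (env s sv) (map (env s) xs) in
   run w W delta (SDelta s' y sv xs) s 0
    (upd (upd s s' (fst r mod 2 ^ W)) y (snd r mod 2 ^ W))
 | run_seq p1 p2 s n1 s1 n2 s2 :
   run w W delta p1 s n1 s1 -> run w W delta p2 s1 n2 s2 ->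
   run w W delta (SSeq p1 p2) s (n1 + n2) s2
 | run_if_true e p1 p2 s n s' :
   eval W s e <> 0 -> run w W delta p1 s n s' -> run w W delta (SIf e p1 p2) s n s'
 | run_if_false e p1 p2 s n s' :
   eval W s e = 0 -> run w W delta p2 s n s' -> run w W delta (SIf e p1 p2) s n s'
 | run_while_true e p s n1 s1 n2 s2 :
   eval W s e <> 0 -> run w W delta p s n1 s1 -> run w W delta (SWhile e p) s1 n2 s2 ->
   run w W delta (SWhile e p) s (S (n1 + n2)) s2
 | run_while_false e p s :
   eval W s e = 0 -> run w W delta (SWhile e p) s 0 s.

(** Keeps the stream arrays below [t0], away from the machine arrays that represent [dm]. *)
Fixpoint cells_ok_e (t0 : nat) (e : expr) : bool :=
 match e with
 | EB _ e1 e2 | ERd _ e1 e2 => cells_ok_e t0 e1 && cells_ok_e t0 e2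
 | ECell k e => Nat.ltb k t0 && cells_ok_e t0 e
 | _ => true
 end%bool.

Fixpoint cells_ok (t0 : nat) (p : stmt) : bool :=
 match p with
 | SSkip | SDelta _ _ _ _ => true
 | SSet _ e => cells_ok_e t0 e
 | SSt _ e1 e2 e => cells_ok_e t0 e1 && cells_ok_e t0 e2 && cells_ok_e t0 e
 | SCell k e1 e => Nat.ltb k t0 && cells_ok_e t0 e1 && cells_ok_e t0 e
 | SSeq p1 p2 => cells_ok t0 p1 && cells_ok t0 p2
 | SIf e p1 p2 => cells_ok_e t0 e && cells_ok t0 p1 && cells_ok t0 p2
 | SWhile e p => cells_ok_e t0 e && cells_ok t0 p
 end%bool.

(** A query must leave the data structure intact; a program without [SSt] does so. *)
Fixpoint store_free (p : stmt) : bool :=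
 match p with
 | SSt _ _ _ _ => false
 | SSeq p1 p2 | SIf _ p1 p2 => store_free p1 && store_free p2
 | SWhile _ p => store_free p
 | _ => true
 end%bool.

Ltac sp := split; [auto|].
Ltac vlia := cbn [fst]; first [lia|discriminate].
Ltac distinct_vars p :=
 repeat match goal with
 | |- context [peqb p ?x] => destruct (peqb_spec p x) as [EE|]; [inversion EE; lia|]
 end.
Ltac all_distinct_vars :=
 repeat match goal with
 | |- context [peqb ?u ?x] => destruct (peqb_spec u x) as [EE|]; [inversion EE; lia|]
 end.

Ltac gp :=
 repeat match goal with
 | |- context [2 ^ ?e] => let p := fresh "P" in set (p := 2 ^ e) in *; clearbody p
 | H : context [2 ^ ?e] |- _ => let p := fresh "P" in set (p := 2 ^ e) in *; clearbody p
 end.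

(** * Multiword arithmetic on the word RAM *)

Section Raw.
Context (w : N) (Hw : 1 <= w) (delta : N -> list N -> N * N) (tau : nat).

(** A time bound for loop-free code; adding up both branches of a conditional avoids maxima. *)
Fixpoint plen (p : prog) : nat :=
 match p with
 | Delta _ _ _ _ => tau
 | Seq p1 p2 => (plen p1 + plen p2)%nat
 | If _ p1 p2 => S (plen p1 + plen p2)%nat
 | While _ p => plen p
 | _ => 1%nat
 end.

Definition rwp (p : prog) (Q : state -> Prop) (st : state) : Prop :=
 exists T st', exec w delta tau p st T st' /\ (T <= plen p)%nat /\ Q st'.

Lemma rwp_mono p (Q Q' : state -> Prop) st :
 (forall s, Q s -> Q' s) -> rwp p Q st -> rwp p Q' st.
Proof. intros H (T & s & ? & ? & ?). exists T, s; auto. Qed.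

Lemma rwp_seq p1 p2 Q st : rwp p1 (rwp p2 Q) st -> rwp (Seq p1 p2) Q st.
Proof.
 intros (T & s & ? & ? & (T' & s' & ? & ? & ?)).
 exists (T + T')%nat, s'; split; [econstructor; eauto|]. simpl; split; [lia|auto].
Qed.

Lemma rwp_skip (Q : state -> Prop) st : Q st -> rwp Skip Q st.
Proof. exists 1%nat, st; simpl; repeat split; auto; constructor. Qed.

Lemma rwp_const d v (Q : state -> Prop) st : Q (set_reg st d (v mod 2 ^ w)) -> rwp (Const d v) Q st.
Proof. intros; eexists 1%nat, _; simpl; repeat split; eauto; constructor. Qed.

Lemma rwp_op o d a b (Q : state -> Prop) st :
 Q (set_reg st d (eval_binop w o (regs st a) (regs st b))) -> rwp (Op o d a b) Q st.
Proof. intros; eexists 1%nat, _; simpl; repeat split; eauto; constructor. Qed.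

Lemma rwp_read d k addr (Q : state -> Prop) st :
 Q (set_reg st d (mem st k (get_num w st addr))) -> rwp (Read d k addr) Q st.
Proof. intros; eexists 1%nat, _; simpl; repeat split; eauto; constructor. Qed.

Lemma rwp_write k addr a (Q : state -> Prop) st :
 Q (set_mem st k (get_num w st addr) (regs st a)) -> rwp (Write k addr a) Q st.
Proof. intros; eexists 1%nat, _; simpl; repeat split; eauto; constructor. Qed.

Lemma rwp_if r p1 p2 (Q : state -> Prop) st :
 (regs st r <> 0 -> rwp p1 Q st) -> (regs st r = 0 -> rwp p2 Q st) -> rwp (If r p1 p2) Q st.
Proof.
 intros H1 H2. destruct (N.eq_dec (regs st r) 0) as [E|E].
 - destruct (H2 E) as (T & s & ? & ? & ?). exists (S T), s; simpl; repeat split; auto; [now constructor|lia].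
 - destruct (H1 E) as (T & s & ? & ? & ?). exists (S T), s; simpl; repeat split; auto; [now constructor|lia].
Qed.

Lemma pow_pos_w k : 0 < 2 ^ k.
Proof. apply N.neq_0_lt_0, N.pow_nonzero; lia. Qed.

Lemma w_lt_pow : w < 2 ^ w.
Proof. apply N.pow_gt_lin_r; lia. Qed.

Lemma two_le_pow : 2 <= 2 ^ w.
Proof. change 2 with (2 ^ 1) at 1. apply N.pow_le_mono_r; lia. Qed.

Definition rwf st := forall r, regs st r < 2 ^ w.

Lemma lt_pow_testbit x k : (forall j, k <= j -> N.testbit x j = false) -> x < 2 ^ k.
Proof.
 intros H. destruct (N.eq_dec x 0) as [->|Hx]; [apply pow_pos_w|].
 destruct (N.lt_ge_cases x (2 ^ k)) as [|Hge]; auto.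
 assert (k <= N.log2 x) by (apply N.log2_le_pow2; lia).
 specialize (H _ H0). rewrite N.bit_log2 in H; congruence.
Qed.

Lemma testbit_above x k j : x < 2 ^ k -> k <= j -> N.testbit x j = false.
Proof.
 intros H Hj. destruct (N.eq_dec x 0) as [->|Hx]; [apply N.bits_0|].
 apply N.bits_above_log2. apply N.log2_lt_pow2 in H; lia.
Qed.

Lemma lor_lt x y k : x < 2 ^ k -> y < 2 ^ k -> N.lor x y < 2 ^ k.
Proof.
 intros. apply lt_pow_testbit; intros. rewrite N.lor_spec.
 rewrite (testbit_above x k), (testbit_above y k); auto.
Qed.

Lemma eval_binop_lt o x y : x < 2 ^ w -> y < 2 ^ w -> eval_binop w o x y < 2 ^ w.
Proof.
 intros Hx Hy. pose proof (pow_pos_w w). pose proof two_le_pow.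
 destruct o; simpl; try (apply N.mod_lt; lia).
 - destruct (N.eq_dec y 0) as [->|]; [destruct x; cbn; lia|].
  apply N.le_lt_trans with x; auto. apply N.Div0.div_le_upper_bound.
  assert (1 <= y) by lia. nia.
 - destruct (N.eq_dec y 0) as [->|]; [destruct x; cbn; lia|].
  pose proof (N.mod_lt x y); lia.
 - apply lt_pow_testbit; intros. rewrite N.land_spec, (testbit_above x w); auto.
 - apply lor_lt; auto.
 - apply lt_pow_testbit; intros. rewrite N.lxor_spec, (testbit_above x w), (testbit_above y w); auto.
 - rewrite N.shiftr_div_pow2. apply N.le_lt_trans with x; auto.
  apply N.Div0.div_le_upper_bound. pose proof (pow_pos_w y); nia.
 - destruct (x =? y); lia.
 - destruct (x <? y); lia.
Qed.

Lemma rwf_set st d v : rwf st -> v < 2 ^ w -> rwf (set_reg st d v).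
Proof. intros H Hv r; simpl. destruct (Nat.eqb r d); auto. Qed.

Lemma get_num_ext st st' l :
 (forall r, In r l -> regs st' r = regs st r) -> get_num w st' l = get_num w st l.
Proof. induction l; simpl; intros; auto. rewrite H, IHl; auto. Qed.

Lemma get_num_lt st l : rwf st -> get_num w st l < 2 ^ (w * N.of_nat (length l)).
Proof.
 intros H; induction l as [|r l IH]; [simpl; rewrite N.mul_0_r; simpl; lia|].
 simpl get_num. specialize (H r).
 replace (2 ^ (w * N.of_nat (length (r :: l)))) with (2 ^ w * 2 ^ (w * N.of_nat (length l))).
 - assert (2 ^ w * (get_num w st l + 1) <= 2 ^ w * 2 ^ (w * N.of_nat (length l)))
   by (apply N.mul_le_mono_l; lia). gp; lia.
 - rewrite <- N.pow_add_r. f_equal. simpl length. lia.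
Qed.

Lemma get_num_app st a b :
 get_num w st (a ++ b) = get_num w st a + 2 ^ (w * N.of_nat (length a)) * get_num w st b.
Proof.
 induction a as [|r a IH]; simpl; [rewrite N.mul_0_r, N.pow_0_r; lia|].
 rewrite IH.
 replace (w * N.pos (Pos.of_succ_nat (length a))) with (w + w * N.of_nat (length a)) by lia.
 rewrite N.pow_add_r. lia.
Qed.

(** Scratch registers are numbered from [B0]. *)
Context (B0 : nat).
Definition RW := B0.
Definition ZR := (B0 + 1)%nat.
Definition R1 := (B0 + 2)%nat.
Definition R2 := (B0 + 3)%nat.
Definition R3 := (B0 + 4)%nat.
Definition CY := (B0 + 5)%nat.
Definition SH := (B0 + 6)%nat.
Definition CSH := (B0 + 7)%nat.
Definition NZ := (B0 + 8)%nat.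
(** [RW] and [ZR] permanently hold the constants [w] and 0 and are therefore excluded; every
    arithmetic routine may destroy the other scratch registers. *)
Definition clobbered (r : reg) := (R1 <= r <= NZ)%nat.
Definition special (r : reg) := (B0 <= r <= NZ)%nat.
Definition safe (l : list reg) := forall r, In r l -> ~ special r.

Definition framed (l : list reg) (st st' : state) : Prop :=
 rwf st' /\ mem st' = mem st /\
 (forall r, ~ clobbered r -> ~ In r l -> regs st' r = regs st r).

Lemma framed_trans l st1 st2 st3 : framed l st1 st2 -> framed l st2 st3 -> framed l st1 st3.
Proof.
 intros (A & B & C) (D & E & F). sp. split; [congruence|].
 intros. rewrite F, C; auto.
Qed.

Lemma framed_incl l l' st st' : incl l l' -> framed l st st' -> framed l' st st'.
Proof. intros H (A & B & C). split; [auto|split; auto]. Qed.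

Lemma framed_refl l st : rwf st -> framed l st st.
Proof. split; auto. Qed.

Lemma framed_RW l st st' : framed l st st' -> safe l -> regs st' RW = regs st RW.
Proof.
 intros (_ & _ & C) Ha. apply C; [unfold clobbered, RW, R1; lia|].
 intros HI. apply (Ha _ HI). unfold special, RW, NZ; lia.
Qed.

Lemma framed_ZR l st st' : framed l st st' -> safe l -> regs st' ZR = regs st ZR.
Proof.
 intros (_ & _ & C) Ha. apply C; [unfold clobbered, ZR, R1; lia|].
 intros HI. apply (Ha _ HI). unfold special, ZR, NZ; lia.
Qed.

Lemma eqb_neq_nat a b : a <> b -> Nat.eqb a b = false.
Proof. apply Nat.eqb_neq. Qed.

Lemma safe_cons x a : safe (x :: a) -> ~ special x /\ safe a.
Proof. split; [apply H; simpl; auto|intros r Hr; apply H; simpl; auto]. Qed.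

Ltac rsolve := unfold special, clobbered, RW, ZR, R1, R2, R3, CY, SH, CSH, NZ in *; lia.
Ltac rsimp :=
 repeat (cbn [regs set_reg mem set_mem];
  repeat match goal with
  | |- context [Nat.eqb ?a ?a] => rewrite (Nat.eqb_refl a)
  | |- context [Nat.eqb ?a ?b] =>
    rewrite (eqb_neq_nat a b) by rsolve
  end).

Lemma rwf_eval o st a b : rwf st -> eval_binop w o (regs st a) (regs st b) < 2 ^ w.
Proof. intros; apply eval_binop_lt; auto. Qed.

Ltac rop := apply rwp_seq, rwp_op || apply rwp_op.

Lemma pow_w_S n : 2 ^ (w * N.of_nat (S n)) = 2 ^ w * 2 ^ (w * N.of_nat n).
Proof. rewrite <- N.pow_add_r. f_equal. lia. Qed.

Lemma bool_le (b : bool) : (if b then 1 else 0) <= 1.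
Proof. destruct b; lia. Qed.

Lemma lor_bit x y : x <= 1 -> y <= 1 -> N.lor x y = N.max x y.
Proof.
 intros. assert (x = 0 \/ x = 1) as [-> | ->] by lia;
 assert (y = 0 \/ y = 1) as [-> | ->] by lia; reflexivity.
Qed.

Fixpoint p_add (a b : list reg) : prog :=
 match a, b with
 | x :: a', y :: b' =>
   Seq (Op Add R1 x y) (Seq (Op Lt R2 R1 x) (Seq (Op Add x R1 CY)
   (Seq (Op Lt R3 x R1) (Seq (Op Or CY R2 R3) (p_add a' b')))))
 | _, _ => Skip
 end.

Fixpoint p_sub (a b : list reg) : prog :=
 match a, b with
 | x :: a', y :: b' =>
   Seq (Op Sub R1 x y) (Seq (Op Lt R2 x y) (Seq (Op Sub x R1 CY)
   (Seq (Op Lt R3 R1 CY) (Seq (Op Or CY R2 R3) (p_sub a' b')))))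
 | _, _ => Skip
 end.

Definition disj (a b : list reg) := forall r, In r a -> ~ In r b.

(** A sum modulo [p] has wrapped around exactly if it is smaller than a summand. The two additions
    cannot both wrap, since [x + y + c < 2 * p], so the disjunction of the two tests is the
    carry. *)
Lemma add_word x y c p : x < p -> y < p -> c <= 1 -> 2 <= p ->
 let r1 := (x + y) mod p in let z := (r1 + c) mod p in
 let c' := N.lor (if r1 <? x then 1 else 0) (if z <? r1 then 1 else 0) in
 z + p * c' = x + y + c /\ c' <= 1.
Proof.
 intros Hx Hy Hc Hp r1 z c'. unfold c'. rewrite lor_bit by apply bool_le.
 assert (r1 = x + y /\ x + y < p \/ r1 + p = x + y).
 { unfold r1. destruct (N.lt_ge_cases (x + y) p).
  - rewrite N.mod_small; auto.
  - right. rewrite <- (N.mod_unique (x + y) p 1 (x + y - p)); lia. }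
 assert (z = r1 + c /\ r1 + c < p \/ z + p = r1 + c).
 { assert (r1 < p) by (apply N.mod_lt; lia).
  unfold z. destruct (N.lt_ge_cases (r1 + c) p).
  - rewrite N.mod_small; auto.
  - right. rewrite <- (N.mod_unique (r1 + c) p 1 (r1 + c - p)); lia. }
 clearbody r1 z. destruct (N.ltb_spec r1 x), (N.ltb_spec z r1); simpl N.max; lia.
Qed.

(** The mirror image for borrows: if the first difference wraps, it is at least 1, and subtracting
    [c] cannot wrap again. *)
Lemma sub_word x y c p : x < p -> y < p -> c <= 1 -> 2 <= p ->
 let r1 := (x + p - y) mod p in let z := (r1 + p - c) mod p in
 let c' := N.lor (if x <? y then 1 else 0) (if r1 <? c then 1 else 0) in
 z + y + c = x + p * c' /\ c' <= 1.
Proof.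
 intros Hx Hy Hc Hp r1 z c'. unfold c'. rewrite lor_bit by apply bool_le.
 assert (r1 + y = x /\ y <= x \/ r1 + y = x + p /\ x < y).
 { unfold r1. destruct (N.lt_ge_cases x y).
  - rewrite N.mod_small; lia.
  - left. rewrite <- (N.mod_unique (x + p - y) p 1 (x - y)); lia. }
 assert (r1 < p) by (apply N.mod_lt; lia).
 assert (z + c = r1 /\ c <= r1 \/ z + c = r1 + p /\ r1 < c).
 { unfold z. destruct (N.lt_ge_cases r1 c).
  - rewrite N.mod_small; lia.
  - left. rewrite <- (N.mod_unique (r1 + p - c) p 1 (r1 - c)); lia. }
 clearbody r1 z. destruct (N.ltb_spec x y), (N.ltb_spec r1 c); simpl N.max; lia.
Qed.

Lemma framed_step l st st' d v : framed l st st' -> v < 2 ^ w -> clobbered d \/ In d l ->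
 framed l st (set_reg st' d v).
Proof.
 intros (A & B & C) Hv Hd. split; [apply rwf_set; auto|split; auto].
 intros r H1 H2; simpl. destruct (Nat.eqb_spec r d); [subst; tauto|auto].
Qed.

Lemma framed_op l st st' d o a b : framed l st st' -> clobbered d \/ In d l ->
 framed l st (set_reg st' d (eval_binop w o (regs st' a) (regs st' b))).
Proof. intros H Hd. apply framed_step; auto. apply rwf_eval, H. Qed.

Ltac frop := repeat (apply framed_op; [|first [left; rsolve | right; simpl; tauto]]);
 try (apply framed_refl; assumption).

Lemma add_step st x y : rwf st -> ~ special x -> ~ clobbered y -> regs st CY <= 1 ->
 forall (Q : state -> Prop) p,
 (forall st', framed [x] st st' -> regs st' CY <= 1 ->
  regs st' x + 2 ^ w * regs st' CY = regs st x + regs st y + regs st CY ->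
  rwp p Q st') ->
 rwp (Seq (Op Add R1 x y) (Seq (Op Lt R2 R1 x) (Seq (Op Add x R1 CY)
   (Seq (Op Lt R3 x R1) (Seq (Op Or CY R2 R3) p))))) Q st.
Proof.
 intros Hf Hx Hy Hc Q p H. do 5 rop. apply H; clear H; [frop|rsimp; cbn [eval_binop]; rsimp ..];
  destruct (add_word (regs st x) (regs st y) (regs st CY) (2 ^ w)); auto; apply two_le_pow.
Qed.

Lemma sub_step st x y : rwf st -> ~ special x -> ~ clobbered y -> regs st CY <= 1 ->
 forall (Q : state -> Prop) p,
 (forall st', framed [x] st st' -> regs st' CY <= 1 ->
  regs st' x + regs st y + regs st CY = regs st x + 2 ^ w * regs st' CY ->
  rwp p Q st') ->
 rwp (Seq (Op Sub R1 x y) (Seq (Op Lt R2 x y) (Seq (Op Sub x R1 CY)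
   (Seq (Op Lt R3 R1 CY) (Seq (Op Or CY R2 R3) p))))) Q st.
Proof.
 intros Hf Hx Hy Hc Q p H. do 5 rop. apply H; clear H; [frop|rsimp; cbn [eval_binop]; rsimp ..];
  destruct (sub_word (regs st x) (regs st y) (regs st CY) (2 ^ w)); auto; apply two_le_pow.
Qed.

(** Operand blocks may contain the read-only registers [RW] and [ZR]. *)
Definition readable (l : list reg) := forall r, In r l -> ~ clobbered r.

Lemma safe_readable l : safe l -> readable l.
Proof. intros H r Hr. specialize (H r Hr). rsolve. Qed.

Lemma framed_getr l st st' a :
 framed l st st' -> readable a -> disj a l -> get_num w st' a = get_num w st a.
Proof. intros (_ & _ & C) Ha Hd. apply get_num_ext. intros r Hr. apply C; auto. Qed.

Lemma p_add_spec a : forall b st, length a = length b -> NoDup a -> safe a -> readable b -> disj b a ->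
 rwf st -> regs st CY <= 1 ->
 rwp (p_add a b) (fun st' => framed a st st' /\ regs st' CY <= 1 /\ get_num w st' a + 2 ^ (w * N.of_nat (length a)) * regs st' CY
  = get_num w st a + get_num w st b + regs st CY) st.
Proof.
 induction a as [|x a IH]; intros [|y b] st Hl Hnd Ha Hb Hd Hf Hc; try discriminate.
 - apply rwp_skip. split; [apply framed_refl; auto|split; auto]. simpl. rewrite N.mul_0_r, N.pow_0_r. lia.
 - apply safe_cons in Ha as [Hx Ha]. assert (readable b) by (intros r ?; apply Hb; simpl; auto).
  assert (disj b a) by (intros r Hr Hr'; apply (Hd r); simpl; auto).
  assert (~ In x b) by (intros Hx'; apply (Hd x); simpl; auto).
  apply NoDup_cons_iff in Hnd as [Hn Hnd]. simpl p_add.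
  apply add_step; auto; [apply Hb; simpl; auto|]. intros st1 F1 C1 E1.
  eapply rwp_mono; [|apply IH; auto; apply F1]. intros st2 (F2 & C2 & E2).
  assert (regs st2 x = regs st1 x) by (apply F2; auto; rsolve).
  rewrite (framed_getr _ _ _ a F1), (framed_getr _ _ _ b F1) in E2; auto using safe_readable;
   try (intros r Hr [->|[]]; auto).
  split; [|split; auto].
  + eapply framed_trans; eapply framed_incl; eauto; intros r Hr; simpl in *; tauto.
  + simpl get_num. simpl length. rewrite pow_w_S. rewrite H2. nia.
Qed.

Lemma p_sub_spec a : forall b st, length a = length b -> NoDup a -> safe a -> readable b -> disj b a ->
 rwf st -> regs st CY <= 1 ->
 rwp (p_sub a b) (fun st' => framed a st st' /\ regs st' CY <= 1 /\ get_num w st' a + get_num w st b + regs st CY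
  = get_num w st a + 2 ^ (w * N.of_nat (length a)) * regs st' CY) st.
Proof.
 induction a as [|x a IH]; intros [|y b] st Hl Hnd Ha Hb Hd Hf Hc; try discriminate.
 - apply rwp_skip. split; [apply framed_refl; auto|split; auto]. simpl. rewrite N.mul_0_r, N.pow_0_r. lia.
 - apply safe_cons in Ha as [Hx Ha]. assert (readable b) by (intros r ?; apply Hb; simpl; auto).
  assert (disj b a) by (intros r Hr Hr'; apply (Hd r); simpl; auto).
  assert (~ In x b) by (intros Hx'; apply (Hd x); simpl; auto).
  apply NoDup_cons_iff in Hnd as [Hn Hnd]. simpl p_sub.
  apply sub_step; auto; [apply Hb; simpl; auto|]. intros st1 F1 C1 E1.
  eapply rwp_mono; [|apply IH; auto; apply F1]. intros st2 (F2 & C2 & E2).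
  assert (regs st2 x = regs st1 x) by (apply F2; auto; rsolve).
  rewrite (framed_getr _ _ _ a F1), (framed_getr _ _ _ b F1) in E2; auto using safe_readable;
   try (intros r Hr [->|[]]; auto).
  split; [|split; auto].
  + eapply framed_trans; eapply framed_incl; eauto; intros r Hr; simpl in *; tauto.
  + simpl get_num. simpl length. rewrite pow_w_S. rewrite H2. nia.
Qed.

Fixpoint p_zero (a : list reg) : prog :=
 match a with [] => Skip | x :: a' => Seq (Const x 0) (p_zero a') end.

Definition p_bit (a : list reg) (v : N) : prog :=
 match a with [] => Skip | x :: a' => Seq (p_zero a') (Const x v) end.

Fixpoint p_move (a b : list reg) : prog :=
 match a, b with
 | x :: a', y :: b' => Seq (Op Or x y y) (p_move a' b')
 | _, _ => Skip
 end.

Lemma p_zero_spec a : forall st, NoDup a -> rwf st ->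
 rwp (p_zero a) (fun st' => framed a st st' /\ get_num w st' a = 0 /\ forall r, ~ In r a -> regs st' r = regs st r) st.
Proof.
 induction a as [|x a IH]; intros st Hnd Hf; simpl.
 - apply rwp_skip. repeat split; auto.
 - apply NoDup_cons_iff in Hnd as [Hn Hnd]. apply rwp_seq, rwp_const.
  assert (rwf (set_reg st x (0 mod 2 ^ w))) by (apply rwf_set; auto; apply N.mod_lt; pose proof two_le_pow; lia).
  eapply rwp_mono; [|apply IH; auto]. intros st' (F & E & G). split; [|split].
  + eapply framed_trans; [apply framed_step; [apply framed_refl; auto| |right; left; eauto]|].
   * apply N.mod_lt; pose proof two_le_pow; lia.
   * eapply framed_incl; eauto. intros r ?; simpl; auto.
  + rewrite E, G; auto. simpl. rewrite Nat.eqb_refl, N.Div0.mod_0_l. lia.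
  + intros r Hr. simpl in Hr. rewrite G by tauto. simpl. rewrite eqb_neq_nat; auto; intuition.
Qed.

Lemma p_bit_spec a v st : a <> [] -> NoDup a -> rwf st -> v <= 1 ->
 rwp (p_bit a v) (fun st' => framed a st st' /\ get_num w st' a = v) st.
Proof.
 destruct a as [|x a]; intros Ha Hnd Hf Hv; [congruence|]. simpl.
 apply NoDup_cons_iff in Hnd as [Hn Hnd]. pose proof two_le_pow.
 apply rwp_seq. eapply rwp_mono; [|apply p_zero_spec; auto]. intros st' (F & E & G).
 apply rwp_const. rewrite N.mod_small by lia. split.
 - apply framed_step; [|lia|right; simpl; auto]. eapply framed_incl; eauto. intros r ?; simpl; auto.
 - cbn. rewrite Nat.eqb_refl. erewrite get_num_ext; [rewrite E; lia|].
  intros r Hr. simpl. rewrite eqb_neq_nat; auto; congruence.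
Qed.

Lemma p_move_spec a : forall b st, length a = length b -> NoDup a -> disj b a -> rwf st ->
 rwp (p_move a b) (fun st' => framed a st st' /\ get_num w st' a = get_num w st b /\ forall r, ~ In r a -> regs st' r = regs st r) st.
Proof.
 induction a as [|x a IH]; intros [|y b] st Hl Hnd Hd Hf; try discriminate.
 - apply rwp_skip. repeat split; auto.
 - apply NoDup_cons_iff in Hnd as [Hn Hnd]. simpl p_move.
  apply rwp_seq, rwp_op. cbn [eval_binop]. rewrite N.lor_diag.
  assert (Hs : rwf (set_reg st x (regs st y))) by (apply rwf_set; auto).
  assert (disj b a) by (intros r Hr Hr'; apply (Hd r); simpl; auto).
  eapply rwp_mono; [|apply IH; auto]. intros st' (F & E & G). split; [|split].
  + eapply framed_trans; [apply framed_step; [apply framed_refl; auto|apply Hf|right; left; eauto]|].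
   eapply framed_incl; eauto. intros r ?; simpl; auto.
  + simpl get_num. rewrite E, G; auto. simpl. rewrite Nat.eqb_refl. f_equal. f_equal.
   apply get_num_ext. intros r Hr. simpl. rewrite eqb_neq_nat; auto.
   intros ->. apply (Hd x); simpl; auto.
  + intros r Hr. simpl in Hr. rewrite G by tauto. simpl. rewrite eqb_neq_nat; auto; intuition.
Qed.

Fixpoint p_nzacc (a : list reg) : prog :=
 match a with [] => Skip | x :: a' => Seq (Op Or NZ NZ x) (p_nzacc a') end.
Definition p_nz (a : list reg) : prog := Seq (Const NZ 0) (p_nzacc a).

Lemma p_nz_spec a st : safe a -> rwf st ->
 rwp (p_nz a) (fun st' => framed [] st st' /\ (regs st' NZ = 0 <-> get_num w st a = 0)) st.
Proof.
 intros Ha Hf. pose proof two_le_pow.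
 assert (H0 : forall st, rwf st -> rwp (p_nzacc a) (fun st' => framed [] st st' /\ (regs st' NZ = 0 <-> regs st NZ = 0 /\ get_num w st a = 0)) st).
 { clear st Hf. induction a as [|x a IH]; intros st Hf; simpl.
  - apply rwp_skip. split; [apply framed_refl; auto|tauto].
  - apply safe_cons in Ha as [Hx Ha]. apply rwp_seq, rwp_op. cbn [eval_binop].
   assert (F : framed [] st (set_reg st NZ (N.lor (regs st NZ) (regs st x)))).
   { apply framed_step; [apply framed_refl; auto|apply lor_lt; auto|left; rsolve]. }
   eapply rwp_mono; [|apply IH; auto; apply F]. intros st' (F' & E). split; [eapply framed_trans; eauto|].
   rewrite E, (framed_getr _ _ _ a F); auto using safe_readable; [|intros r ? []].
   rsimp. rewrite N.lor_eq_0_iff. pose proof (pow_pos_w w).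
   assert (regs st x + 2 ^ w * get_num w st a = 0 <-> regs st x = 0 /\ get_num w st a = 0) by nia.
   tauto. }
 apply rwp_seq, rwp_const. rewrite N.mod_small by lia.
 assert (F : framed [] st (set_reg st NZ 0)) by (apply framed_step; [apply framed_refl; auto|lia|left; rsolve]).
 eapply rwp_mono; [|apply H0; apply F]. intros st' (F' & E). split; [eapply framed_trans; eauto|].
 rewrite E, (framed_getr _ _ _ a F); auto using safe_readable; [|intros r ? []].
 rsimp. tauto.
Qed.

(** Blocks are little-endian. A right shift moves material from a word to its predecessor in the
    list, so right shifts recurse before they act on the head and left shifts afterwards; [CY]
    transports what crosses a word boundary. *)
Fixpoint p_wshr (a : list reg) : prog :=
 match a with
 | [] => Const CY 0
 | x :: a' => Seq (p_wshr a') (Seq (Op Or R1 x x) (Seq (Op Or x CY CY) (Op Or CY R1 R1)))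
 end.

Fixpoint p_wshl (a : list reg) : prog :=
 match a with
 | [] => Skip
 | x :: a' => Seq (Op Or R1 x x) (Seq (Op Or x CY CY) (Seq (Op Or CY R1 R1) (p_wshl a')))
 end.

Fixpoint p_bshr (a : list reg) : prog :=
 match a with
 | [] => Const CY 0
 | x :: a' => Seq (p_bshr a') (Seq (Op Shr R1 x SH) (Seq (Op Shl R2 R1 SH) (Seq (Op Sub R2 x R2)
   (Seq (Op Shl R3 CY CSH) (Seq (Op Add x R1 R3) (Op Or CY R2 R2))))))
 end.

Fixpoint p_bshl (a : list reg) : prog :=
 match a with
 | [] => Skip
 | x :: a' => Seq (Op Shr R1 x CSH) (Seq (Op Shl R2 x SH) (Seq (Op Add x R2 CY)
   (Seq (Op Or CY R1 R1) (p_bshl a'))))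
 end.

Lemma framed_const0 l st d : rwf st -> clobbered d \/ In d l -> framed l st (set_reg st d (0 mod 2 ^ w)).
Proof. intros. apply framed_step; [apply framed_refl; auto| |auto]. apply N.mod_lt. pose proof two_le_pow; lia. Qed.

Ltac pw := pose proof two_le_pow; pose proof pow_pos_w.

Lemma p_wshr_spec a : forall st, NoDup a -> safe a -> rwf st ->
 rwp (p_wshr a) (fun st' => framed a st st' /\
  get_num w st a = get_num w st' a * 2 ^ w + regs st' CY) st.
Proof.
 induction a as [|x a IH]; intros st Hnd Ha Hf; simpl p_wshr.
 - apply rwp_const. split; [apply framed_const0; auto; left; rsolve|]. rsimp. rewrite N.Div0.mod_0_l. reflexivity.
 - apply safe_cons in Ha as [Hx Ha]. apply NoDup_cons_iff in Hnd as [Hn Hnd].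
  apply rwp_seq. eapply rwp_mono; [|apply IH; auto]. intros st1 (F1 & E1).
  assert (Ex : regs st1 x = regs st x) by (apply F1; auto; rsolve).
  do 3 rop. split.
  + eapply framed_trans; [eapply framed_incl; [|exact F1]; intros r ?; simpl; auto|].
   assert (rwf st1) by apply F1. frop.
  + simpl get_num. rewrite E1. do 3 (rsimp; cbn [eval_binop]; rewrite ?N.lor_diag). rewrite Ex.
   match goal with |- context [get_num w (set_reg ?s1 ?d ?v) a] => replace (get_num w (set_reg s1 d v) a) with (get_num w st1 a) end.
   * ring.
   * apply get_num_ext. intros r Hr. assert (r <> x) by congruence.
    assert (~ special r) by (apply Ha; auto). rsimp. reflexivity.
Qed.

Lemma p_wshl_spec a : forall st, NoDup a -> safe a -> rwf st ->
 rwp (p_wshl a) (fun st' => framed a st st' /\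
  get_num w st' a + 2 ^ (w * N.of_nat (length a)) * regs st' CY = get_num w st a * 2 ^ w + regs st CY) st.
Proof.
 induction a as [|x a IH]; intros st Hnd Ha Hf; simpl p_wshl.
 - apply rwp_skip. split; [apply framed_refl; auto|]. simpl. rewrite N.mul_0_r, N.pow_0_r. lia.
 - apply safe_cons in Ha as [Hx Ha]. apply NoDup_cons_iff in Hnd as [Hn Hnd].
  do 3 rop. set (st1 := set_reg _ CY _).
  assert (F1 : framed [x] st st1) by (unfold st1; frop).
  assert (Ex : regs st1 x = regs st CY) by (unfold st1; rsimp; cbn [eval_binop]; rewrite N.lor_diag; rsimp; reflexivity).
  assert (Ec : regs st1 CY = regs st x) by (unfold st1; rsimp; cbn [eval_binop]; rewrite N.lor_diag; rsimp; cbn [eval_binop]; rewrite N.lor_diag; reflexivity).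
  clearbody st1. eapply rwp_mono; [|apply IH; auto; apply F1]. intros st2 (F2 & E2). split.
  + eapply framed_trans; eapply framed_incl; eauto; intros r Hr; simpl in *; tauto.
  + assert (regs st2 x = regs st1 x) by (apply F2; auto; rsolve).
   rewrite (framed_getr _ _ _ a F1) in E2; auto using safe_readable; [|intros r Hr [->|[]]; auto].
   simpl get_num. simpl length. rewrite pow_w_S, H, Ex. rewrite Ec in E2. nia.
Qed.

(** Write [x = h * 2 ^ s + l]. The new word consists of the bits of [c] above those of [h], which do
    not overlap because [c < 2 ^ s], and [l] moves on. For [s = 0] the incoming [c] is 0, so a shift
    of it by the full word length does no harm. *)
Lemma shr_word x c s : x < 2 ^ w -> c < 2 ^ s -> s < w ->
 let r1 := N.shiftr x s in let r2 := (x + 2 ^ w - N.shiftl r1 s mod 2 ^ w) mod 2 ^ w in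
 let z := (r1 + N.shiftl c (w - s) mod 2 ^ w) mod 2 ^ w in
 z * 2 ^ s + r2 = x + c * 2 ^ w /\ r2 < 2 ^ s.
Proof.
 intros Hx Hc Hs r1 r2 z. unfold r2, z, r1. rewrite N.shiftr_div_pow2, !N.shiftl_mul_pow2.
 assert (E : 2 ^ w = 2 ^ (w - s) * 2 ^ s) by (rewrite <- N.pow_add_r; f_equal; lia).
 pose proof (pow_pos_w s). pose proof (pow_pos_w (w - s)).
 pose proof (N.div_mod' x (2 ^ s)). pose proof (N.mod_lt x (2 ^ s) ltac:(lia)).
 set (h := x / 2 ^ s) in *. set (l := x mod 2 ^ s) in *.
 assert (h < 2 ^ (w - s)) by (apply N.Div0.div_lt_upper_bound; rewrite N.mul_comm, <- E; auto).
 clearbody h l. rewrite E in *. set (A := 2 ^ (w - s)) in *. set (B := 2 ^ s) in *. clearbody A B.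
 subst x. assert (B <= A * B) by nia. assert (h * B + B <= A * B) by nia. assert (c * A + A <= A * B) by nia.
 rewrite (N.mod_small (h * B)) by lia.
 replace (B * h + l + A * B - h * B) with (l + 1 * (A * B)) by lia.
 rewrite N.Div0.mod_add. rewrite (N.mod_small l) by lia.
 rewrite (N.mod_small (c * A)) by lia. rewrite N.mod_small by nia. split; [nia|auto].
Qed.

Lemma shl_word x c s : x < 2 ^ w -> c < 2 ^ s -> s < w ->
 let r1 := N.shiftr x (w - s) in
 let z := (N.shiftl x s mod 2 ^ w + c) mod 2 ^ w in
 z + 2 ^ w * r1 = x * 2 ^ s + c /\ r1 < 2 ^ s.
Proof.
 intros Hx Hc Hs r1 z. unfold z, r1. rewrite N.shiftr_div_pow2, !N.shiftl_mul_pow2.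
 assert (E : 2 ^ w = 2 ^ s * 2 ^ (w - s)) by (rewrite <- N.pow_add_r; f_equal; lia).
 pose proof (pow_pos_w s). pose proof (pow_pos_w (w - s)).
 pose proof (N.div_mod' x (2 ^ (w - s))). pose proof (N.mod_lt x (2 ^ (w - s)) ltac:(lia)).
 set (h := x / 2 ^ (w - s)) in *. set (l := x mod 2 ^ (w - s)) in *.
 assert (h < 2 ^ s) by (apply N.Div0.div_lt_upper_bound; rewrite N.mul_comm, <- E; auto).
 clearbody h l. rewrite E in *. set (A := 2 ^ (w - s)) in *. set (B := 2 ^ s) in *. clearbody A B.
 subst x. assert (l * B + B <= B * A) by nia.
 replace ((A * h + l) * B) with (l * B + h * (B * A)) by lia.
 rewrite N.Div0.mod_add. rewrite (N.mod_small (l * B)) by lia. rewrite N.mod_small by nia. split; [nia|auto].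
Qed.

Lemma p_bshr_spec a s : s < w -> forall st, NoDup a -> safe a -> rwf st ->
 regs st SH = s -> regs st CSH = w - s ->
 rwp (p_bshr a) (fun st' => framed a st st' /\ regs st' SH = s /\ regs st' CSH = w - s /\ regs st' CY < 2 ^ s /\
  get_num w st a = get_num w st' a * 2 ^ s + regs st' CY) st.
Proof.
 intros Hs. induction a as [|x a IH]; intros st Hnd Ha Hf Es Ecs; simpl p_bshr.
 - apply rwp_const. pose proof (pow_pos_w s). split; [apply framed_const0; auto; left; rsolve|]. rsimp. rewrite N.Div0.mod_0_l. auto.
 - apply safe_cons in Ha as [Hx Ha]. apply NoDup_cons_iff in Hnd as [Hn Hnd].
  apply rwp_seq. eapply rwp_mono; [|apply IH; auto]. intros st1 (F1 & Es1 & Ecs1 & C1 & E1).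
  assert (Ex : regs st1 x = regs st x) by (apply F1; auto; rsolve).
  do 6 rop.
  match goal with |- framed _ _ ?s /\ _ => set (st2 := s) end.
  assert (Hf1 : rwf st1) by apply F1.
  assert (F2 : framed [x] st1 st2) by (unfold st2; frop).
  pose proof (shr_word (regs st1 x) (regs st1 CY) s (Hf1 x) C1 Hs) as [A B].
  assert (G1 : regs st2 x * 2 ^ s + regs st2 CY = regs st1 x + regs st1 CY * 2 ^ w /\ regs st2 CY < 2 ^ s).
  { unfold st2. rsimp. cbn [eval_binop]. rsimp. rewrite N.lor_diag. cbn [eval_binop]. rsimp. rewrite Es1, Ecs1. auto. }
  assert (G2 : regs st2 SH = s /\ regs st2 CSH = w - s) by (unfold st2; rsimp; auto).
  clearbody st2. destruct G1, G2. split; [|split; [|split; [|split]]]; auto.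
  + eapply framed_trans; eapply framed_incl; eauto; intros r Hr; simpl in *; tauto.
  + simpl get_num. rewrite (framed_getr _ _ _ a F2); auto using safe_readable; [|intros r Hr [->|[]]; auto].
   rewrite E1. nia.
Qed.

Lemma p_bshl_spec a s : s < w -> forall st, NoDup a -> safe a -> rwf st ->
 regs st SH = s -> regs st CSH = w - s -> regs st CY < 2 ^ s ->
 rwp (p_bshl a) (fun st' => framed a st st' /\
  get_num w st' a + 2 ^ (w * N.of_nat (length a)) * regs st' CY = get_num w st a * 2 ^ s + regs st CY) st.
Proof.
 intros Hs. induction a as [|x a IH]; intros st Hnd Ha Hf Es Ecs Hc; simpl p_bshl.
 - apply rwp_skip. split; [apply framed_refl; auto|]. simpl. rewrite N.mul_0_r, N.pow_0_r. lia.
 - apply safe_cons in Ha as [Hx Ha]. apply NoDup_cons_iff in Hnd as [Hn Hnd].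
  do 4 rop. set (st1 := set_reg _ CY _).
  assert (F1 : framed [x] st st1) by (unfold st1; frop).
  pose proof (shl_word (regs st x) (regs st CY) s (Hf x) Hc Hs) as [A B].
  assert (G1 : regs st1 x + 2 ^ w * regs st1 CY = regs st x * 2 ^ s + regs st CY /\ regs st1 CY < 2 ^ s).
  { unfold st1. rsimp. cbn [eval_binop]. rsimp. rewrite N.lor_diag. cbn [eval_binop]. rsimp. rewrite Es, Ecs. auto. }
  assert (G2 : regs st1 SH = s /\ regs st1 CSH = w - s) by (unfold st1; rsimp; auto).
  clearbody st1. destruct G1, G2. eapply rwp_mono; [|apply IH; auto; apply F1]. intros st2 (F2 & E2). split.
  + eapply framed_trans; eapply framed_incl; eauto; intros r Hr; simpl in *; tauto.
  + assert (Ex : regs st2 x = regs st1 x) by (apply F2; auto; rsolve).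
   rewrite (framed_getr _ _ _ a F1) in E2; auto using safe_readable; [|intros r Hr [->|[]]; auto].
   simpl get_num. simpl length. rewrite pow_w_S, Ex. nia.
Qed.

(** Shifting block [a] by the amount in block [b]: whole words while the amount is at least [w],
  then a shift by less than a word. *)
Definition WB (n : nat) : list reg := RW :: repeat ZR n.

Definition p_cmpw (b : list reg) : prog := Seq (Const CY 0) (p_sub b (WB (pred (length b)))).
Definition p_restore (b : list reg) : prog := Seq (Const CY 0) (p_add b (WB (pred (length b)))).

(** The comparison of the amount with [w] is a subtraction: a borrow means that the amount was
    smaller, and then it is undone; otherwise the reduced amount is kept and one word shift is made.
    As many rounds as [a] has words suffice, since that many word shifts already yield 0. *)
Fixpoint p_words (step : prog) (n : nat) (b : list reg) : prog :=
 match n with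
 | O => Skip
 | S n' => Seq (p_cmpw b) (Seq (If CY (p_restore b) step) (p_words step n' b))
 end.

Definition p_shift (step bits : prog) (a b : list reg) : prog :=
 Seq (p_words step (length a) b) (Seq (p_cmpw b)
  (If CY (Seq (p_restore b) (Seq (Op Or SH (hd ZR b) (hd ZR b)) (Seq (Op Sub CSH RW SH) bits))) (p_zero a))).

Lemma WB_get st n : regs st RW = w -> regs st ZR = 0 -> get_num w st (WB n) = w.
Proof.
 intros H1 H2. simpl. rewrite H1. replace (get_num w st (repeat ZR n)) with 0; [lia|].
 induction n; simpl; auto. rewrite <- IHn, H2. lia.
Qed.

Lemma WB_len n : length (WB n) = S n.
Proof. simpl. now rewrite repeat_length. Qed.

Lemma WB_in n r : In r (WB n) -> r = RW \/ r = ZR.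
Proof. intros [->|H]; auto. apply repeat_spec in H; auto. Qed.

Lemma WB_readable n : readable (WB n).
Proof. intros r Hr. apply WB_in in Hr as [->| ->]; rsolve. Qed.

Lemma WB_disj n b : safe b -> disj (WB n) b.
Proof. intros Hb r Hr Hr'. apply Hb in Hr'. apply WB_in in Hr as [->| ->]; apply Hr'; rsolve. Qed.

Definition okb (b : list reg) st := NoDup b /\ safe b /\ b <> [] /\ rwf st /\ regs st RW = w /\ regs st ZR = 0.

Lemma okb_framed b st st' l : okb b st -> framed l st st' -> safe l -> okb b st'.
Proof.
 intros (A & B & C & D & E & F) G Hl. repeat split; auto; try apply G.
 - rewrite (framed_RW l st); auto.
 - rewrite (framed_ZR l st); auto.
Qed.

Lemma p_cmpw_spec b st : okb b st ->
 rwp (p_cmpw b) (fun st' => framed b st st' /\ regs st' CY <= 1 /\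
  get_num w st' b + w = get_num w st b + 2 ^ (w * N.of_nat (length b)) * regs st' CY) st.
Proof.
 intros (Hnd & Hb & Hn & Hf & E1 & E2). apply rwp_seq, rwp_const.
 assert (F : framed [] st (set_reg st CY (0 mod 2 ^ w))) by (apply framed_const0; auto; left; rsolve).
 eapply rwp_mono; [|apply p_sub_spec; auto].
 - intros st' (F' & C & E). split; [eapply framed_trans; [eapply framed_incl; [|exact F]; intros ? []|exact F']|].
  split; auto. rewrite WB_get in E by (rsimp; auto).
  rewrite (framed_getr _ _ _ b F) in E; auto using safe_readable; [|intros ? ? []].
  revert E. rsimp. rewrite N.Div0.mod_0_l. lia.
 - rewrite WB_len. destruct b; simpl; congruence.
 - apply WB_readable.
 - apply WB_disj; auto.
 - apply F.
 - rsimp. rewrite N.Div0.mod_0_l. lia.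
Qed.

Lemma p_restore_spec b st v : okb b st -> v < 2 ^ (w * N.of_nat (length b)) ->
 get_num w st b + w = v + 2 ^ (w * N.of_nat (length b)) ->
 rwp (p_restore b) (fun st' => framed b st st' /\ get_num w st' b = v) st.
Proof.
 intros (Hnd & Hb & Hn & Hf & E1 & E2) Hv Ev. apply rwp_seq, rwp_const.
 assert (F : framed [] st (set_reg st CY (0 mod 2 ^ w))) by (apply framed_const0; auto; left; rsolve).
 eapply rwp_mono; [|apply p_add_spec; auto].
 - intros st' (F' & C & E). split; [eapply framed_trans; [eapply framed_incl; [|exact F]; intros ? []|exact F']|].
  rewrite WB_get in E by (rsimp; auto).
  rewrite (framed_getr _ _ _ b F) in E; auto using safe_readable; [|intros ? ? []].
  revert E. rsimp. rewrite N.Div0.mod_0_l, N.add_0_r, Ev. intros E.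
  pose proof (get_num_lt st' b ltac:(apply F')). revert E H Hv. gp. intros.
  assert (regs st' CY = 0 \/ regs st' CY = 1) as [Q|Q] by lia; rewrite Q in E; lia.
 - rewrite WB_len. destruct b; simpl; congruence.
 - apply WB_readable.
 - apply WB_disj; auto.
 - apply F.
 - rsimp. rewrite N.Div0.mod_0_l. lia.
Qed.

Section Shift.
Context (a b : list reg) (F : N -> N -> N) (step bits : prog).
Hypothesis Hlen : length a = length b.
Hypothesis Hda : NoDup a.
Hypothesis Hsa : safe a.
Hypothesis Hdis : disj a b.
Hypothesis Fadd : forall v m n, F (F v m) n = F v (m + n).
Hypothesis F0 : forall v, v < 2 ^ (w * N.of_nat (length a)) -> F v 0 = v.
Hypothesis Fbig : forall v n, v < 2 ^ (w * N.of_nat (length a)) -> w * N.of_nat (length a) <= n -> F v n = 0.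
Hypothesis Hstep : forall st, rwf st -> regs st CY <= 1 -> regs st RW = w -> regs st ZR = 0 -> regs st CY = 0 ->
 rwp step (fun st' => framed a st st' /\ get_num w st' a = F (get_num w st a) w) st.
Hypothesis Hbits : forall st s, s < w -> rwf st -> regs st SH = s -> regs st CSH = w - s ->
 rwp bits (fun st' => framed a st st' /\ get_num w st' a = F (get_num w st a) s) st.

Lemma disj_sym : disj b a.
Proof. intros r H1 H2. apply (Hdis r); auto. Qed.

Lemma safe_app : safe b -> safe (a ++ b).
Proof. intros Hb r Hr. apply in_app_iff in Hr as []; auto. Qed.

Lemma p_words_spec n : forall st, okb b st ->
 rwp (p_words step n b) (fun st' => framed (a ++ b) st st' /\ exists j, j <= N.of_nat n /\
   get_num w st b = get_num w st' b + j * w /\ get_num w st' a = F (get_num w st a) (j * w) /\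
   (get_num w st' b < w \/ j = N.of_nat n)) st.
Proof.
 induction n as [|n IH]; intros st Hok; simpl p_words.
 - apply rwp_skip. split; [apply framed_refl; apply Hok|]. exists 0. rewrite F0 by (apply get_num_lt; apply Hok).
  repeat split; auto; lia.
 - apply rwp_seq. eapply rwp_mono; [|apply p_cmpw_spec; auto]. intros st1 (F1 & C1 & E1).
  pose proof Hok as (Hnb & Hsb & Hne & Hf & _).
  assert (Ea : get_num w st1 a = get_num w st a) by (eapply framed_getr; eauto using safe_readable).
  assert (Hb1 := get_num_lt st1 b ltac:(apply F1)). assert (Hb0 := get_num_lt st b Hf).
  assert (Hwb : w < 2 ^ (w * N.of_nat (length b))).
  { eapply N.lt_le_trans; [apply w_lt_pow|]. apply N.pow_le_mono_r; [lia|]. destruct b; [congruence|].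
   simpl length. nia. }
  apply rwp_seq, rwp_if; intros Ec.
  + assert (Q : regs st1 CY = 1) by lia. rewrite Q in E1.
   eapply rwp_mono; [|apply (p_restore_spec b st1 (get_num w st b)); auto; [|lia]].
   2: eapply okb_framed; eauto.
   intros st2 (F2 & E2). assert (F12 : framed b st st2) by (eapply framed_trans; eauto).
   eapply rwp_mono; [|apply IH; eapply okb_framed; eauto].
   assert (Ea2 : get_num w st2 a = get_num w st a) by (eapply framed_getr; eauto using safe_readable).
   intros st3 (F3 & j & J1 & J2 & J3 & J4). rewrite Ea2 in J3. rewrite E2 in J2. split.
   { eapply framed_trans; [eapply framed_incl; [|exact F12]; intros ? ?; apply in_app_iff; auto|exact F3]. }
   assert (get_num w st b < w) by lia.
   exists j. repeat split; auto; try lia.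
  + rewrite Ec in E1.
   assert (Hok1 : okb b st1) by (eapply okb_framed; eauto).
   eapply rwp_mono; [|apply Hstep; auto; apply Hok1].
   intros st2 (F2 & E2).
   assert (Eb2 : get_num w st2 b = get_num w st1 b) by (eapply framed_getr; eauto using safe_readable, disj_sym).
   eapply rwp_mono; [|apply IH; eapply okb_framed; eauto].
   intros st3 (F3 & j & J1 & J2 & J3 & J4). split.
   { eapply framed_trans; [eapply framed_incl; [|exact F1]; intros ? ?; apply in_app_iff; auto|].
    eapply framed_trans; [eapply framed_incl; [|exact F2]; intros ? ?; apply in_app_iff; auto|exact F3]. }
   exists (j + 1). split; [lia|]. split; [lia|]. split.
   * rewrite J3, E2, Ea, Fadd. f_equal. lia.
   * destruct J4; [auto|right; lia].
Qed.

(** [F v n] stands for [v] shifted by [n]. Both directions compose additively and give 0 once [n]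
    reaches the width of the block, which is all that the word-then-bit scheme relies on besides the
    correctness of single shifts. *)
Lemma p_shift_spec st : okb b st ->
 rwp (p_shift step bits a b) (fun st' => framed (a ++ b) st st' /\
   get_num w st' a = F (get_num w st a) (get_num w st b)) st.
Proof.
 intros Hok. apply rwp_seq. eapply rwp_mono; [|apply p_words_spec; auto].
 intros st1 (F1 & j & J1 & J2 & J3 & J4).
 pose proof Hok as (Hnb & Hsb & Hne & Hf & _).
 assert (Hok1 : okb b st1) by (eapply okb_framed; eauto using safe_app).
 apply rwp_seq. eapply rwp_mono; [|apply p_cmpw_spec; auto]. intros st2 (F2 & C2 & E2).
 assert (Ea : get_num w st2 a = get_num w st1 a) by (eapply framed_getr; eauto using safe_readable).
 assert (Hok2 : okb b st2) by (eapply okb_framed; eauto).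
 assert (Hb1 := get_num_lt st1 b ltac:(apply F1)). assert (Hb2 := get_num_lt st2 b ltac:(apply F2)).
 assert (F12 : framed (a ++ b) st st2).
 { eapply framed_trans; [exact F1|]. eapply framed_incl; [|exact F2]; intros ? ?; apply in_app_iff; auto. }
 apply rwp_if; intros Ec.
 - assert (Q : regs st2 CY = 1) by lia. rewrite Q in E2.
  apply rwp_seq. eapply rwp_mono; [|apply (p_restore_spec b st2 (get_num w st1 b)); auto; lia].
  intros st3 (F3 & E3). assert (Hok3 : okb b st3) by (eapply okb_framed; eauto).
  assert (Hlt : get_num w st3 b < w) by lia.
  (* The remaining amount is below [w < 2 ^ w], so its higher words vanish and the lowest register
     alone holds it. *)
  assert (Hhd : get_num w st3 b = regs st3 (hd ZR b) /\ ~ special (hd ZR b)).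
  { destruct b as [|y b']; [congruence|]. simpl in *. split; [|apply Hsb; simpl; auto].
   destruct (N.eq_dec (get_num w st3 b') 0) as [Z|Z]; [rewrite Z; lia|].
   pose proof w_lt_pow. assert (2 ^ w * 1 <= 2 ^ w * get_num w st3 b') by (apply N.mul_le_mono_l; lia). lia. }
  destruct Hhd as [Hhd Hsp]. assert (Hf3 : rwf st3) by apply Hok3.
  assert (E3a : get_num w st3 a = get_num w st1 a).
  { rewrite <- Ea. eapply framed_getr; eauto using safe_readable. }
  apply rwp_seq, rwp_op, rwp_seq, rwp_op. set (st4 := set_reg _ CSH _).
  assert (F4 : framed [] st3 st4) by (unfold st4; frop).
  assert (S4 : regs st4 SH = get_num w st3 b /\ regs st4 CSH = w - get_num w st3 b).
  { unfold st4. rsimp. cbn [eval_binop]. rewrite N.lor_diag. rsimp.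
   replace (regs st3 RW) with w by (symmetry; apply Hok3). rewrite <- Hhd. split; auto.
   pose proof w_lt_pow. replace (w + 2 ^ w - get_num w st3 b) with (w - get_num w st3 b + 1 * 2 ^ w) by lia.
   rewrite N.Div0.mod_add. apply N.mod_small. lia. }
  clearbody st4. destruct S4 as [S4 S4'].
  eapply rwp_mono; [|apply (Hbits st4 (get_num w st3 b)); auto; apply F4].
  intros st5 (F5 & E5). split.
  + eapply framed_trans; [exact F12|]. eapply framed_trans; [eapply framed_incl; [|exact F3]; intros ? ?; apply in_app_iff; auto|].
   eapply framed_trans; [eapply framed_incl; [|exact F4]; intros ? []|].
   eapply framed_incl; [|exact F5]; intros ? ?; apply in_app_iff; auto.
  + rewrite E5. rewrite (framed_getr _ _ _ a F4); auto using safe_readable; [|intros ? ? []].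
   rewrite E3a, J3, E3, Fadd. f_equal. lia.
 - rewrite Ec in E2. assert (Hge : w <= get_num w st1 b) by lia. destruct J4 as [J4|J4]; [lia|].
  eapply rwp_mono; [|apply p_zero_spec; auto; apply F2]. intros st3 (F3 & E3 & _). split.
  + eapply framed_trans; [exact F12|]. eapply framed_incl; [|exact F3]; intros ? ?; apply in_app_iff; auto.
  + rewrite E3. symmetry. apply Fbig; [apply get_num_lt; auto|]. subst j. nia.
Qed.
End Shift.

Definition p_shr (a b : list reg) : prog := p_shift (p_wshr a) (p_bshr a) a b.
Definition p_shl (a b : list reg) : prog := p_shift (p_wshl a) (Seq (Const CY 0) (p_bshl a)) a b.

Lemma p_shr_spec a b st : length a = length b -> NoDup a -> safe a -> disj a b -> okb b st ->
 rwp (p_shr a b) (fun st' => framed (a ++ b) st st' /\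
   get_num w st' a = get_num w st a / 2 ^ get_num w st b) st.
Proof.
 intros. apply (p_shift_spec a b (fun v n => v / 2 ^ n)); auto.
 - intros. rewrite N.Div0.div_div, N.pow_add_r. reflexivity.
 - intros. rewrite N.pow_0_r. apply N.div_1_r.
 - intros. apply N.div_small. eapply N.lt_le_trans; eauto. apply N.pow_le_mono_r; lia.
 - intros. eapply rwp_mono; [|apply p_wshr_spec; auto]. intros st' (F & E). split; auto.
  rewrite E. pw. apply N.div_unique with (regs st' CY); [apply F|lia].
 - intros. eapply rwp_mono; [|apply (p_bshr_spec a s); auto]. intros st' (F & _ & _ & C & E). split; auto.
  rewrite E. apply N.div_unique with (regs st' CY); lia.
Qed.

Lemma p_shl_spec a b st : length a = length b -> NoDup a -> safe a -> disj a b -> okb b st ->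
 rwp (p_shl a b) (fun st' => framed (a ++ b) st st' /\
   get_num w st' a = (get_num w st a * 2 ^ get_num w st b) mod 2 ^ (w * N.of_nat (length a))) st.
Proof.
 intros. apply (p_shift_spec a b (fun v n => (v * 2 ^ n) mod 2 ^ (w * N.of_nat (length a)))); auto.
 - intros. rewrite N.Div0.mul_mod_idemp_l, N.pow_add_r, N.mul_assoc. reflexivity.
 - intros. rewrite N.pow_0_r, N.mul_1_r. apply N.mod_small; auto.
 - intros v n Hv Hn. replace n with (n - w * N.of_nat (length a) + w * N.of_nat (length a)) by lia.
  rewrite N.pow_add_r, N.mul_assoc. apply N.Div0.mod_mul.
 - intros s Hf _ _ _ Hc. eapply rwp_mono; [|apply p_wshl_spec; auto]. intros st' (F & E). split; auto.
  rewrite Hc, N.add_0_r in E. rewrite <- E. rewrite N.mul_comm with (n := 2 ^ _), N.Div0.mod_add. symmetry.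
  apply N.mod_small, get_num_lt, F.
 - intros s0 s Hs Hf E1 E2. apply rwp_seq, rwp_const.
  assert (F0 : framed [] s0 (set_reg s0 CY (0 mod 2 ^ w))) by (apply framed_const0; auto; left; rsolve).
  pose proof (pow_pos_w s).
  eapply rwp_mono; [|apply (p_bshl_spec a s); auto; try apply F0; rsimp; rewrite ?N.Div0.mod_0_l; auto].
  intros st' (F & E). split.
  + eapply framed_trans; [eapply framed_incl; [|exact F0]; intros ? []|exact F].
  + rewrite (framed_getr _ _ _ a F0) in E; auto using safe_readable; [|intros ? ? []].
   revert E. rsimp. rewrite N.Div0.mod_0_l, N.add_0_r. intros <-.
   rewrite N.mul_comm with (n := 2 ^ _), N.Div0.mod_add. symmetry. apply N.mod_small, get_num_lt, F.
Qed.

(** * Compilation of structured programs to the RAM *)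

Context (t0 K' : nat).
Definition K := S K'.
Definition VW : N := w * N.of_nat K.

(** Cantor pairing gives every word of every block its own register; the parity of the offset
    separates the temporaries of expression evaluation from the registers of variables. *)
Definition tregs (k : nat) : list reg := map (fun x => (B0 + 9 + 2 * to_nat (k, x))%nat) (seq 0 K).
Definition vregs (v : var) : list reg := map (fun x => (B0 + 10 + 2 * to_nat (to_nat v, x))%nat) (seq 0 K).
Local Arguments tregs : simpl never.
Local Arguments vregs : simpl never.
(** Each word position of the entries has its own machine array. Array [t0] itself stays free; it
    will keep the word length for the queries. *)
Definition DA (A : darr) (x : nat) : arr := (t0 + 1 + to_nat (to_nat A, x))%nat.

Definition p_op (o : vop) (a b : list reg) : prog :=
 match o with
 | VAdd => Seq (Const CY 0) (p_add a b)
 | VSub => Seq (Const CY 0) (Seq (p_sub a b) (If CY (p_zero a) Skip))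
 | VLt => Seq (Const CY 0) (Seq (p_sub a b) (If CY (p_bit a 1) (p_bit a 0)))
 | VShl => p_shl a b
 | VShr => p_shr a b
 end.

Lemma p_op_spec o a b st : length a = length b -> okb a st -> okb b st -> disj a b ->
 rwp (p_op o a b) (fun st' => framed (a ++ b) st st' /\
   get_num w st' a = eop (w * N.of_nat (length a)) o (get_num w st a) (get_num w st b)) st.
Proof.
 intros Hl Ha Hb Hd. assert (Hda : disj b a) by (intros r ? ?; apply (Hd r); auto).
 pose proof Ha as (A1 & A2 & A3 & A4 & A5 & A6). pose proof Hb as (B1 & B2 & B3 & _).
 assert (F : framed [] st (set_reg st CY (0 mod 2 ^ w))) by (apply framed_const0; auto; left; rsolve).
 assert (HC : regs (set_reg st CY (0 mod 2 ^ w)) CY = 0) by (rsimp; apply N.Div0.mod_0_l).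
 assert (Ea : get_num w (set_reg st CY (0 mod 2 ^ w)) a = get_num w st a)
  by (eapply framed_getr; eauto using safe_readable; intros ? ? []).
 assert (Eb : get_num w (set_reg st CY (0 mod 2 ^ w)) b = get_num w st b)
  by (eapply framed_getr; eauto using safe_readable; intros ? ? []).
 pose proof (get_num_lt st a A4) as La. pose proof (get_num_lt st b A4) as Lb. rewrite <- Hl in Lb.
 pose proof (pow_pos_w (w * N.of_nat (length a))) as Hp.
 assert (Hfr : forall st', framed a (set_reg st CY (0 mod 2 ^ w)) st' -> framed (a ++ b) st st').
 { intros st' F'. eapply framed_trans; [eapply framed_incl; [|exact F]; intros ? []|].
  eapply framed_incl; [|exact F']. intros ? ?; apply in_app_iff; auto. }
 destruct o; cbn [p_op eop].
 - apply rwp_seq, rwp_const. eapply rwp_mono; [|apply p_add_spec; auto using safe_readable; try apply F; lia].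
  intros st' (F' & C & E). split; auto. rewrite Ea, Eb, HC in E.
  pose proof (get_num_lt st' a ltac:(apply F')).
  replace (get_num w st a + get_num w st b)
   with (get_num w st' a + regs st' CY * 2 ^ (w * N.of_nat (length a))) by lia.
  rewrite N.Div0.mod_add, N.mod_small; auto.
 - apply rwp_seq, rwp_const, rwp_seq.
  eapply rwp_mono; [|apply p_sub_spec; auto using safe_readable; try apply F; lia].
  intros st' (F' & C & E). rewrite Ea, Eb, HC in E.
  pose proof (get_num_lt st' a ltac:(apply F')).
  apply rwp_if; intros Hc.
  + eapply rwp_mono; [|apply p_zero_spec; auto; apply F']. intros st2 (F2 & E2 & _).
   split; [apply Hfr; eapply framed_trans; eauto|]. assert (Q : regs st' CY = 1) by lia. rewrite Q in E. lia.
  + apply rwp_skip. split; auto. rewrite Hc in E. lia.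
 - apply rwp_seq, rwp_const, rwp_seq.
  eapply rwp_mono; [|apply p_sub_spec; auto using safe_readable; try apply F; lia].
  intros st' (F' & C & E). rewrite Ea, Eb, HC in E.
  pose proof (get_num_lt st' a ltac:(apply F')).
  apply rwp_if; intros Hc; (eapply rwp_mono; [|apply p_bit_spec; auto; try apply F'; lia]);
   intros st2 (F2 & E2); (split; [apply Hfr; eapply framed_trans; eauto|]); rewrite E2.
  + assert (Q : regs st' CY = 1) by lia. rewrite Q in E. destruct (N.ltb_spec (get_num w st a) (get_num w st b)); lia.
  + rewrite Hc in E. destruct (N.ltb_spec (get_num w st a) (get_num w st b)); lia.
 - apply p_shl_spec; auto.
 - apply p_shr_spec; auto.
Qed.

Fixpoint p_read (l : list reg) (A : darr) (addr : list reg) (i : nat) : prog :=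
 match l with
 | [] => Skip
 | x :: l' => Seq (Read x (DA A i) addr) (p_read l' A addr (S i))
 end.

Fixpoint p_write (l : list reg) (A : darr) (addr : list reg) (i : nat) : prog :=
 match l with
 | [] => Skip
 | x :: l' => Seq (Write (DA A i) addr x) (p_write l' A addr (S i))
 end.

Fixpoint cnum (m : arr -> N -> N) (A : darr) (i n : nat) (a : N) : N :=
 match n with
 | O => 0
 | S n' => m (DA A i) a + 2 ^ w * cnum m A (S i) n' a
 end.

Definition mwf (m : arr -> N -> N) := forall k a, m k a < 2 ^ w.

Lemma to_nat_inj a b a' b' : to_nat (a, b) = to_nat (a', b') -> a = a' /\ b = b'.
Proof. intros H. apply to_nat_inj in H. inversion H; auto. Qed.

Lemma DA_inj A A' x x' : DA A x = DA A' x' -> A = A' /\ x = x'.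
Proof.
 unfold DA. intros H. assert (E : to_nat (to_nat A, x) = to_nat (to_nat A', x')) by lia.
 apply to_nat_inj in E as [E ->]. destruct A, A'. apply to_nat_inj in E as [-> ->]. auto.
Qed.

Lemma p_read_spec l A addr : forall i st, NoDup l -> disj addr l -> rwf st -> mwf (mem st) ->
 rwp (p_read l A addr i) (fun st' => framed l st st' /\ (forall r, ~ In r l -> regs st' r = regs st r) /\
  get_num w st' l = cnum (mem st) A i (length l) (get_num w st addr)) st.
Proof.
 induction l as [|x l IH]; intros i st Hnd Hd Hf Hm; simpl p_read.
 - apply rwp_skip. repeat split; auto.
 - apply NoDup_cons_iff in Hnd as [Hn Hnd]. apply rwp_seq, rwp_read.
  assert (disj addr l) by (intros r Hr Hr'; apply (Hd r); simpl; auto).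
  set (st1 := set_reg _ _ _).
  assert (F1 : framed [x] st st1) by (apply framed_step; [apply framed_refl; auto|apply Hm|right; simpl; auto]).
  assert (E1 : get_num w st1 addr = get_num w st addr).
  { apply get_num_ext. intros r Hr. unfold st1. cbn. rewrite eqb_neq_nat; auto.
   intros ->. apply (Hd x); simpl; auto. }
  eapply rwp_mono; [|apply IH; auto; apply F1].
  intros st2 (F2 & G & E). split; [|split].
  + eapply framed_trans; eapply framed_incl; eauto; intros r Hr; simpl in *; tauto.
  + intros r Hr. simpl in Hr. rewrite G by tauto. unfold st1; cbn. rewrite eqb_neq_nat; auto; intuition.
  + cbn [get_num length cnum]. rewrite E, E1, G by auto. unfold st1 at 1. cbn. rewrite Nat.eqb_refl. reflexivity.
Qed.

Lemma cnum_ext m m' A n a : forall i, (forall x, (i <= x < i + n)%nat -> m (DA A x) a = m' (DA A x) a) ->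
 cnum m A i n a = cnum m' A i n a.
Proof.
 induction n as [|n IH]; intros i H; cbn; auto. rewrite H by lia. rewrite (IH (S i)); auto.
 intros. apply H. lia.
Qed.

Lemma p_write_spec l A addr : forall i st, mwf (mem st) -> rwf st ->
 rwp (p_write l A addr i) (fun st' => regs st' = regs st /\ mwf (mem st') /\
  cnum (mem st') A i (length l) (get_num w st addr) = get_num w st l /\
  (forall k a, (~ exists x, (i <= x)%nat /\ k = DA A x) \/ a <> get_num w st addr -> mem st' k a = mem st k a) /\
  (forall x a, (x < i)%nat -> mem st' (DA A x) a = mem st (DA A x) a)) st.
Proof.
 induction l as [|x l IH]; intros i st Hm Hf; simpl p_write.
 - apply rwp_skip. repeat split; auto.
 - apply rwp_seq, rwp_write. set (st1 := set_mem _ _ _ _).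
  assert (Hm1 : mwf (mem st1)).
  { intros k a; unfold st1; cbn. destruct (_ && _)%bool; auto. }
  assert (E1 : get_num w st1 addr = get_num w st addr) by (apply get_num_ext; reflexivity).
  assert (E2 : get_num w st1 l = get_num w st l) by (apply get_num_ext; reflexivity).
  eapply rwp_mono; [|apply IH; auto].
  intros st2 (R & Hm2 & E & G & G2). rewrite E1, E2 in *.
  split; [exact R|split; [auto|split; [|split]]].
  + cbn [length cnum get_num]. rewrite E, G2 by lia. unfold st1; cbn. rewrite Nat.eqb_refl, N.eqb_refl. reflexivity.
  + intros k a H. rewrite G.
   * unfold st1; cbn. destruct (Nat.eqb_spec k (DA A i)), (N.eqb_spec a (get_num w st addr)); auto.
    exfalso. destruct H as [H|H]; auto. apply H. exists i. auto.
   * destruct H as [H|H]; auto. left. intros (y & ? & ?). apply H. exists y. split; [lia|auto].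
  + intros y a Hy. rewrite G2 by lia. unfold st1; cbn.
   destruct (Nat.eqb_spec (DA A y) (DA A i)) as [e|]; auto. apply DA_inj in e. lia.
Qed.

Fixpoint ce (e : expr) (k : nat) : prog :=
 match e with
 | EV v => p_move (tregs k) (vregs v)
 | E0 => p_bit (tregs k) 0
 | E1 => p_bit (tregs k) 1
 | EB o e1 e2 => Seq (ce e1 k) (Seq (ce e2 (S k)) (p_op o (tregs k) (tregs (S k))))
 | ERd A e1 e2 => Seq (ce e1 k) (Seq (ce e2 (S k))
   (Seq (p_read (tregs (S (S k))) A (tregs k ++ tregs (S k)) 0) (p_move (tregs k) (tregs (S (S k))))))
 | ECell j e => Seq (ce e k) (Seq (Read R1 j (tregs k)) (Seq (p_zero (tregs k)) (Op Or (hd ZR (tregs k)) R1 R1)))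
 end.

Fixpoint depth (e : expr) : nat :=
 match e with
 | EB _ e1 e2 | ERd _ e1 e2 => S (S (S (depth e1 + depth e2)))
 | ECell _ e => S (depth e)
 | _ => 1
 end%nat.

Definition temps (k n : nat) : list reg := flat_map tregs (seq k n).

Lemma temps_in k n r : In r (temps k n) <-> exists j, (k <= j < k + n)%nat /\ In r (tregs j).
Proof.
 unfold temps. rewrite in_flat_map. split; intros (j & H1 & H2); exists j; [apply in_seq in H1|rewrite in_seq]; auto.
Qed.

Lemma tb_in k r : In r (tregs k) -> exists x, (x < K)%nat /\ r = (B0 + 9 + 2 * to_nat (k, x))%nat.
Proof. unfold tregs. rewrite in_map_iff. intros (x & <- & H). apply in_seq in H. exists x; split; [lia|auto]. Qed.

Lemma vb_in v r : In r (vregs v) -> exists x, (x < K)%nat /\ r = (B0 + 10 + 2 * to_nat (to_nat v, x))%nat.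
Proof. unfold vregs. rewrite in_map_iff. intros (x & <- & H). apply in_seq in H. exists x; split; [lia|auto]. Qed.

Lemma tb_safe k : safe (tregs k).
Proof. intros r H. apply tb_in in H as (x & _ & ->). unfold special, NZ. lia. Qed.

Lemma vb_safe v : safe (vregs v).
Proof. intros r H. apply vb_in in H as (x & _ & ->). unfold special, NZ. lia. Qed.

Lemma tb_nodup k : NoDup (tregs k).
Proof.
 unfold tregs. apply Injective_map_NoDup; [|apply seq_NoDup]. intros x y H.
 assert (E : to_nat (k, x) = to_nat (k, y)) by lia. apply to_nat_inj in E; tauto.
Qed.

Lemma vb_nodup v : NoDup (vregs v).
Proof.
 unfold vregs. apply Injective_map_NoDup; [|apply seq_NoDup]. intros x y H.
 assert (E : to_nat (to_nat v, x) = to_nat (to_nat v, y)) by lia. apply to_nat_inj in E; tauto.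
Qed.

Lemma tb_len k : length (tregs k) = K.
Proof. unfold tregs. now rewrite length_map, length_seq. Qed.

Lemma vb_len v : length (vregs v) = K.
Proof. unfold vregs. now rewrite length_map, length_seq. Qed.

Lemma tb_disj j k : j <> k -> disj (tregs j) (tregs k).
Proof.
 intros Hn r H1 H2. apply tb_in in H1 as (x & _ & ->). apply tb_in in H2 as (y & _ & H).
 assert (E : to_nat (j, x) = to_nat (k, y)) by lia. apply to_nat_inj in E; tauto.
Qed.

Lemma vb_disj u v : u <> v -> disj (vregs u) (vregs v).
Proof.
 intros Hn r H1 H2. apply vb_in in H1 as (x & _ & ->). apply vb_in in H2 as (y & _ & H).
 assert (E : to_nat (to_nat u, x) = to_nat (to_nat v, y)) by lia. apply to_nat_inj in E as [E _].
 destruct u, v. apply to_nat_inj in E as [-> ->]; auto.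
Qed.

Lemma vb_tb_disj v k : disj (vregs v) (tregs k).
Proof. intros r H1 H2. apply vb_in in H1 as (x & _ & ->). apply tb_in in H2 as (y & _ & H). lia. Qed.

(** A pair of indices is stored at the address [i + 2 ^ VW * j]; requiring [i < 2 ^ VW] makes this
    injective, and all values of expressions satisfy it. *)
Definition rep (s : vst) (st : state) : Prop :=
 rwf st /\ mwf (mem st) /\ regs st RW = w /\ regs st ZR = 0 /\
 (forall v, get_num w st (vregs v) = env s v) /\
 (forall A i j, i < 2 ^ VW -> dm s A i j = cnum (mem st) A 0 K (i + 2 ^ VW * j)) /\
 (forall k a, (k < t0)%nat -> cm s k a = mem st k a).

Lemma temps_safe k n : safe (temps k n).
Proof. intros r H. apply temps_in in H as (j & _ & H). apply (tb_safe j r H). Qed.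

Lemma rep_framed s st st' k n : rep s st -> framed (temps k n) st st' -> rep s st'.
Proof.
 intros (A & B & C & D & E & F & G) H. pose proof H as (H1 & H2 & H3).
 sp. rewrite H2. sp. split; [|split; [|split; [|auto]]].
 - rewrite <- C. eapply framed_RW; eauto. apply temps_safe.
 - rewrite <- D. eapply framed_ZR; eauto. apply temps_safe.
 - intros v. rewrite <- E. eapply framed_getr; eauto using safe_readable, vb_safe.
  intros r Hr Hr'. apply temps_in in Hr' as (j & _ & Hr'). apply (vb_tb_disj v j r); auto.
Qed.

Lemma okb_tb k s st : rep s st -> okb (tregs k) st.
Proof.
 intros (A & B & C & D & _). repeat split; auto using tb_nodup, tb_safe.
 intros E. pose proof (tb_len k). rewrite E in H. discriminate.
Qed.

Lemma temps_incl k n k' n' : (k' <= k)%nat -> (k + n <= k' + n')%nat -> incl (temps k n) (temps k' n').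
Proof. intros ? ? r H1. apply temps_in in H1 as (j & ? & ?). apply temps_in. exists j. split; [lia|auto]. Qed.

Lemma tb_incl k k' n' : (k' <= k)%nat -> (k < k' + n')%nat -> incl (tregs k) (temps k' n').
Proof. intros ? ? r H1. apply temps_in. exists k. split; [lia|auto]. Qed.

Lemma disj_tb_temps j k n : (j < k)%nat -> disj (tregs j) (temps k n).
Proof. intros H r H1 H2. apply temps_in in H2 as (i & ? & ?). apply (tb_disj j i ltac:(lia) r); auto. Qed.

(** Stack discipline: evaluation at level [k] changes no temporary below [k], hence the first
    operand survives the evaluation of the second one at level [S k]. *)
Lemma ce_spec e : forall k s st, rep s st -> cells_ok_e t0 e = true ->
 rwp (ce e k) (fun st' => framed (temps k (depth e)) st st' /\ get_num w st' (tregs k) = eval VW s e) st.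
Proof.
 induction e; intros k0 s st Hrep Hok; cbn [ce eval depth cells_ok_e] in *.
 - eapply rwp_mono; [|apply p_move_spec; try apply Hrep; auto using tb_nodup, vb_tb_disj; now rewrite tb_len, vb_len].
  intros st' (F & E & _). split; [eapply framed_incl; [|exact F]; apply tb_incl; lia|].
  rewrite E. apply Hrep.
 - eapply rwp_mono; [|apply p_bit_spec; try apply Hrep; auto using tb_nodup; try lia].
  + intros st' (F & E). split; [eapply framed_incl; [|exact F]; apply tb_incl; lia|auto].
  + intros E. pose proof (tb_len k0) as L. rewrite E in L. discriminate.
 - eapply rwp_mono; [|apply p_bit_spec; try apply Hrep; auto using tb_nodup; try lia].
  + intros st' (F & E). split; [eapply framed_incl; [|exact F]; apply tb_incl; lia|auto].
  + intros E. pose proof (tb_len k0) as L. rewrite E in L. discriminate.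
 - apply Bool.andb_true_iff in Hok as [Ok1 Ok2].
  apply rwp_seq. eapply rwp_mono; [|apply IHe1; eauto]. intros st1 (F1 & V1).
  assert (R1' : rep s st1) by (eapply rep_framed; eauto).
  apply rwp_seq. eapply rwp_mono; [|apply IHe2; eauto]. intros st2 (F2 & V2).
  assert (R2' : rep s st2) by (eapply rep_framed; eauto).
  assert (V1' : get_num w st2 (tregs k0) = eval VW s e1).
  { rewrite <- V1. eapply framed_getr; eauto using safe_readable, tb_safe. apply disj_tb_temps; lia. }
  eapply rwp_mono; [|apply p_op_spec; eauto using okb_tb].
  + intros st3 (F3 & V3). split.
   * eapply framed_trans; [eapply framed_incl; [|exact F1]; apply temps_incl; lia|].
    eapply framed_trans; [eapply framed_incl; [|exact F2]; apply temps_incl; lia|].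
    eapply framed_incl; [|exact F3]. apply incl_app; apply tb_incl; lia.
   * rewrite V3, V1', V2, tb_len. reflexivity.
  + now rewrite !tb_len.
  + apply tb_disj; lia.
 - apply Bool.andb_true_iff in Hok as [Ok1 Ok2].
  apply rwp_seq. eapply rwp_mono; [|apply IHe1; eauto]. intros st1 (F1 & V1).
  assert (R1' : rep s st1) by (eapply rep_framed; eauto).
  apply rwp_seq. eapply rwp_mono; [|apply IHe2; eauto]. intros st2 (F2 & V2).
  assert (R2' : rep s st2) by (eapply rep_framed; eauto).
  assert (V1' : get_num w st2 (tregs k0) = eval VW s e1).
  { rewrite <- V1. eapply framed_getr; eauto using safe_readable, tb_safe. apply disj_tb_temps; lia. }
  apply rwp_seq. eapply rwp_mono; [|apply p_read_spec; try apply R2'; auto using tb_nodup].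
  2:{ intros r Hr. apply in_app_iff in Hr as [Hr|Hr]; revert r Hr; apply tb_disj; lia. }
  intros st3 (F3 & _ & V3).
  eapply rwp_mono; [|apply p_move_spec; try apply F3; auto using tb_nodup].
  + intros st4 (F4 & V4 & _). split.
   * eapply framed_trans; [eapply framed_incl; [|exact F1]; apply temps_incl; lia|].
    eapply framed_trans; [eapply framed_incl; [|exact F2]; apply temps_incl; lia|].
    eapply framed_trans; (eapply framed_incl; [|eassumption]; apply tb_incl; lia).
   * rewrite V4, V3, get_num_app, V1', V2, !tb_len. symmetry. apply R2'.
    rewrite <- V1'. unfold VW. rewrite <- (tb_len k0). apply get_num_lt, R2'.
  + now rewrite !tb_len.
  + apply tb_disj; lia.
 - apply Bool.andb_true_iff in Hok as [Ok1 Ok2]. apply Nat.ltb_lt in Ok1.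
  apply rwp_seq. eapply rwp_mono; [|apply IHe; eauto]. intros st1 (F1 & V1).
  assert (R1' : rep s st1) by (eapply rep_framed; eauto).
  apply rwp_seq, rwp_read. set (st2 := set_reg st1 R1 _).
  assert (F2 : framed [] st1 st2).
  { apply framed_step; [apply framed_refl; apply R1'|apply R1'|left; rsolve]. }
  assert (E2 : regs st2 R1 = cm s k (eval VW s e)).
  { unfold st2. rsimp. rewrite V1. symmetry. apply R1'; auto. }
  clearbody st2.
  apply rwp_seq. eapply rwp_mono; [|apply p_zero_spec; auto using tb_nodup; apply F2].
  intros st3 (F3 & Z & G).
  apply rwp_op. cbn [eval_binop]. rewrite N.lor_diag.
  assert (E3 : regs st3 R1 = cm s k (eval VW s e)).
  { rewrite G; auto. intros H. apply tb_safe in H. apply H. rsolve. }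
  split.
  + eapply framed_trans; [eapply framed_incl; [|exact F1]; apply temps_incl; lia|].
   eapply framed_trans; [eapply framed_incl; [|exact F2]; intros ? []|].
   eapply framed_trans; [eapply framed_incl; [|exact F3]; apply tb_incl; lia|].
   apply framed_step; [apply framed_refl; apply F3|apply F3|].
   right. apply (tb_incl k0); [lia|lia|]. unfold tregs, K; simpl; auto.
  + revert Z E3. pose proof (tb_nodup k0) as Hnd. unfold tregs, K in *. cbn [seq map hd] in *.
   set (x0 := (B0 + 9 + 2 * to_nat (k0, 0))%nat) in *. cbn [get_num] in *. intros Z E3.
   apply NoDup_cons_iff in Hnd as [Hn _].
   erewrite get_num_ext; [|intros r Hr; cbn [set_reg regs]; rewrite eqb_neq_nat; [reflexivity|intros ->; exact (Hn Hr)]].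
   cbn [set_reg regs]. rewrite Nat.eqb_refl, E3. apply N.eq_add_0 in Z as [_ Z]. rewrite Z. apply N.add_0_r.
Qed.

Definition test (e : expr) : prog := Seq (ce e 0) (p_nz (tregs 0)).

Lemma test_spec e s st : rep s st -> cells_ok_e t0 e = true ->
 rwp (test e) (fun st' => rep s st' /\ mem st' = mem st /\ (regs st' NZ = 0 <-> eval VW s e = 0)) st.
Proof.
 intros Hr Hok. apply rwp_seq. eapply rwp_mono; [|apply ce_spec; eauto]. intros st1 (F1 & V1).
 assert (R1' : rep s st1) by (eapply rep_framed; eauto).
 eapply rwp_mono; [|apply p_nz_spec; auto using tb_safe; apply F1].
 intros st2 (F2 & E2). rewrite V1 in E2. split; [|split; auto].
 - eapply (rep_framed s st1 st2 0 0); auto.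
 - transitivity (mem st1); [apply F2|apply F1].
Qed.

Fixpoint cs (p : stmt) : prog :=
 match p with
 | SSkip => Skip
 | SSet v e => Seq (ce e 0) (p_move (vregs v) (tregs 0))
 | SSt A e1 e2 e => Seq (ce e1 0) (Seq (ce e2 1) (Seq (ce e 2) (p_write (tregs 2) A (tregs 0 ++ tregs 1) 0)))
 | SCell k e1 e => Seq (ce e1 0) (Seq (ce e 1) (Write k (tregs 0) (hd ZR (tregs 1))))
 | SDelta s' y sv xs => Delta (vregs s') (vregs y) (vregs sv) (map vregs xs)
 | SSeq p1 p2 => Seq (cs p1) (cs p2)
 | SIf e p1 p2 => Seq (test e) (If NZ (cs p1) (cs p2))
 | SWhile e p => Seq (test e) (While NZ (Seq (cs p) (test e)))
 end.

(** The time of one pass through the program, with every loop body counted once. Each counted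
    iteration pays for at most one further pass. *)
Fixpoint ccost (p : stmt) : nat :=
 match p with
 | SSeq p1 p2 => ccost p1 + ccost p2
 | SIf e p1 p2 => plen (test e) + S (ccost p1 + ccost p2)
 | SWhile e p => plen (test e) + 2 + ccost p
 | p => plen (cs p)
 end%nat.

Lemma set_num_regs l : forall st v, NoDup l ->
 (forall r, ~ In r l -> regs (set_num w st l v) r = regs st r) /\
 mem (set_num w st l v) = mem st /\ (rwf st -> rwf (set_num w st l v)) /\
 get_num w (set_num w st l v) l = v mod 2 ^ (w * N.of_nat (length l)).
Proof.
 induction l as [|x l IH]; intros st v Hnd; simpl set_num.
 - repeat split; auto. simpl. rewrite N.mul_0_r, N.pow_0_r, N.mod_1_r. reflexivity.
 - apply NoDup_cons_iff in Hnd as [Hn Hnd].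
  destruct (IH (set_reg st x (v mod 2 ^ w)) (v / 2 ^ w) Hnd) as (A & B & C & D).
  split; [|split; [|split]].
  + intros r Hr. simpl in Hr. rewrite A by tauto. simpl. rewrite eqb_neq_nat; auto; intuition.
  + rewrite B. reflexivity.
  + intros Hf. apply C, rwf_set; auto. apply N.mod_lt. pw. lia.
  + cbn [get_num length]. rewrite D, A by auto. cbn [set_reg regs]. rewrite Nat.eqb_refl, pow_w_S.
   rewrite N.Div0.mod_mul_r. reflexivity.
Qed.

Lemma rep_set s st st' v x : rep s st -> framed (vregs v) st st' -> get_num w st' (vregs v) = x ->
 rep (upd s v x) st'.
Proof.
 intros (A & B & C & D & E & F & G) H Hx. pose proof H as (H1 & H2 & H3).
 sp. rewrite H2. sp. split; [|split; [|split; [|split; auto]]].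
 - rewrite <- C. eapply framed_RW; eauto. apply vb_safe.
 - rewrite <- D. eapply framed_ZR; eauto. apply vb_safe.
 - intros u. cbn [upd env]. destruct (peqb_spec u v) as [->|Hn]; auto.
  rewrite <- E. eapply framed_getr; eauto using safe_readable, vb_safe. apply vb_disj; auto.
Qed.

Lemma ce_lt e s st : rep s st -> cells_ok_e t0 e = true -> eval VW s e < 2 ^ VW.
Proof.
 intros Hr Hok. destruct (ce_spec e 0 s st Hr Hok) as (T & st' & _ & _ & F & V).
 rewrite <- V. unfold VW. rewrite <- (tb_len 0). apply get_num_lt, F.
Qed.

Lemma addr_inj i j i' j' : i < 2 ^ VW -> i' < 2 ^ VW -> i + 2 ^ VW * j = i' + 2 ^ VW * j' -> i = i' /\ j = j'.
Proof.
 intros H1 H2 H. set (P := 2 ^ VW) in *. clearbody P.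
 assert (j = j') by nia. subst. split; [lia|auto].
Qed.

(** Induction on the run; the bound is stated with [1 + n] because even a program without iterations
    needs constant time. *)
Theorem compile_correct p s n s' : run w VW delta p s n s' -> forall st, rep s st -> cells_ok t0 p = true ->
 exists T st', exec w delta tau (cs p) st T st' /\ (T <= ccost p * (1 + n))%nat /\ rep s' st' /\
  (store_free p = true -> forall k a, (t0 <= k)%nat -> mem st' k a = mem st k a).
Proof.
 induction 1; intros st Hr Hok; cbn [cells_ok] in Hok.
 - exists 1%nat, st. split; [constructor|]. split; [cbn; lia|auto].
 - assert (HR : rwp (cs (SSet v e)) (fun st' => rep (upd s v (eval VW s e)) st' /\ mem st' = mem st) st).
  { apply rwp_seq. eapply rwp_mono; [|apply ce_spec; eauto]. intros st1 (F1 & V1).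
   assert (R1' : rep s st1) by (eapply rep_framed; eauto).
   eapply rwp_mono; [|apply p_move_spec; auto using vb_nodup; [| |apply F1]].
   - intros st2 (F2 & V2 & _). split; [|transitivity (mem st1); [apply F2|apply F1]].
    eapply rep_set; eauto. congruence.
   - now rewrite tb_len, vb_len.
   - intros r ? ?. apply (vb_tb_disj v 0 r); auto. }
  destruct HR as (T & st' & X & L & R & M). exists T, st'. sp. split; [cbn [ccost]; lia|].
  split; auto. intros. rewrite M. auto.
 - apply Bool.andb_true_iff in Hok as [Ok1 Ok3]. apply Bool.andb_true_iff in Ok1 as [Ok1 Ok2].
  assert (HR : rwp (cs (SSt A e1 e2 e)) (rep (updm s A (eval VW s e1) (eval VW s e2) (eval VW s e))) st).
  { apply rwp_seq. eapply rwp_mono; [|apply ce_spec; eauto]. intros st1 (F1 & V1).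
   assert (R1' : rep s st1) by (eapply rep_framed; eauto).
   apply rwp_seq. eapply rwp_mono; [|apply ce_spec; eauto]. intros st2 (F2 & V2).
   assert (R2' : rep s st2) by (eapply rep_framed; eauto).
   apply rwp_seq. eapply rwp_mono; [|apply ce_spec; eauto]. intros st3 (F3 & V3).
   assert (R3' : rep s st3) by (eapply rep_framed; eauto).
   assert (V1' : get_num w st3 (tregs 0) = eval VW s e1).
   { rewrite <- V1. rewrite (framed_getr _ _ _ _ F3), (framed_getr _ _ _ _ F2); auto using safe_readable, tb_safe;
     apply disj_tb_temps; lia. }
   assert (V2' : get_num w st3 (tregs 1) = eval VW s e2).
   { rewrite <- V2. rewrite (framed_getr _ _ _ _ F3); auto using safe_readable, tb_safe;
     apply disj_tb_temps; lia. }
   eapply rwp_mono; [|apply p_write_spec; apply R3']. intros st4 (G & M & E & O & _).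
   pose proof R3' as (A' & B' & C' & D' & E' & F' & G').
   rewrite get_num_app, V1', V2', V3, !tb_len in *.
   split; [intros r; rewrite G; apply A'|]. sp. rewrite G. sp. sp.
   split; [|split].
   - intros v. cbn. rewrite <- E'. apply get_num_ext. intros; now rewrite G.
   - intros A0 i j Hi. cbn [updm dm]. pose proof (ce_lt e1 s st Hr Ok1) as Hlt.
    destruct (peqb_spec A0 A) as [->|HA]; cbn [andb].
    + destruct (N.eqb_spec i (eval VW s e1)) as [->|Hi']; cbn [andb].
     * destruct (N.eqb_spec j (eval VW s e2)) as [->|Hj]; [symmetry; exact E|].
      rewrite F' by auto. apply cnum_ext. intros x _. symmetry. apply O. right. intros EE.
      apply addr_inj in EE; auto; tauto.
     * rewrite F' by auto. apply cnum_ext. intros x _. symmetry. apply O. right. intros EE.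
      apply addr_inj in EE; auto; tauto.
    + rewrite F' by auto. apply cnum_ext. intros x _. symmetry. apply O. left. intros (y & _ & EE).
     apply DA_inj in EE; tauto.
   - intros k a Hk. cbn. rewrite O; [apply G'; auto|]. left. intros (y & _ & ->). unfold DA in Hk. lia. }
  destruct HR as (T & st' & X & L & R). exists T, st'. sp. split; [cbn [ccost]; lia|].
  split; auto. discriminate.
 - apply Bool.andb_true_iff in Hok as [Ok1 Ok3]. apply Bool.andb_true_iff in Ok1 as [Ok1 Ok2].
  apply Nat.ltb_lt in Ok1.
  assert (HR : rwp (cs (SCell k e1 e)) (fun st' => rep (updc s k (eval VW s e1) (eval VW s e mod 2 ^ w)) st' /\
    forall k a, (t0 <= k)%nat -> mem st' k a = mem st k a) st).
  { apply rwp_seq. eapply rwp_mono; [|apply ce_spec; eauto]. intros st1 (F1 & V1).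
   assert (R1' : rep s st1) by (eapply rep_framed; eauto).
   apply rwp_seq. eapply rwp_mono; [|apply ce_spec; eauto]. intros st2 (F2 & V2).
   assert (R2' : rep s st2) by (eapply rep_framed; eauto).
   assert (V1' : get_num w st2 (tregs 0) = eval VW s e1).
   { rewrite <- V1. rewrite (framed_getr _ _ _ _ F2); auto using safe_readable, tb_safe;
     apply disj_tb_temps; lia. }
   apply rwp_write. rewrite V1'.
   assert (E : regs st2 (hd ZR (tregs 1)) = eval VW s e mod 2 ^ w).
   { rewrite <- V2. assert (Hf : rwf st2) by apply F2. revert Hf. unfold tregs, K. cbn [seq map hd get_num].
    intros Hf. rewrite N.mul_comm, N.Div0.mod_add, N.mod_small; auto. }
   rewrite E. pose proof R2' as (A' & B' & C' & D' & E' & F' & G').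
   split.
   - split; [exact A'|]. split.
    { intros k' a'; cbn. destruct (_ && _)%bool; auto. apply N.mod_lt; pw; lia. }
    sp. sp. split; [intros v; cbn [updc env]; rewrite <- E'; apply get_num_ext; reflexivity|]. split.
    + intros A0 i j Hi. cbn [updc dm]. rewrite F' by auto. apply cnum_ext. intros x _. cbn.
     rewrite eqb_neq_nat; auto. unfold DA. lia.
    + intros k' a' Hk'. cbn. rewrite <- G' by auto. reflexivity.
   - intros k' a' Hk'. cbn. rewrite eqb_neq_nat by lia. cbn. destruct F1 as (_ & <- & _).
    destruct F2 as (_ & <- & _). reflexivity. }
  destruct HR as (T & st' & X & L & R & M). exists T, st'. sp. split; [cbn [ccost]; lia|].
  split; auto.
 - pose proof Hr as (A' & B' & C' & D' & E' & F' & G').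
  set (r0 := delta (get_num w st (vregs sv)) (map (get_num w st) (map vregs xs))).
  assert (Er : r0 = r).
  { unfold r0, r. rewrite E', map_map. f_equal. apply map_ext. auto. }
  eexists tau, _. split; [apply exec_Delta|]. fold r0. rewrite Er. split; [cbn; lia|].
  destruct (set_num_regs (vregs s') st (fst r) (vb_nodup s')) as (P1 & P2 & P3 & P4).
  set (st1 := set_num w st (vregs s') (fst r)) in *.
  destruct (set_num_regs (vregs y) st1 (snd r) (vb_nodup y)) as (Q1 & Q2 & Q3 & Q4).
  rewrite vb_len in *. split.
  + eapply rep_set with (st := st1); [eapply rep_set with (st := st); eauto|..]; auto.
   * split; [auto|split; [auto|]]. intros; apply P1; auto.
   * split; [auto|split; [auto|]]. intros; apply Q1; auto.
  + intros. rewrite Q2, P2. auto.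
 - apply Bool.andb_true_iff in Hok as [Ok1 Ok2].
  destruct (IHrun1 st Hr Ok1) as (T1 & st1 & X1 & L1 & R1' & S1).
  destruct (IHrun2 st1 R1' Ok2) as (T2 & st2 & X2 & L2 & R2' & S2).
  exists (T1 + T2)%nat, st2. split; [econstructor; eauto|]. split; [cbn [ccost]; nia|]. split; auto.
  cbn [store_free]. intros Hs k a Hk. apply Bool.andb_true_iff in Hs as [Hs1 Hs2]. rewrite S2, S1; auto.
 - apply Bool.andb_true_iff in Hok as [Ok1 Ok3]. apply Bool.andb_true_iff in Ok1 as [Ok1 Ok2].
  destruct (test_spec e s st Hr Ok1) as (T0 & st0 & X0 & L0 & R0 & M0 & E0').
  destruct (IHrun st0 R0 Ok2) as (T1 & st1 & X1 & L1 & R1' & S1).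
  eexists (T0 + S T1)%nat, st1. split; [econstructor; [eauto|]; apply exec_If_true; auto; tauto|].
  split; [cbn [ccost]; nia|]. split; auto.
  cbn [store_free]. intros Hs k a Hk. apply Bool.andb_true_iff in Hs as [Hs1 Hs2]. rewrite S1, M0; auto.
 - apply Bool.andb_true_iff in Hok as [Ok1 Ok3]. apply Bool.andb_true_iff in Ok1 as [Ok1 Ok2].
  destruct (test_spec e s st Hr Ok1) as (T0 & st0 & X0 & L0 & R0 & M0 & E0').
  destruct (IHrun st0 R0 Ok3) as (T1 & st1 & X1 & L1 & R1' & S1).
  eexists (T0 + S T1)%nat, st1. split; [econstructor; [eauto|]; apply exec_If_false; auto; tauto|].
  split; [cbn [ccost]; nia|]. split; auto.
  cbn [store_free]. intros Hs k a Hk. apply Bool.andb_true_iff in Hs as [Hs1 Hs2]. rewrite S1, M0; auto.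
 - pose proof Hok as Hokw. apply Bool.andb_true_iff in Hok as [Ok1 Ok2].
  destruct (test_spec e s st Hr Ok1) as (T0 & st0 & X0 & L0 & R0 & M0 & E0').
  destruct (IHrun1 st0 R0 Ok2) as (T1 & st1 & X1 & L1 & R1' & S1).
  destruct (IHrun2 st1 R1' Hokw) as (T2 & st2 & X2 & L2 & R2' & S2).
  (* The code for the remaining iterations starts with an evaluation of the test. It is split off
     and becomes the test at the end of the body of the current iteration. *)
  cbn [cs] in X2. inversion X2 as [| | | | | |? ? ? stm ? Ta Tb XA XB| | | |]; subst.
  eexists (T0 + S ((T1 + Ta) + Tb))%nat, st2. split.
  { cbn [cs]. econstructor; [eauto|]. eapply exec_While_true; [tauto| |eauto]. econstructor; eauto. }
  split; [cbn [ccost] in *; nia|]. split; auto.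
  cbn [store_free] in *. intros Hs k a Hk. rewrite S2, S1, M0; auto.
 - apply Bool.andb_true_iff in Hok as [Ok1 Ok2].
  destruct (test_spec e s st Hr Ok1) as (T0 & st0 & X0 & L0 & R0 & M0 & E0').
  eexists (T0 + 1)%nat, st0. split; [econstructor; [eauto|]; apply exec_While_false; tauto|].
  split; [cbn [ccost]; nia|]. split; auto. intros. rewrite M0. auto.
Qed.

End Raw.

(** * Bit strings *)

Fixpoint bits (m : nat) (v : N) : list bool :=
 match m with O => [] | S m' => N.testbit v (N.of_nat m') :: bits m' v end.
Notation bitsN m v := (bits (N.to_nat m) v).

Lemma bits_length m v : length (bits m v) = m.
Proof. induction m; simpl; auto. Qed.

Lemma nth_bits m : forall v i, (i < m)%nat -> nth i (bits m v) false = N.testbit v (N.of_nat (m - 1 - i)).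
Proof.
 induction m as [|m IH]; intros v [|i] H; simpl; try lia.
 - f_equal. f_equal. lia.
 - rewrite IH by lia. f_equal. f_equal. lia.
Qed.

Lemma pow2_pos k : 0 < 2 ^ k.
Proof. apply N.neq_0_lt_0, N.pow_nonzero; lia. Qed.

Lemma pow2_1 k : 1 <= 2 ^ k.
Proof. pose proof (pow2_pos k); lia. Qed.

Lemma testbit_split a v1 v2 j : v2 < 2 ^ a ->
 N.testbit (v1 * 2 ^ a + v2) j = if j <? a then N.testbit v2 j else N.testbit v1 (j - a).
Proof.
 intros H. destruct (N.ltb_spec j a).
 - rewrite <- (N.mod_pow2_bits_low _ a j) by auto. rewrite N.add_comm, N.Div0.mod_add, N.mod_small; auto.
 - replace j with (j - a + a) at 1 by lia. rewrite <- N.div_pow2_bits.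
  f_equal. rewrite N.add_comm, N.div_add by (pose proof (pow2_pos a); lia). rewrite N.div_small; auto.
Qed.

Lemma bits_low m a v1 v2 : v2 < 2 ^ a -> (N.of_nat m <= a) -> bits m (v1 * 2 ^ a + v2) = bits m v2.
Proof.
 intros H. induction m as [|m IH]; intros Hm; simpl; auto.
 rewrite IH by lia. f_equal. rewrite testbit_split by auto. destruct (N.ltb_spec (N.of_nat m) a); auto. lia.
Qed.

Lemma bits_app m1 m2 v1 v2 : v2 < 2 ^ N.of_nat m2 ->
 bits (m1 + m2) (v1 * 2 ^ N.of_nat m2 + v2) = bits m1 v1 ++ bits m2 v2.
Proof.
 intros H. induction m1 as [|m1 IH]; simpl.
 - apply bits_low; auto. lia.
 - rewrite IH. f_equal. rewrite testbit_split by auto.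
  destruct (N.ltb_spec (N.of_nat (m1 + m2)) (N.of_nat m2)); [lia|]. f_equal. lia.
Qed.

Lemma bitsN_app m1 m2 v1 v2 : v2 < 2 ^ m2 ->
 bitsN (m1 + m2) (v1 * 2 ^ m2 + v2) = bitsN m1 v1 ++ bitsN m2 v2.
Proof.
 intros H. rewrite N2Nat.inj_add, <- bits_app; rewrite N2Nat.id; auto.
Qed.

Lemma bits_inj m : forall u v, u < 2 ^ N.of_nat m -> v < 2 ^ N.of_nat m -> bits m u = bits m v -> u = v.
Proof.
 intros u v Hu Hv H. apply N.bits_inj. intros j.
 destruct (N.lt_ge_cases j (N.of_nat m)) as [Hj|Hj].
 - assert (E : nth (m - 1 - N.to_nat j) (bits m u) false = nth (m - 1 - N.to_nat j) (bits m v) false) by congruence.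
  rewrite !nth_bits in E by lia. replace (N.of_nat (m - 1 - (m - 1 - N.to_nat j))) with j in E by lia. auto.
 - assert (G : forall x, x < 2 ^ N.of_nat m -> N.testbit x j = false).
  { intros x Hx. destruct (N.eq_dec x 0) as [->|]; [apply N.bits_0|].
   apply N.bits_above_log2. apply N.log2_lt_pow2 in Hx; lia. }
  rewrite !G; auto.
Qed.

Lemma bits_zero m : bits m 0 = repeat false m.
Proof. induction m; simpl; congruence. Qed.

Lemma bitsN_inj m u v : u < 2 ^ m -> v < 2 ^ m -> bitsN m u = bitsN m v -> u = v.
Proof. intros. apply (bits_inj (N.to_nat m)); rewrite ?N2Nat.id; auto. Qed.

(** * Tokens *)

Definition toklen (x : N) : N := 2 * N.log2 x + 2.
(** The zeros in front of a gamma code are just leading zeros of the numeral of [x]. A token is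
    therefore one binary numeral of [toklen x] digits whose leading digit is the flag, and packed
    bits can be handled by arithmetic. *)
Definition tokval (f x : N) : N := f * 2 ^ (toklen x - 1) + x.
Definition token (f x : N) : list bool := bitsN (toklen x) (tokval f x).
Definition runlen (x : N) : N := if x =? 0 then 0 else toklen x.

Lemma log2_bounds x : 0 < x -> 2 ^ N.log2 x <= x < 2 ^ (N.log2 x + 1).
Proof. intros. rewrite N.add_1_r. apply N.log2_spec; auto. Qed.

Lemma lt_pow_toklen x : 0 < x -> x < 2 ^ (toklen x - 1).
Proof.
 intros H. eapply N.lt_le_trans; [apply log2_bounds; auto|]. apply N.pow_le_mono_r; unfold toklen; lia.
Qed.

Lemma tokval_lt f x : 0 < x -> f <= 1 -> tokval f x < 2 ^ toklen x.
Proof.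
 intros H Hf. pose proof (lt_pow_toklen x H). unfold tokval.
 replace (2 ^ toklen x) with (2 * 2 ^ (toklen x - 1)).
 - nia.
 - rewrite <- N.pow_succ_r'. f_equal. unfold toklen. lia.
Qed.

Lemma toklen_mono x y : x <= y -> toklen x <= toklen y.
Proof. intros. unfold toklen. pose proof (N.log2_le_mono x y H). lia. Qed.

Lemma runlen_mono x y : x <= y -> runlen x <= runlen y.
Proof.
 intros. unfold runlen. destruct (N.eqb_spec x 0), (N.eqb_spec y 0); try lia. apply toklen_mono; auto.
Qed.

Lemma gamma_bits x : 0 < x -> gamma x = bitsN (toklen x - 1) x.
Proof.
 intros H. unfold gamma. set (l := N.to_nat (N.log2 x)).
 assert (E : forall m, map (fun i => N.testbit x (N.of_nat i)) (rev (seq 0 m)) = bits m x).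
 { induction m; [reflexivity|]. rewrite seq_S, rev_app_distr. simpl. now rewrite IHm. }
 rewrite E, <- bits_zero.
 replace (N.to_nat (toklen x - 1)) with (l + S l)%nat by (unfold toklen; lia).
 rewrite <- (bits_app l (S l) 0 x); [f_equal|].
 replace (N.of_nat (S l)) with (N.log2 x + 1) by lia. apply log2_bounds; auto.
Qed.

Lemma token_cons f x : 0 < x -> f <= 1 -> token f x = (f =? 1) :: gamma x.
Proof.
 intros H Hf. unfold token, tokval. replace (toklen x) with (1 + (toklen x - 1)) at 1 by (unfold toklen; lia).
 rewrite bitsN_app by (apply lt_pow_toklen; auto). rewrite gamma_bits by auto.
 assert (f = 0 \/ f = 1) as [-> | ->] by lia; reflexivity.
Qed.

Lemma literal_token_eq x : 0 < x -> literal_token x = token 1 x.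
Proof. intros. rewrite token_cons; auto. lia. Qed.

Lemma zero_run_token_eq x : 0 < x -> zero_run_token x = token 0 x.
Proof. intros. rewrite token_cons by lia. unfold zero_run_token. destruct (N.eqb_spec x 0); [lia|auto]. Qed.

Lemma token_length f x : length (token f x) = N.to_nat (toklen x).
Proof. apply bits_length. Qed.

Lemma zrt_length x : N.of_nat (length (zero_run_token x)) = runlen x.
Proof.
 unfold runlen. destruct (N.eqb_spec x 0) as [->|]; [reflexivity|].
 rewrite zero_run_token_eq, token_length by lia. lia.
Qed.

(** * Sparse encodings *)

Definition nzhead (B : list N) : Prop := match B with [] => True | u :: _ => u <> 0 end.

Lemma senc_from_zeros x : forall z B, senc_from z (repeat 0 x ++ B) = senc_from (z + N.of_nat x) B.
Proof.
 induction x as [|x IH]; intros z B; [simpl; f_equal; lia|]. cbn [repeat app senc_from N.eqb].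
 rewrite IH. f_equal. lia.
Qed.

Lemma senc_from_nz z B : nzhead B -> senc_from z B = zero_run_token z ++ senc B.
Proof.
 destruct B as [|u B]; unfold senc; intros H; simpl in *.
 - now rewrite app_nil_r.
 - destruct (N.eqb_spec u 0); [lia|]. reflexivity.
Qed.

Lemma senc_run x B : nzhead B -> senc (repeat 0 x ++ B) = zero_run_token (N.of_nat x) ++ senc B.
Proof. intros. unfold senc at 1. rewrite senc_from_zeros. apply senc_from_nz; auto. Qed.

Lemma senc_lit u B : u <> 0 -> senc (u :: B) = literal_token u ++ senc B.
Proof. intros. unfold senc at 1. simpl. destruct (N.eqb_spec u 0); [lia|]. reflexivity. Qed.

Lemma zeros_split B : exists x B', B = repeat 0 x ++ B' /\ nzhead B'.
Proof.
 induction B as [|u B (x & B' & -> & H)]; [exists 0%nat, []; simpl; auto|].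
 destruct (N.eq_dec u 0) as [->|Hu].
 - exists (S x), B'. auto.
 - exists 0%nat, (u :: repeat 0 x ++ B'). auto.
Qed.

Inductive tokens : list N -> list bool -> Prop :=
 | tk_nil : tokens [] []
 | tk_lit u B : 0 < u -> tokens (u :: B) (token 1 u ++ senc B)
 | tk_run x B : 0 < x -> tokens (repeat 0 (N.to_nat x) ++ B) (token 0 x ++ senc B).

Lemma senc_tokens B : tokens B (senc B).
Proof.
 destruct (zeros_split B) as ([|x] & B' & -> & H).
 - destruct B' as [|u B']; simpl in *; [constructor|].
  rewrite senc_lit, literal_token_eq by lia. constructor; lia.
 - rewrite senc_run by auto. rewrite zero_run_token_eq by lia.
  replace (S x) with (N.to_nat (N.of_nat (S x))) at 1 by lia. constructor; lia.
Qed.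

(** * Decoding the first token of a window [V] of [m] bits *)

(** Behind the flag, the leading one of the remaining [m - 1] bits is at position [L], so
    [l = m - 2 - L] zeros precede it. The gamma code has [l] bits after its leading one; they are in
    the window iff [l <= L], and then [L - l] bits are left over. *)
Definition decode (V m : N) : option (N * N * N * N) :=
 if m =? 0 then None else
 let f := V / 2 ^ (m - 1) in
 let U := V - f * 2 ^ (m - 1) in
 if U =? 0 then None else
 let L := N.log2 U in
 let l := m - 2 - L in
 if L <? l then None else
 Some (f, U / 2 ^ (L - l), U - U / 2 ^ (L - l) * 2 ^ (L - l), L - l).

Lemma decode_token f X V2 m2 : f <= 1 -> 0 < X -> V2 < 2 ^ m2 ->
 decode (tokval f X * 2 ^ m2 + V2) (toklen X + m2) = Some (f, X, V2, m2).
Proof.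
 intros Hf HX HV. unfold decode.
 destruct (N.eqb_spec (toklen X + m2) 0); [unfold toklen in *; lia|].
 assert (Hlt : X * 2 ^ m2 + V2 < 2 ^ (toklen X + m2 - 1)).
 { replace (toklen X + m2 - 1) with (toklen X - 1 + m2) by (unfold toklen; lia).
  rewrite N.pow_add_r. pose proof (lt_pow_toklen X HX). nia. }
 assert (Ef : (tokval f X * 2 ^ m2 + V2) = f * 2 ^ (toklen X + m2 - 1) + (X * 2 ^ m2 + V2)).
 { unfold tokval. replace (toklen X + m2 - 1) with (toklen X - 1 + m2) by (unfold toklen; lia).
  rewrite N.pow_add_r. lia. }
 rewrite Ef. set (P := 2 ^ (toklen X + m2 - 1)) in *.
 replace ((f * P + (X * 2 ^ m2 + V2)) / P) with f by (apply N.div_unique with (X * 2 ^ m2 + V2); lia).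
 replace (f * P + (X * 2 ^ m2 + V2) - f * P) with (X * 2 ^ m2 + V2) by lia.
 pose proof (pow2_pos m2).
 destruct (N.eqb_spec (X * 2 ^ m2 + V2) 0); [nia|].
 assert (EL : N.log2 (X * 2 ^ m2 + V2) = N.log2 X + m2).
 { apply N.log2_unique; [lia|]. pose proof (log2_bounds X HX) as [L1 L2].
  rewrite N.add_1_r in L2. rewrite <- N.add_succ_l, !N.pow_add_r.
  assert ((X + 1) * 2 ^ m2 <= 2 ^ N.succ (N.log2 X) * 2 ^ m2) by (apply N.mul_le_mono_r; lia).
  assert (2 ^ N.log2 X * 2 ^ m2 <= X * 2 ^ m2) by (apply N.mul_le_mono_r; lia).
  clear - HV H0 H1. gp. lia. }
 rewrite EL. unfold toklen.
 replace (2 * N.log2 X + 2 + m2 - 2 - (N.log2 X + m2)) with (N.log2 X) by lia.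
 destruct (N.ltb_spec (N.log2 X + m2) (N.log2 X)); [lia|].
 replace (N.log2 X + m2 - N.log2 X) with m2 by lia.
 replace ((X * 2 ^ m2 + V2) / 2 ^ m2) with X by (apply N.div_unique with V2; lia).
 repeat f_equal. lia.
Qed.

Lemma decode_inv V m f X V2 m2 : V < 2 ^ m -> decode V m = Some (f, X, V2, m2) ->
 f <= 1 /\ 0 < X /\ V2 < 2 ^ m2 /\ V = tokval f X * 2 ^ m2 + V2 /\ m = toklen X + m2.
Proof.
 intros HV. unfold decode. destruct (N.eqb_spec m 0) as [|Hm]; [discriminate|].
 set (P := 2 ^ (m - 1)).
 assert (HP : 2 ^ m = 2 * P) by (unfold P; rewrite <- N.pow_succ_r'; f_equal; lia).
 assert (0 < P) by apply pow2_pos. assert (HPd : P = 2 ^ (m - 1)) by reflexivity. clearbody P.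
 pose proof (N.div_mod' V P) as Hdm. pose proof (N.mod_lt V P ltac:(lia)).
 set (f0 := V / P) in *. set (U := V - f0 * P). set (r := V mod P) in *. clearbody r.
 assert (Hf0 : f0 <= 1) by (clearbody f0; nia). assert (HU : U < P) by (unfold U; clearbody f0; lia).
 assert (HVU : V = f0 * P + U) by (unfold U; clearbody f0; lia). clearbody U f0.
 destruct (N.eqb_spec U 0) as [|HU0]; [discriminate|].
 set (L := N.log2 U). destruct (N.ltb_spec L (m - 2 - L)) as [|HL]; [discriminate|].
 set (k := L - (m - 2 - L)). intros Q. injection Q as -> HX2 HV2 Hk2.
 assert (HLm : L < m - 1) by (apply N.log2_lt_pow2; [lia|congruence]).
 pose proof (N.div_mod' U (2 ^ k)) as Hd. pose proof (N.mod_lt U (2 ^ k) ltac:(pose proof (pow2_pos k); lia)).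
 rewrite HX2 in *.
 assert (HX : N.log2 X = m - 2 - L).
 { rewrite <- HX2, <- N.shiftr_div_pow2, N.log2_shiftr. unfold k. fold L. lia. }
 assert (HX0 : 0 < X).
 { rewrite <- HX2. apply N.div_str_pos. split; [apply pow2_pos|].
  transitivity (2 ^ L); [apply N.pow_le_mono_r; unfold k; lia|apply log2_bounds; lia]. }
 assert (Hm' : m = toklen X + m2) by (unfold toklen; rewrite HX; unfold k in Hk2; lia).
 clearbody k. subst k.
 assert (EU : U = X * 2 ^ m2 + V2 /\ V2 < 2 ^ m2).
 { clear - HV2 H1 Hd. set (x := U mod 2 ^ m2) in *. clearbody x. gp. lia. }
 destruct EU as [EU EV].
 sp. sp. sp. split; [|auto].
 unfold tokval. rewrite HVU, HPd.
 replace (m - 1) with (toklen X - 1 + m2) by (rewrite Hm'; unfold toklen; lia).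
 rewrite N.pow_add_r. clear - EU. gp. lia.
Qed.

(** [V] consists of the first [m] bits of [rem], padded with zeros. *)
Definition wmatch (m V : N) (rem : list bool) : Prop :=
 V < 2 ^ m /\ bitsN m V = firstn (N.to_nat m) (rem ++ repeat false (N.to_nat m)).

Lemma firstn_false n k : (n <= k)%nat -> firstn n (repeat false k) = repeat false n.
Proof. revert k. induction n; intros [|k] H; simpl; auto; [lia|]. f_equal. apply IHn. lia. Qed.

Lemma skipn_false n k : skipn n (repeat false k) = repeat false (k - n).
Proof. revert k. induction n; intros [|k]; simpl; auto. Qed.

Lemma firstn_pad n k k' (l : list bool) : (n <= k)%nat -> (n <= k')%nat ->
 firstn n (l ++ repeat false k) = firstn n (l ++ repeat false k').
Proof.
 intros. rewrite !firstn_app. f_equal.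
 rewrite !firstn_false by lia. auto.
Qed.

Lemma wmatch_split m1 m2 V rem : wmatch (m1 + m2) V rem ->
 bitsN m1 (V / 2 ^ m2) = firstn (N.to_nat m1) (rem ++ repeat false (N.to_nat m1)) /\
 V / 2 ^ m2 < 2 ^ m1 /\ wmatch m2 (V mod 2 ^ m2) (skipn (N.to_nat m1) rem).
Proof.
 intros [HV H]. pose proof (pow2_pos m2) as Hp.
 pose proof (N.div_mod' V (2 ^ m2)) as E. pose proof (N.mod_lt V (2 ^ m2) ltac:(lia)) as Hm.
 set (V1 := V / 2 ^ m2) in *. set (V2 := V mod 2 ^ m2) in *.
 assert (V1 < 2 ^ m1).
 { apply N.Div0.div_lt_upper_bound. rewrite <- N.pow_add_r. now rewrite N.add_comm. }
 clearbody V1 V2. rewrite E, N.mul_comm, bitsN_app in H by auto.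
 assert (L1 : length (bitsN m1 V1) = N.to_nat m1) by apply bits_length.
 split; [|split; [auto|split; [auto|]]].
 - apply (f_equal (firstn (N.to_nat m1))) in H.
  rewrite firstn_app, L1, Nat.sub_diag, app_nil_r, firstn_firstn in H.
  rewrite firstn_all2 in H by lia. rewrite H, Nat.min_l by lia. apply firstn_pad; lia.
 - apply (f_equal (skipn (N.to_nat m1))) in H.
  rewrite skipn_app, L1, Nat.sub_diag, skipn_all2 in H by lia. simpl in H. rewrite H.
  rewrite N2Nat.inj_add, skipn_firstn_comm, Nat.add_comm, Nat.add_sub, skipn_app.
  rewrite !firstn_app, length_skipn. f_equal.
  destruct (Nat.le_gt_cases (length rem) (N.to_nat m1)).
  + replace (length rem - N.to_nat m1)%nat with 0%nat by lia. rewrite Nat.sub_0_r.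
   rewrite skipn_false, !firstn_false by lia. auto.
  + replace (N.to_nat m1 - length rem)%nat with 0%nat by lia. simpl skipn.
   rewrite !firstn_false by lia. auto.
Qed.

Lemma wmatch_zero m V : wmatch m V [] -> V = 0.
Proof.
 intros [H1 H2]. apply (bitsN_inj m); auto; [apply pow2_pos|]. rewrite H2, bits_zero. simpl.
 rewrite firstn_all2; [auto|rewrite repeat_length; auto].
Qed.

Lemma decode_zero m : decode 0 m = None.
Proof. unfold decode. rewrite N.Div0.div_0_l. destruct (m =? 0); reflexivity. Qed.

Lemma decode_complete m V f X rem : f <= 1 -> 0 < X -> wmatch m V (token f X ++ rem) -> toklen X <= m ->
 exists V2, decode V m = Some (f, X, V2, m - toklen X) /\ wmatch (m - toklen X) V2 rem.
Proof.
 intros Hf HX Hm Hle. replace m with (toklen X + (m - toklen X)) in Hm by lia.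
 set (m2 := m - toklen X) in *. apply wmatch_split in Hm as (H1 & H2 & H3).
 assert (Hs : skipn (N.to_nat (toklen X)) (token f X ++ rem) = rem).
 { rewrite skipn_app, token_length, Nat.sub_diag, skipn_all2; [auto|rewrite token_length; auto]. }
 rewrite Hs in H3. exists (V mod 2 ^ m2). split; auto.
 assert (E : V / 2 ^ m2 = tokval f X).
 { apply (bitsN_inj (toklen X)); auto using tokval_lt. rewrite H1.
  rewrite <- app_assoc, firstn_app, token_length, Nat.sub_diag, firstn_all2 by (rewrite token_length; auto).
  simpl. now rewrite app_nil_r. }
 replace m with (toklen X + m2) by lia.
 rewrite (N.div_mod' V (2 ^ m2)) at 1. rewrite E, N.mul_comm. apply decode_token; auto.
 apply N.mod_lt. pose proof (pow2_pos m2); lia.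
Qed.

(** Prefix-freeness. If the window decoded, then so would the window extended by the [k > 0] missing
    bits of the token, with at least [k] bits left over; but the complete token decodes with nothing
    left over. *)
Lemma decode_incomplete m V f X rem : f <= 1 -> 0 < X -> wmatch m V (token f X ++ rem) -> m < toklen X ->
 decode V m = None.
Proof.
 intros Hf HX [HV H] Hlt. destruct (decode V m) as [[[[f' X'] V2] m2]|] eqn:E; auto. exfalso.
 apply decode_inv in E as (Hf' & HX' & HV2 & EV & Em); auto.
 set (k := toklen X - m). set (T := tokval f X).
 assert (ET : V = T / 2 ^ k).
 { pose proof (tokval_lt f X HX Hf) as HT. fold T in HT.
  replace (toklen X) with (m + k) in HT by (unfold k; lia).
  assert (T / 2 ^ k < 2 ^ m) by (apply N.Div0.div_lt_upper_bound; rewrite <- N.pow_add_r, N.add_comm; auto).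
  apply (bitsN_inj m); auto. rewrite H.
  rewrite <- app_assoc, firstn_app, token_length.
  replace (N.to_nat m - N.to_nat (toklen X))%nat with 0%nat by lia. simpl. rewrite app_nil_r.
  unfold token. fold T. rewrite (N.div_mod' T (2 ^ k)) at 1. rewrite N.mul_comm.
  replace (toklen X) with (m + k) by (unfold k; lia).
  rewrite bitsN_app by (apply N.mod_lt; pose proof (pow2_pos k); lia).
  rewrite firstn_app, bits_length, Nat.sub_diag, app_nil_r. apply firstn_all2. now rewrite bits_length. }
 assert (D1 : decode T (toklen X) = Some (f, X, 0, 0)).
 { rewrite <- (decode_token f X 0 0); auto; [|lia]. fold T. f_equal; [rewrite N.pow_0_r|]; lia. }
 assert (D2 : decode T (toklen X) = Some (f', X', V2 * 2 ^ k + T mod 2 ^ k, m2 + k)).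
 { assert (Hr : T mod 2 ^ k < 2 ^ k) by (apply N.mod_lt; pose proof (pow2_pos k); lia).
  rewrite <- (decode_token f' X'); auto.
  - f_equal; [|unfold k; lia]. rewrite (N.div_mod' T (2 ^ k)) at 1. rewrite <- ET, EV, N.pow_add_r. lia.
  - rewrite N.pow_add_r. nia. }
 rewrite D1 in D2. injection D2 as ? ? ? ?. unfold k in *. lia.
Qed.

(** * One symbol of one stream

  [r] zeros are pending, and [V] is a window of [m] bits of the rest. *)

Definition next1 (r V m : N) : option (N * N * N * N) :=
 if r =? 0 then
  match decode V m with
  | None => None
  | Some (f, X, V2, m2) => if f =? 0 then Some (0, X - 1, V2, m2) else Some (X, 0, V2, m2)
  end
 else Some (0, r - 1, V, m).

(** Besides the [r] zeros that a window shows, [D] further zeros may be pending. *)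
Definition SR (r V m D : N) (A : list N) (rem : list bool) : Prop :=
 exists B, A = repeat 0 (N.to_nat (r + D)) ++ B /\ rem = senc B /\ wmatch m V rem /\ (D = 0 \/ 0 < r).

(** The [D] hidden zeros follow the [r] visible ones and precede the symbols in the window. So as
    long as [D] is positive, the visible part must not become empty, or the next token would be read
    too early. The last inequality holds since reading a token frees its bits and leaves a pending
    run whose token is no longer. *)
Lemma next1_sound r V m D A rem u r' V' m' :
 SR r V m D A rem -> next1 r V m = Some (u, r', V', m') -> D = 0 \/ 0 < r' ->
 (exists A', A = u :: A' /\ SR r' V' m' D A' (skipn (N.to_nat (m - m')) rem)) /\ m' <= m /\
 2 * m' + runlen (r' + D) <= 2 * m + runlen (r + D) /\
 (N.to_nat (m - m') <= length rem)%nat.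
Proof.
 intros (B & -> & -> & Hm & HD) Hn HD'. unfold next1 in Hn. destruct (N.eqb_spec r 0) as [->|Hr].
 - assert (D = 0) as -> by lia. rewrite !N.add_0_r. change (N.to_nat 0) with 0%nat. cbn [repeat app].
  destruct (decode V m) as [[[[f X] V2] m2]|] eqn:E; [|discriminate].
  destruct (senc_tokens B) as [|x B Hx|x B Hx].
  + apply wmatch_zero in Hm. subst V. rewrite decode_zero in E. discriminate.
  + destruct (N.lt_ge_cases m (toklen x)) as [Hlt|Hge].
   * rewrite (decode_incomplete m V 1 x _ ltac:(lia) Hx Hm Hlt) in E. discriminate.
   * destruct (decode_complete m V 1 x _ ltac:(lia) Hx Hm Hge) as (V2' & E' & Hm').
    rewrite E in E'. injection E' as -> -> -> ->. simpl in Hn. injection Hn as <- <- <- <-.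
    assert (Htl : toklen x = m - (m - toklen x)) by lia.
    rewrite <- Htl. rewrite skipn_app, token_length, Nat.sub_diag, skipn_all2 by (rewrite token_length; auto).
    split; [exists B; split; auto; exists B; simpl; auto|]. split; [lia|].
    split; [assert (runlen 0 = 0) by reflexivity; rewrite ?N.add_0_r; lia|]. rewrite length_app, token_length. lia.
  + destruct (N.lt_ge_cases m (toklen x)) as [Hlt|Hge].
   * rewrite (decode_incomplete m V 0 x _ ltac:(lia) Hx Hm Hlt) in E. discriminate.
   * destruct (decode_complete m V 0 x _ ltac:(lia) Hx Hm Hge) as (V2' & E' & Hm').
    rewrite E in E'. injection E' as -> -> -> ->. simpl in Hn. injection Hn as <- <- <- <-.
    assert (Htl : toklen x = m - (m - toklen x)) by lia.
    rewrite <- Htl. rewrite skipn_app, token_length, Nat.sub_diag, skipn_all2 by (rewrite token_length; auto).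
    split; [|split; [lia|split]].
    -- exists (repeat 0 (N.to_nat (x - 1)) ++ B). split.
      ++ replace (N.to_nat x) with (S (N.to_nat (x - 1))) by lia. reflexivity.
      ++ exists B. rewrite N.add_0_r. simpl. auto.
    -- pose proof (runlen_mono (x - 1) x ltac:(lia)).
      assert (runlen x = toklen x) by (unfold runlen; destruct (N.eqb_spec x 0); lia).
      assert (runlen 0 = 0) by reflexivity. rewrite ?N.add_0_r. lia.
    -- rewrite length_app, token_length. lia.
 - injection Hn as <- <- <- <-. rewrite N.sub_diag. simpl skipn.
  split; [|split; [lia|split; [|simpl; lia]]].
  + exists (repeat 0 (N.to_nat (r - 1 + D)) ++ B). split.
   * replace (N.to_nat (r + D)) with (S (N.to_nat (r - 1 + D))) by lia. reflexivity.
   * exists B. auto.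
  + pose proof (runlen_mono (r - 1 + D) (r + D) ltac:(lia)). lia.
Qed.

(** If the next symbol is not available, then the first token does not fit into the window. *)
Lemma next1_none r V m A rem : SR r V m 0 A rem -> A <> [] -> next1 r V m = None ->
 r = 0 /\ exists f X rem', f <= 1 /\ 0 < X /\ rem = token f X ++ rem' /\ m < toklen X.
Proof.
 intros (B & -> & -> & Hm & HD) HA Hn. unfold next1 in Hn. destruct (N.eqb_spec r 0) as [->|Hr]; [|discriminate].
 split; auto. simpl in HA.
 assert (G : forall f X rem', f <= 1 -> 0 < X -> senc B = token f X ++ rem' ->
  exists f X rem', f <= 1 /\ 0 < X /\ senc B = token f X ++ rem' /\ m < toklen X).
 { intros f X rem' Hf HX E. exists f, X, rem'. repeat split; auto.
  destruct (N.lt_ge_cases m (toklen X)); auto. rewrite E in Hm.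
  destruct (decode_complete m V f X rem' Hf HX Hm) as (V2 & E' & _); auto. rewrite E' in Hn.
  destruct (f =? 0); discriminate. }
 destruct (senc_tokens B) as [|x B Hx|x B Hx]; [congruence|..]; eapply G; eauto; lia.
Qed.

Lemma next1_m r V m u r' V' m' : V < 2 ^ m -> next1 r V m = Some (u, r', V', m') ->
 (r = 0 /\ m' + 2 <= m /\ V' < 2 ^ m') \/ (0 < r /\ r' = r - 1 /\ V' = V /\ m' = m).
Proof.
 intros HV. unfold next1. destruct (N.eqb_spec r 0) as [->|Hr].
 - destruct (decode V m) as [[[[f X] V2] m2]|] eqn:E; [|discriminate].
  apply decode_inv in E as (H1 & H2 & H3 & H4 & H5); auto.
  destruct (f =? 0); intros Q; injection Q as <- <- <- <-; left; unfold toklen in *; repeat split; auto; lia.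
 - intros Q; injection Q as <- <- <- <-. right. repeat split; auto. lia.
Qed.

(** * Simulating the transducer on windows *)

(** The output of a simulation phase consists of [z0] zeros, then, if [F] is nonzero, of a nonzero
  symbol and further symbols, encoded by the [ol] bits of [o], and finally of [z] zeros.
  If [F] is zero, then it consists of [z] zeros only. *)
Record wc := { wS : N; wr : nat -> N; wV : nat -> N; wm : nat -> N;
 wF : N; wz0 : N; wo : N; wol : N; wz : N }.

Definition out_step (F z0 o ol z Y : N) : N * N * N * N * N :=
 if Y =? 0 then (F, z0, o, ol, z + 1)
 else if F =? 0 then (1, z, o * 2 ^ toklen Y + tokval 1 Y, ol + toklen Y, 0)
 else (F, z0, (o * 2 ^ runlen z + z) * 2 ^ toklen Y + tokval 1 Y, ol + runlen z + toklen Y, 0).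

(** [zg] is the output run that is pending when the phase starts. The phase can be precomputed
    independently of it because the [z0] leading zeros only lengthen it: its token is written when
    the phase is applied, and [o] starts with the literal behind that token. *)
Definition OutRel (F z0 o ol z : N) (Ys : list N) : Prop :=
 o < 2 ^ ol /\
 (F = 0 -> o = 0 /\ ol = 0 /\ Ys = repeat 0 (N.to_nat z)) /\
 (F <> 0 -> forall zg rest,
   senc_from zg (Ys ++ rest) = zero_run_token (zg + z0) ++ bitsN ol o ++ senc_from z rest).

Lemma out_step_sound F z0 o ol z Ys Y F' z0' o' ol' z' :
 OutRel F z0 o ol z Ys -> out_step F z0 o ol z Y = (F', z0', o', ol', z') ->
 OutRel F' z0' o' ol' z' (Ys ++ [Y]).
Proof.
 intros (H1 & H2 & H3) H. unfold out_step in H. destruct (N.eqb_spec Y 0) as [->|HY].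
 - injection H as <- <- <- <- <-. split; [auto|split].
  + intros HF. destruct (H2 HF) as (? & ? & ->). repeat split; auto.
   rewrite <- repeat_cons. rewrite N.add_1_r, N2Nat.inj_succ. reflexivity.
  + intros HF zg rest. rewrite <- app_assoc, H3 by auto. cbn [app senc_from N.eqb]. reflexivity.
 - assert (Htv := tokval_lt 1 Y ltac:(lia) ltac:(lia)).
  destruct (N.eqb_spec F 0) as [HF|HF].
  + injection H as <- <- <- <- <-. destruct (H2 HF) as (-> & -> & ->). split; [simpl; auto|]. split; [lia|].
   intros _ zg rest. rewrite <- app_assoc, senc_from_zeros, N2Nat.id. cbn [app senc_from].
   destruct (N.eqb_spec Y 0); [lia|]. f_equal. f_equal. apply literal_token_eq; lia.
  + injection H as <- <- <- <- <-. split; [|split; [lia|]].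
   * rewrite !N.pow_add_r.
    assert (z < 2 ^ runlen z).
    { unfold runlen. destruct (N.eqb_spec z 0); [subst; reflexivity|].
     pose proof (tokval_lt 0 z ltac:(lia) ltac:(lia)). unfold tokval in *. lia. }
    set (a := 2 ^ runlen z) in *. set (b := 2 ^ toklen Y) in *. set (d := 2 ^ ol) in *. clearbody a b d.
    assert (o * a + z + 1 <= d * a) by nia. assert ((o * a + z + 1) * b <= d * a * b) by nia. lia.
   * intros _ zg rest. rewrite <- app_assoc, H3 by auto. cbn [app senc_from].
    destruct (N.eqb_spec Y 0); [lia|]. f_equal. rewrite literal_token_eq by lia.
    rewrite bitsN_app by auto. rewrite <- app_assoc. fold (token 1 Y).
    assert (Hz : bitsN (ol + runlen z) (o * 2 ^ runlen z + z) = bitsN ol o ++ zero_run_token z).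
    { unfold runlen. destruct (N.eqb_spec z 0) as [->|].
     - rewrite N.pow_0_r, N.mul_1_r, !N.add_0_r. simpl. now rewrite app_nil_r.
     - pose proof (tokval_lt 0 z ltac:(lia) ltac:(lia)) as Hz.
      rewrite zero_run_token_eq by lia. unfold token.
      assert (Ez : tokval 0 z = z) by (unfold tokval; lia). rewrite Ez in *. apply bitsN_app; auto. }
    rewrite Hz, <- app_assoc. reflexivity.
Qed.

Section Windows.
Context (t : nat) (delta : N -> list N -> N * N) (W lim : N).

Definition symbols (c : wc) (u r' V' m' : nat -> N) : Prop :=
 forall i, (i < t)%nat -> next1 (wr c i) (wV c i) (wm c i) = Some (u i, r' i, V' i, m' i).

Definition dnext (c : wc) (u : nat -> N) : N := fst (delta (wS c) (map u (seq 0 t))) mod 2 ^ W.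
Definition dout (c : wc) (u : nat -> N) : N := snd (delta (wS c) (map u (seq 0 t))) mod 2 ^ W.

(** The bound [lim] on output symbols limits the number of bits by which a single step can lengthen
    the output. *)
Definition WStep (c c' : wc) : Prop :=
 exists u, symbols c u (wr c') (wV c') (wm c') /\ wS c' = dnext c u /\ dout c u < 2 ^ lim /\
  (wF c', wz0 c', wo c', wol c', wz c')
  = out_step (wF c) (wz0 c) (wo c) (wol c) (wz c) (dout c u).

Definition Stuck (c : wc) : Prop :=
 (exists i, (i < t)%nat /\ next1 (wr c i) (wV c i) (wm c i) = None) \/
 (exists u r' V' m', symbols c u r' V' m' /\ 2 ^ lim <= dout c u).

Inductive WSteps : nat -> wc -> wc -> Prop :=
 | ws_0 c : WSteps 0 c c
 | ws_S j c c1 c2 : WSteps j c c1 -> WStep c1 c2 -> WSteps (S j) c c2.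

Fixpoint nsum (n : nat) (f : nat -> N) : N :=
 match n with O => 0 | S n' => nsum n' f + f n' end.

Lemma nsum_le n f g : (forall i, (i < n)%nat -> f i <= g i) -> nsum n f <= nsum n g.
Proof. induction n; simpl; intros H; [lia|]. pose proof (H n ltac:(lia)). specialize (IHn (fun i Hi => H i ltac:(lia))). lia. Qed.

Lemma nsum_lt n f g j d : (forall i, (i < n)%nat -> f i <= g i) -> (j < n)%nat -> f j + d <= g j ->
 nsum n f + d <= nsum n g.
Proof.
 induction n; simpl; intros H Hj Hd; [lia|]. destruct (Nat.eq_dec j n) as [->|].
 - pose proof (nsum_le n f g (fun i Hi => H i ltac:(lia))). lia.
 - pose proof (H n ltac:(lia)). specialize (IHn (fun i Hi => H i ltac:(lia)) ltac:(lia) Hd). lia.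
Qed.

Lemma nsum_add n f g : nsum n (fun i => f i + g i) = nsum n f + nsum n g.
Proof. induction n; simpl; lia. Qed.

Lemma nsum_mul n a f : nsum n (fun i => a * f i) = a * nsum n f.
Proof. induction n; simpl; [lia|]. rewrite IHn. lia. Qed.

Lemma nsum_const n a : nsum n (fun _ => a) = N.of_nat n * a.
Proof. induction n; simpl nsum; [lia|]. rewrite IHn. lia. Qed.

Lemma nsum_ext n f g : (forall i, (i < n)%nat -> f i = g i) -> nsum n f = nsum n g.
Proof. induction n; simpl; intros H; auto. rewrite IHn, H; auto. Qed.

(** A phase stops when all pending runs, including the one of the output, have length at least [X]. *)
Definition paused (X b : N) (c : wc) : Prop :=
 b <= wol c \/ (X <= wz c /\ forall i, (i < t)%nat -> X <= wr c i).

(** The number of steps still possible in a phase. A step that only consumes or produces zeros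
    lowers a run term by 1. Reading a token may create a run, worth up to [X], and a nonzero output
    resets [z], which restores up to [X]; the weight [2 * X] per unread or missing bit outweighs
    both. *)
Definition fuel (X b : N) (c : wc) : N :=
 nsum t (fun i => 2 * X * wm c i + N.min (wr c i) X) + 2 * X * (b - wol c) + (X - wz c).

Lemma fuel_step X b c c' : 0 < X -> (forall i, (i < t)%nat -> wV c i < 2 ^ wm c i) ->
 ~ paused X b c -> WStep c c' -> fuel X b c' < fuel X b c.
Proof.
 intros HX HV Hp (u & Hs & _ & _ & Ho).
 assert (Hol : wol c < b) by (destruct (N.lt_ge_cases (wol c) b); auto; exfalso; apply Hp; left; auto).
 assert (Hle : forall i, (i < t)%nat -> 2 * X * wm c' i + N.min (wr c' i) X <= 2 * X * wm c i + N.min (wr c i) X).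
 { intros i Hi. destruct (next1_m _ _ _ _ _ _ _ (HV i Hi) (Hs i Hi)) as [(? & ? & ?)|(? & -> & ? & ->)]; [nia|lia]. }
 unfold out_step in Ho. unfold fuel.
 pose proof (nsum_le t _ _ Hle) as Hsum. cbv beta in Hsum.
 destruct (N.eqb_spec (dout c u) 0) as [E|E].
 - injection Ho as _ _ _ -> ->. destruct (N.lt_ge_cases (wz c) X) as [Hz|Hz]; [lia|].
  (* The output run is already long, so a phase that is not paused has an input run below the cap,
     and that stream makes the fuel fall. *)
  assert (Hi : exists i, (i < t)%nat /\ wr c i < X).
  { assert (G : forall n, (exists i, (i < n)%nat /\ wr c i < X) \/ forall i, (i < n)%nat -> X <= wr c i).
   { induction n as [|n [(i & ? & ?)|IH]]; [right; lia|left; exists i; split; auto; lia|].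
    destruct (N.lt_ge_cases (wr c n) X); [left; exists n; auto|].
    right. intros i Hi. destruct (Nat.eq_dec i n) as [->|]; auto. apply IH. lia. }
   destruct (G t); auto. exfalso. apply Hp. right. auto. }
  destruct Hi as (i & Hi & Hr).
  assert (Hlt : 2 * X * wm c' i + N.min (wr c' i) X + 1 <= 2 * X * wm c i + N.min (wr c i) X).
  { destruct (next1_m _ _ _ _ _ _ _ (HV i Hi) (Hs i Hi)) as [(? & ? & ?)|(? & -> & ? & ->)]; [nia|lia]. }
  pose proof (nsum_lt t _ _ i 1 Hle Hi Hlt) as H. cbv beta in H. lia.
 - assert (wol c < wol c' /\ wz c' = 0).
  { destruct (wF c =? 0); injection Ho as _ _ _ -> ->; unfold toklen; lia. }
  nia.
Qed.

Lemma WSteps_r j c0 c i : WSteps j c0 c -> (i < t)%nat -> N.of_nat j <= wr c0 i ->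
 wr c i = wr c0 i - N.of_nat j.
Proof.
 induction 1 as [|j c c1 c2 H IH (u & Hs & _)]; intros Hi Hj; [lia|].
 specialize (IH Hi ltac:(lia)). specialize (Hs i Hi). unfold next1 in Hs.
 destruct (N.eqb_spec (wr c1 i) 0); [lia|]. injection Hs as _ E _ _. lia.
Qed.
End Windows.

(** * Soundness of phases with respect to an actual run *)

Section Sound.
Context (t : nat) (sigma q : N) (M : transducer t sigma q) (W : N) (n : nat) (Ss : list (list N)) (T : list N)
 (sq : nat -> N).
Hypothesis Ht : (1 <= t)%nat.
Hypothesis Hsig : sigma <= 2 ^ W.
Hypothesis Hq : q <= 2 ^ W.
Hypothesis HSs : length Ss = t.
Hypothesis HS : Forall (fun S => length S = n /\ Forall (fun a => a < sigma) S) Ss.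
Hypothesis HT : length T = n.
Hypothesis Hs0 : sq 0 = tr_init M.
Hypothesis Hsq : forall i, (i < n)%nat ->
 tr_step M (sq i) (map (fun S => nth i S 0) Ss) = (sq (S i), nth i T 0).

Definition stream (i k : nat) : list N := skipn k (nth i Ss []).

Lemma Ss_nth i : (i < t)%nat -> length (nth i Ss []) = n /\ Forall (fun a => a < sigma) (nth i Ss []).
Proof. intros Hi. rewrite Forall_forall in HS. apply HS. apply nth_In. lia. Qed.

Lemma stream_cons i k : (i < t)%nat -> (k < n)%nat ->
 stream i k = nth k (nth i Ss []) 0 :: stream i (S k).
Proof.
 intros Hi Hk. unfold stream. destruct (Ss_nth i Hi) as [L _].
 revert k Hk L. generalize (nth i Ss []) as l. generalize n as n'.
 intros n' l; revert n'. induction l as [|a l IH]; intros n' k Hk L; simpl in L; [lia|].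
 destruct k; [reflexivity|]. simpl. apply (IH (pred n')); lia.
Qed.

Lemma stream_nil i k : (i < t)%nat -> (stream i k = [] <-> (n <= k)%nat).
Proof.
 intros Hi. destruct (Ss_nth i Hi) as [L _]. unfold stream. rewrite <- L. split; intros H.
 - apply (f_equal (@length N)) in H. rewrite length_skipn in H. simpl in H. lia.
 - apply skipn_all2; auto.
Qed.

Lemma sq_lt k : (k <= n)%nat -> sq k < q.
Proof.
 induction k as [|k IH]; intros Hk; [rewrite Hs0; apply tr_init_lt|].
 specialize (IH ltac:(lia)). assert (E := Hsq k ltac:(lia)).
 destruct (tr_step_lt _ _ _ M (sq k) (map (fun S => nth k S 0) Ss)) as [H _]; auto.
 - now rewrite length_map.
 - rewrite Forall_map. rewrite Forall_forall in *. intros S HS'. destruct (HS S HS') as [L F].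
  rewrite Forall_forall in F. apply F, nth_In. lia.
 - rewrite E in H. auto.
Qed.

Lemma T_lt k : (k < n)%nat -> nth k T 0 < sigma.
Proof.
 intros Hk. pose proof (sq_lt k ltac:(lia)). assert (E := Hsq k Hk).
 destruct (tr_step_lt _ _ _ M (sq k) (map (fun S => nth k S 0) Ss)) as [_ H0]; auto.
 - now rewrite length_map.
 - rewrite Forall_map. rewrite Forall_forall in *. intros S HS'. destruct (HS S HS') as [L F].
  rewrite Forall_forall in F. apply F, nth_In. lia.
 - rewrite E in H0. auto.
Qed.

Lemma map_nth_seq (u : nat -> N) k : (forall i, (i < t)%nat -> u i = nth k (nth i Ss []) 0) ->
 map u (seq 0 t) = map (fun S => nth k S 0) Ss.
Proof.
 intros H. apply nth_ext with 0 0; rewrite !length_map, length_seq; [auto|]. intros i Hi.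
 rewrite (nth_indep _ 0 (u 0%nat)) by (rewrite length_map, length_seq; auto).
 rewrite map_nth, seq_nth by auto.
 rewrite (nth_indep _ 0 (nth k [] 0)) by (rewrite length_map; lia).
 rewrite (map_nth (fun S => nth k S 0)). apply H; auto.
Qed.

(** Connects a window configuration with the actual run at position [k] of a phase begun at [k0].
    [D i] is what the table key cut off from the pending run of stream [i], and [m0 i - wm c i] is
    the number of its bits consumed so far. [ph_pot] is the contribution of a stream to the
    potential. *)
Record Phase (k0 : nat) (D : nat -> N) (rem0 : nat -> list bool) (r0 m0 : nat -> N) (c : wc) (k : nat) : Prop := {
 ph_k : (k0 <= k <= n)%nat;
 ph_S : wS c = sq k;
 ph_SR : forall i, (i < t)%nat ->
  SR (wr c i) (wV c i) (wm c i) (D i) (stream i k) (skipn (N.to_nat (m0 i - wm c i)) (rem0 i));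
 ph_m : forall i, (i < t)%nat -> wm c i <= m0 i;
 ph_len : forall i, (i < t)%nat -> (N.to_nat (m0 i - wm c i) <= length (rem0 i))%nat;
 ph_pot : forall i, (i < t)%nat -> 2 * wm c i + runlen (wr c i + D i) <= 2 * m0 i + runlen (r0 i + D i);
 ph_out : OutRel (wF c) (wz0 c) (wo c) (wol c) (wz c) (firstn (k - k0) (skipn k0 T)) }.

Lemma symbols_sound c k u r' V' m' D rem : (k <= n)%nat ->
 symbols t c u r' V' m' -> (forall i, (i < t)%nat -> D i = 0 \/ 0 < wr c i) ->
 (forall i, (i < t)%nat -> SR (wr c i) (wV c i) (wm c i) (D i) (stream i k) (rem i)) ->
 (k < n)%nat /\ forall i, (i < t)%nat -> u i = nth k (nth i Ss []) 0.
Proof.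
 intros Hk Hs HD HR.
 assert (G : forall i, (i < t)%nat -> exists A', stream i k = u i :: A').
 { intros i Hi. specialize (HR i Hi). specialize (Hs i Hi).
  destruct (N.eq_dec (wr c i) 0) as [E|E].
  - assert (D i = 0) by (destruct (HD i Hi); lia).
   destruct (next1_sound _ _ _ _ _ _ _ _ _ _ HR Hs) as ((A' & HA & _) & _); eauto.
  - destruct HR as (B & HA & _). unfold next1 in Hs. destruct (N.eqb_spec (wr c i) 0); [lia|].
   injection Hs as <- _ _ _. exists (repeat 0 (N.to_nat (wr c i - 1 + D i)) ++ B). rewrite HA.
   replace (N.to_nat (wr c i + D i)) with (S (N.to_nat (wr c i - 1 + D i))) by lia. reflexivity. }
 assert (Hkn : (k < n)%nat).
 { destruct (Nat.lt_ge_cases k n); auto. destruct (G 0%nat ltac:(lia)) as (A' & E).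
  rewrite (proj2 (stream_nil 0 k ltac:(lia))) in E by auto. discriminate. }
 split; auto. intros i Hi. destruct (G i Hi) as (A' & E). rewrite stream_cons in E by auto. congruence.
Qed.

Lemma delta_sound c k u : (k < n)%nat -> wS c = sq k -> (forall i, (i < t)%nat -> u i = nth k (nth i Ss []) 0) ->
 dnext t (tr_step M) W c u = sq (S k) /\ dout t (tr_step M) W c u = nth k T 0.
Proof.
 intros Hk HSk Hu. unfold dnext, dout. rewrite (map_nth_seq u k Hu), HSk, Hsq by auto. simpl.
 pose proof (sq_lt (S k) ltac:(lia)). pose proof (T_lt k Hk). rewrite !N.mod_small by lia. auto.
Qed.

Lemma phase_step lim k0 D rem0 r0 m0 c k c' :
 Phase k0 D rem0 r0 m0 c k -> WStep t (tr_step M) W lim c c' ->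
 (forall i, (i < t)%nat -> D i = 0 \/ 0 < wr c' i) ->
 (k < n)%nat /\ Phase k0 D rem0 r0 m0 c' (S k) /\ dout t (tr_step M) W c (fun i => nth k (nth i Ss []) 0) = nth k T 0.
Proof.
 intros [Hk HSk HR Hm Hl Hpot Ho] (u & Hs & HS' & HY & Hout) HD.
 assert (HD' : forall i, (i < t)%nat -> D i = 0 \/ 0 < wr c i).
 { intros i Hi. destruct (HR i Hi) as (_ & _ & _ & _ & ?). auto. }
 destruct (symbols_sound c k u _ _ _ D _ ltac:(lia) Hs HD' HR) as [Hkn Hu].
 split; auto. destruct (delta_sound c k u Hkn HSk Hu) as [E1 E2].
 split.
 2:{ apply delta_sound; auto. }
 assert (G : forall i, (i < t)%nat -> (exists A', stream i k = u i :: A' /\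
   SR (wr c' i) (wV c' i) (wm c' i) (D i) A'
    (skipn (N.to_nat (wm c i - wm c' i)) (skipn (N.to_nat (m0 i - wm c i)) (rem0 i)))) /\ wm c' i <= wm c i /\
   2 * wm c' i + runlen (wr c' i + D i) <= 2 * wm c i + runlen (wr c i + D i) /\
   (N.to_nat (wm c i - wm c' i) <= length (skipn (N.to_nat (m0 i - wm c i)) (rem0 i)))%nat).
 { intros i Hi. exact (next1_sound _ _ _ _ _ _ _ _ _ _ (HR i Hi) (Hs i Hi) (HD i Hi)). }
 constructor.
 - lia.
 - congruence.
 - intros i Hi. destruct (G i Hi) as ((A' & HA & HR') & Hm' & _). rewrite skipn_skipn in HR'.
  rewrite stream_cons in HA by auto. injection HA as _ <-.
  specialize (Hm i Hi). replace (N.to_nat (m0 i - wm c' i)) with (N.to_nat (wm c i - wm c' i) + N.to_nat (m0 i - wm c i))%nat by lia.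
  auto.
 - intros i Hi. destruct (G i Hi) as (_ & Hm' & _). specialize (Hm i Hi). lia.
 - intros i Hi. destruct (G i Hi) as (_ & Hm' & _ & Hl'). specialize (Hm i Hi). specialize (Hl i Hi).
  rewrite length_skipn in Hl'. lia.
 - intros i Hi. destruct (G i Hi) as (_ & _ & Hp' & _). specialize (Hpot i Hi). lia.
 - replace (firstn (S k - k0) (skipn k0 T)) with (firstn (k - k0) (skipn k0 T) ++ [nth k T 0]).
  + eapply out_step_sound; eauto. rewrite <- E2. auto.
  + replace (S k - k0)%nat with (S (k - k0)) by lia.
   assert (Hlen : (k - k0 < length (skipn k0 T))%nat) by (rewrite length_skipn; lia).
   replace (nth k T 0) with (nth (k - k0) (skipn k0 T) 0) by (rewrite nth_skipn; f_equal; lia).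
   revert Hlen. generalize (skipn k0 T) as l. generalize (k - k0)%nat as j.
   induction j as [|j IH]; intros [|a l] Hlen; simpl in *; try lia; auto. f_equal. apply IH. lia.
Qed.

(** While symbols remain, each stream still has a pending zero or a first token. So failure to fetch
    a symbol can only mean that this token exceeds the window, and the other cause of a stop is a
    large output symbol. *)
Lemma phase_stuck lim k0 D rem0 r0 m0 c k :
 Phase k0 D rem0 r0 m0 c k -> Stuck t (tr_step M) W lim c -> (k < n)%nat ->
 (exists i f X rem', (i < t)%nat /\ wr c i = 0 /\ D i = 0 /\ f <= 1 /\ 0 < X /\
   skipn (N.to_nat (m0 i - wm c i)) (rem0 i) = token f X ++ rem' /\ wm c i < toklen X) \/
 2 ^ lim <= nth k T 0.
Proof.
 intros [Hk HSk HR Hm Hl Hpot Ho] [(i & Hi & Hn)|(u & r' & V' & m' & Hs & HY)] Hkn.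
 - left. specialize (HR i Hi).
  assert (D i = 0 /\ wr c i = 0) as [HD Hr].
  { destruct HR as (_ & _ & _ & _ & HD). unfold next1 in Hn. destruct (N.eqb_spec (wr c i) 0); [|discriminate].
   split; lia. }
  rewrite HD in HR. destruct (next1_none _ _ _ _ _ HR) as (_ & f & X & rem' & ? & ? & ? & ?); auto.
  + rewrite stream_nil; auto. lia.
  + exists i, f, X, rem'. repeat split; auto.
 - right. destruct (symbols_sound c k u r' V' m' D (fun i => skipn (N.to_nat (m0 i - wm c i)) (rem0 i))) as [_ Hu]; auto; try lia.
  + intros i Hi. destruct (HR i Hi) as (_ & _ & _ & _ & ?). auto.
  + destruct (delta_sound c k u Hkn HSk Hu) as [_ E]. rewrite E in HY. auto.
Qed.

(** If zeros are hidden, the visible run is longer than the phase; hence no intermediate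
    configuration has used it up. *)
Lemma phase_steps lim k0 D rem0 r0 m0 c0 k j c :
 WSteps t (tr_step M) W lim j c0 c -> Phase k0 D rem0 r0 m0 c0 k ->
 (forall i, (i < t)%nat -> D i = 0 \/ N.of_nat j < wr c0 i) ->
 Phase k0 D rem0 r0 m0 c (k + j).
Proof.
 induction 1 as [c0|j c0 c1 c2 H IH Hstep]; intros HP HD; [rewrite Nat.add_0_r; auto|].
 rewrite Nat.add_succ_r. eapply phase_step; eauto.
 - apply IH; auto. intros i Hi. destruct (HD i Hi); [auto|right; lia].
 - intros i Hi. destruct (HD i Hi) as [|Hlt]; auto. right.
  rewrite (WSteps_r t (tr_step M) W lim (S j) c0 c2 i); [lia|econstructor; eauto|auto|lia].
Qed.
End Sound.

(** * Verification of programs *)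

Notation "a +! b" := (EB VAdd a b) (at level 50, left associativity).
Notation "a -! b" := (EB VSub a b) (at level 50, left associativity).
Notation "a <! b" := (EB VLt a b) (at level 70).
Notation "a <<! b" := (EB VShl a b) (at level 48, left associativity).
Notation "a >>! b" := (EB VShr a b) (at level 48, left associativity).
Notation "$ x" := (EV x) (at level 2, x at level 1, format "$ x").
Notation "p ;; q" := (SSeq p q) (at level 90, right associativity).
Notation "x <- e" := (SSet x e) (at level 80, e at level 75).
Notation enot e := (E1 -! e).

Fixpoint modv (p : stmt) (v : var) : bool :=
 match p with
 | SSet u _ => peqb v u
 | SDelta s y _ _ => peqb v s || peqb v y
 | SSeq p1 p2 | SIf _ p1 p2 => modv p1 v || modv p2 v
 | SWhile _ p => modv p v
 | _ => false
 end%bool.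

Fixpoint moda (p : stmt) (A : darr) : bool :=
 match p with
 | SSt B _ _ _ => peqb A B
 | SSeq p1 p2 | SIf _ p1 p2 => moda p1 A || moda p2 A
 | SWhile _ p => moda p A
 | _ => false
 end%bool.

Fixpoint modc (p : stmt) (k : nat) : bool :=
 match p with
 | SCell j _ _ => Nat.eqb k j
 | SSeq p1 p2 | SIf _ p1 p2 => modc p1 k || modc p2 k
 | SWhile _ p => modc p k
 | _ => false
 end%bool.

Record Frame (p : stmt) (s s' : vst) : Prop := {
 fv : forall v, modv p v = false -> env s' v = env s v;
 fa : forall A i j, moda p A = false -> dm s' A i j = dm s A i j;
 fc : forall k a, modc p k = false -> cm s' k a = cm s k a }.
Arguments fv {p s s'}.
Arguments fa {p s s'}.
Arguments fc {p s s'}.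

(** Unrolled repetition. It is used only with counts that depend on [t] and [c] alone, so it adds to
    the length of the program and not to the counted iterations. *)
Fixpoint fors (n : nat) (f : nat -> stmt) : stmt :=
 match n with O => SSkip | S n' => fors n' f ;; f n' end.

Lemma modv_fors n f v : (forall i, (i < n)%nat -> modv (f i) v = false) -> modv (fors n f) v = false.
Proof. induction n; simpl; intros H; auto. rewrite IHn, H; auto. Qed.

Lemma moda_fors n f A : (forall i, (i < n)%nat -> moda (f i) A = false) -> moda (fors n f) A = false.
Proof. induction n; simpl; intros H; auto. rewrite IHn, H; auto. Qed.

Lemma modc_fors n f k : (forall i, (i < n)%nat -> modc (f i) k = false) -> modc (fors n f) k = false.
Proof. induction n; simpl; intros H; auto. rewrite IHn, H; auto. Qed.

Lemma cells_ok_fors t0 n f : (forall i, (i < n)%nat -> cells_ok t0 (f i) = true) -> cells_ok t0 (fors n f) = true.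
Proof. induction n; simpl; intros H; auto. rewrite IHn, H; auto. Qed.

Lemma store_free_fors n f : (forall i, (i < n)%nat -> store_free (f i) = true) -> store_free (fors n f) = true.
Proof. induction n; simpl; intros H; auto. rewrite IHn, H; auto. Qed.

Section WP.
Context (w W : N) (delta : N -> list N -> N * N).

Lemma run_frame p s n s' : run w W delta p s n s' -> Frame p s s'.
Proof.
 induction 1; constructor; intros; simpl in *; auto;
  repeat match goal with H : (_ || _)%bool = false |- _ => apply Bool.orb_false_iff in H as [? ?] end;
  repeat match goal with H : ?b = false |- context [?b] => rewrite H end; auto.
 all: try (rewrite ?(fv IHrun2), ?(fv IHrun1), ?(fa IHrun2), ?(fa IHrun1), ?(fc IHrun2), ?(fc IHrun1); auto; fail).
 all: try (rewrite ?(fv IHrun), ?(fa IHrun), ?(fc IHrun); auto; fail).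
Qed.

Definition wp (p : stmt) (Q : nat -> vst -> Prop) (s : vst) : Prop :=
 exists n s', run w W delta p s n s' /\ Q n s'.

Lemma wp_mono p (Q Q' : nat -> vst -> Prop) s : wp p Q s -> (forall n s', Frame p s s' -> Q n s' -> Q' n s') -> wp p Q' s.
Proof. intros (n & s' & H & HQ) HI. exists n, s'. split; auto. apply HI; auto. eapply run_frame; eauto. Qed.

Lemma wp_skip (Q : nat -> vst -> Prop) s : Q 0%nat s -> wp SSkip Q s.
Proof. intros. exists 0%nat, s. split; auto. constructor. Qed.

Lemma wp_set v e (Q : nat -> vst -> Prop) s : Q 0%nat (upd s v (eval W s e)) -> wp (SSet v e) Q s.
Proof. intros. eexists 0%nat, _. split; eauto. constructor. Qed.

Lemma wp_st A e1 e2 e (Q : nat -> vst -> Prop) s :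
 Q 0%nat (updm s A (eval W s e1) (eval W s e2) (eval W s e)) -> wp (SSt A e1 e2 e) Q s.
Proof. intros. eexists 0%nat, _. split; eauto. constructor. Qed.

Lemma wp_cell k e1 e (Q : nat -> vst -> Prop) s :
 Q 0%nat (updc s k (eval W s e1) (eval W s e mod 2 ^ w)) -> wp (SCell k e1 e) Q s.
Proof. intros. eexists 0%nat, _. split; eauto. constructor. Qed.

Lemma wp_delta s' y sv xs (Q : nat -> vst -> Prop) s :
 (let r := delta (env s sv) (map (env s) xs) in
  Q 0%nat (upd (upd s s' (fst r mod 2 ^ W)) y (snd r mod 2 ^ W))) -> wp (SDelta s' y sv xs) Q s.
Proof. intros. eexists 0%nat, _. split; [constructor|]. auto. Qed.

Lemma wp_seq p1 p2 (Q : nat -> vst -> Prop) s :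
 wp p1 (fun n1 s1 => wp p2 (fun n2 s2 => Q (n1 + n2)%nat s2) s1) s -> wp (p1 ;; p2) Q s.
Proof. intros (n1 & s1 & H1 & n2 & s2 & H2 & HQ). eexists _, _. split; [econstructor; eauto|auto]. Qed.
(* Straight-line first components need no addition of costs. *)
Lemma wp_set_seq v e p (Q : nat -> vst -> Prop) s : wp p Q (upd s v (eval W s e)) -> wp (v <- e ;; p) Q s.
Proof. intros. apply wp_seq, wp_set. auto. Qed.

Lemma wp_st_seq A e1 e2 e p (Q : nat -> vst -> Prop) s :
 wp p Q (updm s A (eval W s e1) (eval W s e2) (eval W s e)) -> wp (SSt A e1 e2 e ;; p) Q s.
Proof. intros. apply wp_seq, wp_st. auto. Qed.

Lemma wp_cell_seq k e1 e p (Q : nat -> vst -> Prop) s :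
 wp p Q (updc s k (eval W s e1) (eval W s e mod 2 ^ w)) -> wp (SCell k e1 e ;; p) Q s.
Proof. intros. apply wp_seq, wp_cell. auto. Qed.

Lemma wp_if e p1 p2 (Q : nat -> vst -> Prop) s :
 (eval W s e <> 0 -> wp p1 Q s) -> (eval W s e = 0 -> wp p2 Q s) -> wp (SIf e p1 p2) Q s.
Proof.
 intros H1 H2. destruct (N.eq_dec (eval W s e) 0) as [E|E].
 - destruct (H2 E) as (n & s' & R & HQ). exists n, s'. split; auto. apply run_if_false; auto.
 - destruct (H1 E) as (n & s' & R & HQ). exists n, s'. split; auto. apply run_if_true; auto.
Qed.

(** [I a s]: the invariant, after cost [a]; [m] is a variant. *)
Lemma wp_while (I : nat -> vst -> Prop) (m : vst -> nat) e p (Q : nat -> vst -> Prop) s :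
 (forall a s, I a s -> eval W s e <> 0 -> wp p (fun n s' => I (S (a + n)) s' /\ (m s' < m s)%nat) s) ->
 (forall a s, I a s -> eval W s e = 0 -> Q a s) -> I 0%nat s -> wp (SWhile e p) Q s.
Proof.
 intros Hstep Hend H0.
 assert (G : forall k a s, (m s < k)%nat -> I a s -> exists n s', run w W delta (SWhile e p) s n s' /\ Q (a + n)%nat s').
 { induction k as [|k IH]; intros a s1 Hk HI; [lia|]. destruct (N.eq_dec (eval W s1 e) 0) as [E|E].
  - exists 0%nat, s1. split; [apply run_while_false; auto|]. rewrite Nat.add_0_r. auto.
  - destruct (Hstep a s1 HI E) as (n1 & s2 & R1 & HI2 & Hm).
   destruct (IH (S (a + n1)) s2 ltac:(lia) HI2) as (n2 & s3 & R2 & HQ).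
   exists (S (n1 + n2)), s3. split; [eapply run_while_true; eauto|].
   replace (a + S (n1 + n2))%nat with (S (a + n1) + n2)%nat by lia. auto. }
 destruct (G (S (m s)) 0%nat s ltac:(lia) H0) as (n & s' & R & HQ). exists n, s'. auto.
Qed.

(* Here the cost itself, bounded by [L], is the variant. *)
Lemma wp_while_bound (I : nat -> vst -> Prop) (L : nat) e p (Q : nat -> vst -> Prop) s :
 (forall a s, I a s -> eval W s e <> 0 -> (a < L)%nat /\ wp p (fun n s' => I (S (a + n)) s') s) ->
 (forall a s, I a s -> eval W s e = 0 -> Q a s) -> I 0%nat s -> wp (SWhile e p) Q s.
Proof.
 intros Hstep Hend H0.
 assert (G : forall k a s, (L < a + k)%nat -> I a s -> exists n s', run w W delta (SWhile e p) s n s' /\ Q (a + n)%nat s').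
 { induction k as [|k IH]; intros a s1 Hk HI; destruct (N.eq_dec (eval W s1 e) 0) as [E|E].
  1, 3: exists 0%nat, s1; split; [apply run_while_false; auto|]; rewrite Nat.add_0_r; auto.
  - destruct (Hstep a s1 HI E) as [? _]. lia.
  - destruct (Hstep a s1 HI E) as (_ & n1 & s2 & R1 & HI2).
   destruct (IH (S (a + n1)) s2 ltac:(lia) HI2) as (n2 & s3 & R2 & HQ).
   exists (S (n1 + n2)), s3. split; [eapply run_while_true; eauto|].
   replace (a + S (n1 + n2))%nat with (S (a + n1) + n2)%nat by lia. auto. }
 destruct (G (S L) 0%nat s ltac:(lia) H0) as (n & s' & R & HQ). exists n, s'. auto.
Qed.

Lemma wp_fors (I : nat -> nat -> vst -> Prop) n f s :
 (forall i a s, (i < n)%nat -> I i a s -> wp (f i) (fun c s' => I (S i) (a + c)%nat s') s) -> I 0%nat 0%nat s ->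
 wp (fors n f) (fun a s' => I n a s') s.
Proof.
 intros H H0. induction n as [|n IH]; simpl.
 - apply wp_skip. auto.
 - apply wp_seq. eapply wp_mono; [apply IH; auto|]. intros a s' _ HI. apply H; auto.
Qed.
End WP.

Arguments wp : simpl never.

Ltac vred := cbn [env dm cm upd updm updc peqb fst snd Nat.eqb andb orb eval eop modv moda modc].
Ltac vredh H := cbn [env dm cm upd updm updc peqb fst snd Nat.eqb andb orb eval eop modv moda modc] in H.
(** * Procedures for token lengths and decoding *)

Notation vw := (1%nat, 0%nat).
Notation vb := (2%nat, 0%nat).
Notation aLG := (1%nat, 0%nat).

Notation vDV := (10%nat, 0%nat).
Notation vDm := (11%nat, 0%nat).
Notation vDok := (12%nat, 0%nat).
Notation vDf := (13%nat, 0%nat).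
Notation vDX := (14%nat, 0%nat).
Notation vDV2 := (15%nat, 0%nat).
Notation vDm2 := (16%nat, 0%nat).
Notation vDU := (17%nat, 0%nat).
Notation vDk := (18%nat, 0%nat).
Notation vDL := (19%nat, 0%nat).
Notation vDl := (20%nat, 0%nat).
Notation vLx := (21%nat, 0%nat).
Notation vLk := (22%nat, 0%nat).
Notation vLL := (23%nat, 0%nat).

(** The leading one is searched from the top in steps of [b] bits and then located by the table of
    logarithms. The time thus depends on the number of zeros in front of the code and not on the
    length of the window. *)
Definition DEC : stmt :=
 vDok <- E0 ;;
 SIf ($vDm)
  (vDf <- ($vDV >>! ($vDm -! E1)) ;;
  vDU <- ($vDV -! ($vDf <<! ($vDm -! E1))) ;;
  SIf ($vDU)
   (vDk <- ($vDm -! E1) ;;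
   SWhile (enot ($vDU >>! ($vDk -! $vb))) (vDk <- ($vDk -! $vb)) ;;
   vDL <- (($vDk -! $vb) +! ERd aLG ($vDU >>! ($vDk -! $vb)) E0) ;;
   vDl <- ($vDm -! E1 -! E1 -! $vDL) ;;
   SIf ($vDL <! $vDl) SSkip
    (vDok <- E1 ;;
    vDm2 <- ($vDL -! $vDl) ;;
    vDX <- ($vDU >>! $vDm2) ;;
    vDV2 <- ($vDU -! ($vDX <<! $vDm2)))) SSkip) SSkip.

(** Here the search starts at the low end, so that the time is proportional to [N.log2 x / b] even
    though the register is much wider. *)
Definition LOG : stmt :=
 vLk <- E0 ;;
 SWhile ($vLx >>! ($vLk +! $vb)) (vLk <- ($vLk +! $vb)) ;;
 vLL <- ($vLk +! ERd aLG ($vLx >>! $vLk) E0).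

Definition lg2ok (b : N) (s : vst) : Prop := forall v, 0 < v < 2 ^ b -> dm s aLG v 0 = N.log2 v.

Lemma lg2ok_frame b p s s' : lg2ok b s -> Frame p s s' -> moda p aLG = false -> lg2ok b s'.
Proof. intros H HF Hm v Hv. rewrite (fa HF); auto. Qed.

Lemma enot_nz x : 1 - x <> 0 -> x = 0.
Proof. lia. Qed.

Lemma enot_z x : 1 - x = 0 -> x <> 0.
Proof. lia. Qed.

Lemma log2_div x k : k <= N.log2 x -> N.log2 (x / 2 ^ k) = N.log2 x - k.
Proof. intros. rewrite <- N.shiftr_div_pow2. apply N.log2_shiftr. Qed.

Lemma div_pow_zero x k : x / 2 ^ k = 0 <-> x < 2 ^ k.
Proof. pose proof (pow2_pos k). apply N.div_small_iff. lia. Qed.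

Lemma div_pow_lt x a k : x < 2 ^ (k + a) -> x / 2 ^ k < 2 ^ a.
Proof. intros. apply N.Div0.div_lt_upper_bound. rewrite <- N.pow_add_r. auto. Qed.

Section Procs.
Context (w W : N) (delta : N -> list N -> N * N).
(** Bit counts are of order [W]; this keeps sums of a few of them from wrapping around. *)
Hypothesis HWbig : 64 * W <= 2 ^ W.
Notation wp := (wp w W delta).

Lemma LOG_spec s b x : env s vb = b -> 1 <= b <= W -> lg2ok b s -> env s vLx = x -> 0 < x < 2 ^ W ->
 wp LOG (fun n s' => env s' vLL = N.log2 x /\ N.of_nat n * b <= N.log2 x) s.
Proof.
 intros Hb Hb1 Hlg Hx Hx0. unfold LOG. apply wp_set_seq, wp_seq.
 assert (Hlog : N.log2 x < W) by (apply N.log2_lt_pow2; lia).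
 apply wp_while with (I := fun a s' => env s' vb = b /\ lg2ok b s' /\ env s' vLx = x /\
   N.of_nat a * b = env s' vLk /\ env s' vLk <= N.log2 x)
  (m := fun s' => N.to_nat (N.log2 x - env s' vLk)).
 - intros a s1 (H1 & H2 & H3 & H4 & H5) Hc. vredh Hc. rewrite H1, H3 in Hc.
  rewrite N.mod_small in Hc by lia. rewrite div_pow_zero in Hc.
  assert (env s1 vLk + b <= N.log2 x).
  { apply N.log2_le_pow2; lia. }
  apply wp_set. vred. rewrite H1. rewrite N.mod_small by lia. repeat split; auto; lia.
 - intros a s1 (H1 & H2 & H3 & H4 & H5) Hc. vredh Hc. rewrite H1, H3 in Hc.
  rewrite N.mod_small in Hc by lia. apply div_pow_zero in Hc.
  apply wp_set. vred. rewrite H3, H2.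
  2:{ split; [|apply div_pow_lt; auto]. apply N.div_str_pos. split; [apply pow2_pos|].
    transitivity (2 ^ N.log2 x); [apply N.pow_le_mono_r; lia|apply log2_bounds; lia]. }
  rewrite log2_div by auto. rewrite N.mod_small by lia. split; lia.
 - vred. repeat split; auto; try apply Hlg; lia.
Qed.

Lemma DEC_spec s b V m : env s vb = b -> 1 <= b <= W -> lg2ok b s -> env s vDV = V -> env s vDm = m ->
 V < 2 ^ m -> m <= W ->
 wp DEC (fun n s' => N.of_nat n * b <= m /\
  match decode V m with
  | None => env s' vDok = 0
  | Some (f, X, V2, m2) => env s' vDok = 1 /\ env s' vDf = f /\ env s' vDX = X /\ env s' vDV2 = V2 /\
    env s' vDm2 = m2 /\ N.of_nat n * b <= N.log2 X
  end) s.
Proof.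
 intros Hb Hb1 Hlg HV Hm HVm HmW. unfold DEC. apply wp_set_seq, wp_if; vred; rewrite Hm.
 2:{ intros ->. apply wp_skip. vred. unfold decode. simpl. split; [lia|auto]. }
 intros Hm0. apply wp_set_seq, wp_set_seq. vred. rewrite HV, Hm.
 set (f := V / 2 ^ (m - 1)).
 assert (Hf : f * 2 ^ (m - 1) <= V).
 { unfold f. rewrite N.mul_comm. apply N.Div0.mul_div_le. }
 assert (HVW : V < 2 ^ W) by (eapply N.lt_le_trans; [eauto|apply N.pow_le_mono_r; lia]).
 assert (Hsub : N.of_nat 1 = 1) by reflexivity.
 unfold decode. destruct (N.eqb_spec m 0); [lia|]. fold f.
 rewrite N.mod_small by (pose proof (pow2_pos W); lia).
 set (U := V - f * 2 ^ (m - 1)).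
 assert (HU : U < 2 ^ (m - 1)).
 { unfold U. pose proof (N.div_mod' V (2 ^ (m - 1))). fold f in H.
  pose proof (N.mod_lt V (2 ^ (m - 1)) ltac:(pose proof (pow2_pos (m - 1)); lia)).
  set (r := V mod 2 ^ (m - 1)) in *. clearbody r f. gp. lia. }
 clearbody U. apply wp_if; vred.
 2:{ intros ->. apply wp_skip. vred. simpl. split; [lia|auto]. }
 intros HU0. destruct (N.eqb_spec U 0); [lia|].
 apply wp_set_seq. vred. apply wp_seq.
 apply wp_while with (I := fun a s' => env s' vb = b /\ lg2ok b s' /\ env s' vDU = U /\ env s' vDm = m /\
   env s' vDf = f /\ env s' vDok = 0 /\
   N.of_nat a * b + env s' vDk = m - 1 /\ U < 2 ^ env s' vDk)
  (m := fun s' => N.to_nat (env s' vDk)).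
 - intros a s1 (H1 & H2 & H3 & H4 & H5 & H6 & H7 & H8) Hc. vredh Hc. rewrite H1, H3 in Hc.
  assert (Hz : U / 2 ^ (env s1 vDk - b) = 0) by (apply enot_nz; auto). apply div_pow_zero in Hz. clear Hc.
  assert (b < env s1 vDk).
  { destruct (N.lt_ge_cases b (env s1 vDk)); auto. replace (env s1 vDk - b) with 0 in Hz by lia.
   rewrite N.pow_0_r in Hz. lia. }
  apply wp_set. vred. rewrite H1. repeat split; auto; lia.
 - intros a s1 (H1 & H2 & H3 & H4 & H5 & H6 & H7 & H8) Hc. vredh Hc. rewrite H1, H3 in Hc.
  set (k := env s1 vDk) in *.
  assert (Hz : U / 2 ^ (k - b) <> 0) by (apply enot_z; auto). rewrite div_pow_zero in Hz.
  assert (HkL : k - b <= N.log2 U) by (apply N.log2_le_pow2; lia).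
  assert (HLk : N.log2 U < k) by (apply N.log2_lt_pow2; [lia|auto]).
  apply wp_set_seq. vred. fold k. rewrite H1, H3, H2.
  2:{ split; [|apply div_pow_lt; eapply N.lt_le_trans; [eauto|apply N.pow_le_mono_r; lia]].
    apply N.div_str_pos. split; [apply pow2_pos|lia]. }
  rewrite log2_div by auto. rewrite N.mod_small by lia.
  replace (k - b + (N.log2 U - (k - b))) with (N.log2 U) by lia.
  apply wp_set_seq. vred. rewrite H4.
  replace (m - 1 - 1) with (m - 2) by lia.
  apply wp_if; vred; destruct (N.ltb_spec (N.log2 U) (m - 2 - N.log2 U)); try lia; intros _.
  + apply wp_skip. vred. split; [lia|auto].
  + apply wp_set_seq, wp_set_seq, wp_set_seq, wp_set. vred. rewrite H3, H5.
   assert (HX : U / 2 ^ (N.log2 U - (m - 2 - N.log2 U)) * 2 ^ (N.log2 U - (m - 2 - N.log2 U)) < 2 ^ W).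
   { eapply N.le_lt_trans; [rewrite N.mul_comm; apply N.Div0.mul_div_le|].
    eapply N.lt_le_trans; [exact HU|apply N.pow_le_mono_r; lia]. }
   rewrite N.mod_small by auto. repeat split; auto; [lia|].
   (* From [a * b + k = m - 1] and [N.log2 U < k], the iterations have passed only zeros in front of
      the code, of which there are [N.log2 X]. *)
   rewrite log2_div by lia. lia.
 - vred. rewrite Hm. repeat split; auto; lia.
Qed.
End Procs.

(** * One step on windows *)

Notation vS := (30%nat, 0%nat).
Notation vlim := (31%nat, 0%nat).
Notation vF := (32%nat, 0%nat).
Notation vz0 := (33%nat, 0%nat).
Notation vo := (34%nat, 0%nat).
Notation vol := (35%nat, 0%nat).
Notation vz := (36%nat, 0%nat).
Notation vS2 := (37%nat, 0%nat).
Notation vY := (38%nat, 0%nat).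
Notation vav := (39%nat, 0%nat).
Notation vr i := (50%nat, i).
Notation vV i := (51%nat, i).
Notation vm i := (52%nat, i).
Notation vu i := (53%nat, i).
Notation vnr i := (54%nat, i).
Notation vnV i := (55%nat, i).
Notation vnm i := (56%nat, i).

Notation TL := ($vLL +! $vLL +! E1 +! E1).

Definition FETCH (i : nat) : stmt :=
 SIf ($(vr i))
  (vu i <- E0 ;; vnr i <- ($(vr i) -! E1) ;; vnV i <- $(vV i) ;; vnm i <- $(vm i))
  (vDV <- $(vV i) ;; vDm <- $(vm i) ;; DEC ;;
   SIf ($vDok)
    (vnV i <- $vDV2 ;; vnm i <- $vDm2 ;;
    SIf ($vDf) (vu i <- $vDX ;; vnr i <- E0) (vu i <- E0 ;; vnr i <- ($vDX -! E1)))
    (vav <- E0)).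

Definition OUTPUT : stmt :=
 SIf ($vY)
  (SIf ($vF)
    (SIf ($vz) (vLx <- $vz ;; LOG ;; vo <- (($vo <<! TL) +! $vz) ;; vol <- ($vol +! TL)) SSkip)
    (vF <- E1 ;; vz0 <- $vz) ;;
   vLx <- $vY ;; LOG ;;
   vo <- (($vo <<! TL) +! ((E1 <<! (TL -! E1)) +! $vY)) ;;
   vol <- ($vol +! TL) ;; vz <- E0)
  (vz <- ($vz +! E1)).

(** New window contents are first collected in separate variables: if another stream cannot deliver
    a symbol, or the output symbol is too large, the configuration has to stay as it was. *)
Definition COMMIT (i : nat) : stmt := vr i <- $(vnr i) ;; vV i <- $(vnV i) ;; vm i <- $(vnm i).

Definition STEP (t : nat) : stmt :=
 vav <- E1 ;;
 fors t FETCH ;;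
 SIf ($vav)
  (SDelta vS2 vY vS (map (fun i => vu i) (seq 0 t)) ;;
   SIf ($vY >>! $vlim) (vav <- E0) SSkip) SSkip ;;
 SIf ($vav) (fors t COMMIT ;; vS <- $vS2 ;; OUTPUT) SSkip.

Definition wc_of (s : vst) : wc :=
 {| wS := env s vS; wr := fun i => env s (vr i); wV := fun i => env s (vV i); wm := fun i => env s (vm i);
   wF := env s vF; wz0 := env s vz0; wo := env s vo; wol := env s vol; wz := env s vz |}.

(** Configurations contain functions on all indices, whereas a program state determines them only on
    the [t] streams. *)
Record wceq (t : nat) (c d : wc) : Prop := {
 weS : wS c = wS d;
 wer : forall i, (i < t)%nat -> wr c i = wr d i;
 weV : forall i, (i < t)%nat -> wV c i = wV d i;
 wem : forall i, (i < t)%nat -> wm c i = wm d i;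
 weF : wF c = wF d; wez0 : wz0 c = wz0 d; weo : wo c = wo d; weol : wol c = wol d; wez : wz c = wz d }.

Lemma wceq_trans t c d e : wceq t c d -> wceq t d e -> wceq t c e.
Proof. intros [] []; constructor; intros; solve [congruence | etransitivity; [apply wer0|]; auto | etransitivity; [apply weV0|]; auto | etransitivity; [apply wem0|]; auto]. Qed.

Lemma symbols_ext t c d u r' V' m' : wceq t c d -> symbols t c u r' V' m' -> symbols t d u r' V' m'.
Proof. intros H Hs i Hi. rewrite <- (wer _ _ _ H), <- (weV _ _ _ H), <- (wem _ _ _ H) by auto. auto. Qed.

Lemma WStep_ext t delta W lim c d c' : wceq t c d -> WStep t delta W lim c c' -> WStep t delta W lim d c'.
Proof.
 intros H (u & H1 & H2 & H3 & H4). exists u. split; [eapply symbols_ext; eauto|].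
 unfold dnext, dout in *. rewrite <- (weS _ _ _ H), <- (weF _ _ _ H), <- (wez0 _ _ _ H), <- (weo _ _ _ H),
  <- (weol _ _ _ H), <- (wez _ _ _ H). auto.
Qed.

Lemma Stuck_ext t delta W lim c d : wceq t c d -> Stuck t delta W lim c -> Stuck t delta W lim d.
Proof.
 intros H [(i & Hi & Hn)|(u & r' & V' & m' & Hs & HY)].
 - left. exists i. rewrite <- (wer _ _ _ H), <- (weV _ _ _ H), <- (wem _ _ _ H) by auto. auto.
 - right. exists u, r', V', m'. split; [eapply symbols_ext; eauto|].
  unfold dout in *. rewrite <- (weS _ _ _ H). auto.
Qed.

Ltac neqs := repeat match goal with
 | |- context [Nat.eqb ?a ?b] => rewrite (proj2 (Nat.eqb_neq a b)) by lia
 end.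
Ltac vs := vred; rewrite ?Nat.eqb_refl; vred.

(* Proves that a program does not modify [(k, j)], given arithmetic facts about [k] and [j]. *)
Ltac keep := cbn [modv];
 repeat match goal with
  |- context [peqb ?u ?x] => let EE := fresh in destruct (peqb_spec u x) as [EE|];
    [exfalso; inversion EE; subst; first [lia | congruence]|] end; reflexivity.

Lemma runlen_lt z : z < 2 ^ runlen z.
Proof.
 unfold runlen. destruct (N.eqb_spec z 0); [subst; reflexivity|].
 pose proof (tokval_lt 0 z ltac:(lia) ltac:(lia)). unfold tokval in *. lia.
Qed.

Lemma toklen_lim Y lim : Y < 2 ^ lim -> Y <> 0 -> toklen Y <= 2 * lim.
Proof. intros. unfold toklen. apply N.log2_lt_pow2 in H; lia. Qed.

Lemma append_lt o ol v k : o < 2 ^ ol -> v < 2 ^ k -> o * 2 ^ k + v < 2 ^ (ol + k).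
Proof.
 intros. rewrite N.pow_add_r. set (a := 2 ^ ol) in *. set (b := 2 ^ k) in *. clearbody a b.
 assert ((o + 1) * b <= a * b) by (apply N.mul_le_mono_r; lia). lia.
Qed.

Section Step.
Context (w W : N) (delta : N -> list N -> N * N) (t : nat) (b : N).
Hypothesis HWbig : 64 * W <= 2 ^ W.
Hypothesis Hb : 1 <= b <= W.
Notation wp := (wp w W delta).

Lemma FETCH_spec i s : env s vb = b -> lg2ok b s -> env s (vV i) < 2 ^ env s (vm i) -> env s (vm i) <= W ->
 wp (FETCH i) (fun n s' =>
  match next1 (env s (vr i)) (env s (vV i)) (env s (vm i)) with
  | Some (u, r', V', m') => env s' (vu i) = u /\ env s' (vnr i) = r' /\ env s' (vnV i) = V' /\
    env s' (vnm i) = m' /\ env s' vav = env s vav /\ N.of_nat n * b + m' <= env s (vm i)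
  | None => env s' vav = 0 /\ N.of_nat n * b <= env s (vm i)
  end) s.
Proof.
 intros Hvb Hlg HV Hm. unfold FETCH, next1. apply wp_if; vs; intros Hr.
 - destruct (N.eqb_spec (env s (vr i)) 0); [lia|].
  apply wp_set_seq, wp_set_seq, wp_set_seq, wp_set. vs. repeat split; lia.
 - rewrite Hr. simpl N.eqb. cbn iota.
  apply wp_set_seq, wp_set_seq, wp_seq. eapply wp_mono.
  { eapply (DEC_spec w W delta HWbig _ b (env s (vV i)) (env s (vm i))); vs; auto. }
  intros n s1 HF [Hc Hd]. destruct (decode (env s (vV i)) (env s (vm i))) as [[[[f X] V2] m2]|] eqn:E.
  + destruct Hd as (D1 & D2 & D3 & D4 & D5 & D6).
   apply decode_inv in E as (E1 & E2 & E3 & E4 & E5); auto.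
   assert (Hn : N.of_nat n * b + m2 <= env s (vm i)) by (unfold toklen in E5; lia).
   assert (Hav : env s1 vav = env s vav) by (rewrite (fv HF) by reflexivity; reflexivity).
   apply wp_if; vs; rewrite D1; [intros _|lia]. apply wp_set_seq, wp_set_seq.
   apply wp_if; vs; rewrite D2; intros Hf;
    (destruct (N.eqb_spec f 0); [try lia|try lia]);
    apply wp_set_seq, wp_set; vs; rewrite ?D3; rewrite Nat.add_0_r; repeat split; auto.
  + apply wp_if; vs; rewrite Hd; [lia|intros _]. apply wp_set. vs. rewrite Nat.add_0_r. auto.
Qed.

Definition FETCHED (s0 : vst) (i a : nat) (s : vst) : Prop :=
 env s vb = b /\ lg2ok b s /\ (forall j, env s (vr j) = env s0 (vr j)) /\ (forall j, env s (vV j) = env s0 (vV j)) /\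
 (forall j, env s (vm j) = env s0 (vm j)) /\
 ((env s vav = 1 /\ (forall j, (j < i)%nat -> next1 (env s0 (vr j)) (env s0 (vV j)) (env s0 (vm j))
    = Some (env s (vu j), env s (vnr j), env s (vnV j), env s (vnm j))) /\
   N.of_nat a * b + nsum i (fun j => env s (vnm j)) <= nsum i (fun j => env s0 (vm j))) \/
  (env s vav = 0 /\ (exists j, (j < i)%nat /\ next1 (env s0 (vr j)) (env s0 (vV j)) (env s0 (vm j)) = None) /\
   N.of_nat a * b <= nsum i (fun j => env s0 (vm j)))).

Lemma FETCH_keep i v : v <> vav -> ~ (10 <= fst v <= 23)%nat -> (snd v <> i \/ ~ (53 <= fst v <= 56)%nat) ->
 modv (FETCH i) v = false.
Proof. destruct v as [k j]. cbn [fst snd]. intros. unfold FETCH, DEC. keep. Qed.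

Lemma FETCHES_spec s0 : env s0 vb = b -> lg2ok b s0 -> env s0 vav = 1 ->
 (forall i, (i < t)%nat -> env s0 (vV i) < 2 ^ env s0 (vm i) /\ env s0 (vm i) <= W) ->
 wp (fors t FETCH) (fun a s => FETCHED s0 t a s) s0.
Proof.
 intros H1 H2 H3 H4. apply wp_fors.
 - intros i a s Hi (Q1 & Q2 & Q3 & Q4 & Q5 & Q6). destruct (H4 i Hi) as [Hv Hm].
  eapply wp_mono; [apply (FETCH_spec i s); auto; rewrite ?Q4, ?Q5; auto|].
  intros n s' HF HQ. rewrite Q3, Q4, Q5 in HQ.
  assert (K : forall k j, (50 <= k)%nat -> ~ (53 <= k <= 56)%nat \/ j <> i -> env s' (k, j) = env s (k, j)).
  { intros k j Hk Hj. apply (fv HF). apply FETCH_keep; cbn [fst snd]; [injection; lia|lia|tauto]. }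
  unfold FETCHED. rewrite (fv HF vb) by reflexivity.
  sp. split; [eapply lg2ok_frame; eauto|]. split; [intros j; rewrite K, Q3; auto; lia|].
  split; [intros j; rewrite K, Q4; auto; lia|]. split; [intros j; rewrite K, Q5; auto; lia|].
  destruct (next1 (env s0 (vr i)) (env s0 (vV i)) (env s0 (vm i))) as [[[[u r'] V'] m']|] eqn:E.
  + destruct HQ as (U1 & U2 & U3 & U4 & U5 & U6). destruct Q6 as [(A & B & C)|(A & (j & Hj & B) & C)].
   * left. split; [congruence|]. split.
    -- intros j Hj. destruct (Nat.eq_dec j i) as [->|]; [rewrite U1, U2, U3, U4; auto|].
      rewrite !K by lia. apply B. lia.
    -- cbn [nsum]. rewrite U4. rewrite (nsum_ext i _ (fun j => env s (vnm j))) by (intros j ?; apply K; lia). lia.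
   * right. split; [congruence|]. split; [exists j; split; auto; lia|]. cbn [nsum]. lia.
  + destruct HQ as [U1 U2]. right. split; auto. split; [exists i; auto|]. cbn [nsum].
   destruct Q6 as [(A & B & C)|(A & _ & C)]; lia.
 - sp. sp. sp. sp. sp. left. split; auto.
  split; [lia|]. cbn [nsum]. lia.
Qed.

Lemma LOG_upd s x : env s vb = b -> lg2ok b s -> 0 < x < 2 ^ W ->
 forall p (Q : nat -> vst -> Prop),
 (forall n s', Frame LOG (upd s vLx x) s' -> env s' vLL = N.log2 x -> N.of_nat n * b <= N.log2 x ->
  wp p (fun n' s'' => Q (n + n')%nat s'') s') ->
 wp (LOG ;; p) Q (upd s vLx x).
Proof.
 intros H1 H2 H3 p Q H. apply wp_seq. eapply wp_mono.
 - apply (LOG_spec w W delta HWbig _ b x); vs; auto.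
 - intros n s' HF [E1 E2]. apply H; auto.
Qed.

Lemma TL_small x : 0 < x < 2 ^ W -> N.log2 x + N.log2 x < 2 ^ W /\ N.log2 x + N.log2 x + 1 < 2 ^ W /\
  N.log2 x + N.log2 x + 1 + 1 < 2 ^ W /\ N.log2 x + N.log2 x + 1 + 1 = toklen x.
Proof. intros H. assert (N.log2 x < W) by (apply N.log2_lt_pow2; lia). unfold toklen. lia. Qed.

Lemma OUTPUT_spec s : env s vb = b -> lg2ok b s -> env s vo < 2 ^ env s vol ->
 env s vol + runlen (env s vz) + toklen (env s vY) + 2 <= W -> env s vY < 2 ^ W ->
 wp OUTPUT (fun n s' =>
  (env s' vF, env s' vz0, env s' vo, env s' vol, env s' vz)
  = out_step (env s vF) (env s vz0) (env s vo) (env s vol) (env s vz) (env s vY) /\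
  N.of_nat n * b + env s vol <= env s' vol) s.
Proof.
 intros H1 H2 Ho HW HY. unfold OUTPUT, out_step.
 assert (Hz : env s vz < 2 ^ runlen (env s vz)) by apply runlen_lt.
 assert (HzW : env s vz + 1 < 2 ^ W).
 { assert (2 ^ (runlen (env s vz) + 1) <= 2 ^ W) by (apply N.pow_le_mono_r; lia).
  rewrite N.pow_add_r, N.pow_1_r in H. pose proof (pow2_pos (runlen (env s vz))). lia. }
 apply wp_if; vs; intros HY0; (destruct (N.eqb_spec (env s vY) 0); [try lia|try lia]).
 2:{ apply wp_set. vs. rewrite N.mod_small by auto. split; [auto|lia]. }
 apply wp_seq.
 eapply wp_mono with (Q := fun n s' => env s' vb = b /\ lg2ok b s' /\ env s' vY = env s vY /\
   (env s' vF, env s' vz0, env s' vo, env s' vol) =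
   (if env s vF =? 0 then (1, env s vz, env s vo, env s vol)
   else (env s vF, env s vz0, env s vo * 2 ^ runlen (env s vz) + env s vz, env s vol + runlen (env s vz))) /\
   N.of_nat n * b + env s vol <= env s' vol).
 - apply wp_if; vs; intros HF; (destruct (N.eqb_spec (env s vF) 0); [try lia|try lia]).
  + apply wp_if; vs; intros Hz0.
   * apply wp_set_seq. vs. apply LOG_upd; auto; [lia|]. intros n1 s1 Fr EL En.
    destruct (TL_small (env s vz)) as (L1 & L2 & L3 & L4); [lia|].
    assert (Erl : runlen (env s vz) = toklen (env s vz)) by (unfold runlen; destruct (N.eqb_spec (env s vz) 0); lia).
    assert (P1 : env s vo * 2 ^ toklen (env s vz) + env s vz < 2 ^ (env s vol + toklen (env s vz))).
    { apply append_lt; auto. rewrite <- Erl; auto. }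
    assert (P2 : 2 ^ (env s vol + toklen (env s vz)) <= 2 ^ W) by (apply N.pow_le_mono_r; lia).
    assert (P3 : env s vo * 2 ^ toklen (env s vz) < 2 ^ W) by lia.
    apply wp_set_seq, wp_set. vs. rewrite !EL, !(fv Fr) by reflexivity. vs.
    rewrite !(N.mod_small (N.log2 _ + N.log2 _)) by auto.
    rewrite !(N.mod_small (_ + _ + 1)) by auto. rewrite ?(N.mod_small (_ + 1)) by auto.
    rewrite L4. rewrite (N.mod_small (_ * _)) by auto. rewrite N.mod_small by lia.
    rewrite N.mod_small by lia. rewrite Erl.
    sp. split; [|split; [auto|split; [auto|unfold toklen; lia]]].
    intros v Hv. vs. rewrite (fa Fr) by reflexivity. vs. auto.
   * apply wp_skip. rewrite Hz0. unfold runlen. simpl N.eqb. cbn iota.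
    rewrite N.pow_0_r, N.mul_1_r, !N.add_0_r. repeat split; auto. lia.
  + apply wp_set_seq, wp_set. vs. repeat split; auto. lia.
 - intros n0 s1 Fr (G1 & G2 & G3 & G4 & G5).
  assert (Hs1 : env s1 vo < 2 ^ env s1 vol /\ env s1 vol + toklen (env s vY) + 2 <= W).
  { destruct (env s vF =? 0); injection G4 as _ _ E3 E4; rewrite E3, E4; split; auto; try lia.
   apply append_lt; auto. }
  destruct Hs1 as [Hs1 Hs2].
  apply wp_set_seq. vs. rewrite G3. apply LOG_upd; auto; [lia|]. intros n1 s2 Fr2 EL En.
  destruct (TL_small (env s vY)) as (L1 & L2 & L3 & L4); [lia|].
  pose proof (tokval_lt 1 (env s vY) ltac:(lia) ltac:(lia)) as Ht. unfold tokval in Ht. rewrite N.mul_1_l in Ht.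
  assert (P1 := append_lt (env s1 vo) (env s1 vol) _ _ Hs1 Ht).
  assert (P2 : 2 ^ (env s1 vol + toklen (env s vY)) <= 2 ^ W) by (apply N.pow_le_mono_r; lia).
  assert (EY : env s2 vY = env s vY) by (rewrite (fv Fr2) by reflexivity; vs; auto).
  assert (Eo : env s2 vo = env s1 vo) by (rewrite (fv Fr2) by reflexivity; vs; auto).
  assert (Eol : env s2 vol = env s1 vol) by (rewrite (fv Fr2) by reflexivity; vs; auto).
  assert (EF : env s2 vF = env s1 vF) by (rewrite (fv Fr2) by reflexivity; vs; auto).
  assert (Ez0 : env s2 vz0 = env s1 vz0) by (rewrite (fv Fr2) by reflexivity; vs; auto).
  apply wp_set_seq, wp_set_seq, wp_set. vs. rewrite !EL, EY, Eo, Eol, EF, Ez0.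
  rewrite !(N.mod_small (N.log2 _ + N.log2 _)) by auto.
  rewrite ?(N.mod_small (N.log2 _ + N.log2 _ + 1)) by auto. rewrite ?(N.mod_small (N.log2 _ + N.log2 _ + 1 + 1)) by auto.
  rewrite L4, N.mul_1_l.
  rewrite (N.mod_small (2 ^ (_ - 1))) by lia. rewrite (N.mod_small (env s1 vo * _)) by lia.
  rewrite (N.mod_small (2 ^ _ + _)) by lia. rewrite N.mod_small by lia.
  rewrite N.mod_small by lia. unfold tokval. rewrite N.mul_1_l.
  split; [|unfold toklen; lia].
  destruct (env s vF =? 0); injection G4 as -> -> -> ->; auto.
Qed.

Lemma COMMIT_keep i v : (snd v <> i \/ ~ (50 <= fst v <= 52)%nat) -> modv (COMMIT i) v = false.
Proof. destruct v as [k j]. cbn [fst snd]. intros. unfold COMMIT. keep. Qed.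

Lemma COMMITS_spec s0 : wp (fors t COMMIT) (fun a s => a = 0%nat /\ forall j, (j < t)%nat ->
  env s (vr j) = env s0 (vnr j) /\ env s (vV j) = env s0 (vnV j) /\ env s (vm j) = env s0 (vnm j)) s0.
Proof.
 eapply wp_mono; [apply wp_fors with (I := fun i a s => a = 0%nat /\ (forall v, ~ (50 <= fst v <= 52)%nat -> env s v = env s0 v) /\
   forall j, (j < i)%nat ->
  env s (vr j) = env s0 (vnr j) /\ env s (vV j) = env s0 (vnV j) /\ env s (vm j) = env s0 (vnm j))|].
 - intros i a s Hi (-> & K & Q). apply wp_set_seq, wp_set_seq, wp_set. sp. split.
  + intros [k j] Hk. cbn [fst] in Hk. cbn [env upd].
   all_distinct_vars.
   apply K; auto.
  + intros j Hj. vs. destruct (Nat.eqb_spec j i) as [->|]; [|apply Q; lia].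
   rewrite !K by (cbn [fst]; lia). auto.
 - repeat split; auto; lia.
 - intros a s _ (-> & _ & Q). auto.
Qed.

(** The last bound leaves room in a [W]-bit register for the token of the pending output run and for
    one admissible literal. *)
Definition step_pre (lim : N) (s : vst) : Prop :=
 env s vb = b /\ lg2ok b s /\ env s vlim = lim /\
 (forall i, (i < t)%nat -> env s (vV i) < 2 ^ env s (vm i) /\ env s (vm i) <= W) /\
 env s vo < 2 ^ env s vol /\ env s vol + runlen (env s vz) + 2 * lim + 4 <= W.

(** Every iteration of a search for a leading one is paid for by [b] bits: those of the token just
    read or those just appended to the output. A failed step is charged to the windows. *)
Definition STEP_post (lim : N) (s : vst) (n : nat) (s' : vst) : Prop :=
 (env s' vav = 1 /\ WStep t delta W lim (wc_of s) (wc_of s') /\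
  N.of_nat n * b + nsum t (fun i => env s' (vm i)) + env s vol <= nsum t (fun i => env s (vm i)) + env s' vol) \/
 (env s' vav = 0 /\ Stuck t delta W lim (wc_of s) /\ wceq t (wc_of s') (wc_of s) /\
  N.of_nat n * b <= nsum t (fun i => env s (vm i))).

Lemma map_env_seq s : map (env s) (map (fun i => vu i) (seq 0 t)) = map (fun i => env s (vu i)) (seq 0 t).
Proof. apply map_map. Qed.

Lemma STEP_spec lim s : step_pre lim s -> wp (STEP t) (STEP_post lim s) s.
Proof.
 intros (H1 & H2 & H3 & H4 & H5 & H6). unfold STEP. apply wp_set_seq, wp_seq.
 set (s0 := upd s vav (eval W s E1)).
 eapply wp_mono; [apply (FETCHES_spec s0); unfold s0; vs; auto|].
 intros a s1 Fr1 (Q1 & Q2 & Q3 & Q4 & Q5 & Q6).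
 assert (K1 : forall k j, (30 <= k)%nat -> ~ (53 <= k <= 56)%nat -> k <> 39%nat -> env s1 (k, j) = env s (k, j)).
 { intros k j Hk1 Hk2 Hk3. rewrite (fv Fr1).
  - unfold s0. cbn [upd env]. destruct (peqb_spec (k, j) vav) as [EE|]; auto. inversion EE; lia.
  - apply modv_fors. intros i Hi. apply FETCH_keep; cbn [fst snd]; [injection; lia|lia|auto]. }
 assert (Es0 : forall v, v <> vav -> env s0 v = env s v).
 { intros v Hv. unfold s0. cbn [upd env]. destruct (peqb_spec v vav); congruence. }
 assert (Q6' : (env s1 vav = 1 /\ symbols t (wc_of s) (fun i => env s1 (vu i)) (fun i => env s1 (vnr i)) (fun i => env s1 (vnV i)) (fun i => env s1 (vnm i)) /\
   N.of_nat a * b + nsum t (fun j => env s1 (vnm j)) <= nsum t (fun j => env s (vm j))) \/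
  (env s1 vav = 0 /\ Stuck t delta W lim (wc_of s) /\ N.of_nat a * b <= nsum t (fun j => env s (vm j)))).
 { rewrite (nsum_ext t (fun j => env s0 (vm j)) (fun j => env s (vm j))) in Q6 by (intros; apply Es0; discriminate).
  destruct Q6 as [(A & B & C)|(A & (j & Hj & B) & C)].
  - left. sp. split; [|auto]. intros i Hi. cbn. specialize (B i Hi).
   rewrite !Es0 in B by discriminate. auto.
  - right. sp. split; [|auto]. left. exists j. rewrite !Es0 in B by discriminate. auto. }
 clear Q6. apply wp_seq.
 eapply wp_mono with (Q := fun n s2 => n = 0%nat /\ (forall k j, (30 <= k)%nat -> k <> 37%nat -> k <> 38%nat -> k <> 39%nat -> env s2 (k, j) = env s1 (k, j)) /\
   env s2 vb = b /\ lg2ok b s2 /\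
   ((env s2 vav = 1 /\ symbols t (wc_of s) (fun i => env s1 (vu i)) (fun i => env s1 (vnr i)) (fun i => env s1 (vnV i)) (fun i => env s1 (vnm i)) /\
    env s2 vS2 = dnext t delta W (wc_of s) (fun i => env s1 (vu i)) /\
    env s2 vY = dout t delta W (wc_of s) (fun i => env s1 (vu i)) /\ env s2 vY < 2 ^ lim /\
    N.of_nat a * b + nsum t (fun j => env s1 (vnm j)) <= nsum t (fun j => env s (vm j))) \/
   (env s2 vav = 0 /\ Stuck t delta W lim (wc_of s) /\ N.of_nat a * b <= nsum t (fun j => env s (vm j))))).
 - apply wp_if; vs; intros Hav.
  + destruct Q6' as [(A & B & C)|(A & _)]; [|lia].
   apply wp_seq, wp_delta. cbn zeta. rewrite map_env_seq.
   assert (ES : env s1 vS = env s vS) by (apply K1; lia). rewrite ES.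
   set (Y := snd _ mod 2 ^ W). set (S2 := fst _ mod 2 ^ W).
   assert (EYd : Y = dout t delta W (wc_of s) (fun i => env s1 (vu i))) by reflexivity.
   assert (ESd : S2 = dnext t delta W (wc_of s) (fun i => env s1 (vu i))) by reflexivity.
   clearbody Y S2.
   assert (El : env s1 vlim = lim) by (rewrite K1 by lia; auto).
   apply wp_if; vs; rewrite El; intros HY.
   * rewrite div_pow_zero in HY. apply wp_set. sp. split.
    { intros k j G1 G2 G3 G4. cbn [upd env].
     all_distinct_vars. auto. }
    vs. sp. sp. right. sp. split.
    { right. exists (fun i => env s1 (vu i)), (fun i => env s1 (vnr i)), (fun i => env s1 (vnV i)), (fun i => env s1 (vnm i)).
     split; auto. rewrite <- EYd. lia. }
    lia.
   * apply div_pow_zero in HY. apply wp_skip. sp. split.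
    { intros k j G1 G2 G3 G4. cbn [upd env].
     all_distinct_vars. auto. }
    vs. sp. sp. left. repeat split; auto.
  + apply wp_skip. split; auto. sp. sp. sp. right.
   destruct Q6' as [(A & _)|(A & B & C)]; [lia|]. auto.
 - intros n s2 Fr2 (-> & K2 & Vb & Lg & Cs). cbn [Nat.add].
  apply wp_if; vs; intros Hav.
  + destruct Cs as [(A & B & C1 & C2 & C3 & C4)|(A & _)]; [|lia].
   apply wp_seq. eapply wp_mono; [apply COMMITS_spec|]. intros n3 s3 Fr3 (-> & K3).
   assert (K3' : forall k j, ~ (50 <= k <= 52)%nat -> env s3 (k, j) = env s2 (k, j)).
   { intros k j Hk. apply (fv Fr3), modv_fors. intros i Hi. apply COMMIT_keep. cbn [fst]. auto. }
   assert (Lg3 : lg2ok b s3).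
   { eapply lg2ok_frame; eauto. apply moda_fors. reflexivity. }
   apply wp_set_seq. set (s4 := upd s3 vS _).
   assert (E4 : forall k j, (30 < k)%nat -> env s4 (k, j) = env s3 (k, j)).
   { intros k j Hk. unfold s4. cbn [upd env]. destruct (peqb_spec (k, j) vS) as [EE|]; auto. inversion EE; lia. }
   assert (F4 : forall k j, (31 <= k <= 36)%nat -> env s4 (k, j) = env s (k, j)).
   { intros k j Hk. rewrite E4, K3', K2, K1 by lia. auto. }
   assert (EY : env s4 vY = env s2 vY) by (rewrite E4, K3' by lia; auto).
   assert (Htl : env s2 vY < 2 ^ W /\ toklen (env s2 vY) <= 2 * lim + 2).
   { split; [rewrite C2; apply N.mod_lt; pose proof (pow2_pos W); lia|].
    destruct (N.eq_dec (env s2 vY) 0) as [->|]; [unfold toklen; simpl; lia|].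
    pose proof (toklen_lim _ _ C3 n). lia. }
   eapply wp_mono; [apply OUTPUT_spec|].
   * unfold s4. vs. rewrite K3' by lia. auto.
   * exact Lg3.
   * rewrite !F4 by lia. auto.
   * rewrite !F4, EY by lia. lia.
   * rewrite EY. apply Htl.
   * intros n5 s5 Fr5 [O1 O2]. left.
    assert (K5 : forall k j, ~ (10 <= k <= 36)%nat \/ k = 30%nat -> env s5 (k, j) = env s4 (k, j)).
    { intros k j Hk. apply (fv Fr5). unfold OUTPUT, LOG. keep. }
    assert (Km : forall j, (j < t)%nat -> env s5 (vr j) = env s1 (vnr j) /\ env s5 (vV j) = env s1 (vnV j) /\ env s5 (vm j) = env s1 (vnm j)).
    { intros j Hj. rewrite !K5, !E4 by lia. destruct (K3 j Hj) as (-> & -> & ->). rewrite !K2 by lia. auto. }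
    split; [rewrite K5, E4, K3' by lia; auto|]. split.
    -- exists (fun i => env s1 (vu i)). split.
      { intros i Hi. cbn [wc_of wr wV wm]. destruct (Km i Hi) as (-> & -> & ->). apply B; auto. }
      split; [cbn [wc_of wS]; rewrite K5 by lia; unfold s4; vs; rewrite K3' by lia; auto|].
      split; [rewrite <- C2; auto|].
      cbn [wc_of wF wz0 wo wol wz]. rewrite O1, !F4, EY, C2 by lia. reflexivity.
    -- rewrite (nsum_ext t (fun i => env s5 (vm i)) (fun i => env s1 (vnm i))) by (intros j Hj; apply Km; auto).
      rewrite F4 in O2 by lia. lia.
  + destruct Cs as [(A & _)|(A & B & C)]; [lia|]. apply wp_skip. right. split; auto. split; auto. split; [|lia].
   constructor; intros; cbn; rewrite K2, K1 by lia; auto.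
Qed.
End Step.

(** * The table of phases *)

Notation vX := (3%nat, 0%nat).
Notation vbe := (4%nat, 0%nat).
Notation vcont := (40%nat, 0%nat).
Notation vall := (41%nat, 0%nat).
Notation vkey := (42%nat, 0%nat).
Notation vkk := (43%nat, 0%nat).
Notation vks := (44%nat, 0%nat).
Notation vkn := (45%nat, 0%nat).
Notation vq := (46%nat, 0%nat).

Definition CHECK (t : nat) : stmt :=
 vcont <- $vav ;;
 SIf ($vol <! $vb) SSkip (vcont <- E0) ;;
 SIf ($vz <! $vX) SSkip
  (vall <- E1 ;; fors t (fun i => SIf ($(vr i) <! $vX) (vall <- E0) SSkip) ;;
   SIf ($vall) (vcont <- E0) SSkip).

Definition SIM (t : nat) : stmt :=
 vF <- E0 ;; vz0 <- E0 ;; vo <- E0 ;; vol <- E0 ;; vz <- E0 ;;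
 vcont <- E1 ;;
 SWhile ($vcont) (STEP t ;; CHECK t).

Lemma STEP_keep t v : (fst v < 10)%nat \/ (39 < fst v < 50)%nat \/ (56 < fst v)%nat \/ fst v = 31%nat -> modv (STEP t) v = false.
Proof.
 destruct v as [k j]. cbn [fst]. intros Hk. unfold STEP. cbn [modv].
 rewrite modv_fors; [|intros i _; unfold FETCH, DEC; keep].
 rewrite modv_fors; [|intros i _; unfold COMMIT; keep].
 unfold OUTPUT, LOG. keep.
Qed.

Lemma STEP_moda t A : moda (STEP t) A = false.
Proof. unfold STEP. cbn [moda]. rewrite !moda_fors; reflexivity. Qed.

Lemma CHECK_keep t v : v <> vcont -> v <> vall -> modv (CHECK t) v = false.
Proof.
 destruct v as [k j]. intros. unfold CHECK. cbn [modv]. rewrite modv_fors by (intros; keep). keep.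
Qed.

Lemma toklen_le_pow z k : z < 2 ^ k -> toklen z <= 2 * k + 2.
Proof.
 intros H. unfold toklen. destruct (N.eq_dec z 0) as [->|]; [simpl; lia|].
 apply N.log2_lt_pow2 in H; lia.
Qed.

Lemma runlen_le_pow z k : z < 2 ^ k -> runlen z <= 2 * k + 2.
Proof.
 intros H. unfold runlen. destruct (N.eqb_spec z 0); [lia|]. apply toklen_le_pow; auto.
Qed.

(** A phase has at most [(t + 1) * (2 * b + 1) * 2 ^ b] steps by its initial fuel. With
    [2 * b + 1 <= 3 * 2 ^ b] and [16 * (t + 1) <= 2 ^ (t + 4)] this is below [2 ^ run_bits t b]. *)
Definition run_bits (t : nat) (b : N) : N := (N.of_nat t + 6) * b.
Definition fld_bits (t : nat) (b : N) : N := run_bits t b + b.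
Definition key_bits (t : nat) (b : N) : N := N.of_nat t * fld_bits t b.

Section Sim.
Context (w W : N) (delta : N -> list N -> N * N) (t : nat) (b : N).
Hypothesis HWbig : 64 * W <= 2 ^ W.
Hypothesis Hb : 1 <= b.
Notation beta := (run_bits t b).
Notation fb := (fld_bits t b).
Notation tot := (key_bits t b).
Hypothesis HWb : 4 * b + 2 * beta + tot + 16 <= W.
Notation wp := (wp w W delta).

Lemma b_lt_pow : b < 2 ^ b.
Proof. apply N.pow_gt_lin_r. lia. Qed.

Lemma fuel_init c : (forall i, (i < t)%nat -> wm c i = b) -> fuel t (2 ^ b) b c + 2 <= 2 ^ beta.
Proof.
 intros Hm. unfold fuel.
 assert (H : nsum t (fun i => 2 * 2 ^ b * wm c i + N.min (wr c i) (2 ^ b)) <= N.of_nat t * (2 * 2 ^ b * b + 2 ^ b)).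
 { rewrite <- nsum_const. apply nsum_le. intros i Hi. rewrite Hm by auto. lia. }
 assert (Hbe : 2 ^ beta = 2 ^ b * 2 ^ b * 2 ^ ((N.of_nat t + 4) * b)).
 { unfold run_bits. rewrite <- !N.pow_add_r. f_equal. lia. }
 assert (H4 : 2 ^ (N.of_nat t + 4) <= 2 ^ ((N.of_nat t + 4) * b)) by (apply N.pow_le_mono_r; nia).
 assert (H5 : 16 * (N.of_nat t + 1) <= 2 ^ (N.of_nat t + 4)).
 { rewrite N.pow_add_r. pose proof (N.pow_gt_lin_r 2 (N.of_nat t) ltac:(lia)). simpl (2 ^ 4). lia. }
 pose proof b_lt_pow as Hbl. rewrite Hbe.
 set (P := 2 ^ b) in *. set (Q := 2 ^ ((N.of_nat t + 4) * b)) in *. set (n := N.of_nat t) in *. clearbody P Q n.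
 set (S := nsum t _) in *. clearbody S.
 assert (E1 : S + 2 * P * (b - wol c) + (P - wz c) <= n * (2 * P * b + P) + 2 * P * b + P) by nia.
 assert (E2 : n * (2 * P * b + P) + 2 * P * b + P = (n + 1) * (P * (2 * b + 1))) by ring.
 assert (E3 : P * (2 * b + 1) <= P * (3 * P)) by (apply N.mul_le_mono_l; lia).
 assert (E4 : (n + 1) * (P * (2 * b + 1)) <= (n + 1) * (P * (3 * P))) by (apply N.mul_le_mono_l; auto).
 assert (E5 : P * P * (16 * (n + 1)) <= P * P * Q) by (apply N.mul_le_mono_l; lia).
 assert (E6 : 1 <= P * P) by nia. nia.
Qed.

Lemma CHECK_spec s : env s vb = b -> env s vX = 2 ^ b ->
 wp (CHECK t) (fun n s' => n = 0%nat /\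
  (env s' vcont <> 0 -> env s vav <> 0 /\ ~ paused t (2 ^ b) b (wc_of s)) /\
  (env s' vcont = 0 -> env s vav = 0 \/ paused t (2 ^ b) b (wc_of s))) s.
Proof.
 intros H1 H2. unfold CHECK. apply wp_set_seq, wp_seq.
 eapply wp_mono with (Q := fun n s1 => n = 0%nat /\
   ((env s1 vcont = env s vav /\ env s vol < b) \/ (env s1 vcont = 0 /\ b <= env s vol))).
 { apply wp_if; vs; rewrite H1; destruct (N.ltb_spec (env s vol) b); try lia; intros _.
  - apply wp_skip. vs. auto.
  - apply wp_set. vs. auto. }
 intros n s1 Fr (-> & Hc). assert (Fr' : forall v, v <> vcont -> env s1 v = env s v).
 { intros v Hv. rewrite (fv Fr); [vs; cbn [upd env]; destruct (peqb_spec v vcont); congruence|].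
  cbn [modv orb]. destruct (peqb_spec v vcont); congruence. }
 assert (Hpa : paused t (2 ^ b) b (wc_of s) <-> (b <= env s vol \/ (2 ^ b <= env s vz /\ forall i, (i < t)%nat -> 2 ^ b <= env s (vr i)))) by reflexivity.
 apply wp_if; vs; rewrite !Fr' by discriminate; rewrite H2; destruct (N.ltb_spec (env s vz) (2 ^ b)); try lia; intros _.
 - apply wp_skip. sp. rewrite Hpa. destruct Hc as [[-> ?]|[-> ?]]; split; intros; try lia;
  (split; [auto|]; intros [?|[? _]]; lia).
 - apply wp_set_seq, wp_seq. eapply wp_mono.
  { apply wp_fors with (I := fun i a s' => a = 0%nat /\ (forall v, v <> vall -> env s' v = env s1 v) /\
    (env s' vall <> 0 <-> forall j, (j < i)%nat -> 2 ^ b <= env s (vr j))).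
   - intros i a s2 Hi (-> & K & Hall). apply wp_if; vs; rewrite !K, !Fr', H2 by discriminate;
     destruct (N.ltb_spec (env s (vr i)) (2 ^ b)); try lia; intros _.
    + apply wp_set. sp. split.
     { intros v Hv. cbn [upd env]. destruct (peqb_spec v vall); [congruence|auto]. }
     vs. split; [lia|]. intros HH. specialize (HH i ltac:(lia)). lia.
    + apply wp_skip. sp. split; auto. rewrite Hall. split; intros HH j Hj.
     * destruct (Nat.eq_dec j i) as [->|]; auto. apply HH. lia.
     * apply HH. lia.
   - sp. split.
    { intros v Hv. cbn [upd env]. destruct (peqb_spec v vall); [congruence|auto]. }
    vs. split; intros; [lia|discriminate]. }
  intros n s2 Fr2 (-> & K & Hall).
  apply wp_if; vs; intros Hv.
  + apply wp_set. sp. vs. split; [lia|]. intros _. right. apply Hpa. right. split; auto. apply Hall; auto.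
  + apply wp_skip. sp. rewrite K by discriminate.
   assert (Hna : ~ forall j, (j < t)%nat -> 2 ^ b <= env s (vr j)) by (intros HH; apply Hall in HH; auto).
   rewrite Hpa. destruct Hc as [[-> ?]|[-> ?]]; split; intros; try lia.
   sp. intros [?|[_ ?]]; [lia|auto].
Qed.

(** The output has fewer than [b] bits before its last extension, which adds a run token of at most
    [2 * beta + 2] bits and a literal of at most [2 * b] bits; hence the bound on [wol c]. *)
Definition sim_ok (c0 c : wc) (n : nat) : Prop := exists j,
 WSteps t delta W b j c0 c /\ N.of_nat j + fuel t (2 ^ b) b c <= fuel t (2 ^ b) b c0 /\
 (Stuck t delta W b c \/ paused t (2 ^ b) b c) /\ wol c <= 3 * b + 2 * beta + 4 /\
 wz c <= N.of_nat j /\ wz0 c <= N.of_nat j /\ (forall i, (i < t)%nat -> wm c i <= b /\ wr c i < 2 ^ W) /\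
 N.of_nat n <= (N.of_nat j + 1) * (3 * N.of_nat t + 20).

Definition zero_out (c : wc) : wc :=
 {| wS := wS c; wr := wr c; wV := wV c; wm := wm c; wF := 0; wz0 := 0; wo := 0; wol := 0; wz := 0 |}.

Lemma wceq_refl c : wceq t c c.
Proof. constructor; auto. Qed.

Lemma paused_ext X B c d : wceq t c d -> paused t X B c -> paused t X B d.
Proof.
 intros H [HP|[HP1 HP2]]; [left|right]; rewrite <- ?(weol _ _ _ H), <- ?(wez _ _ _ H); auto.
 split; auto. intros i Hi. rewrite <- (wer _ _ _ H) by auto. auto.
Qed.

Lemma SIM_spec s : env s vb = b -> lg2ok b s -> env s vlim = b -> env s vX = 2 ^ b ->
 (forall i, (i < t)%nat -> env s (vV i) < 2 ^ b /\ env s (vm i) = b /\ env s (vr i) < 2 ^ beta) ->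
 wp (SIM t) (fun n s' => exists c, wceq t (wc_of s') c /\ sim_ok (zero_out (wc_of s)) c n) s.
Proof.
 intros H1 H2 H3 H4 H5. unfold SIM. do 6 apply wp_set_seq. vs.
 set (c0 := zero_out (wc_of s)).
 assert (Hf0 : fuel t (2 ^ b) b c0 + 2 <= 2 ^ beta) by (apply fuel_init; intros; apply H5; auto).
 pose proof b_lt_pow as Hbl.
 assert (HbeW : 2 ^ beta * 4 <= 2 ^ W).
 { change 4 with (2 ^ 2). rewrite <- N.pow_add_r. apply N.pow_le_mono_r; lia. }
 set (CS := 3 * N.of_nat t + 20).
 (* A failed step leaves the fuel unchanged but clears [vcont]; the additional unit makes the
    variant fall in this case too. *)
 apply wp_while with (m := fun s' => (N.to_nat (env s' vcont) * 0 + N.to_nat (fuel t (2 ^ b) b (wc_of s')) + (if N.eqb (env s' vcont) 0 then 0 else 1))%nat)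
  (I := fun a s' => env s' vb = b /\ lg2ok b s' /\ env s' vlim = b /\ env s' vX = 2 ^ b /\ env s' vo < 2 ^ env s' vol /\
   (forall i, (i < t)%nat -> env s' (vV i) < 2 ^ env s' (vm i) /\ env s' (vm i) <= b /\ env s' (vr i) < 2 ^ W) /\
   exists j c, wceq t (wc_of s') c /\ WSteps t delta W b j c0 c /\
    N.of_nat j + fuel t (2 ^ b) b c <= fuel t (2 ^ b) b c0 /\
    env s' vol <= 3 * b + 2 * beta + 4 /\ env s' vz <= N.of_nat j /\ env s' vz0 <= N.of_nat j /\
    N.of_nat a <= (N.of_nat j + (if env s' vcont =? 0 then 1 else 0)) * CS /\
    (if env s' vcont =? 0 then Stuck t delta W b c \/ paused t (2 ^ b) b c else ~ paused t (2 ^ b) b c)).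
 - intros a s1 (V1 & V2 & V3 & V4 & V5 & V6 & j & c & E1 & E2 & E3 & E4 & E5 & E6 & E7 & E8) Hc. vredh Hc.
  assert (Hc' : (env s1 vcont =? 0) = false) by (apply N.eqb_neq; auto). rewrite Hc' in *.
  assert (Hnp : ~ paused t (2 ^ b) b (wc_of s1)) by (intros HP; apply E8; eapply paused_ext; eauto).
  assert (Hol : env s1 vol < b).
  { destruct (N.lt_ge_cases (env s1 vol) b); auto. exfalso. apply Hnp. left. auto. }
  assert (Hz : env s1 vz < 2 ^ beta) by lia. pose proof (runlen_le_pow _ _ Hz) as Hrz.
  apply wp_seq. eapply wp_mono.
  { apply (STEP_spec w W delta t b HWbig ltac:(lia) b s1). sp. sp. sp. split; [|split; [auto|lia]].
   intros i Hi. destruct (V6 i Hi) as (? & ? & ?). split; auto. lia. }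
  intros n1 s2 Fr1 HP.
  assert (K : forall v, (fst v < 10)%nat \/ (39 < fst v < 50)%nat \/ (56 < fst v)%nat \/ fst v = 31%nat -> env s2 v = env s1 v).
  { intros v Hv. apply (fv Fr1), STEP_keep; auto. }
  assert (Lg2 : lg2ok b s2) by (eapply lg2ok_frame; eauto; apply STEP_moda).
  eapply wp_mono.
  { apply (CHECK_spec s2); rewrite K; cbn [fst]; auto; lia. }
  intros n2 s3 Fr2 (-> & C1 & C2).
  assert (K2 : forall v, v <> vcont -> v <> vall -> env s3 v = env s2 v).
  { intros v Hv Hv'. apply (fv Fr2), CHECK_keep; auto. }
  assert (Ewc : wceq t (wc_of s3) (wc_of s2)).
  { constructor; intros; cbn; rewrite K2 by discriminate; auto. }
  assert (Ef : fuel t (2 ^ b) b (wc_of s3) = fuel t (2 ^ b) b (wc_of s2)).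
  { unfold fuel. f_equal; [f_equal|]; [|cbn; rewrite K2 by discriminate; auto..]. apply nsum_ext. intros i Hi. cbn. rewrite !K2 by discriminate. auto. }
  assert (Lg3 : lg2ok b s3).
  { eapply lg2ok_frame; eauto. unfold CHECK. cbn [moda]. rewrite moda_fors; reflexivity. }
  assert (Bs : env s3 vb = b /\ lg2ok b s3 /\ env s3 vlim = b /\ env s3 vX = 2 ^ b).
  { rewrite !K2 by discriminate. rewrite !K by (cbn [fst]; auto; lia). auto. }
  destruct Bs as (B1 & B2 & B3 & B4).
  assert (HCS : 0 < CS) by (unfold CS; lia).
  assert (Hms : nsum t (fun i => env s1 (vm i)) <= N.of_nat t * b).
  { rewrite <- nsum_const. apply nsum_le. intros; apply V6; auto. }
  destruct HP as [(A1 & A2 & A3)|(A1 & A2 & A3 & A4)].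
  + assert (HV1 : forall i, (i < t)%nat -> wV (wc_of s1) i < 2 ^ wm (wc_of s1) i) by (intros; apply V6; auto).
   assert (Hfs := fuel_step t delta W b (2 ^ b) b (wc_of s1) (wc_of s2) ltac:(apply pow2_pos) HV1 Hnp A2).
   assert (Hfc : fuel t (2 ^ b) b (wc_of s1) = fuel t (2 ^ b) b c).
   { unfold fuel. rewrite (weol _ _ _ E1), (wez _ _ _ E1). f_equal. f_equal. apply nsum_ext. intros i Hi.
    rewrite (wem _ _ _ E1), (wer _ _ _ E1) by auto. auto. }
   pose proof A2 as (u & S1 & S2 & S3 & S4).
   assert (Hout : env s2 vo < 2 ^ env s2 vol /\ env s2 vol <= 3 * b + 2 * beta + 4 /\ env s2 vz <= N.of_nat j + 1 /\ env s2 vz0 <= N.of_nat j + 1).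
   { cbn [wc_of wF wz0 wo wol wz] in S4. unfold out_step in S4.
    destruct (N.eqb_spec (dout t delta W (wc_of s1) u) 0) as [|Y0]; [injection S4 as EF Ez0 Eo Eol Ez; rewrite Ez0, Eo, Eol, Ez; repeat split; auto; lia|].
    pose proof (toklen_lim _ _ S3 Y0) as Htl. assert (Y0' : 0 < dout t delta W (wc_of s1) u) by lia. pose proof (tokval_lt 1 _ Y0' ltac:(lia)) as Htv.
    destruct (N.eqb_spec (env s1 vF) 0) as [|F0]; injection S4 as EF Ez0 Eo Eol Ez; rewrite Ez0, Eo, Eol, Ez.
    - split; [apply append_lt; auto|]. lia.
    - split; [rewrite <- ?N.add_assoc; rewrite N.add_assoc; apply append_lt; auto; apply append_lt; auto; apply runlen_lt|]. lia. }
   destruct Hout as (O1 & O2 & O3 & O4).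
   assert (HV2 : forall i, (i < t)%nat -> env s2 (vV i) < 2 ^ env s2 (vm i) /\ env s2 (vm i) <= b /\ env s2 (vr i) < 2 ^ W).
   { intros i Hi. destruct (V6 i Hi) as (G1 & G2 & G3). specialize (S1 i Hi).
    pose proof (next1_m _ _ _ _ _ _ _ (HV1 i Hi) S1) as Hn. cbn [wc_of wr wV wm] in *. unfold next1 in S1.
    destruct (N.eqb_spec (env s1 (vr i)) 0) as [Z|Z].
    - destruct Hn as [(_ & N1 & N2)|(? & _)]; [|lia]. split; auto. split; [lia|].
     destruct (decode _ _) as [[[[f X] V2'] m2]|] eqn:Ed; [|discriminate].
     apply decode_inv in Ed as (D1 & D2 & D3 & D4 & D5); auto.
     assert (X < 2 ^ W).
     { eapply N.lt_le_trans; [apply (lt_pow_toklen X D2)|]. apply N.pow_le_mono_r; lia. }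
     destruct (f =? 0); injection S1 as _ <- _ _; [lia|apply pow2_pos].
    - destruct Hn as [(? & _)|(_ & N1 & N2 & N3)]; [lia|]. rewrite N1, N2, N3. repeat split; auto. lia. }
   (* A step draws [b] per iteration from at most [t * b] window bits and [3 * b + 2 * beta + 4]
      output bits, where [beta = (t + 6) * b]. This sums up to at most [(3 * t + 19) * b]. *)
   assert (Hcost : N.of_nat n1 <= CS - 1).
   { assert (N.of_nat n1 * b <= (CS - 1) * b) by (unfold CS, run_bits in *; nia). apply (N.mul_le_mono_pos_r _ _ b); [lia|auto]. }
   split; [|rewrite Ef; destruct (env s3 vcont =? 0); lia].
   sp. sp. sp. sp.
   rewrite !K2 by discriminate. sp. split.
   { intros i Hi. rewrite !K2 by discriminate. auto. }
   exists (S j), (wc_of s2). sp. split; [econstructor; eauto; eapply WStep_ext; eauto|].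
   split; [lia|]. sp. split; [lia|]. split; [lia|].
   destruct (N.eqb_spec (env s3 vcont) 0) as [Z|Z].
   * split; [nia|]. destruct (C2 Z); [lia|]. auto.
   * split; [nia|]. apply C1; auto.
  +   assert (Z : env s3 vcont = 0).
   { destruct (N.eq_dec (env s3 vcont) 0); auto. destruct (C1 n) as [Z _]. congruence. }
   rewrite Z, Ef. simpl N.eqb. cbn iota.
   assert (Efs : fuel t (2 ^ b) b (wc_of s2) = fuel t (2 ^ b) b (wc_of s1)).
   { unfold fuel. rewrite (weol _ _ _ A3), (wez _ _ _ A3). f_equal. f_equal. apply nsum_ext. intros i Hi.
    rewrite (wem _ _ _ A3), (wer _ _ _ A3) by auto. auto. }
   split; [|rewrite Efs; lia].
   assert (Hcost : N.of_nat n1 <= CS - 1).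
   { assert (N.of_nat n1 * b <= (CS - 1) * b) by (unfold CS in *; nia). apply (N.mul_le_mono_pos_r _ _ b); [lia|auto]. }
   assert (W3 : wceq t (wc_of s3) (wc_of s1)) by (eapply wceq_trans; eauto).
   sp. sp. sp. sp.
   assert (Eo : env s3 vo = env s1 vo) by apply W3. assert (Eol : env s3 vol = env s1 vol) by apply W3.
   assert (Ez : env s3 vz = env s1 vz) by apply W3. assert (Ez0 : env s3 vz0 = env s1 vz0) by apply W3.
   rewrite Eo, Eol, Ez, Ez0. sp. split.
   { intros i Hi. pose proof (wer _ _ _ W3 i Hi) as Y1. pose proof (weV _ _ _ W3 i Hi) as Y2. pose proof (wem _ _ _ W3 i Hi) as Y3.
    cbn in Y1, Y2, Y3. rewrite Y1, Y2, Y3. auto. }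
   exists j, c. split; [eapply wceq_trans; eauto|]. sp. sp. sp. sp. sp.
   split; [nia|]. left. eapply Stuck_ext; eauto.
 - intros a s1 (V1 & V2 & V3 & V4 & V5 & V6 & j & c & E1 & E2 & E3 & E4 & E5 & E6 & E7 & E8) Hc. vredh Hc.
  rewrite Hc in *. simpl N.eqb in *. cbn iota in *.
  exists c. split; auto. exists j. split; auto. split; auto. split; auto.
  rewrite <- (weol _ _ _ E1), <- (wez _ _ _ E1), <- (wez0 _ _ _ E1). cbn [wc_of wol wz wz0].
  sp. sp. sp. split; [|lia].
  intros i Hi. rewrite <- (wem _ _ _ E1), <- (wer _ _ _ E1) by auto. cbn. destruct (V6 i Hi) as (? & ? & ?). auto.
 - vs. repeat split; auto; try (intros; apply H5; auto).
  + intros. destruct (H5 i H) as (? & -> & _). auto.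
  + destruct (H5 i H) as (_ & -> & _). lia.
  + destruct (H5 i H) as (_ & _ & ?). lia.
  + exists 0%nat, c0. split.
   { constructor; intros; reflexivity. }
   split; [constructor|]. split; [lia|]. split; [lia|]. split; [lia|]. split; [lia|]. simpl N.eqb. cbn iota. split; [lia|].
   intros [HP|[HP _]]; cbn in HP; [lia|]. pose proof (pow2_pos b). lia.
Qed.
End Sim.

(** * Tabulation of the phases for all states and keys *)

Notation aTS := (20%nat, 0%nat).
Notation aTF := (21%nat, 0%nat).
Notation aTz0 := (22%nat, 0%nat).
Notation aTo := (23%nat, 0%nat).
Notation aTol := (24%nat, 0%nat).
Notation aTz := (25%nat, 0%nat).
Notation aTr i := (26%nat, i).
Notation aTm i := (27%nat, i).

Definition EXTRACT (t : nat) : stmt :=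
 vkk <- $vkey ;;
 fors t (fun i =>
  vV i <- ($vkk -! (($vkk >>! $vb) <<! $vb)) ;; vkk <- ($vkk >>! $vb) ;;
  vr i <- ($vkk -! (($vkk >>! $vbe) <<! $vbe)) ;; vkk <- ($vkk >>! $vbe) ;; vm i <- $vb).

Definition STORE (t : nat) : stmt :=
 SSt aTS ($vks) ($vkey) ($vS) ;; SSt aTF ($vks) ($vkey) ($vF) ;; SSt aTz0 ($vks) ($vkey) ($vz0) ;;
 SSt aTo ($vks) ($vkey) ($vo) ;; SSt aTol ($vks) ($vkey) ($vol) ;; SSt aTz ($vks) ($vkey) ($vz) ;;
 fors t (fun i => SSt (aTr i) ($vks) ($vkey) ($(vr i)) ;; SSt (aTm i) ($vks) ($vkey) ($(vm i))).

Definition BUILD (t : nat) : stmt :=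
 vks <- E0 ;;
 SWhile ($vks <! $vq)
  (vkey <- E0 ;;
   SWhile ($vkey <! $vkn)
    (vS <- $vks ;; EXTRACT t ;; SIM t ;; STORE t ;; vkey <- ($vkey +! E1)) ;;
   vks <- ($vks +! E1)).

Lemma SIM_keep t v : (fst v < 10)%nat \/ (41 < fst v < 50)%nat \/ (56 < fst v)%nat \/ fst v = 31%nat -> modv (SIM t) v = false.
Proof.
 intros Hv. unfold SIM. cbn [modv]. rewrite STEP_keep by lia. rewrite CHECK_keep by (intros ->; cbn [fst] in Hv; lia).
 destruct v as [k j]. cbn [fst] in Hv. keep.
Qed.

Lemma SIM_moda t A : moda (SIM t) A = false.
Proof. unfold SIM. cbn [moda]. rewrite STEP_moda. unfold CHECK. cbn [moda]. rewrite moda_fors; reflexivity. Qed.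

Lemma sub_mod x k W : x < 2 ^ W -> x - ((x / 2 ^ k) * 2 ^ k) mod 2 ^ W = x mod 2 ^ k.
Proof.
 intros H. pose proof (N.div_mod' x (2 ^ k)).
 assert (x / 2 ^ k * 2 ^ k <= x) by (rewrite N.mul_comm; apply N.Div0.mul_div_le).
 rewrite N.mod_small by lia. rewrite (N.mul_comm (x / 2 ^ k)) in *. set (a := 2 ^ k * (x / 2 ^ k)) in *. set (r := x mod 2 ^ k) in *.
 clearbody a r. lia.
Qed.

Section Build.
Context (w W : N) (delta : N -> list N -> N * N) (t : nat) (b : N).
Hypothesis HWbig : 64 * W <= 2 ^ W.
Hypothesis Hb : 1 <= b.
Hypothesis HWb : 4 * b + 2 * run_bits t b + key_bits t b + 16 <= W.
Notation wp := (wp w W delta).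
Notation beta := (run_bits t b).
Notation fb := (fld_bits t b).
Notation tot := (key_bits t b).

(** Layout of a key: stream [i] owns [fb] consecutive bits, the window in the lowest [b] of them and
    the truncated run above. *)
Definition fldV (i : nat) (k : N) : N := (k / 2 ^ (N.of_nat i * fb)) mod 2 ^ b.
Definition fldr (i : nat) (k : N) : N := (k / 2 ^ (N.of_nat i * fb + b)) mod 2 ^ beta.

Definition init_c (s k : N) : wc :=
 {| wS := s; wr := fun i => fldr i k; wV := fun i => fldV i k; wm := fun _ => b;
   wF := 0; wz0 := 0; wo := 0; wol := 0; wz := 0 |}.

Lemma WSteps_ext lim j c0 c d0 : wceq t c0 d0 -> WSteps t delta W lim j c0 c ->
 exists d, wceq t c d /\ WSteps t delta W lim j d0 d.
Proof.
 intros H HS. induction HS as [c0|j c0 c1 c2 HS IH Hst].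
 - exists d0. split; auto. constructor.
 - destruct (IH H) as (d1 & E & HS1). exists c2. split; [apply wceq_refl|].
  econstructor; eauto. eapply WStep_ext; eauto.
Qed.

Lemma fuel_ext X B c d : wceq t c d -> fuel t X B c = fuel t X B d.
Proof.
 intros E. unfold fuel. rewrite (weol _ _ _ E), (wez _ _ _ E). f_equal. f_equal. apply nsum_ext. intros i Hi.
 rewrite (wem _ _ _ E), (wer _ _ _ E) by auto. auto.
Qed.

Lemma sim_ok_ext c0 c n d0 : wceq t c0 d0 -> sim_ok W delta t b c0 c n ->
 exists d, wceq t c d /\ sim_ok W delta t b d0 d n.
Proof.
 intros H (j & S1 & S2 & S3 & S4 & S5 & S6 & S7 & S8).
 destruct (WSteps_ext _ _ _ _ _ H S1) as (d & E & S1'). exists d. split; auto. exists j.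
 rewrite <- (weol _ _ _ E), <- (wez _ _ _ E), <- (wez0 _ _ _ E), <- (fuel_ext _ _ _ _ E), <- (fuel_ext _ _ _ _ H).
 repeat split; auto.
 - destruct S3; [left; eapply Stuck_ext; eauto|right; eapply paused_ext; eauto].
 - rewrite <- (wem _ _ _ E) by auto. apply S7; auto.
 - rewrite <- (wer _ _ _ E) by auto. apply S7; auto.
Qed.

Definition entry (st : vst) (s k : N) : Prop := exists c n, sim_ok W delta t b (init_c s k) c n /\
 dm st aTS s k = wS c /\ dm st aTF s k = wF c /\ dm st aTz0 s k = wz0 c /\ dm st aTo s k = wo c /\
 dm st aTol s k = wol c /\ dm st aTz s k = wz c /\
 forall i, (i < t)%nat -> dm st (aTr i) s k = wr c i /\ dm st (aTm i) s k = wm c i.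

Lemma EXTRACT_spec s : env s vb = b -> env s vbe = beta -> env s vkey < 2 ^ W ->
 wp (EXTRACT t) (fun n s' => n = 0%nat /\ forall i, (i < t)%nat ->
  env s' (vV i) = fldV i (env s vkey) /\ env s' (vr i) = fldr i (env s vkey) /\ env s' (vm i) = b) s.
Proof.
 intros H1 H2 H3. set (k := env s vkey) in *. unfold EXTRACT. apply wp_set_seq.
 eapply wp_mono.
 { apply wp_fors with (I := fun i a s' => a = 0%nat /\ env s' vb = b /\ env s' vbe = beta /\
   env s' vkk = k / 2 ^ (N.of_nat i * fb) /\ forall j, (j < i)%nat ->
   env s' (vV j) = fldV j k /\ env s' (vr j) = fldr j k /\ env s' (vm j) = b).
  - intros i a s' Hi (-> & E1 & E2 & E3 & E4).
   do 4 apply wp_set_seq. apply wp_set. vs. rewrite E1, E2, E3. sp.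
   assert (Hd : forall x y, x < 2 ^ W -> x / 2 ^ y < 2 ^ W).
   { intros x y Hx. eapply N.le_lt_trans; [|exact Hx]. apply N.Div0.div_le_upper_bound. pose proof (pow2_pos y). nia. }
   rewrite !sub_mod by auto. rewrite !N.Div0.div_div, <- !N.pow_add_r.
   sp. sp. split.
   { f_equal. f_equal. unfold fld_bits. lia. }
   intros j Hj. destruct (Nat.eqb_spec j i) as [->|]; [|apply E4; lia]. auto.
  - vs. repeat split; auto; try lia. rewrite N.mul_0_l, N.pow_0_r, N.div_1_r. auto. }
 intros n s' _ (-> & _ & _ & _ & H). auto.
Qed.

Lemma STORE_spec s c n : env s vks < 2 ^ W -> wceq t (wc_of s) c ->
 sim_ok W delta t b (init_c (env s vks) (env s vkey)) c n ->
 wp (STORE t) (fun m s' => m = 0%nat /\ entry s' (env s vks) (env s vkey) /\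
   forall a k, (a <> env s vks \/ k <> env s vkey) -> entry s a k -> entry s' a k) s.
Proof.
 intros Hk Hc Hs. unfold STORE. do 6 apply wp_st_seq. vs.
 eapply wp_mono.
 { set (s0 := updm _ aTz _ _ _).
  apply wp_fors with (I := fun i m s' => m = 0%nat /\ env s' = env s /\
   (forall A a k, ~ (26 <= fst A <= 27)%nat -> dm s' A a k = dm s0 A a k) /\
   (forall A a k, a <> env s vks \/ k <> env s vkey -> dm s' A a k = dm s A a k) /\
   (forall j, (j < i)%nat -> dm s' (aTr j) (env s vks) (env s vkey) = env s (vr j) /\ dm s' (aTm j) (env s vks) (env s vkey) = env s (vm j))).
  - intros i m s' Hi (-> & E1 & E2 & E3 & E4). apply wp_st_seq, wp_st. vs. rewrite E1.
   sp. sp. split; [|split].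
   + intros [A1 A2] a k HA. cbn [fst] in HA. cbn [updm dm].
    all_distinct_vars.
    cbn [andb]. apply E2. auto.
   + intros A a k Hak.
    assert (Ef : ((a =? env s vks) && (k =? env s vkey))%bool = false).
    { destruct (N.eqb_spec a (env s vks)), (N.eqb_spec k (env s vkey)); auto. subst. tauto. }
    rewrite <- !Bool.andb_assoc, Ef, !Bool.andb_false_r. apply E3; auto.
   + intros j Hj. rewrite !N.eqb_refl. cbn [andb]. rewrite !Bool.andb_true_r.
    destruct (Nat.eqb_spec j i) as [->|]; auto. apply E4; lia.
  - unfold s0. vs. sp. sp. sp. split; [|lia].
   intros A a k Hak.
   assert (Ef : ((a =? env s vks) && (k =? env s vkey))%bool = false).
   { destruct (N.eqb_spec a (env s vks)), (N.eqb_spec k (env s vkey)); auto. subst. tauto. }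
   rewrite <- !Bool.andb_assoc, Ef, !Bool.andb_false_r. auto. }
 intros m s' _ (-> & E1 & E2 & E3 & E4). sp. split.
 - exists c, n. sp.
  rewrite !E2 by (cbn [fst]; lia). vs. rewrite !N.eqb_refl. cbn [andb].
  repeat split; try apply Hc.
  + destruct (E4 i H) as [-> _]. apply (wer _ _ _ Hc i H).
  + destruct (E4 i H) as [_ ->]. apply (wem _ _ _ Hc i H).
 - intros a k Hak (c' & n' & F1 & F2 & F3 & F4 & F5 & F6 & F7 & F8). exists c', n'. split; auto.
  rewrite !E3 by auto. repeat split; auto; intros; rewrite E3 by auto; apply F8; auto.
Qed.

Lemma entry_ext s s' a k : (forall A, (20 <= fst A <= 27)%nat -> dm s' A a k = dm s A a k) -> entry s a k -> entry s' a k.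
Proof.
 intros E (c' & n' & F1 & F2 & F3 & F4 & F5 & F6 & F7 & F8). exists c', n'. split; auto.
 rewrite !E by (cbn [fst]; lia). repeat split; auto; intros; rewrite E by (cbn [fst]; lia); apply F8; auto.
Qed.

Lemma EXTRACT_keep v : v <> vkk -> ~ (50 <= fst v <= 52)%nat -> modv (EXTRACT t) v = false.
Proof.
 destruct v as [k j]. cbn [fst]. intros. unfold EXTRACT. cbn [modv]. rewrite modv_fors by (intros; keep). keep.
Qed.

Lemma EXTRACT_moda A : moda (EXTRACT t) A = false.
Proof. unfold EXTRACT. cbn [moda]. rewrite moda_fors; reflexivity. Qed.

Lemma STORE_modv v : modv (STORE t) v = false.
Proof. unfold STORE. cbn [modv]. rewrite modv_fors; reflexivity. Qed.

Lemma STORE_moda A : ~ (20 <= fst A <= 27)%nat -> moda (STORE t) A = false.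
Proof.
 destruct A as [k j]. cbn [fst]. intros. unfold STORE. cbn [moda]. rewrite moda_fors by (intros; cbn [moda]; keep). keep.
Qed.

Definition KC : N := 1 + 2 ^ beta * (3 * N.of_nat t + 20).

Lemma BUILD_spec s : env s vb = b -> env s vbe = beta -> env s vlim = b -> env s vX = 2 ^ b -> lg2ok b s ->
 env s vkn = 2 ^ tot -> env s vq + 1 < 2 ^ W ->
 wp (BUILD t) (fun n s' => (forall a k, a < env s vq -> k < 2 ^ tot -> entry s' a k) /\
   N.of_nat n <= env s vq * (1 + 2 ^ tot * KC)) s.
Proof.
 intros H1 H2 H3 H4 H5 H6 H7. unfold BUILD. apply wp_set_seq.
 set (Inv := fun s' => env s' vb = b /\ env s' vbe = beta /\ env s' vlim = b /\ env s' vX = 2 ^ b /\ lg2ok b s' /\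
   env s' vkn = 2 ^ tot /\ env s' vq = env s vq).
 assert (HtW : 2 ^ tot * 2 <= 2 ^ W).
 { rewrite <- (N.pow_1_r 2) at 2. rewrite <- N.pow_add_r. apply N.pow_le_mono_r; lia. }
 pose proof (pow2_pos tot) as Htp.
 apply wp_while with (m := fun s' => N.to_nat (env s vq - env s' vks))
  (I := fun a s' => Inv s' /\ env s' vks <= env s vq /\
   (forall x k, x < env s' vks -> k < 2 ^ tot -> entry s' x k) /\
   N.of_nat a <= env s' vks * (1 + 2 ^ tot * KC)).
 - intros a s1 ((V1 & V2 & V3 & V4 & V5 & V6 & V7) & Hle & He & Ha) Hc. vredh Hc. rewrite V7 in Hc.
  destruct (N.ltb_spec (env s1 vks) (env s vq)) as [Hlt|]; [|lia]. clear Hc.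
  set (x0 := env s1 vks) in *.
  apply wp_set_seq, wp_seq.
  apply wp_while with (m := fun s' => N.to_nat (2 ^ tot - env s' vkey))
   (I := fun a' s' => Inv s' /\ env s' vks = x0 /\ env s' vkey <= 2 ^ tot /\
    (forall x k, x < x0 -> k < 2 ^ tot -> entry s' x k) /\
    (forall k, k < env s' vkey -> entry s' x0 k) /\
    N.of_nat a' <= env s' vkey * KC).
  + intros a2 s2 ((U1 & U2 & U3 & U4 & U5 & U6 & U7) & Ux & Uk & E1 & E2 & E3) Hc. vredh Hc. rewrite U6 in Hc.
   destruct (N.ltb_spec (env s2 vkey) (2 ^ tot)) as [Hk|]; [|lia]. clear Hc.
   set (k0 := env s2 vkey) in *.
   apply wp_set_seq. vs. rewrite Ux. apply wp_seq. eapply wp_mono.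
   { apply EXTRACT_spec; vs; auto. fold k0. lia. }
   intros n3 s3 Fr3 (-> & X3). vredh X3. fold k0 in X3.
   assert (K3 : forall v, v <> vS -> v <> vkk -> ~ (50 <= fst v <= 52)%nat -> env s3 v = env s2 v).
   { intros v G1 G2 G3. rewrite (fv Fr3) by (apply EXTRACT_keep; auto). cbn [upd env].
    destruct (peqb_spec v vS); congruence. }
   assert (D3 : forall A i j, dm s3 A i j = dm s2 A i j).
   { intros. rewrite (fa Fr3) by apply EXTRACT_moda. reflexivity. }
   assert (L3 : lg2ok b s3) by (intros v Hv; rewrite D3; auto).
   assert (Hfl : forall i, (i < t)%nat -> env s3 (vV i) < 2 ^ b /\ env s3 (vm i) = b /\ env s3 (vr i) < 2 ^ beta).
   { intros i Hi. destruct (X3 i Hi) as (-> & -> & ->). unfold fldV, fldr.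
    split; [apply N.mod_lt; pose proof (pow2_pos b); lia|]. split; auto.
    apply N.mod_lt; pose proof (pow2_pos beta); lia. }
   apply wp_seq. eapply wp_mono.
   { apply (SIM_spec w W delta t b HWbig Hb HWb s3); auto; rewrite K3 by (cbn [fst]; congruence || lia); auto. }
   intros n4 s4 Fr4 (c & C1 & C2).
   assert (K4 : forall v, (fst v < 10)%nat \/ (41 < fst v < 50)%nat -> env s4 v = env s3 v).
   { intros v Hv. apply (fv Fr4), SIM_keep. lia. }
   assert (D4 : forall A i j, dm s4 A i j = dm s2 A i j).
   { intros. rewrite (fa Fr4) by apply SIM_moda. apply D3. }
   assert (Ek4 : env s4 vkey = k0) by (rewrite K4, K3; cbn [fst]; auto; congruence || lia).
   assert (Ex4 : env s4 vks = x0) by (rewrite K4, K3; cbn [fst]; auto; congruence || lia).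
   (* The fuel falls with each step of the phase and is at most [2 ^ beta - 2] initially, so a table
      entry takes fewer than [2 ^ beta] steps. *)
   assert (Hcost : N.of_nat n4 + 1 <= KC).
   { destruct C2 as (j & J1 & J2 & _ & _ & _ & _ & _ & J8).
    assert (Hf : (forall i, (i < t)%nat -> wm (zero_out (wc_of s3)) i = b) -> fuel t (2 ^ b) b (zero_out (wc_of s3)) + 2 <= 2 ^ beta) by (eapply fuel_init; eauto). cbn [zero_out wc_of wm] in Hf.
    specialize (Hf ltac:(intros; apply Hfl; auto)). unfold KC.
    assert (Hj : N.of_nat j + 1 <= 2 ^ beta) by lia.
    assert ((N.of_nat j + 1) * (3 * N.of_nat t + 20) <= 2 ^ beta * (3 * N.of_nat t + 20)) by (apply N.mul_le_mono_r; auto).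
    lia. }
   assert (Hinit : wceq t (zero_out (wc_of s3)) (init_c x0 k0)).
   { constructor; cbn [zero_out wc_of init_c wS wr wV wm wF wz0 wo wol wz]; auto; try (intros i Hi; apply X3; auto).
    rewrite (fv Fr3) by (apply EXTRACT_keep; cbn [fst]; congruence || lia). vs. auto. }
   destruct (sim_ok_ext _ _ _ _ Hinit C2) as (d & Ed & C2').
   apply wp_seq. eapply wp_mono.
   { apply (STORE_spec s4 d n4); rewrite ?Ek4, ?Ex4; auto; [lia|]. eapply wceq_trans; eauto. }
   intros n5 s5 Fr5 (-> & G1 & G2). rewrite Ek4, Ex4 in *.
   assert (K5 : forall v, (fst v < 10)%nat \/ (43 < fst v < 50)%nat \/ v = vlim -> env s5 v = env s2 v).
   { intros v Hv. rewrite (fv Fr5) by apply STORE_modv.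
    assert (v <> vS /\ v <> vkk /\ ~ (50 <= fst v <= 52)%nat) as (? & ? & ?).
    { destruct Hv as [Hv|[Hv| ->]]; cbn [fst]; repeat split; try (intros ->; cbn [fst] in Hv); try discriminate; try lia. }
    rewrite <- (K3 v) by auto. apply (fv Fr4), SIM_keep. destruct Hv as [?|[?| ->]]; cbn [fst]; lia. }
   apply wp_set. vs.
   assert (Ek5 : env s5 vkey = k0) by (rewrite (fv Fr5) by apply STORE_modv; auto).
   rewrite Ek5. rewrite N.mod_small by lia. split; [|lia].
   split; [|split; [|split; [|split; [|split]]]].
   * unfold Inv. vs. rewrite !K5 by (cbn [fst]; auto; lia).
    repeat split; auto. intros v Hv. vs. rewrite (fa Fr5) by (apply STORE_moda; cbn [fst]; lia). rewrite D4. auto.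
   * rewrite K5 by (cbn [fst]; lia). auto.
   * lia.
   * intros x k Hx Hk'. eapply entry_ext; [|apply G2; [left; lia|]]; [reflexivity|].
    eapply entry_ext; [|apply E1; eauto]. intros. apply D4.
   * intros k Hk'. eapply entry_ext with (s := s5); [reflexivity|]. destruct (N.eq_dec k k0) as [->|]; auto.
    apply G2; [right; auto|]. eapply entry_ext; [|apply E2; lia]. intros. apply D4.
   * rewrite !Nat.add_0_r. simpl Nat.add. lia.
  + intros a2 s2 ((U1 & U2 & U3 & U4 & U5 & U6 & U7) & Ux & Uk & E1 & E2 & E3) Hc. vredh Hc. rewrite U6 in Hc.
   destruct (N.ltb_spec (env s2 vkey) (2 ^ tot)) as [|Hk]; [lia|]. assert (Ek : env s2 vkey = 2 ^ tot) by lia. clear Hc.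
   rewrite Ek in *. apply wp_set. vs. rewrite Ux. rewrite N.mod_small by lia.
   split; [|lia]. split; [|split; [lia|split]].
   * unfold Inv. vs. repeat split; auto.
   * intros x k Hx Hk'. eapply entry_ext with (s := s2); [reflexivity|].
    destruct (N.eq_dec x x0) as [->|]; [auto|apply E1; auto; lia].
   * lia.
  + vs. split; [unfold Inv; vs; repeat split; auto|]. sp. split; [lia|]. split; [|split; lia].
   intros x k Hx Hk. eapply entry_ext with (s := s1); [reflexivity|]. apply He; auto.
 - intros a s1 ((V1 & V2 & V3 & V4 & V5 & V6 & V7) & Hle & He & Ha) Hc. vredh Hc. rewrite V7 in Hc.
  destruct (N.ltb_spec (env s1 vks) (env s vq)) as [|Hlt]; [lia|]. assert (Ex : env s1 vks = env s vq) by lia. clear Hc.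
  rewrite Ex in *. auto.
 - vs. split; [unfold Inv; vs; repeat split; auto|]. split; [lia|]. split; [|lia]. intros; lia.
Qed.
End Build.

(** * Jumping along zero inputs and zero outputs *)

Notation aNX := (2%nat, 0%nat).
Notation aOU := (3%nat, 0%nat).
Notation aMK := (4%nat, 0%nat).
Notation aH := (5%nat, 0%nat).
Notation aLF := (6%nat, 0%nat).
Notation aLAD := (7%nat, 0%nat).
Notation aJT := (8%nat, 0%nat).
Notation aMB := (9%nat, 0%nat).
Notation aDI := (10%nat, 0%nat).
Notation aRO := (11%nat, 0%nat).
Notation aCU := (12%nat, 0%nat).
Notation aOR := (13%nat, 0%nat).
Notation aSK := (14%nat, 0%nat).

Notation jS := (60%nat, 0%nat).
Notation jX := (61%nat, 0%nat).
Notation jE := (62%nat, 0%nat).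
Notation jRt := (63%nat, 0%nat).
Notation jD := (64%nat, 0%nat).
Notation jT := (65%nat, 0%nat).
Notation jI := (66%nat, 0%nat).
Notation jR := (67%nat, 0%nat).
Notation jSh := (68%nat, 0%nat).
Notation jY := (69%nat, 0%nat).

Notation "A [: e :]" := (ERd A e E0) (at level 8, e at level 200, format "A [: e :]").

(** Level ancestors by the ladder method. A state of height [h] is entry [h] of the ladder of its
    leaf, and this ladder has at least [2 ^ b * (h + 1)] entries. If the target is beyond that, the
    jump to entry [2 ^ b * (h + 1) - 1] multiplies height plus one by at least [2 ^ b], so about
    [log e / b] jumps suffice. *)
Definition TREE : stmt :=
 SWhile (enot (aH[:$jS:] +! $jT <! (aH[:$jS:] +! E1) <<! $vb))
  (jI <- (((aH[:$jS:] +! E1) <<! $vb) -! E1) ;;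
   jT <- (aH[:$jS:] +! $jT -! $jI) ;;
   jS <- ERd aLAD (aLF[:$jS:]) ($jI)) ;;
 jS <- ERd aLAD (aLF[:$jS:]) (aH[:$jS:] +! $jT).

(** Horner's rule in base [2 ^ b] for the position on a cycle, counted from the successor of the
    cut: [aMB] multiplies the position by [2 ^ b] and [aJT] adds the next digit. Reduction modulo
    the length of the cycle happens by itself, because only states are manipulated. *)
Definition HORNER : stmt :=
 jR <- ($jX -! $jD -! E1) ;; jSh <- E0 ;;
 SWhile ($jR >>! $jSh) (jSh <- ($jSh +! $vb)) ;;
 jY <- aNX[:$jRt:] ;;
 SWhile ($jSh)
  (jSh <- ($jSh -! $vb) ;;
   jI <- ($jR >>! $jSh) ;;
   jY <- ERd aJT (aMB[:$jY:]) ($jI -! (($jI >>! $vb) <<! $vb))) ;;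
 jS <- $jY.

Definition JUMP : stmt :=
 jRt <- aRO[:$jS:] ;; jD <- aDI[:$jS:] ;;
 SIf (aCU[:$jRt:])
  (jE <- $jX ;; SIf ($jD <! $jX) HORNER (jT <- $jX ;; TREE))
  (SIf ($jX <! $jD) (jE <- $jX) (jE <- $jD) ;; jT <- $jE ;; TREE).

Section Jump.
Context (w W : N) (delta : N -> list N -> N * N) (b q : N) (g out : N -> N).
Hypothesis HWbig : 64 * W <= 2 ^ W.
Hypothesis Hb : 1 <= b.
Hypothesis HbW : b <= W.
Hypothesis HqW : 4 * (q * 2 ^ b) <= 2 ^ W.
Notation wp := (wp w W delta).

(** Zero-output paths form a forest whose roots are the states with a nonzero output, and one state,
  the cut (marked in [aCU]), of each zero-output cycle.  For a state, [aDI] and [aRO] are the distance to its root and the root,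
  [aH] is its height, [aLF] is a descendant at that depth below it.  [aLAD] at [l] lists the path from the
  leaf [l] up to [2 ^ b] times the length of the part of that path that belongs to [l].
  On a cycle, [aMB] maps the [i]-th state after the cut to the [2 ^ b * i]-th. *)
Record jump_data (s : vst) : Prop := {
 jd_g : forall x, x < q -> g x < q;
 jd_NX : forall x, x < q -> dm s aNX x 0 = g x;
 jd_RO : forall x, x < q -> dm s aRO x 0 < q;
 jd_DI : forall x, x < q -> dm s aDI x 0 < q;
 jd_root : forall x, x < q -> dm s aDI x 0 = 0 -> dm s aRO x 0 = x;
 jd_step : forall x, x < q -> 0 < dm s aDI x 0 -> out x = 0 /\
   dm s aDI x 0 = dm s aDI (g x) 0 + 1 /\ dm s aRO (g x) 0 = dm s aRO x 0;
 jd_nz : forall x, x < q -> dm s aCU (dm s aRO x 0) 0 = 0 -> out (dm s aRO x 0) <> 0;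
 jd_cut : forall x r, x < q -> r = dm s aRO x 0 -> dm s aCU r 0 <> 0 -> out r = 0 /\
   forall k, out (Nat.iter k g (g r)) = 0 /\
    dm s aMB (Nat.iter k g (g r)) 0 = Nat.iter (k * N.to_nat (2 ^ b)) g (g r);
 jd_JT : forall x j, x < q -> j < 2 ^ b -> dm s aJT x j = Nat.iter (N.to_nat j) g x;
 jd_H : forall x, x < q -> dm s aH x 0 < q /\ Nat.iter (N.to_nat (dm s aH x 0)) g (dm s aLF x 0) = x;
 jd_up : forall x, x < q -> 0 < dm s aDI x 0 -> dm s aH x 0 + 1 <= dm s aH (g x) 0;
 jd_LAD : forall x j, x < q -> j < 2 ^ b * (dm s aH x 0 + 1) ->
   dm s aLAD (dm s aLF x 0) j = Nat.iter (N.to_nat j) g (dm s aLF x 0) }.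

Lemma jump_data_ext s s' : (forall A i j, (2 <= fst A <= 14)%nat -> dm s' A i j = dm s A i j) ->
 jump_data s -> jump_data s'.
Proof.
 intros E []. constructor; try (intros *; rewrite ?E by (cbn [fst]; lia); auto; fail).
 intros x r. rewrite !E by (cbn [fst]; lia). intros H1 H2 H3. destruct (jd_cut0 x r H1 H2 H3) as [? G].
 split; auto. intros k. rewrite E by (cbn [fst]; lia). auto.
Qed.

Notation it n x := (Nat.iter n g x).

Lemma it_add m n x : it (m + n) x = it m (it n x).
Proof. apply Nat.iter_add. Qed.

Section Data.
Context (s0 : vst) (HJ : jump_data s0).
Notation DI x := (dm s0 aDI x 0).
Notation RO x := (dm s0 aRO x 0).
Notation HH x := (dm s0 aH x 0).
Notation LF x := (dm s0 aLF x 0).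

Lemma it_lt k x : x < q -> it k x < q.
Proof. intros H. induction k; simpl; auto. apply (jd_g _ HJ); auto. Qed.

Lemma it_path k x : x < q -> N.of_nat k <= DI x ->
 DI (it k x) + N.of_nat k = DI x /\ RO (it k x) = RO x /\ HH x + N.of_nat k <= HH (it k x) /\
 forall j, (j < k)%nat -> out (it j x) = 0.
Proof.
 intros H. induction k as [|k IH]; intros Hk; simpl Nat.iter.
 - repeat split; auto; lia.
 - destruct (IH ltac:(lia)) as (A & B & C & D). pose proof (it_lt k x H) as Hl.
  destruct (jd_step _ HJ (it k x) Hl ltac:(lia)) as (E1 & E2 & E3).
  pose proof (jd_up _ HJ (it k x) Hl ltac:(lia)).
  split; [lia|]. split; [congruence|]. split; [lia|].
  intros j Hj. destruct (Nat.eq_dec j k) as [->|]; auto. apply D. lia.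
Qed.

Lemma it_root x : x < q -> it (N.to_nat (DI x)) x = RO x.
Proof.
 intros H. destruct (it_path (N.to_nat (DI x)) x H ltac:(lia)) as (A & B & _).
 rewrite <- B. symmetry. apply (jd_root _ HJ); [apply it_lt; auto|lia].
Qed.

Definition same_dm (s : vst) : Prop := forall A i j, dm s A i j = dm s0 A i j.

Lemma TREE_spec s x e : same_dm s -> env s vb = b -> env s jS = x -> env s jT = e -> x < q -> e <= DI x ->
 wp TREE (fun n s' => env s' jS = it (N.to_nat e) x /\ N.of_nat n * b <= N.log2 e + b) s.
Proof.
 intros Hd Hvb Hx He Hxq Hex. unfold TREE. apply wp_seq.
 pose proof (pow2_pos b) as Hpb.
 assert (HB2 : 2 <= 2 ^ b) by (change 2 with (2 ^ 1) at 1; apply N.pow_le_mono_r; lia).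
 apply wp_while with (m := fun s' => N.to_nat (env s' jT)) (I := fun a s' => same_dm s' /\ env s' vb = b /\
   exists k, env s' jS = it k x /\ N.of_nat k + env s' jT = e /\
    N.of_nat a * b <= N.log2 e + b /\ 2 ^ (N.of_nat a * b) <= HH (env s' jS) + 1).
 - intros a s1 (D1 & V1 & k & E1 & E2 & E3 & E4) Hc. vredh Hc. rewrite !D1, V1 in Hc.
  pose proof (it_lt k x Hxq) as Hl. destruct (it_path k x Hxq ltac:(lia)) as (A & B & C & D).
  rewrite E1 in *. set (y := it k x) in *. destruct (jd_H _ HJ y Hl) as [Hh1 Hh2].
  pose proof (jd_DI _ HJ y Hl).
  assert (Hm0 : (HH y + 1) * 2 ^ b <= q * 2 ^ b) by (apply N.mul_le_mono_r; lia).
  assert (Hq0 : q * 2 <= q * 2 ^ b) by (apply N.mul_le_mono_l; lia).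
  assert (Hm1 : (HH y + 1) * 2 <= (HH y + 1) * 2 ^ b) by (apply N.mul_le_mono_l; lia).
  assert (Hm : (HH y + 1) * 2 ^ b < 2 ^ W) by lia.
  rewrite (N.mod_small (HH y + 1)) in Hc by lia. rewrite (N.mod_small (_ * _)) in Hc by auto.
  rewrite (N.mod_small (HH y + env s1 jT)) in Hc by lia.
  destruct (N.ltb_spec (HH y + env s1 jT) ((HH y + 1) * 2 ^ b)) as [|Hge]; [lia|]. clear Hc.
  (* A further jump is made only if [(h + 1) * 2 ^ b <= h + T] for the height [h] and the remaining
     distance [T], whence [h + 1 <= T <= e]. With the invariant [2 ^ (a * b) <= h + 1] this bounds
     the jumps made so far. *)
  assert (Hlog : N.of_nat a * b <= N.log2 e).
  { apply N.log2_le_pow2; lia. }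
  assert (Hidx : (HH y + 1) * 2 ^ b - 1 < 2 ^ b * (HH y + 1)) by lia.
  pose proof (jd_LAD _ HJ y _ Hl Hidx) as HL.
  assert (Hjt : (HH y + 1) * 2 ^ b - 1 < HH y + env s1 jT) by lia.
  set (i := (HH y + 1) * 2 ^ b - 1) in *.
  assert (Hi : HH y + 1 <= i) by (unfold i; lia).
  assert (EL : dm s0 aLAD (LF y) i = it (N.to_nat (i - HH y)) y).
  { rewrite HL. replace (N.to_nat i) with (N.to_nat (i - HH y) + N.to_nat (HH y))%nat by lia.
   rewrite it_add, Hh2. auto. }
  do 2 apply wp_set_seq. apply wp_set. vs. rewrite !D1, V1, E1.
  rewrite !(N.mod_small (HH y + 1)) by lia. rewrite !(N.mod_small (_ * _)) by auto.
  rewrite !(N.mod_small (HH y + env s1 jT)) by lia. fold i. rewrite EL.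
  destruct (it_path (N.to_nat (i - HH y)) y Hl ltac:(lia)) as (A' & B' & C' & D').
  split; [|lia]. sp. sp.
  exists (N.to_nat (i - HH y) + k)%nat. split; [symmetry; apply it_add|]. split; [lia|]. split; [lia|].
  eapply N.le_trans; [|apply N.add_le_mono_r; exact C'].
  replace (N.of_nat (S (a + 0)) * b) with (N.of_nat a * b + b) by lia. rewrite N.pow_add_r.
  assert (2 ^ (N.of_nat a * b) * 2 ^ b <= (HH y + 1) * 2 ^ b) by (apply N.mul_le_mono_r; auto). lia.
 - intros a s1 (D1 & V1 & k & E1 & E2 & E3 & E4) Hc. vredh Hc. rewrite !D1, V1 in Hc.
  pose proof (it_lt k x Hxq) as Hl. destruct (it_path k x Hxq ltac:(lia)) as (A & B & C & D).
  rewrite E1 in *. set (y := it k x) in *. destruct (jd_H _ HJ y Hl) as [Hh1 Hh2].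
  pose proof (jd_DI _ HJ y Hl).
  assert (Hm0 : (HH y + 1) * 2 ^ b <= q * 2 ^ b) by (apply N.mul_le_mono_r; lia).
  assert (Hq0 : q * 2 <= q * 2 ^ b) by (apply N.mul_le_mono_l; lia).
  assert (Hm1 : (HH y + 1) * 2 <= (HH y + 1) * 2 ^ b) by (apply N.mul_le_mono_l; lia).
  assert (Hm : (HH y + 1) * 2 ^ b < 2 ^ W) by lia.
  rewrite (N.mod_small (HH y + 1)) in Hc by lia. rewrite (N.mod_small (_ * _)) in Hc by auto.
  rewrite (N.mod_small (HH y + env s1 jT)) in Hc by lia.
  destruct (N.ltb_spec (HH y + env s1 jT) ((HH y + 1) * 2 ^ b)) as [Hlt|]; [|lia]. clear Hc.
  apply wp_set. vs. rewrite !D1, E1. rewrite (N.mod_small (HH y + env s1 jT)) by lia.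
  rewrite (jd_LAD _ HJ y) by (auto; lia).
  replace (N.to_nat (HH y + env s1 jT)) with (N.to_nat (env s1 jT) + N.to_nat (HH y))%nat by lia.
  rewrite it_add, Hh2. unfold y. rewrite <- it_add. split; [f_equal; lia|]. rewrite Nat.add_0_r. auto.
 - sp. sp. exists 0%nat. rewrite Hx. sp. split; [lia|]. split; [lia|].
  rewrite N.mul_0_l, N.pow_0_r. lia.
Qed.

Lemma HORNER_spec s r : same_dm s -> env s vb = b -> env s jRt = r -> r < q -> env s jX < 2 ^ W ->
 (forall k, dm s0 aMB (it k (g r)) 0 = it (k * N.to_nat (2 ^ b)) (g r)) ->
 wp HORNER (fun n s' => env s' jS = it (N.to_nat (env s jX - env s jD - 1)) (g r) /\
   N.of_nat n * b <= 2 * N.log2 (env s jX - env s jD - 1) + 2 * b) s.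
Proof.
 intros Hd Hvb Hr Hrq HX HM. unfold HORNER. do 2 apply wp_set_seq. vs.
 set (v := env s jX - env s jD - 1). set (v0 := g r) in *.
 assert (Hv0 : v0 < q) by (apply (jd_g _ HJ); auto).
 assert (HvW : v < 2 ^ W) by (unfold v; lia).
 pose proof (pow2_pos b) as Hpb.
 apply wp_seq. eapply wp_mono.
 { apply wp_while with (m := fun s' => N.to_nat (N.log2 v + 1 - env s' jSh))
   (I := fun a s' => env s' jSh = N.of_nat a * b /\ env s' jR = v /\ env s' vb = b /\ (N.of_nat a * b <= N.log2 v + b))
   (Q := fun n s' => v / 2 ^ env s' jSh = 0 /\ env s' jSh = N.of_nat n * b /\ (N.of_nat n * b <= N.log2 v + b)).
  - intros a s1 (E1 & E2 & E3 & E4) Hc. vredh Hc. rewrite E2, div_pow_zero in Hc.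
   assert (Hle : env s1 jSh <= N.log2 v).
   { apply N.log2_le_pow2; [|lia]. pose proof (pow2_pos (env s1 jSh)). lia. }
   assert (N.log2 v < W).
   { destruct (N.eq_dec v 0) as [->|]; [simpl; lia|]. apply N.log2_lt_pow2; lia. }
   apply wp_set. vs. rewrite E3. rewrite N.mod_small by lia. repeat split; auto; lia.
  - intros a s1 (E1 & E2 & E3 & E4) Hc. vredh Hc. rewrite E2 in Hc. auto.
  - vs. repeat split; auto; lia. }
 intros n1 s1 Fr1 (G1 & G2 & G3).
 assert (K1 : forall u, u <> jSh -> u <> jR -> env s1 u = env s u).
 { intros u Hu Hu'. rewrite (fv Fr1).
  - cbn [upd env]. destruct (peqb_spec u jSh), (peqb_spec u jR); congruence.
  - destruct u. keep. }
 assert (D1 : same_dm s1) by (intros A i j; rewrite (fa Fr1) by reflexivity; apply Hd).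
 assert (ER : env s1 jR = v) by (rewrite (fv Fr1) by reflexivity; vs; reflexivity).
 apply wp_set_seq. vs. rewrite D1, K1, Hr by discriminate. rewrite (jd_NX _ HJ) by auto. fold v0.
 apply wp_seq. eapply wp_mono.
 { apply wp_while with (m := fun s' => N.to_nat (env s' jSh))
   (I := fun a s' => same_dm s' /\ env s' vb = b /\ env s' jR = v /\
    env s' jY = it (N.to_nat (v / 2 ^ env s' jSh)) v0 /\ exists k, env s' jSh = k * b /\ (k + N.of_nat a) * b <= N.log2 v + b)
   (Q := fun n s' => env s' jY = it (N.to_nat v) v0 /\ N.of_nat n * b <= N.log2 v + b).
  - intros a s2 (D2 & V2 & R2' & Y2 & k & S2 & C2) Hc. vredh Hc.
   assert (Hk : 1 <= k) by nia.
   assert (Eb : env s2 jSh - b = (k - 1) * b) by nia.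
   apply wp_set_seq, wp_set_seq, wp_set. vs. rewrite !D2, V2, R2', Y2, Eb.
   set (sh := (k - 1) * b) in *.
   assert (Esh : env s2 jSh = sh + b) by (unfold sh; nia). rewrite Esh.
   assert (Hd1 : v / 2 ^ sh < 2 ^ W).
   { eapply N.le_lt_trans; [|exact HvW]. apply N.Div0.div_le_upper_bound. pose proof (pow2_pos sh). nia. }
   rewrite sub_mod by auto. rewrite HM. rewrite (jd_JT _ HJ) by (first [apply it_lt; auto | apply N.mod_lt; lia]).
   rewrite <- it_add.
   split; [|lia]. sp. sp. sp. split.
   (* The prefix [v / 2 ^ sh] is [2 ^ b] times the previous, shorter prefix plus the new digit. *)
   + f_equal. rewrite N.pow_add_r, <- N.Div0.div_div.
    pose proof (N.div_mod' (v / 2 ^ sh) (2 ^ b)) as Hdm.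
    rewrite Hdm at 3. rewrite <- N2Nat.inj_mul, <- N2Nat.inj_add. f_equal. lia.
   + exists (k - 1). sp. nia.
  - intros a s2 (D2 & V2 & R2' & Y2 & k & S2 & C2) Hc. vredh Hc. rewrite Hc in *.
   rewrite N.pow_0_r, N.div_1_r in Y2. split; auto. nia.
  - vs. split; [exact D1|]. split; [rewrite K1 by discriminate; auto|]. sp. rewrite G1. sp.
   exists (N.of_nat n1). split; auto. rewrite N.add_0_r. auto. }
 intros n2 s2 _ (Y & C). apply wp_set. vs. sp. rewrite !Nat.add_0_r. nia.
Qed.

(** If the root is a cut, then the output stays zero forever and all [jX] steps can be made.
    Otherwise the root has a nonzero output, and the walk must stop there unless [jX] is smaller
    than the distance. *)
Lemma JUMP_spec s x : same_dm s -> env s vb = b -> env s jS = x -> x < q -> env s jX < 2 ^ W ->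
 wp JUMP (fun n s' => exists e, env s' jE = e /\ env s' jS = it (N.to_nat e) x /\ e <= env s jX /\
  (forall k, (k < N.to_nat e)%nat -> out (it k x) = 0) /\
  (e = env s jX \/ out (it (N.to_nat e) x) <> 0) /\
  N.of_nat n * b <= 2 * N.log2 e + 2 * b) s.
Proof.
 intros Hd Hvb Hx Hxq HX. unfold JUMP. do 2 apply wp_set_seq. vs. rewrite Hx, Hd.
 assert (Ero : RO x < q) by (apply (jd_RO _ HJ); auto).
 apply wp_if; vs; rewrite !Hd; intros Hcu.
 - apply wp_set_seq. vs. destruct (jd_cut _ HJ x _ Hxq eq_refl Hcu) as [Ho Hcy].
  apply wp_if; vs; destruct (N.ltb_spec (DI x) (env s jX)) as [Hlt|Hge]; try lia; intros _.
  + eapply wp_mono; [apply (HORNER_spec _ (RO x)); vs; auto; apply Hcy|].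
   vs. intros n s' Fr (E1 & E2). exists (env s jX).
   rewrite (fv Fr) by reflexivity. vs.
   (* Positions on the cycle start at the successor of the root, which explains the subtraction of 1
      in [HORNER]. *)
   assert (Esplit : forall k, (N.to_nat (DI x) < k)%nat -> it k x = it (k - N.to_nat (DI x) - 1) (g (RO x))).
   { intros k Hk. rewrite <- it_root by auto.
    transitivity (it ((k - N.to_nat (DI x) - 1) + S (N.to_nat (DI x))) x); [f_equal; lia|]. rewrite it_add. reflexivity. }
   sp. split; [rewrite E1, Esplit by lia; f_equal; lia|]. split; [lia|]. split; [|split; [auto|]].
   * intros k Hk. destruct (it_path (N.to_nat (DI x)) x Hxq ltac:(lia)) as (_ & _ & _ & Hp).
    destruct (Nat.lt_trichotomy k (N.to_nat (DI x))) as [|[->|]]; auto.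
    -- rewrite it_root; auto.
    -- rewrite Esplit by auto. apply Hcy.
   * pose proof (N.log2_le_mono (env s jX - DI x - 1) (env s jX) ltac:(lia)). lia.
  + apply wp_set_seq. vs. eapply wp_mono; [apply (TREE_spec _ x (env s jX)); vs; auto|].
   intros n s' Fr (E1 & E2). exists (env s jX). rewrite (fv Fr) by reflexivity. vs.
   sp. sp. split; [lia|]. split; [|split; [auto|lia]].
   intros k Hk. destruct (it_path (N.to_nat (env s jX)) x Hxq ltac:(lia)) as (_ & _ & _ & Hp). auto.
 - apply wp_seq. set (e := N.min (env s jX) (DI x)).
  eapply wp_mono with (Q := fun n s' => n = 0%nat /\ same_dm s' /\ env s' vb = b /\ env s' jS = x /\ env s' jE = e).
  { apply wp_if; vs; destruct (N.ltb_spec (env s jX) (DI x)); try lia; intros _; apply wp_set; vs; repeat split; auto; unfold e; lia. }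
  intros n s1 _ (-> & D1 & V1 & S1 & E1). apply wp_set_seq. vs.
  eapply wp_mono; [apply (TREE_spec _ x e); vs; auto; unfold e; lia|].
  intros n s' Fr (F1 & F2). exists e. rewrite (fv Fr) by reflexivity. vs.
  sp. sp. split; [unfold e; lia|]. split; [|split; [|cbn [Nat.add]; lia]].
  + intros k Hk. destruct (it_path (N.to_nat e) x Hxq ltac:(unfold e; lia)) as (_ & _ & _ & Hp). auto.
  + destruct (N.lt_ge_cases (env s jX) (DI x)); [left; unfold e; lia|]. right.
   replace e with (DI x) by (unfold e; lia). rewrite it_root by auto. apply (jd_nz _ HJ); auto.
Qed.
End Data.
End Jump.

(** * Construction of the jump structure *)

Notation gI := (70%nat, 0%nat).
Notation gV := (71%nat, 0%nat).
Notation gT := (72%nat, 0%nat).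
Notation gC := (73%nat, 0%nat).
Notation gR := (74%nat, 0%nat).
Notation gY := (75%nat, 0%nat).
Notation gM := (76%nat, 0%nat).
Notation gJ := (77%nat, 0%nat).
Notation gH := (78%nat, 0%nat).
Notation gL := (79%nat, 0%nat).
Notation gO := (80%nat, 0%nat).
Notation gZ := (81%nat, 0%nat).

Definition NEXTS (t : nat) : stmt :=
 gI <- E0 ;;
 SWhile ($gI <! $vq)
  (gZ <- E0 ;; SDelta gV gO gI (map (fun _ => gZ) (seq 0 t)) ;;
   SIf ($gV <! $vq) SSkip (gV <- E0) ;;
   SSt aNX ($gI) E0 ($gV) ;; SSt aOU ($gI) E0 (E0 <! $gO) ;; SSt aMK ($gI) E0 E0 ;;
   SSt aH ($gI) E0 E0 ;; SSt aLF ($gI) E0 ($gI) ;;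
   gI <- ($gI +! E1)).

Definition JTAB : stmt :=
 gI <- E0 ;;
 SWhile ($gI <! $vq)
  (gV <- $gI ;; gJ <- E0 ;;
   SWhile ($gJ <! $vX)
    (SSt aJT ($gI) ($gJ) ($gV) ;; gV <- aNX[:$gV:] ;; gJ <- ($gJ +! E1)) ;;
   gI <- ($gI +! E1)).

Definition PUSH (x : var) : stmt := SSt aMK ($x) E0 (E1 +! E1) ;; SSt aOR ($gC) E0 ($x) ;; gC <- ($gC +! E1).

(** Marks: 0 for unseen states, 1 for states on the current stack, 2 for finished ones. The walk
    halts at a state that is marked or has a nonzero output; what is found there decides between a
    known tree, a new cycle and a new root. *)
Definition WALK : stmt :=
 SWhile (enot (aMK[:$gV:] +! aOU[:$gV:]))
  (SSt aMK ($gV) E0 E1 ;; SSt aSK ($gT) E0 ($gV) ;; gT <- ($gT +! E1) ;; gV <- aNX[:$gV:]).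

(** The walk has run into its own stack at [gV], so the top of the stack is the predecessor of [gV]
    on the cycle; it becomes the cut. Then two pointers go around: [gY] by single steps and [gM] by
    [2 ^ b] steps at once. The table [aJT] ends at [2 ^ b - 1], hence the extra application of
    [aNX]. *)
Definition CYCLE : stmt :=
 gT <- ($gT -! E1) ;; gR <- aSK[:$gT:] ;;
 SSt aDI ($gR) E0 E0 ;; SSt aRO ($gR) E0 ($gR) ;; SSt aCU ($gR) E0 E1 ;; PUSH gR ;;
 gY <- $gV ;; gM <- $gV ;; gJ <- E1 ;;
 SWhile ($gJ)
  (SSt aMB ($gY) E0 ($gM) ;; gY <- aNX[:$gY:] ;; gM <- aNX[:ERd aJT ($gM) ($vX -! E1):] ;;
   gJ <- (($gY <! $gV) +! ($gV <! $gY))).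

Definition NZROOT : stmt :=
 SSt aDI ($gV) E0 E0 ;; SSt aRO ($gV) E0 ($gV) ;; SSt aCU ($gV) E0 E0 ;; PUSH gV.

Definition POPS : stmt :=
 SWhile ($gT)
  (gT <- ($gT -! E1) ;; gY <- aSK[:$gT:] ;;
   SSt aDI ($gY) E0 (aDI[:aNX[:$gY:]:] +! E1) ;; SSt aRO ($gY) E0 (aRO[:aNX[:$gY:]:]) ;; SSt aCU ($gY) E0 E0 ;; PUSH gY).

Definition COLOR : stmt :=
 gI <- E0 ;; gC <- E0 ;;
 SWhile ($gI <! $vq)
  (gV <- $gI ;; gT <- E0 ;; WALK ;;
   SIf (aMK[:$gV:]) (SIf (E1 <! aMK[:$gV:]) SSkip CYCLE) NZROOT ;;
   POPS ;;
   gI <- ($gI +! E1)).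

(** In the reverse of the finishing order all children come before their parent, so a height is
    final when its state is reached. The state extends the ladder of its leaf by [2 ^ b] entries,
    continuing from the last one, and thus all ladders together are built in [q * 2 ^ b] iterations.
    A parent changes its leaf only for a strictly greater height, which yields the long-path
    decomposition. *)
Definition TREES : stmt :=
 gI <- $gC ;;
 SWhile ($gI)
  (gI <- ($gI -! E1) ;; gV <- aOR[:$gI:] ;; gH <- aH[:$gV:] ;; gL <- aLF[:$gV:] ;;
   gJ <- ($gH <<! $vb) ;;
   SIf ($gH) (gY <- aNX[:ERd aLAD ($gL) ($gJ -! E1):]) (gY <- $gL) ;;
   gM <- (($gH +! E1) <<! $vb) ;;
   SWhile ($gJ <! $gM) (SSt aLAD ($gL) ($gJ) ($gY) ;; gY <- aNX[:$gY:] ;; gJ <- ($gJ +! E1)) ;;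
   SIf (aDI[:$gV:])
    (gY <- aNX[:$gV:] ;;
    SIf (aH[:$gY:] <! $gH +! E1) (SSt aH ($gY) E0 ($gH +! E1) ;; SSt aLF ($gY) E0 ($gL)) SSkip) SSkip).

Definition GRAPH (t : nat) : stmt := NEXTS t ;; JTAB ;; COLOR ;; TREES.

Ltac vm := vred; rewrite ?N.eqb_refl, ?Bool.andb_true_r, ?Nat.eqb_refl; vred.

Lemma exists_last_or {A} (l : list A) : l = [] \/ exists l' a, l = l' ++ [a].
Proof. destruct l as [|a l]; [auto|right]. destruct (@exists_last _ (a :: l)) as (l' & z & E); [discriminate|]. eauto. Qed.

Lemma NoDup_app_intro3 (l st : list N) x : NoDup (l ++ st) -> ~ In x l -> ~ In x st -> NoDup (l ++ [x] ++ st).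
Proof.
 intros H H1 H2. apply (NoDup_Add (Add_app x l st)). split; auto. rewrite in_app_iff. tauto.
Qed.

Lemma NoDup_app_disj {A} (l st : list A) x : NoDup (l ++ st) -> In x st -> In x l -> False.
Proof.
 intros H H1 H2. induction l as [|y l IH]; simpl in *; [auto|]. apply NoDup_cons_iff in H as [Hn H].
 destruct H2 as [->|H2]; auto. apply Hn, in_app_iff. auto.
Qed.

Section Graph.
Context (w W : N) (delta : N -> list N -> N * N) (t : nat) (b q : N).
Hypothesis HWbig : 64 * W <= 2 ^ W.
Hypothesis Hb : 1 <= b.
Hypothesis HbW : b <= W.
Hypothesis Hq0 : 0 < q.
Hypothesis HqW : 4 * (q * 2 ^ b) <= 2 ^ W.
Notation wp := (wp w W delta).

(** Nothing is assumed about [delta] in this section, and the all-zero input need not be legal when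
    [sigma = 0]. Replacing an out-of-range successor by 0 keeps the graph on [[0..q)]. *)
Definition gz (x : N) : N :=
 let r := fst (delta x (repeat 0 t)) mod 2 ^ W in if r <? q then r else 0.
Definition oz (x : N) : N := if snd (delta x (repeat 0 t)) mod 2 ^ W =? 0 then 0 else 1.
Notation it n x := (Nat.iter n gz x).
Notation Bn := (N.to_nat (2 ^ b)).

Lemma gz_lt x : gz x < q.
Proof. unfold gz. destruct (N.ltb_spec (fst (delta x (repeat 0 t)) mod 2 ^ W) q); auto. Qed.

Lemma itz_lt k x : x < q -> it k x < q.
Proof. intros. destruct k; simpl; auto. apply gz_lt. Qed.

Lemma itz_add m n x : it (m + n) x = it m (it n x).
Proof. apply Nat.iter_add. Qed.

Lemma qW : q + 1 < 2 ^ W /\ q + q < 2 ^ W.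
Proof. pose proof (pow2_1 b). nia. Qed.

Definition params (s : vst) : Prop := env s vq = q /\ env s vb = b /\ env s vX = 2 ^ b.

Lemma params_frame p s s' : Frame p s s' -> modv p vq = false -> modv p vb = false -> modv p vX = false ->
 params s -> params s'.
Proof. intros F H1 H2 H3 (A & B & C). unfold params. rewrite !(fv F) by auto. auto. Qed.

Lemma map_zero s (l : list nat) : env s gZ = 0 -> map (env s) (map (fun _ => gZ) l) = repeat 0 (length l).
Proof. intros H. induction l; simpl; auto. rewrite H, IHl. auto. Qed.

Definition next_data (n : N) (s : vst) : Prop := forall x, x < n ->
 dm s aNX x 0 = gz x /\ dm s aOU x 0 = oz x /\ dm s aMK x 0 = 0 /\ dm s aH x 0 = 0 /\ dm s aLF x 0 = x.

Lemma NEXTS_spec s : params s -> wp (NEXTS t) (fun n s' => next_data q s' /\ N.of_nat n <= q) s.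
Proof.
 intros HP. pose proof qW as HqW'. unfold NEXTS. apply wp_set_seq.
 apply wp_while with (m := fun s' => N.to_nat (q - env s' gI))
  (I := fun a s' => params s' /\ env s' gI <= q /\ next_data (env s' gI) s' /\ N.of_nat a <= env s' gI).
 - intros a s1 (P1 & L1 & D1 & A1) Hc. vredh Hc. destruct P1 as (Q1 & Q2 & Q3). rewrite Q1 in Hc.
  destruct (N.ltb_spec (env s1 gI) q) as [Hlt|]; [|lia]. clear Hc.
  apply wp_set_seq, wp_seq, wp_delta. rewrite map_zero by reflexivity. rewrite length_seq. vs.
  set (x := env s1 gI) in *.
  apply wp_seq.
  eapply wp_mono with (Q := fun n s2 => n = 0%nat /\ env s2 gV = gz x /\
    env s2 gO = snd (delta x (repeat 0 t)) mod 2 ^ W /\ env s2 gI = x /\ params s2 /\ dm s2 = dm s1).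
  { unfold gz. apply wp_if; vs; rewrite Q1; destruct (N.ltb_spec (fst (delta x (repeat 0 t)) mod 2 ^ W) q); try lia; intros _.
   - apply wp_skip. vs. unfold params. vs. auto 10.
   - apply wp_set. vs. unfold params. vs. auto 10. }
  intros n s2 _ (-> & E1 & E2 & E3 & P2 & E4).
  do 5 apply wp_st_seq. apply wp_set. vm. rewrite E3.
  rewrite N.mod_small by lia. split; [|lia]. split.
  { destruct P2 as (? & ? & ?). unfold params. vs. auto. }
  split; [lia|]. split; [|lia].
  intros y Hy. vm. rewrite E1, E2, E4. destruct (N.eqb_spec y x) as [->|].
  + repeat split; auto. unfold oz. destruct (N.ltb_spec 0 (snd (delta x (repeat 0 t)) mod 2 ^ W)),
    (N.eqb_spec (snd (delta x (repeat 0 t)) mod 2 ^ W) 0); auto; lia.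
  + apply D1. fold x. lia.
 - intros a s1 (P1 & L1 & D1 & A1) Hc. vredh Hc. destruct P1 as (Q1 & Q2 & Q3). rewrite Q1 in Hc.
  destruct (N.ltb_spec (env s1 gI) q) as [|]; [lia|]. assert (E : env s1 gI = q) by lia. rewrite E in *. auto.
 - vs. split; [destruct HP as (? & ? & ?); unfold params; vs; auto|]. split; [lia|]. split; [|lia]. intros x Hx. vs. lia.
Qed.

Definition jt_data (s : vst) : Prop := forall x j, x < q -> j < 2 ^ b -> dm s aJT x j = it (N.to_nat j) x.

Lemma B_small : 2 ^ b + 1 < 2 ^ W.
Proof. assert (1 * 2 ^ b <= q * 2 ^ b) by (apply N.mul_le_mono_r; lia). pose proof (pow2_1 b). lia. Qed.

Lemma JTAB_spec s : params s -> next_data q s ->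
 wp JTAB (fun n s' => jt_data s' /\ N.of_nat n <= q * (1 + 2 ^ b)) s.
Proof.
 intros HP HN. pose proof qW as HqW'. pose proof B_small as HB. unfold JTAB. apply wp_set_seq.
 apply wp_while with (m := fun s' => N.to_nat (q - env s' gI))
  (I := fun a s' => params s' /\ (forall x, x < q -> dm s' aNX x 0 = gz x) /\ env s' gI <= q /\
   (forall x j, x < env s' gI -> j < 2 ^ b -> dm s' aJT x j = it (N.to_nat j) x) /\
   N.of_nat a <= env s' gI * (1 + 2 ^ b)).
 - intros a s1 (P1 & D0 & L1 & D1 & A1) Hc. vredh Hc. pose proof P1 as (Q1 & Q2 & Q3). rewrite Q1 in Hc.
  destruct (N.ltb_spec (env s1 gI) q) as [Hlt|]; [|lia]. clear Hc.
  do 2 apply wp_set_seq. vs. set (x0 := env s1 gI) in *. apply wp_seq.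
  apply wp_while with (m := fun s' => N.to_nat (2 ^ b - env s' gJ))
   (I := fun a' s' => params s' /\ env s' gI = x0 /\ (forall x, x < q -> dm s' aNX x 0 = gz x) /\
    (forall x j, x < x0 -> j < 2 ^ b -> dm s' aJT x j = it (N.to_nat j) x) /\
    (forall j, j < env s' gJ -> dm s' aJT x0 j = it (N.to_nat j) x0) /\
    env s' gV = it (N.to_nat (env s' gJ)) x0 /\ env s' gJ <= 2 ^ b /\ N.of_nat a' <= env s' gJ).
  + intros a2 s2 (P2 & E1 & E2 & E3 & E4 & E5 & E6 & E7) Hc. vredh Hc. pose proof P2 as (R1' & R2' & R3'). rewrite R3' in Hc.
   destruct (N.ltb_spec (env s2 gJ) (2 ^ b)) as [Hj|]; [|lia]. clear Hc.
   apply wp_st_seq, wp_set_seq, wp_set. vm. rewrite E1, E5. rewrite N.mod_small by lia.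
   rewrite E2 by (apply itz_lt; auto).
   split; [|lia]. split; [unfold params; vs; auto|]. sp. sp. split.
   { intros x j Hx Hj'. destruct (N.eqb_spec x x0); [lia|]. cbn [andb]. apply E3; auto. }
   split.
   { intros j Hj'. rewrite N.eqb_refl. destruct (N.eqb_spec j (env s2 gJ)) as [->|]; cbn [andb]; auto. apply E4. lia. }
   split; [|lia]. rewrite N.add_1_r, N2Nat.inj_succ. reflexivity.
  + intros a2 s2 (P2 & E1 & E2 & E3 & E4 & E5 & E6 & E7) Hc. vredh Hc. pose proof P2 as (R1' & R2' & R3'). rewrite R3' in Hc.
   destruct (N.ltb_spec (env s2 gJ) (2 ^ b)) as [|Hj]; [lia|]. clear Hc. assert (Ej : env s2 gJ = 2 ^ b) by lia.
   rewrite Ej in *. apply wp_set. vs. rewrite E1. rewrite N.mod_small by lia.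
   split; [|lia]. split; [unfold params; vs; auto|]. sp. split; [lia|]. split; [|lia].
   intros x j Hx Hj'. destruct (N.eq_dec x x0) as [->|]; auto. apply E3; auto. lia.
  + vs. split; [unfold params; vs; auto|]. sp. sp. sp. split; [intros; lia|].
   sp. split; lia.
 - intros a s1 (P1 & D0 & L1 & D1 & A1) Hc. vredh Hc. destruct P1 as (Q1 & Q2 & Q3). rewrite Q1 in Hc.
  destruct (N.ltb_spec (env s1 gI) q) as [|]; [lia|]. assert (E : env s1 gI = q) by lia. rewrite E in *. auto.
 - vs. split; [destruct HP as (? & ? & ?); unfold params; vs; auto|]. split; [intros; apply HN; auto|].
  split; [lia|]. split; [intros; lia|lia].
Qed.

(** The state after the walks: [ol] is the order in which states have been finished, parents first. *)
Definition node_ok (DI RO CU : N -> N) (l1 : list N) (x : N) : Prop :=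
 (DI x = 0 /\ RO x = x /\ (CU x = 0 <-> oz x <> 0)) \/
 (oz x = 0 /\ In (gz x) l1 /\ DI x = DI (gz x) + 1 /\ RO x = RO (gz x)).

Definition forest (DI RO CU : N -> N) (ol : list N) : Prop :=
 forall l1 x l2, ol = l1 ++ x :: l2 -> node_ok DI RO CU l1 x /\ DI x <= N.of_nat (length l1).

(** When a cut is finished, the rest of its cycle is still on the stack; [rem] accounts for it. That
    every state of the cycle is in [ol ++ rem] ensures that the entries of [MB] are not overwritten
    for a later cycle. *)
Definition cycles (CU MB : N -> N) (ol rem : list N) : Prop :=
 forall r, In r ol -> CU r <> 0 -> oz r = 0 /\ forall k, oz (it k (gz r)) = 0 /\
  MB (it k (gz r)) = it (k * Bn) (gz r) /\ In (it k (gz r)) (ol ++ rem).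

Lemma forest_ext DI RO CU DI' RO' CU' ol :
 (forall x, In x ol -> DI' x = DI x /\ RO' x = RO x /\ CU' x = CU x) -> forest DI RO CU ol -> forest DI' RO' CU' ol.
Proof.
 intros E H l1 x l2 ->. destruct (H l1 x l2 eq_refl) as [Hn Hd].
 destruct (E x) as (E1 & E2 & E3); [apply in_app_iff; simpl; auto|]. unfold node_ok. rewrite E1, E2, E3.
 split; [|auto]. destruct Hn as [Hn|(A & B & C & D)]; [left; auto|right].
 destruct (E (gz x)) as (F1 & F2 & _); [apply in_app_iff; auto|]. rewrite F1, F2. auto.
Qed.

Lemma forest_snoc DI RO CU ol x : forest DI RO CU ol -> node_ok DI RO CU ol x -> DI x <= N.of_nat (length ol) ->
 forest DI RO CU (ol ++ [x]).
Proof.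
 intros H Hn Hd l1 y l2 E. destruct (exists_last_or l2) as [->|(l2' & z & ->)].
 - apply app_inj_tail in E as [-> ->]. auto.
 - rewrite app_comm_cons, app_assoc in E. apply app_inj_tail in E as [-> ->]. eapply H; eauto.
Qed.

Record CB (s : vst) (ol : list N) : Prop := {
 cb_par : params s;
 cb_NX : forall x, x < q -> dm s aNX x 0 = gz x;
 cb_OU : forall x, x < q -> dm s aOU x 0 = oz x;
 cb_JT : jt_data s;
 cb_nd : NoDup ol;
 cb_lt : forall x, In x ol -> x < q;
 cb_C : env s gC = N.of_nat (length ol);
 cb_OR : forall i, (i < length ol)%nat -> dm s aOR (N.of_nat i) 0 = nth i ol 0;
 cb_for : forest (fun x => dm s aDI x 0) (fun x => dm s aRO x 0) (fun x => dm s aCU x 0) ol }.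

Lemma CB_ext s s' ol : CB s ol -> params s' -> env s' gC = env s gC ->
 (forall A i j, (fst A <> 4 /\ fst A <> 9 /\ fst A <> 14)%nat -> dm s' A i j = dm s A i j) -> CB s' ol.
Proof.
 intros [] HP HC E. constructor; auto.
 - intros. rewrite E by (cbn [fst]; lia). auto.
 - intros. rewrite E by (cbn [fst]; lia). auto.
 - intros x j Hx Hj. rewrite E by (cbn [fst]; lia). auto.
 - congruence.
 - intros. rewrite E by (cbn [fst]; lia). auto.
 - eapply forest_ext; [|exact cb_for0]. intros. rewrite !E by (cbn [fst]; lia). auto.
Qed.

Lemma nodup_len l : NoDup l -> (forall x, In x l -> x < q) -> N.of_nat (length l) <= q.
Proof.
 intros Hn Hl. assert (H : (length l <= length (map N.of_nat (seq 0 (N.to_nat q))))%nat).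
 { apply NoDup_incl_length; auto. intros x Hx. apply in_map_iff. exists (N.to_nat x).
  split; [lia|]. apply in_seq. specialize (Hl x Hx). lia. }
 rewrite length_map, length_seq in H. lia.
Qed.

Lemma NoDup_snoc (l : list N) x : NoDup l -> ~ In x l -> NoDup (l ++ [x]).
Proof.
 intros. apply NoDup_app; auto.
 - constructor; [intros []|constructor].
 - intros y Hy [->|[]]; auto.
Qed.

Lemma CB_push s s' ol x : CB s ol -> ~ In x ol -> x < q -> params s' -> env s' gC = env s gC + 1 ->
 (forall y j, dm s' aNX y j = dm s aNX y j) -> (forall y j, dm s' aOU y j = dm s aOU y j) ->
 (forall y j, dm s' aJT y j = dm s aJT y j) -> dm s' aOR (env s gC) 0 = x ->
 (forall i, i <> env s gC -> dm s' aOR i 0 = dm s aOR i 0) ->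
 (forall y, y <> x -> dm s' aDI y 0 = dm s aDI y 0 /\ dm s' aRO y 0 = dm s aRO y 0 /\ dm s' aCU y 0 = dm s aCU y 0) ->
 node_ok (fun x => dm s' aDI x 0) (fun x => dm s' aRO x 0) (fun x => dm s' aCU x 0) ol x ->
 dm s' aDI x 0 <= N.of_nat (length ol) -> CB s' (ol ++ [x]).
Proof.
 intros [] Hx Hxq HP HC E1 E2 E3 E4 E5 E6 E7 E8. constructor; auto.
 - intros. rewrite E1. auto.
 - intros. rewrite E2. auto.
 - intros y j Hy Hj. rewrite E3. auto.
 - apply NoDup_snoc; auto.
 - intros y Hy. apply in_app_iff in Hy as [|[<-|[]]]; auto.
 - rewrite length_app. simpl. lia.
 - intros i Hi. rewrite length_app in Hi. simpl in Hi. destruct (Nat.eq_dec i (length ol)) as [->|Hi'].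
  + rewrite app_nth2, Nat.sub_diag by lia. rewrite <- cb_C0. auto.
  + rewrite app_nth1 by lia. rewrite E5 by lia. apply cb_OR0. lia.
 - apply forest_snoc; auto. eapply forest_ext; [|exact cb_for0]. intros y Hy.
  assert (y <> x) by (intros ->; auto). apply E6; auto.
Qed.

Definition stk (T : nat) (x0 : N) : list N := map (fun i => it i x0) (seq 0 T).

Lemma stk_S T x0 : stk (S T) x0 = stk T x0 ++ [it T x0].
Proof. unfold stk. rewrite seq_S, map_app. reflexivity. Qed.

Lemma stk_in T x0 y : In y (stk T x0) <-> exists i, (i < T)%nat /\ y = it i x0.
Proof.
 unfold stk. rewrite in_map_iff. split; intros (i & A & B); exists i.
 - apply in_seq in B. split; [lia|auto].
 - split; auto. apply in_seq. lia.
Qed.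

Lemma stk_inj T x0 i j : NoDup (stk T x0) -> (i < T)%nat -> (j < T)%nat -> it i x0 = it j x0 -> i = j.
Proof.
 intros Hn Hi Hj E. apply (proj1 (NoDup_nth _ (it 0 x0)) Hn); unfold stk; rewrite ?length_map, ?length_seq; auto.
 rewrite !(map_nth (fun i => it i x0)), !seq_nth by auto. auto.
Qed.

Definition marks (s : vst) (ol st : list N) : Prop := forall x, x < q ->
 (In x ol /\ dm s aMK x 0 = 2) \/ (~ In x ol /\ In x st /\ dm s aMK x 0 = 1) \/
 (~ In x ol /\ ~ In x st /\ dm s aMK x 0 = 0).

Definition Cyc (s : vst) ol rem := cycles (fun x => dm s aCU x 0) (fun x => dm s aMB x 0) ol rem.

Lemma WALK_spec s ol x0 : CB s ol -> marks s ol [] -> env s gV = x0 -> x0 < q -> env s gT = 0 ->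
 wp WALK (fun n s' => CB s' ol /\ exists T, n = T /\ env s' gT = N.of_nat T /\ env s' gV = it T x0 /\
  (forall i, (i < T)%nat -> dm s' aSK (N.of_nat i) 0 = it i x0 /\ oz (it i x0) = 0) /\
  NoDup (ol ++ stk T x0) /\ marks s' ol (stk T x0) /\ (dm s' aMK (it T x0) 0 = 0 -> oz (it T x0) <> 0)) s.
Proof.
 intros HB HM HV Hx0 HT. pose proof qW as HqW'.
 apply wp_while with (m := fun s' => N.to_nat (q - env s' gT)) (I := fun a s' => CB s' ol /\
  env s' gT = N.of_nat a /\ env s' gV = it a x0 /\
  (forall i, (i < a)%nat -> dm s' aSK (N.of_nat i) 0 = it i x0 /\ oz (it i x0) = 0) /\
  NoDup (ol ++ stk a x0) /\ marks s' ol (stk a x0)).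
 - intros a s1 (B1 & T1 & V1 & S1 & N1 & M1) Hc. vredh Hc. rewrite V1 in Hc.
  set (v := it a x0) in *. assert (Hv : v < q) by (apply itz_lt; auto).
  pose proof (M1 v Hv) as Mv. rewrite (cb_OU _ _ B1) in Hc by auto.
  assert (Hoz : oz v <= 1) by (unfold oz; destruct (snd _ mod _ =? 0); lia).
  assert (HW4 : 4 < 2 ^ W) by lia.
  assert (Hmk : dm s1 aMK v 0 <= 2) by (destruct Mv as [[_ ->]|[(_ & _ & ->)|(_ & _ & ->)]]; lia).
  rewrite N.mod_small in Hc by lia. assert (Ho : oz v = 0 /\ dm s1 aMK v 0 = 0) by lia. clear Hc.
  destruct Ho as [Ho Hm0]. assert (Hnin : ~ In v ol /\ ~ In v (stk a x0)).
  { destruct Mv as [[_ E]|[(_ & _ & E)|(? & ? & _)]]; [lia|lia|auto]. }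
  assert (N2 : NoDup (ol ++ stk (S a) x0)).
  { rewrite stk_S, app_assoc. apply NoDup_snoc; auto. rewrite in_app_iff. tauto. }
  (* By the pigeonhole principle, distinct states bound the stack; this gives termination and
     excludes an overflow of [gT]. *)
  assert (Hlen : N.of_nat (length (ol ++ stk (S a) x0)) <= q).
  { apply nodup_len; auto. intros y Hy. apply in_app_iff in Hy as [Hy|Hy]; [apply (cb_lt _ _ B1); auto|].
   apply stk_in in Hy as (i & _ & ->). apply itz_lt; auto. }
  unfold stk in Hlen. rewrite length_app, length_map, length_seq in Hlen.
  apply wp_st_seq, wp_st_seq, wp_set_seq, wp_set. vm. rewrite V1, T1. fold v.
  rewrite N.mod_small by lia. rewrite (cb_NX _ _ B1) by auto. rewrite !Nat.add_0_r.
  split; [|lia]. split.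
  { eapply CB_ext; [exact B1| | |].
   - destruct (cb_par _ _ B1) as (? & ? & ?). unfold params. vs. auto.
   - vs. auto.
   - intros [A1 A2] i j HA. cbn [fst] in HA. cbn [upd updm dm].
    destruct (peqb_spec (A1, A2) aSK) as [EE|]; [inversion EE; lia|].
    destruct (peqb_spec (A1, A2) aMK) as [EE|]; [inversion EE; lia|]. reflexivity. }
  split; [lia|]. split; [reflexivity|]. split.
  { intros i Hi. destruct (N.eqb_spec (N.of_nat i) (N.of_nat a)) as [E|E].
   - assert (i = a) by lia. subst i. auto.
   - apply S1. lia. }
  sp. intros y Hy. vm. rewrite stk_S, in_app_iff.
  destruct (N.eqb_spec y v) as [->|Hyv].
  + right. left. split; [tauto|]. split; [right; simpl; auto|auto].
  + destruct (M1 y Hy) as [?|[(? & ? & ?)|(? & ? & ?)]]; [auto|right; left; auto|right; right].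
   split; auto. split; auto. intros [?|[?|[]]]; [auto|apply Hyv; symmetry; auto].
 - intros a s1 (B1 & T1 & V1 & S1 & N1 & M1) Hc. sp. exists a.
  sp. sp. sp. sp. sp. sp.
  intros Hm0 Ho. vredh Hc. rewrite V1, (cb_OU _ _ B1), Hm0, Ho in Hc by (apply itz_lt; auto).
  rewrite N.mod_small in Hc by lia. discriminate.
 - sp. sp. sp. split; [lia|]. split.
  { simpl. rewrite app_nil_r. apply HB. }
  auto.
Qed.

Lemma it_period l v k : it l v = v -> it k v = it (k mod l) v.
Proof.
 intros E. destruct l as [|l]; [now rewrite Nat.mod_0_r|].
 transitivity (it (k mod S l + k / S l * S l) v); [f_equal; pose proof (Nat.div_mod_eq k (S l)); lia|].
 rewrite itz_add. f_equal.
 induction (k / S l)%nat as [|m IH]; [reflexivity|]. rewrite Nat.mul_succ_l, Nat.add_comm, itz_add, IH. auto.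
Qed.

(** The common outcome of the three ways in which a walk can end: the state following the remaining
    stack is finished, so the stack can be popped one state after another, each time with a finished
    successor. *)
Definition MID_post (x0 : N) (ol : list N) (T : nat) (n : nat) (s' : vst) : Prop :=
 exists ol1 T', CB s' ol1 /\ (T' <= T)%nat /\ env s' gT = N.of_nat T' /\
  (forall i, (i < T')%nat -> dm s' aSK (N.of_nat i) 0 = it i x0 /\ oz (it i x0) = 0) /\
  NoDup (ol1 ++ stk T' x0) /\ marks s' ol1 (stk T' x0) /\ Cyc s' ol1 (stk T' x0) /\
  In (it T' x0) ol1 /\ incl ol ol1 /\ (length ol + T <= length ol1 + T')%nat /\ (n <= T)%nat.

Lemma marks_push s s' ol st x : marks s (ol) (st) -> x < q -> In x (ol ++ st ++ [x]) ->
 dm s' aMK x 0 = 2 -> (forall y, y <> x -> dm s' aMK y 0 = dm s aMK y 0) -> marks s' (ol ++ [x]) st.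
Proof.
 intros HM Hx _ E1 E2 y Hy. rewrite in_app_iff. destruct (N.eq_dec y x) as [->|Hn].
 - left. simpl. auto.
 - rewrite E2 by auto. destruct (HM y Hy) as [[? ?]|[(? & ? & ?)|(? & ? & ?)]]; [auto|right; left|right; right];
   (split; [intros [?|[?|[]]]; auto; congruence|auto]).
Qed.

Lemma Cyc_push s s' ol rem rem' x : Cyc s ol rem -> ~ In x ol ->
 (forall y, In y (ol ++ rem) -> In y ((ol ++ [x]) ++ rem')) ->
 (forall y, In y ol -> dm s' aCU y 0 = dm s aCU y 0) ->
 (forall y, In y (ol ++ rem) -> dm s' aMB y 0 = dm s aMB y 0) ->
 (dm s' aCU x 0 <> 0 -> oz x = 0 /\ forall k, oz (it k (gz x)) = 0 /\
   dm s' aMB (it k (gz x)) 0 = it (k * Bn) (gz x) /\ In (it k (gz x)) ((ol ++ [x]) ++ rem')) ->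
 Cyc s' (ol ++ [x]) rem'.
Proof.
 intros HC Hx Hin E1 E2 E3 r Hr Hc. apply in_app_iff in Hr as [Hr|[<-|[]]]; [|auto].
 rewrite E1 in Hc by auto. destruct (HC r Hr Hc) as [A B]. split; auto. intros k.
 destruct (B k) as (B1 & B2 & B3). rewrite E2 by auto. auto.
Qed.

Lemma NZROOT_spec s ol T x0 : CB s ol -> x0 < q -> env s gT = N.of_nat T -> env s gV = it T x0 ->
 (forall i, (i < T)%nat -> dm s aSK (N.of_nat i) 0 = it i x0 /\ oz (it i x0) = 0) ->
 NoDup (ol ++ stk T x0) -> marks s ol (stk T x0) -> Cyc s ol [] -> dm s aMK (it T x0) 0 = 0 -> oz (it T x0) <> 0 ->
 wp NZROOT (MID_post x0 ol T) s.
Proof.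
 intros HB Hx0 HT HV HS HN HM HC Hm Ho. pose proof qW as HqW'. set (v := it T x0) in *.
 assert (Hv : v < q) by (apply itz_lt; auto).
 assert (Hnin : ~ In v ol /\ ~ In v (stk T x0)).
 { destruct (HM v Hv) as [[_ E]|[(_ & _ & E)|(? & ? & _)]]; [lia|lia|auto]. }
 assert (Hlen : N.of_nat (length ol) <= q) by (apply nodup_len; apply HB).
 pose proof (cb_C _ _ HB) as HCn.
 unfold NZROOT, PUSH. do 5 apply wp_st_seq. apply wp_set. vm. rewrite HV, HCn. rewrite !N.mod_small by lia.
 set (s' := upd _ _ _). exists (ol ++ [v]), T.
 assert (CB1 : CB s' (ol ++ [v])).
 { eapply CB_push; [exact HB|tauto|auto|..]; unfold s'; vm; auto.
  - destruct (cb_par _ _ HB) as (? & ? & ?). unfold params. vs. auto.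
  - lia.
  - rewrite HCn, N.eqb_refl. auto.
  - intros i Hi. destruct (N.eqb_spec i (N.of_nat (length ol))); [congruence|auto].
  - intros y Hy. vm. destruct (N.eqb_spec y v); [congruence|auto].
  - left. vm. repeat split; auto; congruence.
  - lia. }
 split; [exact CB1|]. split; [lia|]. split; [unfold s'; vs; auto|]. split; [exact HS|]. split.
 { rewrite <- app_assoc. apply NoDup_app_intro3; tauto. }
 split.
 { eapply marks_push; eauto; [apply in_app_iff; right; apply in_app_iff; simpl; auto|..]; unfold s'; vm; auto.
  intros y Hy. vm. destruct (N.eqb_spec y v); [congruence|auto]. }
 split.
 { eapply Cyc_push; [exact HC|tauto|..]; unfold s'; vm; auto.
  - intros y. rewrite app_nil_r, !in_app_iff. auto.
  - intros y Hy. destruct (N.eqb_spec y v) as [->|]; [tauto|auto].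
  - intros; congruence. }
 split; [apply in_app_iff; simpl; auto|]. split; [intros y ?; apply in_app_iff; auto|].
 rewrite length_app. simpl. lia.
Qed.

Lemma CYCLE_spec s ol T x0 : CB s ol -> x0 < q -> env s gT = N.of_nat T -> env s gV = it T x0 ->
 (forall i, (i < T)%nat -> dm s aSK (N.of_nat i) 0 = it i x0 /\ oz (it i x0) = 0) ->
 NoDup (ol ++ stk T x0) -> marks s ol (stk T x0) -> Cyc s ol [] -> dm s aMK (it T x0) 0 = 1 ->
 wp CYCLE (MID_post x0 ol T) s.
Proof.
 intros HB Hx0 HT HV HS HN HM HC Hm. pose proof qW as HqW'. set (v := it T x0) in *.
 assert (Hv : v < q) by (apply itz_lt; auto).
 assert (Hin : In v (stk T x0)).
 { destruct (HM v Hv) as [[_ E]|[(_ & ? & E)|(_ & _ & E)]]; [lia|auto|lia]. }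
 apply stk_in in Hin as (i0 & Hi0 & Ev).
 destruct T as [|T]; [lia|]. set (r := it T x0). assert (Hgr : gz r = v) by reflexivity.
 assert (Hr : r < q) by (apply itz_lt; auto).
 rewrite stk_S in HN. fold r in HN.
 assert (HNs : NoDup (stk (S T) x0)).
 { rewrite stk_S. apply NoDup_app_remove_l in HN. auto. }
 assert (Hnr : ~ In r ol /\ ~ In r (stk T x0)).
 { rewrite app_assoc in HN. apply NoDup_remove_2 in HN. rewrite app_nil_r, in_app_iff in HN. tauto. }
 assert (Hlen : N.of_nat (length ol) <= q) by (apply nodup_len; apply HB).
 (* [v] occurred as entry [i0] of the stack and recurs after [S T] steps. Its iterates therefore
    have period [l], run through the stack entries from [i0] on, and are distinct within one
    period. *)
 set (l := (S T - i0)%nat). assert (Hl : (0 < l)%nat) by (unfold l; lia).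
 assert (Hper : it l v = v).
 { rewrite Ev at 1. rewrite <- itz_add. unfold l. replace (S T - i0 + i0)%nat with (S T) by lia. reflexivity. }
 assert (Hvk : forall k, it k v = it (i0 + k mod l) x0 /\ (i0 + k mod l < S T)%nat).
 { intros k. pose proof (Nat.mod_upper_bound k l ltac:(lia)). split; [|unfold l in *; lia].
  rewrite (it_period l v k Hper), Ev, <- itz_add. f_equal. lia. }
 assert (Hozk : forall k, oz (it k v) = 0) by (intros k; destruct (Hvk k) as [-> ?]; apply HS; lia).
 assert (Hvin : forall k, In (it k v) (stk (S T) x0)).
 { intros k. destruct (Hvk k) as [E ?]. apply stk_in. eauto. }
 pose proof (cb_C _ _ HB) as HCn. destruct (cb_par _ _ HB) as (P1 & P2 & P3).
 unfold CYCLE, PUSH. apply wp_set_seq, wp_set_seq. vs. rewrite HT.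
 replace (N.of_nat (S T) - 1) with (N.of_nat T) by lia. destruct (HS T ltac:(lia)) as [ESr Eor]. rewrite ESr. fold r.
 do 3 apply wp_st_seq. apply wp_seq. do 2 apply wp_st_seq. apply wp_set. apply wp_set_seq, wp_set_seq, wp_set_seq. vm.
 rewrite HCn, HV. rewrite !N.mod_small by lia. fold v.
 set (s1 := upd _ gJ 1).
 assert (HM1 : marks s1 (ol ++ [r]) (stk T x0)).
 { intros y Hy. unfold s1. vm. rewrite in_app_iff. destruct (N.eqb_spec y r) as [->|Hyr]; [left; simpl; auto|].
  destruct (HM y Hy) as [[? ?]|[(? & Hst & ?)|(? & Hst & ?)]]; [auto|right; left|right; right];
   rewrite stk_S, in_app_iff in Hst.
  - split; [intros [?|[?|[]]]; auto; congruence|]. destruct Hst as [?|[?|[]]]; [auto|unfold r in Hyr; congruence].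
  - split; [intros [?|[?|[]]]; auto; congruence|]. auto. }
 assert (HB1 : CB s1 (ol ++ [r])).
 { eapply CB_push; [exact HB|tauto|auto|..]; unfold s1; vm; auto.
  - unfold params. vs. auto.
  - lia.
  - rewrite HCn, N.eqb_refl. auto.
  - intros i Hi. destruct (N.eqb_spec i (N.of_nat (length ol))); [congruence|auto].
  - intros y Hy. vm. destruct (N.eqb_spec y r); [congruence|auto].
  - left. vm. rewrite ?N.eqb_refl. sp. sp. unfold r. rewrite Eor. split; [discriminate|congruence].
  - rewrite ?N.eqb_refl. lia. }
 assert (HSK1 : forall i, (i < S T)%nat -> dm s1 aSK (N.of_nat i) 0 = it i x0) by (intros i Hi; apply HS; auto).
 assert (HMB0 : forall y, dm s1 aMB y 0 = dm s aMB y 0) by (intros; reflexivity).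
 assert (HCU1 : forall y, dm s1 aCU y 0 = if y =? r then 1 else dm s aCU y 0) by (intros; unfold s1; vm; auto).
 assert (E1 : env s1 gT = N.of_nat T /\ env s1 gV = v /\ env s1 gY = v /\ env s1 gM = v /\ env s1 gJ = 1) by (unfold s1; vs; auto).
 clearbody s1. destruct E1 as (ET & EV1 & EY1 & EM1 & EJ1). rewrite ?Nat.add_0_l.
 (* [gJ] is nonzero exactly until [gY] is back at [v]; this happens after at most [l] steps, and
    meanwhile no entry is written twice. *)
 apply wp_while_bound with (L := l)
  (I := fun a s' => CB s' (ol ++ [r]) /\ marks s' (ol ++ [r]) (stk T x0) /\ env s' gT = N.of_nat T /\ env s' gV = v /\
   (forall A i j, fst A <> 9%nat -> dm s' A i j = dm s1 A i j) /\
   env s' gY = it a v /\ env s' gM = it (a * Bn) v /\ (a <= l)%nat /\ (env s' gJ = 0 -> (0 < a)%nat /\ it a v = v) /\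
   (env s' gJ <> 0 -> (a < l)%nat) /\
   (forall k, (k < a)%nat -> dm s' aMB (it k v) 0 = it (k * Bn) v) /\
   (forall y, ~ In y (stk (S T) x0) -> dm s' aMB y 0 = dm s aMB y 0)).
 - intros a s2 (B2 & M2 & T2 & V2 & D2 & Y2 & G2 & A2 & J2 & J2' & K2 & O2) Hc. vredh Hc. specialize (J2' Hc).
  sp.
  apply wp_st_seq, wp_set_seq, wp_set_seq, wp_set. vm. rewrite V2, Y2, G2.
  destruct (cb_par _ _ B2) as (Q1 & Q2 & Q3). rewrite Q3. pose proof (pow2_1 b).
  assert (Hak : it a v < q /\ it (a * Bn) v < q) by (split; apply itz_lt; auto).
  rewrite !(cb_NX _ _ B2) by apply Hak.
  rewrite (cb_JT _ _ B2) by (try apply Hak; lia). rewrite (cb_NX _ _ B2) by (apply itz_lt, Hak).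
  assert (Egm : gz (it (N.to_nat (2 ^ b - 1)) (it (a * Bn) v)) = it (S a * Bn) v).
  { rewrite <- itz_add. change (gz (it (N.to_nat (2 ^ b - 1) + a * Bn) v)) with (it (S (N.to_nat (2 ^ b - 1) + a * Bn)) v).
   f_equal. lia. }
  rewrite Egm. rewrite Nat.add_0_r.
  change (gz (it a v)) with (it (S a) v).
  assert (Hbool : (((if it (S a) v <? v then 1 else 0) + (if v <? it (S a) v then 1 else 0)) mod 2 ^ W = 0 <-> it (S a) v = v)).
  { destruct (N.ltb_spec (it (S a) v) v), (N.ltb_spec v (it (S a) v)); rewrite N.mod_small by lia; lia. }
  set (jv := _ mod 2 ^ W) in *. clearbody jv.
  split.
  { eapply CB_ext; [exact B2| | |].
   - unfold params. vs. auto.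
   - vs. auto.
   - intros [A1 A3] i j HA. cbn [fst] in HA. cbn [upd updm dm].
    destruct (peqb_spec (A1, A3) aMB) as [EE|]; [inversion EE; lia|]. reflexivity. }
  split; [exact M2|]. sp. sp. split.
  { intros [A1 A3] i j HA. cbn [fst] in HA. cbn [upd updm dm].
   destruct (peqb_spec (A1, A3) aMB) as [EE|]; [inversion EE; lia|]. apply D2; auto. }
  sp. sp. split; [lia|]. split; [intros E; split; [lia|apply Hbool; auto]|]. split.
  { intros E. destruct (Nat.eq_dec (S a) l) as [El|]; [|lia]. exfalso. apply E, Hbool. rewrite El. auto. }
  split.
  { intros k Hk. destruct (N.eqb_spec (it k v) (it a v)) as [E|E].
   - destruct (Hvk k) as [E1 L1], (Hvk a) as [E2 L2]. rewrite E1, E2 in E. apply stk_inj with (T := S T) in E; auto.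
    rewrite !Nat.mod_small in E by lia. replace k with a by lia. auto.
   - apply K2. destruct (Nat.eq_dec k a) as [->|]; [congruence|lia]. }
  intros y Hy. destruct (N.eqb_spec y (it a v)) as [->|]; cbn [andb]; [exfalso; auto|auto].
 - intros a s2 (B2 & M2 & T2 & V2 & D2 & Y2 & G2 & A2 & J2 & J2' & K2 & O2) Hc. vredh Hc. destruct (J2 Hc) as [Ha Hav].
  exists (ol ++ [r]), T. sp. split; [lia|]. sp. split.
  { intros i Hi. rewrite D2 by (cbn [fst]; lia). split; [apply HSK1; lia|apply HS; lia]. }
  split.
  { rewrite <- app_assoc. apply NoDup_app_intro3; try tauto. rewrite app_assoc in HN. apply NoDup_app_remove_r in HN. auto. }
  sp. split.
  { eapply Cyc_push with (s := s); [exact HC|tauto|..].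
   - intros y. rewrite app_nil_r, !in_app_iff. auto.
   - intros y Hy. rewrite D2 by (cbn [fst]; lia). rewrite HCU1. destruct (N.eqb_spec y r) as [->|]; [tauto|auto].
   - intros y Hy. rewrite app_nil_r in Hy. apply O2. intros Hst. rewrite stk_S in Hst.
    fold r in Hst. revert HN Hst Hy. clear. intros HN Hst Hy. eapply NoDup_app_disj; eauto.
   - intros _. split; [apply HS; lia|]. rewrite Hgr. intros k. sp. split.
    (* Since [a] is a period, [k] may be reduced modulo [a] both before and after the multiplication
       by [2 ^ b]. *)
    + rewrite (it_period a v k Hav). rewrite K2 by (apply Nat.mod_upper_bound; lia).
     replace (k * Bn)%nat with (k mod a * Bn + (k / a * Bn) * a)%nat by (pose proof (Nat.div_mod_eq k a); nia).
     rewrite itz_add. f_equal. rewrite (it_period a v _ Hav), Nat.Div0.mod_mul. reflexivity.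
    + specialize (Hvin k). rewrite stk_S in Hvin. fold r in Hvin. rewrite !in_app_iff in *. tauto. }
  split; [apply in_app_iff; simpl; auto|]. split; [intros y ?; apply in_app_iff; auto|].
  rewrite length_app. simpl. unfold l in A2. lia.
 - sp. sp. sp. sp. sp. split; [rewrite EY1; auto|].
  split; [rewrite EM1; auto|]. split; [lia|]. split; [rewrite EJ1; discriminate|]. sp. split; [lia|]. auto.
Qed.

Lemma forest_le DI RO CU ol x : forest DI RO CU ol -> In x ol -> DI x < N.of_nat (length ol).
Proof.
 intros H Hx. apply in_split in Hx as (l1 & l2 & ->). destruct (H l1 x l2 eq_refl) as [_ Hd].
 rewrite length_app. simpl. lia.
Qed.

(** The successor of the topmost state is finished at every moment, so distance and root can be read
    off it; finishing the state restores this for the next one. *)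
Lemma POPS_spec s ol1 T x0 : CB s ol1 -> x0 < q -> env s gT = N.of_nat T ->
 (forall i, (i < T)%nat -> dm s aSK (N.of_nat i) 0 = it i x0 /\ oz (it i x0) = 0) ->
 NoDup (ol1 ++ stk T x0) -> marks s ol1 (stk T x0) -> Cyc s ol1 (stk T x0) -> In (it T x0) ol1 ->
 wp POPS (fun n s' => exists ol2, CB s' ol2 /\ incl ol1 ol2 /\ In x0 ol2 /\ marks s' ol2 [] /\ Cyc s' ol2 [] /\
  length ol2 = (length ol1 + T)%nat /\ n = T) s.
Proof.
 intros HB Hx0 HT HS HN HM HC Hin. pose proof qW as HqW'.
 apply wp_while_bound with (L := T) (I := fun a s' => (a <= T)%nat /\ env s' gT = N.of_nat (T - a) /\
  exists ol2, CB s' ol2 /\ incl ol1 ol2 /\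
  (forall i, (i < T - a)%nat -> dm s' aSK (N.of_nat i) 0 = it i x0) /\
  NoDup (ol2 ++ stk (T - a) x0) /\ marks s' ol2 (stk (T - a) x0) /\ Cyc s' ol2 (stk (T - a) x0) /\
  In (it (T - a) x0) ol2 /\ length ol2 = (length ol1 + a)%nat).
 - intros a s1 (Ha & T1 & ol2 & B1 & I1 & S1 & N1 & M1 & C1 & In1 & L1) Hc. vredh Hc.
  assert (Ha' : (a < T)%nat) by lia. sp.
  replace (T - a)%nat with (S (T - S a)) in * by lia. set (j := (T - S a)%nat) in *. set (y := it j x0) in *.
  assert (Hy : y < q) by (apply itz_lt; auto).
  rewrite stk_S in N1, M1, C1. fold y in N1, M1, C1.
  assert (Hny : ~ In y ol2 /\ ~ In y (stk j x0)).
  { rewrite app_assoc in N1. apply NoDup_remove_2 in N1. rewrite app_nil_r, in_app_iff in N1. tauto. }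
  assert (Hlen : N.of_nat (length ol2) <= q) by (eapply nodup_len; eauto; apply B1).
  pose proof (cb_C _ _ B1) as HCn. destruct (cb_par _ _ B1) as (P1 & P2 & P3).
  change (it (S j) x0) with (gz y) in In1.
  assert (HDI : dm s1 aDI (gz y) 0 < N.of_nat (length ol2)) by (apply (forest_le _ _ _ _ _ (cb_for _ _ B1)); auto).
  assert (Hgy : gz y <> y) by (intros E; rewrite E in In1; tauto).
  unfold PUSH. do 2 apply wp_set_seq. vs. rewrite T1.
  replace (N.of_nat (S j) - 1) with (N.of_nat j) by lia. rewrite S1 by lia. fold y.
  do 5 apply wp_st_seq. apply wp_set. vm. rewrite HCn, !(cb_NX _ _ B1) by auto. rewrite !N.mod_small by lia.
  set (s' := upd _ _ _). rewrite ?Nat.add_0_r. fold j. split; [lia|]. split; [unfold s'; vs; lia|]. exists (ol2 ++ [y]).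
  assert (E1 : dm s' aDI y 0 = dm s1 aDI (gz y) 0 + 1) by (unfold s'; vm; rewrite ?N.eqb_refl; auto).
  assert (E2 : dm s' aRO y 0 = dm s1 aRO (gz y) 0) by (unfold s'; vm; rewrite ?N.eqb_refl; auto).
  assert (Ez : forall z, z <> y -> dm s' aDI z 0 = dm s1 aDI z 0 /\ dm s' aRO z 0 = dm s1 aRO z 0 /\ dm s' aCU z 0 = dm s1 aCU z 0
    /\ dm s' aMK z 0 = dm s1 aMK z 0).
  { intros z Hz. unfold s'. vm. destruct (N.eqb_spec z y); [congruence|]. cbn [andb]. auto. }
  assert (CB1 : CB s' (ol2 ++ [y])).
  { eapply (CB_push s1 s' ol2 y B1); [tauto|auto|..].
   - unfold s', params. vs. auto.
   - unfold s'. vs. lia.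
   - intros; reflexivity.
   - intros; reflexivity.
   - intros; reflexivity.
   - unfold s'. vm. rewrite HCn, N.eqb_refl. auto.
   - intros i Hi. unfold s'. vm. destruct (N.eqb_spec i (N.of_nat (length ol2))); [congruence|auto].
   - intros z Hz. destruct (Ez z Hz) as (? & ? & ? & ?). auto.
   - right. split; [apply HS; lia|]. sp. destruct (Ez (gz y) Hgy) as (F1 & F2 & _).
    rewrite E1, E2, F1, F2. auto.
   - rewrite E1. lia. }
  sp. split; [intros z ?; apply in_app_iff; auto|]. split; [intros; apply S1; lia|]. split.
  { rewrite <- app_assoc. apply NoDup_app_intro3; try tauto. rewrite app_assoc in N1. apply NoDup_app_remove_r in N1. auto. }
  split.
  { intros z Hz. rewrite in_app_iff. destruct (N.eq_dec z y) as [->|Hzy].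
   - left. split; [simpl; auto|]. unfold s'. vm. rewrite ?N.eqb_refl. auto.
   - destruct (Ez z Hzy) as (_ & _ & _ & F). rewrite F.
    destruct (M1 z Hz) as [[? ?]|[(? & Hst & ?)|(? & Hst & ?)]]; [auto|right; left|right; right]; rewrite in_app_iff in Hst.
    + split; [intros [?|[?|[]]]; auto; congruence|]. destruct Hst as [?|[?|[]]]; [auto|congruence].
    + split; [intros [?|[?|[]]]; auto; congruence|]. auto. }
  split.
  { eapply Cyc_push; [exact C1|tauto|..].
   - intros z. rewrite !in_app_iff. simpl. tauto.
   - intros z Hz. apply Ez. intros ->. tauto.
   - intros; reflexivity.
   - unfold s'. vm. rewrite ?N.eqb_refl. cbn [andb]. congruence. }
  split; [apply in_app_iff; simpl; auto|]. rewrite length_app. simpl. lia.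
 - intros a s1 (Ha & T1 & ol2 & B1 & I1 & S1 & N1 & M1 & C1 & In1 & L1) Hc. vredh Hc.
  assert (a = T) by lia. subst a. rewrite Nat.sub_diag in *. exists ol2. auto 10.
 - split; [lia|]. rewrite Nat.sub_0_r. sp. exists ol1. sp. split; [apply incl_refl|].
  split; [intros; apply HS; auto|]. auto.
Qed.

(** Amortization: a state is pushed once, lies on at most one new cycle and is popped at most once,
    which accounts for three iterations per finished state; the outer loop adds one per start. *)
Lemma COLOR_spec s : params s -> next_data q s -> jt_data s ->
 wp COLOR (fun n s' => exists ol, CB s' ol /\ (forall x, x < q -> In x ol) /\ Cyc s' ol [] /\ N.of_nat n <= 4 * q) s.
Proof.
 intros HP HN HJ. pose proof (qW) as HqW'. unfold COLOR. do 2 apply wp_set_seq.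
 apply wp_while with (m := fun s' => N.to_nat (q - env s' gI)) (I := fun a s' => exists ol,
  CB s' ol /\ env s' gI <= q /\ (forall x, x < env s' gI -> In x ol) /\ marks s' ol [] /\ Cyc s' ol [] /\
  N.of_nat a <= env s' gI + 3 * N.of_nat (length ol)).
 - intros a s1 (ol & B1 & L1 & I1 & M1 & C1 & A1) Hc. vredh Hc.
  pose proof (cb_par _ _ B1) as (P1 & P2 & P3). rewrite P1 in Hc.
  destruct (N.ltb_spec (env s1 gI) q) as [Hlt|]; [|lia]. clear Hc. set (x0 := env s1 gI) in *.
  do 2 apply wp_set_seq. apply wp_seq. vs. fold x0.
  eapply wp_mono.
  { apply (WALK_spec _ ol x0); vs; auto.
   eapply (CB_ext _ _ _ B1); vs; auto. unfold params. vs. auto. }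
  intros n1 s2 Fr1 (B2 & T & -> & T2 & V2 & S2 & N2 & M2 & Z2).
  assert (C2 : Cyc s2 ol []).
  { intros r Hr Hcu. rewrite (fa Fr1) in Hcu by reflexivity. destruct (C1 r Hr Hcu) as [G1 G2]. split; auto.
   intros k. rewrite (fa Fr1) by reflexivity. apply G2. }
  assert (EI2 : env s2 gI = x0) by (rewrite (fv Fr1) by reflexivity; reflexivity).
  apply wp_seq.
  eapply wp_mono with (Q := fun n s3 => MID_post x0 ol T n s3).
  { set (v := it T x0) in *. assert (Hv : v < q) by (apply itz_lt; auto).
   pose proof (M2 v Hv) as Mv. apply wp_if; vs; rewrite V2; fold v; intros Hm.
   - apply wp_if; vs; rewrite V2; fold v; destruct (N.ltb_spec 1 (dm s2 aMK v 0)) as [Hm2|Hm2]; try lia; intros _.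
    + apply wp_skip. destruct Mv as [[Hin _]|[(_ & _ & E)|(_ & _ & E)]]; [|lia|lia].
     exists ol, T. sp. split; [lia|]. sp. sp. sp. sp.
     split; [|split; [auto|split; [apply incl_refl|lia]]].
     intros r Hr Hcu. destruct (C2 r Hr Hcu) as [G1 G2]. split; auto. intros k. destruct (G2 k) as (G3 & G4 & G5).
     split; auto. split; auto. rewrite app_nil_r in G5. apply in_app_iff. auto.
    + apply (CYCLE_spec); auto. fold v. lia.
   - apply (NZROOT_spec); auto. }
  intros n3 s3 Fr3 (ol1 & T' & B3 & L3 & T3 & S3 & N3 & M3 & C3 & In3 & Inc3 & Len3 & Cost3).
  assert (EI3 : env s3 gI = x0) by (rewrite (fv Fr3) by reflexivity; auto).
  apply wp_seq. eapply wp_mono.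
  { apply (POPS_spec s3 ol1 T' x0); auto. }
  intros n4 s4 Fr4 (ol2 & B4 & Inc4 & In4 & M4 & C4 & Len4 & ->).
  assert (EI4 : env s4 gI = x0) by (rewrite (fv Fr4) by reflexivity; auto).
  apply wp_set. vs. rewrite EI4. rewrite N.mod_small by lia. split; [|lia]. exists ol2. split.
  { eapply (CB_ext _ _ _ B4); vs; auto. destruct (cb_par _ _ B4) as (? & ? & ?). unfold params. vs. auto. }
  split; [lia|]. split.
  { intros x Hx. destruct (N.eq_dec x x0) as [->|]; auto. apply Inc4, Inc3, I1. lia. }
  split; [exact M4|]. split; [exact C4|]. lia.
 - intros a s1 (ol & B1 & L1 & I1 & M1 & C1 & A1) Hc. vredh Hc.
  pose proof (cb_par _ _ B1) as (P1 & P2 & P3). rewrite P1 in Hc.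
  destruct (N.ltb_spec (env s1 gI) q) as [Hlt|]; [lia|]. assert (E : env s1 gI = q) by lia. rewrite E in *.
  exists ol. sp. sp. sp.
  assert (Hlen : N.of_nat (length ol) <= q) by (eapply nodup_len; eauto; apply B1). lia.
 - exists []. vs. split; [|split; [lia|split; [intros; lia|split; [|split; [intros r []|simpl; lia]]]]].
  + constructor; vs; auto.
   * intros; apply HN; auto.
   * intros; apply HN; auto.
   * constructor.
   * intros x [].
   * simpl. lia.
   * intros l1 x l2 E. destruct l1; discriminate.
  + intros x Hx. right. right. vs. sp. sp. apply HN; auto.
Qed.

(** The part of the data that concerns heights: [done] lists the states that have been processed. *)
Definition ladders (DI : N -> N) (s : vst) (i : N) (done : list N) : Prop :=
 (forall x, x < q -> dm s aLF x 0 < q /\ it (N.to_nat (dm s aH x 0)) (dm s aLF x 0) = x /\ dm s aH x 0 + i <= q /\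
   forall j, j < 2 ^ b * dm s aH x 0 -> dm s aLAD (dm s aLF x 0) j = it (N.to_nat j) (dm s aLF x 0)) /\
 (forall x, In x done -> dm s aH x 0 + 1 <= q /\
   (forall j, j < 2 ^ b * (dm s aH x 0 + 1) -> dm s aLAD (dm s aLF x 0) j = it (N.to_nat j) (dm s aLF x 0)) /\
   (0 < DI x -> dm s aH x 0 + 1 <= dm s aH (gz x) 0)).

Lemma skipn_nth (l : list N) i : (i < length l)%nat -> skipn i l = nth i l 0 :: skipn (S i) l.
Proof.
 revert i. induction l as [|a l IH]; intros [|i] H; simpl in *; try lia; auto. apply IH. lia.
Qed.

Lemma TREES_spec s ol : CB s ol -> (forall x, x < q -> In x ol) -> (forall x, x < q -> dm s aH x 0 = 0 /\ dm s aLF x 0 = x) ->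
 wp TREES (fun n s' => ladders (fun x => dm s aDI x 0) s' 0 ol /\ N.of_nat n <= q * (1 + 2 ^ b)) s.
Proof.
 intros HB Hall H0. pose proof (qW) as HqW'. unfold TREES. apply wp_set_seq.
 assert (Hlen : N.of_nat (length ol) <= q) by (eapply nodup_len; eauto; apply HB).
 set (DI := fun x => dm s aDI x 0). pose proof (pow2_1 b) as HB1.
 destruct (cb_par _ _ HB) as (P1 & P2 & P3).
 apply wp_while with (m := fun s' => N.to_nat (env s' gI)) (I := fun a s' => exists i, env s' gI = N.of_nat i /\ (i <= length ol)%nat /\
  params s' /\ (forall A k j, ~ (5 <= fst A <= 7)%nat -> dm s' A k j = dm s A k j) /\
  ladders DI s' (N.of_nat i) (skipn i ol) /\ N.of_nat a <= N.of_nat (length ol - i) * (1 + 2 ^ b)).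
 - intros a s1 (i & Ei & Li & (Q1 & Q2 & Q3) & D1 & [G1 G2] & A1) Hc. vredh Hc. destruct i as [|i]; [lia|].
  set (v := nth i ol 0).
  assert (Hsk : skipn i ol = v :: skipn (S i) ol) by (apply skipn_nth; lia).
  assert (Hvin : In v ol) by (apply nth_In; lia). assert (Hv : v < q) by (apply (cb_lt _ _ HB); auto).
  destruct (G1 v Hv) as (Hl & Hit & Hh & Hlad). set (h := dm s1 aH v 0) in *. set (l := dm s1 aLF v 0) in *.
  assert (Hhq : h + 1 <= q) by lia.
  assert (Hm2 : (h + 1) * 2 ^ b <= q * 2 ^ b) by (apply N.mul_le_mono_r; auto).
  do 5 apply wp_set_seq. vs. rewrite Ei. replace (N.of_nat (S i) - 1) with (N.of_nat i) by lia.
  rewrite !D1 by (cbn [fst]; lia). rewrite (cb_OR _ _ HB) by lia. fold v. fold h. fold l. rewrite Q2.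
  rewrite (N.mod_small (h * 2 ^ b)) by nia.
  apply wp_seq.
  eapply wp_mono with (Q := fun n s2 => n = 0%nat /\ env s2 gY = it (N.to_nat (h * 2 ^ b)) l /\
   env s2 gI = N.of_nat i /\ env s2 gV = v /\ env s2 gH = h /\ env s2 gL = l /\ env s2 gJ = h * 2 ^ b /\ params s2 /\ dm s2 = dm s1).
  { apply wp_if; vs; intros Hh0; apply wp_set; vs.
   - rewrite Hlad by nia. rewrite D1 by (cbn [fst]; lia). rewrite (cb_NX _ _ HB) by (apply itz_lt; auto).
    sp. split; [|unfold params; vs; auto 10].
    replace (N.to_nat (h * 2 ^ b)) with (S (N.to_nat (h * 2 ^ b - 1))) by nia. reflexivity.
   - rewrite Hh0, N.mul_0_l. sp. split; [reflexivity|]. unfold params; vs; auto 10. }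
  intros n2 s2 _ (-> & Y2 & I2 & V2 & H2 & L2 & J2 & (R1' & R2' & R3') & D2).
  apply wp_set_seq. vs. rewrite H2, R2'. rewrite (N.mod_small (h + 1)) by lia. rewrite (N.mod_small ((h + 1) * 2 ^ b)) by lia.
  apply wp_seq. eapply wp_mono.
  { apply wp_while with (m := fun s' => N.to_nat ((h + 1) * 2 ^ b - env s' gJ))
    (I := fun a' s' => env s' gI = N.of_nat i /\ env s' gV = v /\ env s' gH = h /\ env s' gL = l /\ env s' gM = (h + 1) * 2 ^ b /\ params s' /\
     env s' gJ <= (h + 1) * 2 ^ b /\ env s' gY = it (N.to_nat (env s' gJ)) l /\ h * 2 ^ b + N.of_nat a' = env s' gJ /\
     (forall A k j, fst A <> 7%nat -> dm s' A k j = dm s1 A k j) /\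
     (forall j, j < env s' gJ -> dm s' aLAD l j = it (N.to_nat j) l) /\
     (forall k j, dm s' aLAD k j = dm s1 aLAD k j \/ (k = l /\ dm s' aLAD k j = it (N.to_nat j) l)))
    (Q := fun n s' => env s' gI = N.of_nat i /\ env s' gV = v /\ env s' gH = h /\ env s' gL = l /\ params s' /\
     N.of_nat n <= 2 ^ b /\
     (forall A k j, fst A <> 7%nat -> dm s' A k j = dm s1 A k j) /\
     (forall j, j < (h + 1) * 2 ^ b -> dm s' aLAD l j = it (N.to_nat j) l) /\
     (forall k j, dm s' aLAD k j = dm s1 aLAD k j \/ (k = l /\ dm s' aLAD k j = it (N.to_nat j) l))).
   - intros a' s3 (E1 & E2 & E3 & E4 & E5 & (E6 & E7 & E8) & E9 & E10 & E11 & E12 & E13 & E14) Hc'. vredh Hc'.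
    rewrite E5 in Hc'. destruct (N.ltb_spec (env s3 gJ) ((h + 1) * 2 ^ b)) as [Hlt|]; [|lia]. clear Hc'.
    apply wp_st_seq, wp_set_seq, wp_set. vm. rewrite E4, E10. rewrite N.mod_small by lia.
    rewrite E12, D1 by (cbn [fst]; lia). rewrite (cb_NX _ _ HB) by (apply itz_lt; auto).
    split; [|lia]. sp. sp. sp. sp. sp. split; [unfold params; vs; auto|].
    split; [lia|]. split; [rewrite N.add_1_r, N2Nat.inj_succ; reflexivity|]. split; [lia|]. split.
    { intros [A1' A2'] k j HA. cbn [fst] in HA. cbn [upd updm dm].
     destruct (peqb_spec (A1', A2') aLAD) as [EE|]; [inversion EE; lia|]. apply E12; auto. }
    split.
    { intros j Hj. rewrite ?N.eqb_refl. destruct (N.eqb_spec j (env s3 gJ)) as [->|]; cbn [andb]; auto. apply E13. lia. }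
    intros k j. destruct (N.eqb_spec k l) as [->|]; cbn [andb]; auto.
    destruct (N.eqb_spec j (env s3 gJ)) as [->|]; auto.
   - intros a' s3 (E1 & E2 & E3 & E4 & E5 & E6 & E9 & E10 & E11 & E12 & E13 & E14) Hc'. vredh Hc'.
    rewrite E5 in Hc'. destruct (N.ltb_spec (env s3 gJ) ((h + 1) * 2 ^ b)) as [|Hge]; [lia|]. clear Hc'.
    assert (EJ : env s3 gJ = (h + 1) * 2 ^ b) by lia. rewrite EJ in *.
    do 5 (split; [auto|]). split; [lia|]. auto.
   - vs. rewrite I2, V2, L2, J2, Y2, D2, H2. do 5 (split; [auto|]). split; [unfold params; vs; auto|].
    split; [nia|]. sp. split; [lia|]. sp. split; [|auto].
    intros j Hj. apply Hlad. lia. }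
  intros n3 s3 _ (E1 & E2 & E3 & E4 & E6 & E7 & E8 & E9 & E10).
  (* Ladder entries are only ever given their correct values, so correct entries stay correct even
     when several states share a leaf. *)
  assert (Lk : forall k j, dm s1 aLAD k j = it (N.to_nat j) k -> dm s3 aLAD k j = it (N.to_nat j) k).
  { intros k j HH. destruct (E10 k j) as [->|[-> ?]]; auto. }
  (* Treats all branches at once: either heights and leaves are unchanged, or only the parent of [v]
     takes over the leaf [l] with height [h + 1]. *)
  assert (Fin : forall s4, params s4 -> env s4 gI = N.of_nat i -> (forall A k j, ~ (5 <= fst A <= 6)%nat -> dm s4 A k j = dm s3 A k j) ->
    (forall x, dm s4 aH x 0 = dm s1 aH x 0 /\ dm s4 aLF x 0 = dm s1 aLF x 0 \/
     (0 < DI v /\ x = gz v /\ dm s1 aH x 0 < h + 1 /\ dm s4 aH x 0 = h + 1 /\ dm s4 aLF x 0 = l)) ->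
    (0 < DI v -> h + 1 <= dm s4 aH (gz v) 0) ->
    ladders DI s4 (N.of_nat i) (v :: skipn (S i) ol)).
  { intros s4 Z1 Z2 Z3 Z4 Z5.
   assert (ZL : forall k j, dm s4 aLAD k j = dm s3 aLAD k j) by (intros; apply Z3; cbn [fst]; lia).
   assert (Hge : forall x, dm s1 aH x 0 <= dm s4 aH x 0) by (intros x; destruct (Z4 x) as [[-> _]|(_ & _ & ? & -> & _)]; lia).
   split.
   - intros x Hx. destruct (G1 x Hx) as (W1 & W2 & W3 & W4). destruct (Z4 x) as [[-> ->]|(Y1 & -> & Y3 & -> & ->)].
    + sp. sp. split; [lia|]. intros j Hj. rewrite ZL. apply Lk, W4. auto.
    + sp. split.
     { rewrite N.add_1_r, N2Nat.inj_succ. change (gz (it (N.to_nat h) l) = gz v). rewrite Hit. auto. }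
     split; [lia|]. intros j Hj. rewrite ZL. apply E9. lia.
   - assert (Hsplit : ol = firstn i ol ++ v :: skipn (S i) ol) by (rewrite <- Hsk, firstn_skipn; auto).
    (* A parent was finished before its child and hence is still to be processed. So its update does
       not touch the states already done. *)
    assert (Hpar : 0 < DI v -> ~ In (gz v) (v :: skipn (S i) ol)).
    { intros Hd. destruct (cb_for _ _ HB _ _ _ Hsplit) as [[(? & _)|(_ & Hin & _)] _]; [unfold DI in Hd; lia|].
     pose proof (cb_nd _ _ HB) as Hnd. rewrite Hsplit in Hnd. intros Hin2.
     eapply NoDup_app_disj; eauto. }
    assert (Hsame : forall x, In x (v :: skipn (S i) ol) -> dm s4 aH x 0 = dm s1 aH x 0 /\ dm s4 aLF x 0 = dm s1 aLF x 0).
    { intros x Hx. destruct (Z4 x) as [?|(Y1 & -> & _)]; auto. exfalso. apply Hpar; auto. }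
    intros x Hx. destruct (Hsame x Hx) as [-> ->]. destruct Hx as [<-|Hx].
    + fold h l. sp. split; [|auto]. intros j Hj. rewrite ZL. apply E9. lia.
    + destruct (G2 x Hx) as (W1 & W2 & W3). sp. split.
     * intros j Hj. rewrite ZL. apply Lk, W2. auto.
     * intros Hd. specialize (W3 Hd). specialize (Hge (gz x)). lia. }
  assert (Hcost : forall n4, n4 = 0%nat -> N.of_nat (S (a + (0 + (n3 + n4)))) <= N.of_nat (length ol - i) * (1 + 2 ^ b)).
  { intros n4 ->. replace (length ol - i)%nat with (S (length ol - S i)) by lia. lia. }
  eapply wp_mono with (Q := fun n s4 => n = 0%nat /\ env s4 gI = N.of_nat i /\ params s4 /\
    (forall A k j, ~ (5 <= fst A <= 7)%nat -> dm s4 A k j = dm s A k j) /\ ladders DI s4 (N.of_nat i) (skipn i ol)).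
  2:{ intros n4 s4 _ (-> & K1 & K2 & K3 & K4). split; [|rewrite K1; lia]. exists i. sp. split; [lia|].
    sp. sp. sp. apply Hcost. auto. }
  rewrite Hsk. pose proof E6 as (E61 & E62 & E63).
  assert (D3 : forall A k j, ~ (5 <= fst A <= 7)%nat -> dm s3 A k j = dm s A k j).
  { intros A k j HA. rewrite E8 by lia. apply D1; auto. }
  apply wp_if; vs; rewrite E2, D3 by (cbn [fst]; lia); fold (DI v); intros Hd.
  + apply wp_set_seq. vs. rewrite E2, D3 by (cbn [fst]; lia). rewrite (cb_NX _ _ HB) by auto.
   apply wp_if; vs; rewrite E3, E8 by (cbn [fst]; lia); rewrite (N.mod_small (h + 1)) by lia;
    destruct (N.ltb_spec (dm s1 aH (gz v) 0) (h + 1)) as [Hu|Hu]; try lia; intros _.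
   * apply wp_st_seq, wp_st. vm. rewrite E3, E4. rewrite (N.mod_small (h + 1)) by lia.
    sp. sp. split; [unfold params; vs; auto|]. split.
    { intros [A1' A2'] k j HA. cbn [fst] in HA. cbn [upd updm dm].
     destruct (peqb_spec (A1', A2') aH) as [EE|]; [inversion EE; lia|].
     destruct (peqb_spec (A1', A2') aLF) as [EE|]; [inversion EE; lia|]. cbn [andb]. apply D3; auto. }
    apply Fin; vs; auto.
    -- intros [A1' A2'] k j HA. cbn [fst] in HA. cbn [upd updm dm].
     destruct (peqb_spec (A1', A2') aH) as [EE|]; [inversion EE; lia|].
     destruct (peqb_spec (A1', A2') aLF) as [EE|]; [inversion EE; lia|]. auto.
    -- intros x. vm. destruct (N.eqb_spec x (gz v)) as [->|].
      ++ right. repeat split; auto; lia.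
      ++ left. rewrite !E8 by (cbn [fst]; lia). auto.
    -- intros _. vm. rewrite ?N.eqb_refl. lia.
   * apply wp_skip. sp. sp. split; [unfold params; vs; auto|]. split; [exact D3|].
    apply Fin; vs; auto.
    -- intros x. left. rewrite !E8 by (cbn [fst]; lia). auto.
    -- intros _. rewrite E8 by (cbn [fst]; lia). auto.
  + apply wp_skip. sp. sp. sp. split; [exact D3|].
   apply Fin; auto.
   -- intros x. left. rewrite !E8 by (cbn [fst]; lia). auto.
   -- lia.
 - intros a s1 (i & Ei & Li & _ & _ & G & A1) Hc. vredh Hc. assert (i = 0%nat) by lia. subst i. split; [exact G|].
  rewrite Nat.sub_0_r in A1. nia.
 - exists (length ol). vs. rewrite (cb_C _ _ HB). sp. sp. split; [unfold params; vs; auto|].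
  sp. split; [|rewrite Nat.sub_diag; lia]. split.
  + intros x Hx. vs. destruct (H0 x Hx) as [-> ->]. sp. split; [reflexivity|]. split; [lia|]. intros j Hj. lia.
  + rewrite skipn_all. intros x [].
Qed.

Lemma forest_root DI RO CU ol : forest DI RO CU ol -> forall x, In x ol -> In (RO x) ol /\ DI (RO x) = 0.
Proof.
 induction ol as [|y ol IH] using rev_ind; intros H x Hx; [destruct Hx|].
 assert (H' : forest DI RO CU ol) by (intros l1 z l2 ->; apply (H l1 z (l2 ++ [y])); rewrite <- app_assoc; reflexivity).
 assert (G : forall z, In z ol -> In (RO z) (ol ++ [y]) /\ DI (RO z) = 0).
 { intros z Hz. destruct (IH H' z Hz). split; auto. apply in_app_iff. auto. }
 apply in_app_iff in Hx as [Hx|[<-|[]]]; auto.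
 destruct (H ol y [] eq_refl) as [[(A & B & _)|(_ & A & _ & B)] _].
 - rewrite B. split; auto. apply in_app_iff. simpl. auto.
 - rewrite B. auto.
Qed.

Lemma GRAPH_spec s : params s ->
 wp (GRAPH t) (fun n s' => jump_data b q gz oz s' /\ N.of_nat n <= q * (8 + 4 * 2 ^ b)) s.
Proof.
 intros HP. unfold GRAPH. apply wp_seq. eapply wp_mono; [apply (NEXTS_spec); auto|].
 intros n1 s1 F1 (N1 & C1). assert (P1 : params s1) by (eapply params_frame; eauto).
 apply wp_seq. eapply wp_mono; [apply (JTAB_spec); auto|].
 intros n2 s2 F2 (J2 & C2). assert (P2 : params s2) by (eapply params_frame; eauto).
 assert (N2 : next_data q s2) by (intros x Hx; rewrite !(fa F2) by reflexivity; apply N1; auto).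
 apply wp_seq. eapply wp_mono; [apply COLOR_spec; auto|].
 intros n3 s3 F3 (ol & B3 & All & Cy & C3).
 eapply wp_mono; [apply (TREES_spec s3 ol); auto|].
 { intros x Hx. rewrite !(fa F3) by reflexivity. destruct (N2 x Hx) as (_ & _ & _ & ? & ?). auto. }
 intros n4 s4 F4 ((L1 & L2) & C4). split; [|lia].
 pose proof (cb_for _ _ B3) as HF. cbv beta in HF.
 assert (Hlen : N.of_nat (length ol) <= q) by (eapply nodup_len; eauto; apply B3).
 assert (E4 : forall A k j, ~ (5 <= fst A <= 7)%nat -> dm s4 A k j = dm s3 A k j).
 { intros [A1 A2] k j HA. apply (fa F4). cbn [fst] in HA. unfold TREES. cbn [moda]. keep. }
 assert (Hno : forall x, x < q -> exists l1 l2, ol = l1 ++ x :: l2 /\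
   node_ok (fun x => dm s3 aDI x 0) (fun x => dm s3 aRO x 0) (fun x => dm s3 aCU x 0) l1 x).
 { intros x Hx. destruct (in_split _ _ (All x Hx)) as (l1 & l2 & E). exists l1, l2. split; auto. apply (HF _ _ _ E). }
 constructor; intros *; rewrite ?E4 by (cbn [fst]; lia).
 - intros _. apply gz_lt; auto.
 - intros Hx. apply (cb_NX _ _ B3); auto.
 - intros Hx. apply (cb_lt _ _ B3). apply (forest_root _ _ _ _ HF); auto.
 - intros Hx. pose proof (forest_le (fun x => dm s3 aDI x 0) _ _ ol x HF (All x Hx)) as G. cbv beta in G. lia.
 - intros Hx Hd. destruct (Hno x Hx) as (l1 & l2 & _ & [(_ & E & _)|(_ & _ & E & _)]); [auto|lia].
 - intros Hx Hd. destruct (Hno x Hx) as (l1 & l2 & _ & [(E & _)|(A & _ & B & C)]); [lia|auto].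
 - intros Hx Hd. destruct (forest_root _ _ _ _ HF x (All x Hx)) as [A B].
  destruct (Hno _ (cb_lt _ _ B3 _ A)) as (l1 & l2 & _ & [(_ & _ & E)|(_ & _ & E & _)]); [tauto|lia].
 - intros Hx -> Hc. destruct (forest_root _ _ _ _ HF x (All x Hx)) as [A B].
  destruct (Cy _ A Hc) as [D E]. split; auto. intros k. rewrite E4 by (cbn [fst]; lia). destruct (E k) as (? & ? & _). auto.
 - intros Hx Hj. apply (cb_JT _ _ B3); auto.
 - intros Hx. destruct (L1 x Hx) as (_ & A & _). destruct (L2 x (All x Hx)) as (B & _). split; [lia|auto].
 - intros Hx Hd. destruct (L2 x (All x Hx)) as (_ & _ & B). apply B. auto.
 - intros Hx Hj. destruct (L2 x (All x Hx)) as (_ & B & _). apply B. auto.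
Qed.
End Graph.

(** * Windows of the input and words of the output *)

Notation qln i := (90%nat, i).
Notation qp i := (91%nat, i).
Notation qh i := (92%nat, i).
Notation ql i := (93%nat, i).
Notation qmin i := (94%nat, i).
Notation qM := (95%nat, 0%nat).
Notation qMw := (95%nat, 1%nat).
Notation qg := (95%nat, 2%nat).
Notation qA := (96%nat, 0%nat).
Notation qC := (96%nat, 1%nat).
Notation qO := (96%nat, 2%nat).
Notation qL := (96%nat, 3%nat).
Notation qv := (97%nat, 0%nat).
Notation qk := (97%nat, 1%nat).
Notation qx := (97%nat, 2%nat).

Fixpoint cst (n : nat) : expr := match n with O => E0 | S n' => cst n' +! E1 end.

Definition FLUSH (t : nat) : stmt :=
 SIf ($qC <! $vw) SSkip
  (qx <- ($qC -! $vw) ;; SCell t ($qO) ($qA >>! $qx) ;; qA <- ($qA -! (($qA >>! $qx) <<! $qx)) ;;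
   qC <- $qx ;; qO <- ($qO +! E1)).

(** Fewer than [w] bits wait in the accumulator, and at most [R] words' worth of bits are added; [R]
    conditional flushes bring it below [w] again. *)
Definition APPEND (t R : nat) : stmt :=
 qA <- (($qA <<! $qk) +! $qv) ;; qC <- ($qC +! $qk) ;; qL <- ($qL +! $qk) ;; fors R (fun _ => FLUSH t).

Definition APPZ (t R : nat) : stmt :=
 SIf ($qg) (vLx <- $qg ;; LOG ;; qv <- $qg ;; qk <- TL ;; APPEND t R) SSkip.

Definition APPLY (t R : nat) : stmt :=
 SIf ($vF)
  (qg <- ($qg +! $vz0) ;; APPZ t R ;; qv <- $vo ;; qk <- $vol ;; APPEND t R ;; qg <- $vz)
  (qg <- ($qg +! $vz)).

(** The position is kept both as a bit count and as word index with offset, because the language has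
    no division by [w]. An advance is by at most [G] words, so [G] conditional corrections of the
    offset suffice. *)
Definition ADV (G i : nat) : stmt :=
 qp i <- ($(qp i) +! $qx) ;; ql i <- ($(ql i) +! $qx) ;;
 fors G (fun _ => SIf ($(ql i) <! $vw) SSkip (ql i <- ($(ql i) -! $vw) ;; qh i <- ($(qh i) +! E1))).

(** An unaligned window of [G] words is spread over [G + 1] words. After the bits before and behind
    it have been removed, everything past the end of the stream is cleared, since memory there is
    arbitrary and could look like a token. *)
Definition LOADWIN (G i : nat) : stmt :=
 vV i <- E0 ;;
 fors (S G) (fun j => vV i <- (($(vV i) <<! $vw) +! ECell i ($(qh i) +! cst j))) ;;
 qx <- ($qMw -! $(ql i)) ;;
 vV i <- ($(vV i) -! (($(vV i) >>! $qx) <<! $qx)) ;;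
 vV i <- ($(vV i) >>! ($vw -! $(ql i))) ;;
 qx <- ($(qln i) -! $(qp i)) ;;
 SIf ($qx <! $qM) (qx <- ($qM -! $qx) ;; vV i <- (($(vV i) >>! $qx) <<! $qx)) SSkip.

Lemma store_free_moda p A : store_free p = true -> moda p A = false.
Proof.
 induction p; simpl; intros H; auto; try discriminate; apply andb_prop in H as [H1 H2]; rewrite IHp1, IHp2; auto.
Qed.

Lemma eval_cst W s n : N.of_nat n < 2 ^ W -> eval W s (cst n) = N.of_nat n.
Proof.
 induction n as [|n IH]; intros H; [reflexivity|]. cbn [cst eval eop]. rewrite IH by lia. rewrite N.mod_small; lia.
Qed.

Lemma mod_pow_split x k : x = (x / 2 ^ k) * 2 ^ k + x mod 2 ^ k.
Proof. pose proof (N.div_mod' x (2 ^ k)). lia. Qed.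

Lemma FLUSH_keep t v : (fst v <> 96%nat /\ fst v <> 97%nat) -> modv (FLUSH t) v = false.
Proof. destruct v as [k j]. cbn [fst]. intros. unfold FLUSH. keep. Qed.

Lemma APPEND_keep t R v : (fst v <> 96%nat /\ fst v <> 97%nat) -> modv (APPEND t R) v = false.
Proof. destruct v as [k j]. cbn [fst]. intros. unfold APPEND. cbn [modv]. rewrite modv_fors by (intros; apply FLUSH_keep; auto). keep. Qed.

Lemma ADV_keep G i v : (fst v <> 91%nat /\ fst v <> 92%nat /\ fst v <> 93%nat) \/ snd v <> i -> modv (ADV G i) v = false.
Proof. destruct v as [k j]. cbn [fst snd]. intros. unfold ADV. cbn [modv]. rewrite modv_fors by (intros; keep). keep. Qed.

Lemma LOADWIN_keep G i v : v <> qx -> v <> vV i -> modv (LOADWIN G i) v = false.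
Proof. destruct v as [k j]. cbn [fst snd]. intros. unfold LOADWIN. cbn [modv]. rewrite modv_fors by (intros; keep). keep. Qed.

Section QueryParts.
Context (w W : N) (delta : N -> list N -> N * N) (t G R : nat).
Hypothesis HWbig : 64 * W <= 2 ^ W.
Hypothesis Hw : 1 <= w.
Hypothesis HWG : (N.of_nat G + N.of_nat R + 4) * w <= W.
Notation wp := (wp w W delta).
Notation M := (N.of_nat G * w).

(** [E] is the part of the output that has been produced: full words are in the output array. *)
Record ACC (E : list bool) (s : vst) : Prop := {
 acc_len : N.of_nat (length E) = env s qO * w + env s qC;
 acc_lt : env s qA < 2 ^ env s qC;
 acc_bits : skipn (N.to_nat (env s qO * w)) E = bitsN (env s qC) (env s qA);
 acc_mem : forall x, (N.of_nat x < env s qO * w) ->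
  N.testbit (cm s t (N.of_nat x / w)) (w - 1 - N.of_nat x mod w) = nth x E false;
 acc_L : env s qL = N.of_nat (length E) }.

Lemma nth_bitsN k v y : N.of_nat y < k -> nth y (bitsN k v) false = N.testbit v (k - 1 - N.of_nat y).
Proof. intros. rewrite nth_bits by lia. f_equal. lia. Qed.

Lemma nth_skipn_b (l : list bool) i j : nth j (skipn i l) false = nth (i + j) l false.
Proof. apply nth_skipn. Qed.

Lemma FLUSH_spec E s : ACC E s -> env s vw = w -> N.of_nat (length E) < 2 ^ W -> env s qC <= W ->
 wp (FLUSH t) (fun n s' => n = 0%nat /\ ACC E s' /\ env s' vw = w /\ env s' qC <= W /\ (env s qC < w -> env s' qC = env s qC) /\
  (w <= env s qC -> env s' qC + w = env s qC)) s.
Proof.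
 intros [A1 A2 A3 A4 A5] Hv HL HC. unfold FLUSH. apply wp_if; vs; rewrite Hv; destruct (N.ltb_spec (env s qC) w) as [Hc|Hc]; try lia; intros _.
 - apply wp_skip. repeat split; auto; lia.
 - apply wp_set_seq, wp_cell_seq, wp_set_seq, wp_set_seq, wp_set. vs. rewrite Hv.
  set (c := env s qC) in *. set (a := env s qA) in *. set (o := env s qO) in *. set (d := c - w) in *.
  assert (Hd : c = d + w) by lia.
  assert (HaW : a < 2 ^ W) by (eapply N.lt_le_trans; [exact A2|apply N.pow_le_mono_r; lia]).
  rewrite sub_mod by auto.
  assert (Hq : a / 2 ^ d < 2 ^ w) by (apply div_pow_lt; rewrite <- Hd; auto).
  assert (HqW : a / 2 ^ d < 2 ^ W) by (eapply N.lt_le_trans; [exact Hq|apply N.pow_le_mono_r; lia]).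
  assert (Ho : o < N.of_nat (length E)) by nia.
  rewrite !N.mod_small by lia. pose proof (N.mod_lt a (2 ^ d) ltac:(pose proof (pow2_pos d); lia)) as Hr.
  assert (HN : N.to_nat ((o + 1) * w) = (N.to_nat (o * w) + N.to_nat w)%nat) by lia.
  assert (HE : skipn (N.to_nat (o * w)) E = bitsN w (a / 2 ^ d) ++ bitsN d (a mod 2 ^ d)).
  { rewrite A3, (mod_pow_split a d) at 1. rewrite Hd. rewrite (N.add_comm d w). apply bitsN_app. auto. }
  sp. split; [|split; [auto|split; [lia|split; intros; lia]]]. constructor; vs; fold c a o d; rewrite ?sub_mod, ?(N.mod_small (o + 1)), ?(N.mod_small (a / 2 ^ d)) by (auto; lia).
  + lia.
  + auto.
  + rewrite HN. rewrite Nat.add_comm, <- skipn_skipn, HE. rewrite skipn_app, bits_length, Nat.sub_diag, skipn_all2 by (rewrite bits_length; auto).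
   reflexivity.
  + intros x Hx. destruct (N.lt_ge_cases (N.of_nat x) (o * w)) as [Hlo|Hge].
   * assert (N.of_nat x / w < o) by (apply N.Div0.div_lt_upper_bound; lia).
    destruct (N.eqb_spec (N.of_nat x / w) o); [lia|]. apply A4. auto.
   * assert (E1 : N.of_nat x / w = o) by (symmetry; apply N.div_unique with (r := N.of_nat x - o * w); lia).
    assert (E2 : N.of_nat x mod w = N.of_nat x - o * w) by (symmetry; apply N.mod_unique with (q := o); lia).
    rewrite E1, E2, N.eqb_refl.
    replace x with (N.to_nat (o * w) + (x - N.to_nat (o * w)))%nat at 2 by lia.
    rewrite <- nth_skipn_b, HE, app_nth1 by (rewrite bits_length; lia).
    rewrite nth_bitsN by lia. f_equal. lia.
  + auto.
Qed.

Lemma APPEND_spec E s v k : ACC E s -> env s vw = w -> env s qC < w -> env s qv = v -> env s qk = k -> v < 2 ^ k ->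
 k <= N.of_nat R * w -> N.of_nat (length E) + k < 2 ^ W ->
 wp (APPEND t R) (fun n s' => n = 0%nat /\ ACC (E ++ bitsN k v) s' /\ env s' qC < w) s.
Proof.
 intros [A1 A2 A3 A4 A5] Hvw HC Hv Hk Hvk HkR HL. unfold APPEND. do 3 apply wp_set_seq.
 set (s1 := upd _ _ _).
 assert (HCk : env s qC + k <= W) by nia.
 assert (Hlt : env s qA * 2 ^ k + v < 2 ^ (env s qC + k)) by (apply append_lt; auto).
 assert (HpW : 2 ^ (env s qC + k) <= 2 ^ W) by (apply N.pow_le_mono_r; lia).
 assert (E1 : env s1 qC = env s qC + k).
 { unfold s1. vs. rewrite Hk. apply N.mod_small. lia. }
 assert (E2 : env s1 qA = env s qA * 2 ^ k + v).
 { unfold s1. vs. rewrite Hk, Hv. rewrite (N.mod_small (env s qA * 2 ^ k)) by lia. apply N.mod_small. lia. }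
 assert (E3 : env s1 qO = env s qO /\ env s1 qL = env s qL + k /\ cm s1 = cm s /\ env s1 vw = w).
 { unfold s1. vs. rewrite Hk. rewrite N.mod_small by lia. auto. }
 destruct E3 as (E3 & E4 & E5 & E6). clearbody s1.
 assert (HA : ACC (E ++ bitsN k v) s1).
 { constructor; rewrite ?E1, ?E2, ?E3, ?E4, ?E5; rewrite ?length_app, ?bits_length.
  - lia.
  - auto.
  - rewrite skipn_app, A3. replace (N.to_nat (env s qO * w) - length E)%nat with 0%nat by lia.
   cbn [skipn]. symmetry. apply bitsN_app. auto.
  - intros x Hx. rewrite A4 by auto. rewrite app_nth1 by lia. auto.
  - lia. }
 eapply wp_mono.
 { apply wp_fors with (I := fun i a s' => a = 0%nat /\ ACC (E ++ bitsN k v) s' /\ env s' vw = w /\ env s' qC <= W /\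
   env s' qC < w + (N.of_nat R - N.of_nat i) * w).
  - intros i a s2 Hi (-> & B1 & B2 & B3 & B4). eapply wp_mono.
   { eapply FLUSH_spec; eauto. rewrite length_app, bits_length. lia. }
   intros n s3 _ (-> & C1 & C2 & C3 & C4 & C5). sp. sp. sp. sp.
   destruct (N.lt_ge_cases (env s2 qC) w) as [Hlt2|Hge]; [rewrite C4 by auto; eapply N.lt_le_trans; [exact Hlt2|apply N.le_add_r]|].
   specialize (C5 Hge). replace (N.of_nat R - N.of_nat i) with (N.of_nat R - N.of_nat (S i) + 1) in B4 by lia. lia.
  - sp. sp. sp. rewrite E1. sp. rewrite N.sub_0_r. lia. }
 intros n s' _ (-> & B1 & B2 & B3 & B4). rewrite N.sub_diag in B4. sp. sp. lia.
Qed.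

Lemma bitsN_ztoken g : 0 < g -> bitsN (toklen g) g = zero_run_token g.
Proof. intros. rewrite zero_run_token_eq by auto. unfold token, tokval. f_equal. Qed.

Lemma APPZ_spec E s b g : ACC E s -> env s vw = w -> env s qC < w -> env s vb = b -> 1 <= b <= W -> lg2ok b s ->
 env s qg = g -> runlen g <= N.of_nat R * w -> N.of_nat (length E) + runlen g < 2 ^ W ->
 wp (APPZ t R) (fun n s' => ACC (E ++ zero_run_token g) s' /\ env s' qC < w /\ N.of_nat n * b <= runlen g) s.
Proof.
 intros HA Hvw HC Hb Hb1 Hlg Hg HR HL. unfold APPZ. apply wp_if; vs; rewrite Hg; intros Hg0.
 2:{ subst g. rewrite Hg0. apply wp_skip. cbn [zero_run_token N.eqb]. rewrite app_nil_r. repeat split; auto; [apply HA..|lia]. }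
 assert (Hrl : runlen g = toklen g) by (unfold runlen; destruct (N.eqb_spec g 0); lia).
 assert (HgW : g < 2 ^ W).
 { eapply N.lt_le_trans; [apply runlen_lt|]. apply N.pow_le_mono_r; nia. }
 rewrite Hrl in *. unfold toklen in HR.
 apply wp_set_seq, wp_seq. eapply wp_mono.
 { apply (LOG_spec w W delta HWbig _ b g); vs; auto. lia. }
 intros n1 s1 F1 (L1 & C1). do 2 apply wp_set_seq. vs.
 assert (K1 : forall v, ~ (20 < fst v < 24)%nat -> env s1 v = env s v).
 { intros [x y] Hxy. cbn [fst] in Hxy. rewrite (fv F1) by (unfold LOG; keep). cbn [upd env].
  destruct (peqb_spec (x, y) vLx) as [EE|]; auto. inversion EE; lia. }
 rewrite K1 by (cbn [fst]; lia). rewrite Hg, L1.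
 assert (Etl : (((N.log2 g + N.log2 g) mod 2 ^ W + 1) mod 2 ^ W + 1) mod 2 ^ W = toklen g).
 { assert (N.of_nat R * w <= W) by nia. unfold toklen. rewrite (N.mod_small (N.log2 g + N.log2 g)) by lia. rewrite (N.mod_small (N.log2 g + N.log2 g + 1)) by lia. rewrite N.mod_small; lia. }
 rewrite Etl. eapply wp_mono.
 { apply APPEND_spec with (E := E) (v := g) (k := toklen g); vs; auto.
  - destruct HA as [A1 A2 A3 A4 A5]. constructor; vs; rewrite ?K1 by (cbn [fst]; lia); auto.
   intros x Hx. rewrite (fc F1) by reflexivity. cbn [upd cm]. auto.
  - rewrite K1 by (cbn [fst]; lia). auto.
  - rewrite K1 by (cbn [fst]; lia). auto.
  - rewrite <- Hrl. apply runlen_lt. }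
 intros n s' _ (-> & B1 & B2). rewrite bitsN_ztoken in B1 by lia. sp. sp.
 rewrite Nat.add_0_r. unfold toklen. lia.
Qed.

Lemma ADV_spec i s d : env s vw = w -> env s qx = d -> env s (ql i) < w -> d <= M -> env s (qp i) + d < 2 ^ W ->
 env s (qp i) = env s (qh i) * w + env s (ql i) ->
 wp (ADV G i) (fun n s' => n = 0%nat /\ env s' (qp i) = env s (qp i) + d /\ env s' (ql i) < w /\
  env s' (qp i) = env s' (qh i) * w + env s' (ql i)) s.
Proof.
 intros Hvw Hd Hl HdM Hp Hpe. unfold ADV. do 2 apply wp_set_seq. vs. rewrite Hd.
 assert (HlW : env s (ql i) + d < 2 ^ W) by lia.
 rewrite !N.mod_small by lia. set (s1 := upd _ _ _).
 set (p := env s (qp i) + d) in *.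
 eapply wp_mono.
 { apply wp_fors with (I := fun k a s' => a = 0%nat /\ env s' vw = w /\ env s' (qp i) = p /\
    env s' (qh i) * w + env s' (ql i) = p /\ env s' (ql i) < w + (N.of_nat G - N.of_nat k) * w).
  - intros k a s2 Hk (-> & B1 & B2 & B3 & B4). apply wp_if; vs; rewrite B1;
    destruct (N.ltb_spec (env s2 (ql i)) w) as [Hc|Hc]; try lia; intros _.
   + apply wp_skip. repeat split; auto. eapply N.lt_le_trans; [exact Hc|apply N.le_add_r].
   + apply wp_set_seq, wp_set. vs. rewrite B1. assert (env s2 (qh i) * 1 <= env s2 (qh i) * w) by (apply N.mul_le_mono_l; auto).
    rewrite N.mod_small by lia. repeat split; auto.
    * lia.
    * replace (N.of_nat G - N.of_nat k) with (N.of_nat G - N.of_nat (S k) + 1) in B4 by lia. lia.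
  - unfold s1. vs. sp. sp. sp. split; [unfold p; lia|]. rewrite N.sub_0_r. lia. }
 intros n s' _ (-> & B1 & B2 & B3 & B4). rewrite N.sub_diag in B4. repeat split; auto; lia.
Qed.

Definition bitat (s : vst) (i : nat) (x : N) : bool := N.testbit (cm s i (x / w)) (w - 1 - x mod w).

Lemma LOADWIN_spec i s L : env s vw = w -> env s qM = M -> env s qMw = M + w -> env s (qln i) = N.of_nat (length L) ->
 env s (ql i) < w -> env s (qp i) = env s (qh i) * w + env s (ql i) -> env s (qp i) <= env s (qln i) ->
 env s (qln i) + M + w < 2 ^ W -> (forall a, cm s i a < 2 ^ w) ->
 (forall x, (x < length L)%nat -> bitat s i (N.of_nat x) = nth x L false) ->
 wp (LOADWIN G i) (fun n s' => n = 0%nat /\ wmatch M (env s' (vV i)) (skipn (N.to_nat (env s (qp i))) L)) s.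
Proof.
 intros H1 H2 H3 H4 H5 H6 H7 H8 H9 H10. unfold LOADWIN. apply wp_set_seq, wp_seq.
 set (p := env s (qp i)) in *. set (h := env s (qh i)) in *. set (l := env s (ql i)) in *.
 assert (HGw : w * (N.of_nat G + 1) <= W) by nia.
 assert (HGW : N.of_nat G + 1 <= W) by nia.
 eapply wp_mono.
 { apply wp_fors with (I := fun k a s' => a = 0%nat /\ (forall v, v <> vV i -> env s' v = env s v) /\ cm s' = cm s /\
    env s' (vV i) < 2 ^ (w * N.of_nat k) /\
    forall y, y < w * N.of_nat k -> N.testbit (env s' (vV i)) (w * N.of_nat k - 1 - y) = bitat s i (h * w + y)).
  - intros k a s2 Hk (-> & B1 & B2 & B3 & B4). apply wp_set.
   assert (Ec : eval W s2 ($(qh i) +! cst k) = h + N.of_nat k).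
   { cbn [eval eop]. rewrite eval_cst by lia. rewrite B1 by discriminate. fold h. apply N.mod_small. nia. }
   vs. cbn [eval eop] in Ec. rewrite Ec, B2, (B1 vw), H1 by discriminate.
   set (V := env s2 (vV i)) in *. set (word := cm s i (h + N.of_nat k)).
   assert (Hwd : word < 2 ^ w) by apply H9.
   assert (Hlt : V * 2 ^ w + word < 2 ^ (w * N.of_nat (S k))).
   { replace (w * N.of_nat (S k)) with (w * N.of_nat k + w) by lia. apply append_lt; auto. }
   assert (HpW : 2 ^ (w * N.of_nat (S k)) <= 2 ^ W) by (apply N.pow_le_mono_r; nia).
   rewrite (N.mod_small (V * 2 ^ w)) by lia. rewrite N.mod_small by lia.
   sp. split.
   { intros v Hv. destruct (peqb_spec v (vV i)); [congruence|]. apply B1. auto. }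
   sp. sp. intros y Hy. rewrite testbit_split by auto.
   destruct (N.ltb_spec (w * N.of_nat (S k) - 1 - y) w) as [Hc|Hc].
   + unfold bitat. assert (E1 : (h * w + y) / w = h + N.of_nat k) by (symmetry; apply N.div_unique with (r := y - w * N.of_nat k); lia).
    assert (E2 : (h * w + y) mod w = y - w * N.of_nat k) by (symmetry; apply N.mod_unique with (q := h + N.of_nat k); lia).
    rewrite E1, E2. fold word. f_equal. lia.
   + rewrite <- B4 by lia. f_equal. lia.
  - vs. sp. split; [intros v Hv; destruct (peqb_spec v (vV i)); [congruence|auto]|]. sp.
   rewrite N.mul_0_r. split; [reflexivity|]. intros; lia. }
 intros n s2 _ (-> & B1 & B2 & B3 & B4). do 4 apply wp_set_seq. vs. rewrite (B1 qMw), (B1 vw), (B1 (ql i)), (B1 (qln i)), (B1 (qp i)) by discriminate.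
 rewrite H1, H3, H4. fold l p.
 set (V := env s2 (vV i)) in *.
 replace (w * N.of_nat (S G)) with (M + w) in * by lia.
 assert (HVW : V < 2 ^ W) by (eapply N.lt_le_trans; [exact B3|apply N.pow_le_mono_r; lia]).
 rewrite sub_mod by auto.
 set (V1 := (V mod 2 ^ (M + w - l)) / 2 ^ (w - l)).
 assert (HV1 : V1 < 2 ^ M).
 { apply div_pow_lt. replace (w - l + M) with (M + w - l) by lia. apply N.mod_lt. pose proof (pow2_pos (M + w - l)). lia. }
 assert (HV1b : forall y, y < M -> N.testbit V1 (M - 1 - y) = bitat s i (p + y)).
 { intros y Hy. unfold V1. rewrite N.div_pow2_bits, N.mod_pow2_bits_low by lia.
  replace (M - 1 - y + (w - l)) with (M + w - 1 - (l + y)) by lia. rewrite B4 by lia. f_equal. lia. }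
 clearbody V1 V. set (rem := N.of_nat (length L) - p).
 assert (Fin : forall V2, V2 < 2 ^ M -> (forall y, y < M -> N.testbit V2 (M - 1 - y) = andb (y <? rem) (bitat s i (p + y))) ->
  wmatch M V2 (skipn (N.to_nat p) L)).
 { intros V2 G1 G2. split; auto. apply nth_ext with false false.
  - rewrite bits_length, length_firstn, length_app, repeat_length. lia.
  - intros y Hy. rewrite bits_length in Hy. rewrite nth_bitsN by lia. rewrite G2 by lia.
   rewrite nth_firstn. destruct (Nat.ltb_spec y (N.to_nat M)); [|lia].
   destruct (N.ltb_spec (N.of_nat y) rem) as [Hc|Hc].
   + rewrite app_nth1 by (rewrite length_skipn; lia). rewrite nth_skipn_b, <- H10 by lia. cbn [andb]. f_equal. lia.
   + rewrite app_nth2 by (rewrite length_skipn; lia). rewrite nth_repeat. reflexivity. }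
 apply wp_if; vs; rewrite (B1 qM), H2 by discriminate; fold rem; destruct (N.ltb_spec rem M) as [Hc|Hc]; try lia; intros _.
 - apply wp_set_seq, wp_set. vs. rewrite (B1 qM), H2 by discriminate. sp.
  set (d := M - rem).
  assert (Hle : V1 / 2 ^ d * 2 ^ d <= V1) by (rewrite N.mul_comm; apply N.Div0.mul_div_le).
  assert (HMW : 2 ^ M <= 2 ^ W) by (apply N.pow_le_mono_r; lia).
  rewrite N.mod_small by lia. apply Fin; [lia|]. intros y Hy.
  destruct (N.ltb_spec y rem) as [Hy2|Hy2]; cbn [andb].
  + rewrite <- HV1b by auto. rewrite N.mul_pow2_bits_high by lia. rewrite N.div_pow2_bits. f_equal. lia.
  + apply N.mul_pow2_bits_low. lia.
 - apply wp_skip. vs. sp. apply Fin; auto. intros y Hy. rewrite HV1b by auto.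
  destruct (N.ltb_spec y rem); [reflexivity|lia].
Qed.

End QueryParts.

(** * Answering a query *)

Definition ADVS (t G : nat) (e : nat -> expr) (p : nat -> stmt) : stmt :=
 fors t (fun i => qx <- e i ;; ADV G i ;; p i).

(** The streams are visited from the last to the first, so that stream 0 ends up in the lowest bits
    of the key. The part of a run above the cap remains in [vr] and is added back after the
    look-up. *)
Definition KEY (t : nat) : stmt :=
 vkey <- E0 ;;
 fors t (fun i =>
  SIf ($(vr (t - 1 - i)%nat) >>! $vbe) (qmin (t - 1 - i)%nat <- ((E1 <<! $vbe) -! E1)) (qmin (t - 1 - i)%nat <- $(vr (t - 1 - i)%nat)) ;;
  vkey <- (((($vkey <<! $vbe) +! $(qmin (t - 1 - i)%nat)) <<! $vb) +! ($(vV (t - 1 - i)%nat) >>! ($qM -! $vb)))).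

Definition FAST (t G R : nat) : stmt :=
 fors t (LOADWIN G) ;; KEY t ;;
 ADVS t G (fun i => $vb -! ERd (aTm i) ($vS) ($vkey))
  (fun i => vr i <- (($(vr i) -! $(qmin i)) +! ERd (aTr i) ($vS) ($vkey))) ;;
 vF <- ERd aTF ($vS) ($vkey) ;; vz0 <- ERd aTz0 ($vS) ($vkey) ;; vo <- ERd aTo ($vS) ($vkey) ;;
 vol <- ERd aTol ($vS) ($vkey) ;; vz <- ERd aTz ($vS) ($vkey) ;; vS <- ERd aTS ($vS) ($vkey) ;;
 APPLY t R.

(** The jump is limited to one zero less than the shortest run. One symbol is thus left for the step
    that follows, and that step is the one in which a run ends and its token length is released. *)
Definition SKIP (t : nat) : stmt :=
 jX <- $(vr 0%nat) ;; fors t (fun i => SIf ($(vr i) <! $jX) (jX <- $(vr i)) SSkip) ;;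
 SIf ($jX)
  (jX <- ($jX -! E1) ;; jS <- $vS ;; JUMP ;; vS <- $jS ;; fors t (fun i => vr i <- ($(vr i) -! $jE)) ;;
   qg <- ($qg +! $jE)) SSkip.

Definition SLOW (t G R : nat) : stmt :=
 SKIP t ;; fors t (LOADWIN G) ;; fors t (fun i => vm i <- $qM) ;;
 vF <- E0 ;; vz0 <- E0 ;; vo <- E0 ;; vol <- E0 ;; vz <- E0 ;; STEP t ;;
 ADVS t G (fun i => $qM -! $(vm i)) (fun _ => SSkip) ;; APPLY t R.

Notation MORE := (($(qp 0%nat) <! $(qln 0%nat)) +! $(vr 0%nat)).

(** A look-up alone may make no progress, for instance at a token longer than [b]; the single step
    behind it always advances. *)
Definition QLOOP (t G R : nat) : stmt := SWhile MORE (FAST t G R ;; SIf MORE (SLOW t G R) SSkip).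

Lemma pow2_le_runlen x k : 2 ^ k <= x -> 2 * k + 2 <= runlen x.
Proof.
 intros H. pose proof (pow2_pos k). unfold runlen. destruct (N.eqb_spec x 0); [lia|]. unfold toklen.
 apply N.log2_le_pow2 in H; lia.
Qed.

Lemma runlen_le_exp x k : x <= 2 ^ k -> runlen x <= 2 * k + 2.
Proof.
 intros H. unfold runlen. destruct (N.eqb_spec x 0); [lia|]. unfold toklen.
 apply N.log2_le_mono in H. rewrite N.log2_pow2 in H by lia. lia.
Qed.

(** With weight one the potential never falls, because the run left over from a token has a token
    that is no longer. With weight two the bits read are therefore a pure gain. *)
Lemma next1_pot r V m u r' V' m' : V < 2 ^ m -> next1 r V m = Some (u, r', V', m') ->
 m' + runlen r' <= m + runlen r.
Proof.
 intros HV H. unfold next1 in H. destruct (N.eqb_spec r 0) as [->|].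
 - destruct (decode V m) as [[[[f X] V2] m2]|] eqn:E; [|discriminate]. apply decode_inv in E as (_ & HX & _ & _ & Hm); auto.
  destruct (N.eqb_spec f 0); injection H as <- <- <- <-; [|simpl (runlen 0); lia].
  pose proof (runlen_mono (X - 1) X ltac:(lia)). assert (runlen X = toklen X) by (unfold runlen; destruct (N.eqb_spec X 0); lia).
  simpl (runlen 0). lia.
 - injection H as <- <- <- <-. pose proof (runlen_mono (r - 1) r ltac:(lia)). lia.
Qed.

Lemma nsum_ge k f i : (i < k)%nat -> f i <= nsum k f.
Proof.
 induction k; intros Hi; simpl; [lia|]. destruct (Nat.eq_dec i k) as [->|]; [lia|]. specialize (IHk ltac:(lia)). lia.
Qed.

Ltac other K := intros; first [solve [auto] | apply K; cbn [fst]; first [lia|discriminate|let EE := fresh in intros EE; inversion EE; lia]].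

Lemma senc_eq_nil A : senc A = [] -> A = [].
Proof.
 pose proof (senc_tokens A) as H. intros E. rewrite E in H. remember [] as l eqn:El. destruct H; auto;
  apply (f_equal (@length bool)) in El; rewrite length_app, token_length in El; unfold toklen in El; cbn [length] in El; lia.
Qed.

Notation aP k := (30%nat, k).

Definition QINIT (t G : nat) : stmt :=
 vw <- ERd (aP 0%nat) E0 E0 ;; vb <- ERd (aP 1%nat) E0 E0 ;; vbe <- ERd (aP 2%nat) E0 E0 ;; vS <- ERd (aP 3%nat) E0 E0 ;;
 qM <- E0 ;; fors G (fun _ => qM <- ($qM +! $vw)) ;; qMw <- ($qM +! $vw) ;; vlim <- $qM ;;
 qg <- E0 ;; qA <- E0 ;; qC <- E0 ;; qO <- E0 ;; qL <- E0 ;;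
 fors t (fun i => qp i <- E0 ;; qh i <- E0 ;; ql i <- E0 ;; vr i <- E0).

Definition QUERY (t G R : nat) : stmt :=
 QINIT t G ;; QLOOP t G R ;; APPZ t R ;;
 SIf ($qC) (SCell t ($qO) ($qA <<! ($vw -! $qC))) SSkip.

Section Query.
Context (t : nat) (sigma q : N) (Tr : transducer t sigma q) (w W : N) (n : nat) (Ss : list (list N)) (T : list N)
 (sq : nat -> N) (G R : nat) (b B : N).
Hypothesis Ht : (1 <= t)%nat.
Hypothesis HSs : length Ss = t.
Hypothesis HS : Forall (fun S => length S = n /\ Forall (fun a => a < sigma) S) Ss.
Hypothesis HT : length T = n.
Hypothesis Hs0 : sq 0%nat = tr_init Tr.
Hypothesis Hsq : forall i, (i < n)%nat ->
 tr_step Tr (sq i) (map (fun S => nth i S 0) Ss) = (sq (S i), nth i T 0).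
Hypothesis HWbig : 64 * W <= 2 ^ W.
Hypothesis Hw : 1 <= w.
Hypothesis HWG : (N.of_nat G + N.of_nat R + 4) * w <= W.
Hypothesis Hb : 1 <= b.
Hypothesis HWb : 4 * b + 2 * run_bits t b + key_bits t b + 16 <= W.
Hypothesis HqW : 4 * (q * 2 ^ b) <= 2 ^ W.
(** Symbols and lengths are at most [2 ^ B], so that every input token has at most [2 * B + 2] bits;
    the windows of single steps have [MM] bits and hold any of them. *)
Hypothesis HsB : sigma <= 2 ^ B.
Hypothesis HnB : N.of_nat n <= 2 ^ B.
Notation MM := (N.of_nat G * w).
Hypothesis HBM : 2 * B + 2 <= MM.
Hypothesis HbM : b <= MM.
Hypothesis HMR : MM <= N.of_nat R * w.
Hypothesis HkR : 3 * b + 2 * run_bits t b + 4 <= N.of_nat R * w.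
Hypothesis HLS : forall i, (i < t)%nat -> N.of_nat (length (senc (nth i Ss []))) + MM + w < 2 ^ W.
Hypothesis HLT : N.of_nat (length (senc T)) < 2 ^ W.
Notation wp := (wp w W (tr_step Tr)).
Notation beta := (run_bits t b).
Notation tot := (key_bits t b).
Notation ACC := (ACC w t).
Notation bs i := (senc (nth i Ss [])).
Notation str := (stream Ss).

Record SI (s : vst) : Prop := {
 si_w : env s vw = w; si_b : env s vb = b; si_be : env s vbe = beta; si_M : env s qM = MM; si_Mw : env s qMw = MM + w;
 si_lim : env s vlim = MM; si_ln : forall i, (i < t)%nat -> env s (qln i) = N.of_nat (length (bs i));
 si_lg : lg2ok b s;
 si_en : forall a k, a < q -> k < 2 ^ tot -> entry W (tr_step Tr) t b s a k;
 si_jd : jump_data b q (gz W (tr_step Tr) t q) (oz W (tr_step Tr) t) s;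
 si_cm : forall i a, (i < t)%nat -> cm s i a < 2 ^ w;
 si_bit : forall i x, (i < t)%nat -> (x < length (bs i))%nat -> bitat w s i (N.of_nat x) = nth x (bs i) false }.

Lemma SI_ext s s' : SI s -> (forall k j, (k < 10 \/ k = 31 \/ k = 90)%nat -> env s' (k, j) = env s (k, j)) ->
 env s' qM = env s qM -> env s' qMw = env s qMw -> (forall A i j, dm s' A i j = dm s A i j) ->
 (forall i a, (i < t)%nat -> cm s' i a = cm s i a) -> SI s'.
Proof.
 intros [] E1 E2 E3 E4 E5. constructor; try (rewrite ?E1, ?E2, ?E3 by lia; auto; fail).
 - intros. rewrite E1 by lia. auto.
 - intros v Hv. rewrite E4. auto.
 - intros. eapply entry_ext; [eauto..| |apply si_en0; auto]. intros; apply E4.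
 - eapply jump_data_ext with (s := s); eauto. nia.
 - intros. rewrite E5; auto.
 - intros. unfold bitat. rewrite E5; auto. apply si_bit0; auto.
Qed.

Record STR (k : nat) (s : vst) : Prop := {
 st_p : forall i, (i < t)%nat -> env s (qp i) <= N.of_nat (length (bs i)) /\
  env s (qp i) = env s (qh i) * w + env s (ql i) /\ env s (ql i) < w;
 st_B : forall i, (i < t)%nat -> exists B', str i k = repeat 0 (N.to_nat (env s (vr i))) ++ B' /\
  skipn (N.to_nat (env s (qp i))) (bs i) = senc B' }.

Lemma STR_ext k s s' : STR k s -> (forall c i, (c = 50 \/ c = 91 \/ c = 92 \/ c = 93)%nat -> env s' (c, i) = env s (c, i)) ->
 STR k s'.
Proof. intros [] E. constructor; intros i Hi; rewrite !E by lia; auto. Qed.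

(** The [qg] zeros at the end of the output produced so far are not yet encoded, because their run
    may continue. *)
Record OUT (k : nat) (E : list bool) (s : vst) : Prop := {
 ou_T : senc T = E ++ senc_from (env s qg) (skipn k T);
 ou_g : env s qg <= N.of_nat k;
 ou_A : ACC E s;
 ou_C : env s qC < w }.

Lemma OUT_ext k E s s' : OUT k E s -> (forall c i, (c = 95 \/ c = 96)%nat -> env s' (c, i) = env s (c, i)) ->
 (forall a, cm s' t a = cm s t a) -> OUT k E s'.
Proof.
 intros [] E1 E2. constructor; rewrite ?E1 by lia; auto. destruct ou_A0. constructor; rewrite ?E1 by lia; auto.
 intros. rewrite E2. auto.
Qed.

Record QS (k : nat) (E : list bool) (s : vst) : Prop := {
 qs_k : (k <= n)%nat; qs_S : env s vS = sq k; qs_SI : SI s; qs_STR : STR k s; qs_OUT : OUT k E s }.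

Definition Pp (s : vst) (E : list bool) : N := nsum t (fun i => 2 * env s (qp i)) + N.of_nat (length E).
Definition Pr (s : vst) : N := nsum t (fun i => runlen (env s (vr i))).
(** The potential [Pp - Pr] grows by at least [g], rearranged so as to avoid truncated
    subtraction. *)
Definition PG (g : N) (s : vst) (E : list bool) (s' : vst) (E' : list bool) : Prop := Pp s E + Pr s' + g <= Pp s' E' + Pr s.

Lemma PG_intro s E s' E' (d : nat -> N) g j : (forall i, (i < t)%nat -> 2 * env s (qp i) + runlen (env s' (vr i)) + d i <= 2 * env s' (qp i) + runlen (env s (vr i))) ->
 N.of_nat (length E) + j <= N.of_nat (length E') -> g <= nsum t d + j -> PG g s E s' E'.
Proof.
 intros H1 H2 H3. unfold PG, Pp, Pr. apply nsum_le in H1. rewrite !nsum_add in H1. cbv beta in H1. lia.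
Qed.

Lemma HsW : sigma <= 2 ^ W.
Proof. transitivity (2 ^ B); auto. apply N.pow_le_mono_r; nia. Qed.

Lemma HqW1 : q <= 2 ^ W.
Proof. pose proof (pow2_pos b). nia. Qed.

Lemma HMW : 2 * MM + 4 <= W.
Proof. nia. Qed.

Lemma HnW : 2 * N.of_nat n < 2 ^ W.
Proof.
 apply N.le_lt_trans with (2 ^ (B + 1)); [rewrite N.pow_add_r; lia|]. apply N.pow_lt_mono_r; [lia|]. pose proof HMW. lia.
Qed.

Notation of_run f := (f t sigma q Tr W n Ss T sq Ht HsW HqW1 HSs HS HT Hs0 Hsq).

Lemma APPLY_spec s E k k' : SI s -> (k <= k' <= n)%nat -> OUT k E s ->
 OutRel (env s vF) (env s vz0) (env s vo) (env s vol) (env s vz) (firstn (k' - k) (skipn k T)) ->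
 N.of_nat k + env s vz0 <= N.of_nat k' -> N.of_nat k + env s vz <= N.of_nat k' -> env s vol <= N.of_nat R * w ->
 wp (APPLY t R) (fun c s' => exists E', OUT k' E' s' /\ N.of_nat c * b + N.of_nat (length E) <= N.of_nat (length E') /\
  (env s vF <> 0 -> N.of_nat (length E') = N.of_nat (length E) + runlen (env s qg + env s vz0) + env s vol) /\
  (env s vF = 0 -> env s' qg = env s qg + env s vz) /\ (env s vF <> 0 -> env s' qg = env s vz)) s.
Proof.
 intros HI Hk [O1 O2 O3 O4] (R1 & R2 & R3) Hz0 Hz Hol. unfold APPLY.
 assert (Hsk : skipn k T = firstn (k' - k) (skipn k T) ++ skipn k' T).
 { rewrite <- (firstn_skipn (k' - k) (skipn k T)) at 1. f_equal. rewrite skipn_skipn. f_equal. lia. }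
 pose proof HnW as HnW. destruct HI. apply wp_if; vs; intros HF.
 - specialize (R3 HF). set (g := env s qg) in *. set (z0 := env s vz0) in *.
  assert (Hg : g + z0 < 2 ^ W) by lia.
  assert (Hrl : runlen (g + z0) <= MM).
  { transitivity (2 * B + 2); auto. apply runlen_le_exp. lia. }
  assert (Efull : senc T = (E ++ zero_run_token (g + z0) ++ bitsN (env s vol) (env s vo)) ++ senc_from (env s vz) (skipn k' T)).
  { rewrite O1, Hsk, R3, <- !app_assoc. reflexivity. }
  assert (HEl : N.of_nat (length E) + runlen (g + z0) + env s vol < 2 ^ W).
  { apply (f_equal (@length bool)) in Efull. rewrite !length_app, bits_length in Efull. rewrite <- zrt_length. lia. }
  apply wp_set_seq, wp_seq. vs. fold g z0. rewrite N.mod_small by auto.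
  eapply wp_mono.
  { eapply (APPZ_spec w W (tr_step Tr) t G R HWbig Hw HWG) with (E := E) (b := b) (g := g + z0); vs; eauto; try lia.
   - destruct O3. constructor; vs; auto. }
  intros n1 s1 F1 (B1 & B2 & B3).
  assert (K1 : forall c i, (30 <= c < 40)%nat -> env s1 (c, i) = env s (c, i)).
  { intros c i Hc. rewrite (fv F1).
   - cbn [upd env]. destruct (peqb_spec (c, i) qg) as [EE|]; auto. inversion EE; lia.
   - unfold APPZ. cbn [modv]. rewrite APPEND_keep by (cbn [fst]; lia). unfold LOG. keep. }
  assert (K2 : env s1 vw = w).
  { rewrite (fv F1); [vs; auto|]. unfold APPZ. cbn [modv]. rewrite APPEND_keep by (cbn [fst]; lia). reflexivity. }
  do 2 apply wp_set_seq. vs. apply wp_seq. eapply wp_mono.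
  { eapply (APPEND_spec w W (tr_step Tr) t G R HWbig Hw HWG) with (E := E ++ zero_run_token (g + z0)) (v := env s vo) (k := env s vol); vs; rewrite ?K1 by lia; auto.
   - destruct B1. constructor; vs; auto.
   - rewrite length_app, Nat2N.inj_add, zrt_length. auto. }
  intros n2 s2 F2 (-> & C1 & C2). apply wp_set. vs.
  assert (K3 : env s2 vz = env s vz).
  { rewrite (fv F2); [vs; apply K1; lia|]. rewrite APPEND_keep; [reflexivity|cbn [fst]; lia]. }
  rewrite K3. exists ((E ++ zero_run_token (g + z0)) ++ bitsN (env s vol) (env s vo)).
  split; [constructor; vs|].
  + rewrite Efull, <- !app_assoc. reflexivity.
  + lia.
  + destruct C1. constructor; vs; auto.
  + auto.
  + rewrite !length_app, bits_length. pose proof (zrt_length (g + z0)).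
   split; [rewrite Nat.add_0_r in *; lia|]. split; [intros _; lia|]. split; [lia|auto].
 - destruct (R2 HF) as (_ & _ & Hys). apply wp_set. vs. rewrite N.mod_small by lia.
  exists E. split; [constructor; vs|].
  + rewrite O1, Hsk, Hys, senc_from_zeros, N2Nat.id. auto.
  + lia.
  + destruct O3. constructor; vs; auto.
  + auto.
  + split; [lia|]. split; [lia|]. split; auto. lia.
Qed.

Lemma LOADS_spec k s : SI s -> STR k s ->
 wp (fors t (LOADWIN G)) (fun c s' => c = 0%nat /\ forall i, (i < t)%nat ->
  wmatch MM (env s' (vV i)) (skipn (N.to_nat (env s (qp i))) (bs i))) s.
Proof.
 intros HI HR. eapply wp_mono.
 { apply wp_fors with (I := fun j a s' => a = 0%nat /\ (forall v, fst v <> 51%nat -> v <> qx -> env s' v = env s v) /\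
   (forall c a, cm s' c a = cm s c a) /\ forall i, (i < j)%nat -> wmatch MM (env s' (vV i)) (skipn (N.to_nat (env s (qp i))) (bs i))).
  - intros j a s1 Hj (-> & K1 & K2 & L1). destruct HI. destruct HR as [P1 P2]. destruct (P1 j Hj) as (P3 & P4 & P5).
   eapply wp_mono.
   { eapply (LOADWIN_spec w W (tr_step Tr) G R HWbig Hw HWG j s1 (bs j)); rewrite ?K1 by vlia; auto.
    - rewrite si_ln0; auto.
    - rewrite si_ln0; auto.
    - intros. rewrite K2. auto.
    - intros x Hx. unfold bitat. rewrite K2. apply si_bit0; auto. }
   intros c s2 F2 (-> & L2). rewrite K1 in L2 by vlia. sp. split.
   { intros v Hv1 Hv2. rewrite (fv F2); auto. apply LOADWIN_keep; auto. intros ->. cbn [fst] in Hv1. lia. }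
   split.
   { intros c x. rewrite (fc F2); auto. unfold LOADWIN. cbn [modc]. rewrite modc_fors; reflexivity. }
   intros i Hi. destruct (Nat.eq_dec i j) as [->|Hij]; auto. rewrite (fv F2); [apply L1; lia|].
   apply LOADWIN_keep; intros EE; inversion EE; lia.
  - sp. sp. sp. intros; lia. }
 intros c s' _ (-> & _ & _ & H). auto.
Qed.

Lemma beta_pos : 1 <= beta.
Proof. unfold run_bits. nia. Qed.

Lemma fields item k i : (k / 2 ^ (N.of_nat i * fld_bits t b)) mod 2 ^ fld_bits t b = item ->
 fldV t b i k = item mod 2 ^ b /\ fldr t b i k = item / 2 ^ b.
Proof.
 unfold fldV, fldr. rewrite (N.add_comm _ b), N.pow_add_r, (N.mul_comm (2 ^ b)), <- N.Div0.div_div.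
 set (x := k / _). unfold fld_bits. intros <-. rewrite N.pow_add_r.
 set (P := 2 ^ beta). set (Q := 2 ^ b). pose proof (pow2_pos beta). pose proof (pow2_pos b). fold P Q in H, H0. clearbody x P Q.
 rewrite (N.mul_comm P Q), N.Div0.mod_mul_r. split.
 - rewrite (N.mul_comm Q), N.Div0.mod_add, N.Div0.mod_mod. auto.
 - rewrite (N.mul_comm Q), N.div_add by lia. rewrite (N.div_small (x mod Q)) by (apply N.mod_lt; lia). auto.
Qed.

Lemma KEY_spec s : SI s -> (forall i, (i < t)%nat -> env s (vV i) < 2 ^ MM /\ env s (vr i) < 2 ^ W) ->
 wp (KEY t) (fun c s' => c = 0%nat /\ env s' vkey < 2 ^ tot /\ forall i, (i < t)%nat ->
  env s' (qmin i) = N.min (env s (vr i)) (2 ^ beta - 1) /\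
  fldV t b i (env s' vkey) = env s (vV i) / 2 ^ (MM - b) /\ fldr t b i (env s' vkey) = env s' (qmin i)) s.
Proof.
 intros [] HV. unfold KEY. apply wp_set_seq. pose proof beta_pos as Hbe. pose proof (pow2_pos beta) as Hpb.
 assert (HbeW : 2 ^ beta <= 2 ^ W) by (apply N.pow_le_mono_r; lia).
 set (mn := fun i => N.min (env s (vr i)) (2 ^ beta - 1)). set (item := fun i => mn i * 2 ^ b + env s (vV i) / 2 ^ (MM - b)).
 assert (HVb : forall i, (i < t)%nat -> env s (vV i) / 2 ^ (MM - b) < 2 ^ b).
 { intros i Hi. apply div_pow_lt. replace (MM - b + b) with MM by lia. apply HV; auto. }
 assert (Hit : forall i, (i < t)%nat -> item i < 2 ^ fld_bits t b).
 { intros i Hi. unfold item, fld_bits. apply append_lt; auto. unfold mn. lia. }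
 eapply wp_mono.
 { apply wp_fors with (I := fun j a s' => a = 0%nat /\ (forall v, fst v <> 94%nat -> v <> vkey -> env s' v = env s v) /\
   (forall i, (t - j <= i < t)%nat -> env s' (qmin i) = mn i) /\ env s' vkey < 2 ^ (N.of_nat j * fld_bits t b) /\
   forall m, (m < j)%nat -> (env s' vkey / 2 ^ (N.of_nat m * fld_bits t b)) mod 2 ^ fld_bits t b = item (t - j + m)%nat).
  - intros j a s1 Hj (-> & K1 & K2 & K3 & K4). set (i := (t - 1 - j)%nat). assert (Hi : (i < t)%nat) by (unfold i; lia).
   destruct (HV i Hi) as [HVi Hri].
   apply wp_seq. eapply wp_mono with (Q := fun c s2 => c = 0%nat /\ (forall v, v <> qmin i -> env s2 v = env s1 v) /\ env s2 (qmin i) = mn i).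
   { apply wp_if; vs; rewrite (K1 (vr i)), (K1 vbe), si_be0 by vlia; intros Hr; apply wp_set; vs;
     (split; [auto|]; split; [intros v Hv; destruct (peqb_spec v (qmin i)); [congruence|auto]|]).
    - rewrite (K1 vbe), si_be0 by vlia. rewrite N.mul_1_l.
     assert (2 ^ beta < 2 ^ W) by (apply N.pow_lt_mono_r; lia). rewrite N.mod_small by auto.
     unfold mn. assert (~ env s (vr i) < 2 ^ beta) by (rewrite <- div_pow_zero; auto). lia.
    - rewrite (K1 (vr i)) by vlia. apply div_pow_zero in Hr. unfold mn. lia. }
   intros c s2 _ (-> & L1 & L2). apply wp_set. vs. fold i.
   rewrite L2, !(L1 vkey), (L1 vbe), (L1 vb), (L1 (vV i)), (L1 qM) by discriminate.
   rewrite (K1 vbe), (K1 vb), (K1 (vV i)), (K1 qM), si_be0, si_b0, si_M0 by vlia.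
   set (key := env s1 vkey) in *. assert (Hm : mn i < 2 ^ beta) by (unfold mn; lia).
   assert (Hk1 : key * 2 ^ beta + mn i < 2 ^ (N.of_nat j * fld_bits t b + beta)) by (apply append_lt; auto).
   assert (Hk2 : (key * 2 ^ beta + mn i) * 2 ^ b + env s (vV i) / 2 ^ (MM - b) < 2 ^ (N.of_nat j * fld_bits t b + beta + b)) by (apply append_lt; auto).
   replace (N.of_nat j * fld_bits t b + beta + b) with (N.of_nat (S j) * fld_bits t b) in Hk2 by (unfold fld_bits; lia).
   assert (HpW : 2 ^ (N.of_nat (S j) * fld_bits t b) < 2 ^ W).
   { apply N.pow_lt_mono_r; [lia|]. assert (N.of_nat (S j) * fld_bits t b <= tot) by (apply N.mul_le_mono_r; lia). lia. }
   assert (Hk3 : 2 ^ (N.of_nat j * fld_bits t b + beta) <= 2 ^ W).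
   { apply N.pow_le_mono_r; [lia|]. assert (N.of_nat (S j) * fld_bits t b <= tot) by (apply N.mul_le_mono_r; lia).
    assert (N.of_nat (S j) * fld_bits t b = N.of_nat j * fld_bits t b + beta + b) by (unfold fld_bits; lia). lia. }
   assert (Hk4 : (key * 2 ^ beta + mn i) * 2 ^ b < 2 ^ W).
   { eapply N.le_lt_trans; [|exact HpW]. eapply N.le_trans; [|apply N.lt_le_incl, Hk2]. apply N.le_add_r. }
   pose proof (N.lt_trans _ _ _ Hk2 HpW) as Hk5.
   rewrite (N.mod_small (key * 2 ^ beta)) by lia. rewrite (N.mod_small (key * 2 ^ beta + mn i)) by lia.
   rewrite (N.mod_small ((key * 2 ^ beta + mn i) * 2 ^ b)) by auto. rewrite (N.mod_small _ _ Hk5).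
   sp. split.
   { intros v Hv1 Hv2. destruct (peqb_spec v vkey); [congruence|]. rewrite L1; auto. intros ->. cbn [fst] in Hv1. lia. }
   split.
   { intros i' Hi'. destruct (Nat.eq_dec i' i) as [->|Hn]; auto. rewrite L1 by (intros EE; injection EE; auto).
    apply K2. clear - Hi' Hn Hi Hj. subst i. lia. }
   sp.
   assert (Enew : (key * 2 ^ beta + mn i) * 2 ^ b + env s (vV i) / 2 ^ (MM - b) = key * 2 ^ fld_bits t b + item i).
   { unfold item, fld_bits. rewrite N.pow_add_r. ring. }
   rewrite Enew. intros m Hmj. specialize (Hit i Hi). pose proof (pow2_pos (fld_bits t b)) as Hpf. destruct m as [|m].
   + rewrite N.mul_0_l, N.pow_0_r, N.div_1_r, N.add_comm, N.Div0.mod_add, N.mod_small by auto. f_equal. clear - Hj. subst i. lia.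
   + replace (N.of_nat (S m) * fld_bits t b) with (fld_bits t b + N.of_nat m * fld_bits t b) by lia.
    rewrite N.pow_add_r, <- N.Div0.div_div, N.div_add_l by lia. rewrite (N.div_small (item i)) by auto. rewrite N.add_0_r.
    rewrite K4 by (clear - Hmj; lia). f_equal. clear - Hj Hmj. lia.
  - vs. sp. split; [intros v _ Hv; destruct (peqb_spec v vkey); [congruence|auto]|]. split; [intros; lia|].
   split; [reflexivity|]. intros; lia. }
 intros c s' _ (-> & K1 & K2 & K3 & K4). sp. split; [exact K3|]. intros i Hi. rewrite K2 by lia.
 specialize (K4 i Hi). replace (t - t + i)%nat with i in K4 by lia. destruct (fields _ _ _ K4) as [E1 E2]. rewrite E1, E2.
 sp. specialize (HVb i Hi). unfold item. pose proof (pow2_pos b). split.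
 - rewrite N.add_comm, N.Div0.mod_add, N.mod_small; auto.
 - rewrite N.div_add_l by lia. rewrite N.div_small by auto. lia.
Qed.

Definition Ag (s s' : vst) : Prop :=
 (forall v, ~ (91 <= fst v <= 93)%nat -> fst v <> 50%nat -> v <> qx -> env s' v = env s v) /\
 (forall A i j, dm s' A i j = dm s A i j) /\ (forall k a, cm s' k a = cm s k a).

Lemma ADVS_spec e p (d rn : nat -> N) s : SI s ->
 (forall i, (i < t)%nat -> env s (qp i) = env s (qh i) * w + env s (ql i) /\ env s (ql i) < w) ->
 (forall i s', (i < t)%nat -> Ag s s' -> env s' (vr i) = env s (vr i) -> eval W s' (e i) = d i /\
   wp (p i) (fun c s2 => c = 0%nat /\ env s2 (vr i) = rn i) s') ->
 (forall i v, (i < t)%nat -> v <> vr i -> modv (p i) v = false) -> (forall i A, moda (p i) A = false) ->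
 (forall i c, modc (p i) c = false) -> (forall i, (i < t)%nat -> d i <= MM) ->
 (forall i, (i < t)%nat -> env s (qp i) + d i < 2 ^ W) ->
 wp (ADVS t G e p) (fun c s' => c = 0%nat /\ Ag s s' /\ forall i, (i < t)%nat ->
  env s' (qp i) = env s (qp i) + d i /\ env s' (qp i) = env s' (qh i) * w + env s' (ql i) /\
  env s' (ql i) < w /\ env s' (vr i) = rn i) s.
Proof.
 intros HI P1 He Hp1 Hp2 Hp3 Hd HdW. unfold ADVS. eapply wp_mono.
 { apply wp_fors with (I := fun j a s' => a = 0%nat /\ Ag s s' /\
   (forall i, (j <= i < t)%nat -> env s' (vr i) = env s (vr i) /\ env s' (qp i) = env s (qp i) /\
     env s' (qh i) = env s (qh i) /\ env s' (ql i) = env s (ql i)) /\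
   (forall i, (i < j)%nat -> env s' (qp i) = env s (qp i) + d i /\ env s' (qp i) = env s' (qh i) * w + env s' (ql i) /\
     env s' (ql i) < w /\ env s' (vr i) = rn i)).
  - intros j a s1 Hj (-> & A1 & K1 & K2). destruct (K1 j ltac:(lia)) as (L1 & L2 & L3 & L4).
   destruct (P1 j Hj) as (P3 & P4). destruct (He j s1 Hj A1 L1) as [He1 _].
   apply wp_set_seq. rewrite He1. apply wp_seq. eapply wp_mono.
   { eapply (ADV_spec w W (tr_step Tr) G R HWbig Hw HWG j _ (d j)); vs; rewrite ?L2, ?L3, ?L4; auto.
    destruct A1 as [A1 _]. rewrite A1 by vlia. apply HI. }
   intros c1 s2 F2 (-> & M1 & M2 & M3).
   assert (Q2 : forall v, (fst v <> 91 /\ fst v <> 92 /\ fst v <> 93)%nat \/ snd v <> j -> v <> qx -> env s2 v = env s1 v).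
   { intros v Hv Hv2. rewrite (fv F2) by (apply ADV_keep; auto). cbn [upd env]. destruct (peqb_spec v qx); [congruence|auto]. }
   assert (C2 : forall k a, cm s2 k a = cm s1 k a).
   { intros k0 a. rewrite (fc F2); [reflexivity|]. unfold ADV. cbn [modc]. rewrite modc_fors; reflexivity. }
   assert (D2 : forall A i' j', dm s2 A i' j' = dm s1 A i' j').
   { intros A i' j'. rewrite (fa F2); [reflexivity|]. unfold ADV. cbn [moda]. rewrite moda_fors; reflexivity. }
   assert (A2 : Ag s s2).
   { destruct A1 as (A1 & A3 & A4). split; [|split; intros; rewrite ?D2, ?C2; auto].
    intros v V1 V2 V3. rewrite Q2; [apply A1; auto| |auto]. lia. }
   destruct (He j s2 Hj A2) as [_ Hw2].
   { rewrite Q2; auto. left. cbn [fst]. lia. discriminate. }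
   eapply wp_mono; [exact Hw2|]. intros c2 s3 F3 (-> & N1). sp.
   assert (Q3 : forall v, v <> vr j -> env s3 v = env s2 v) by (intros; apply (fv F3), Hp1; auto).
   split.
   { destruct A2 as (A2 & A3 & A4). split; [|split; intros].
    - intros v V1 V2 V3. rewrite Q3; [apply A2; auto|]. intros ->. cbn [fst] in V2. lia.
    - rewrite (fa F3); auto.
    - rewrite (fc F3); auto. }
   split.
   { intros i Hi. rewrite !Q3 by (intros EE; inversion EE; lia). rewrite !Q2 by (first [discriminate|cbn [snd]; right; lia]).
    apply K1. lia. }
   intros i Hi. destruct (Nat.eq_dec i j) as [->|Hn].
   { rewrite !Q3 by discriminate. revert M1. vs. rewrite L2. auto. }
   rewrite !Q3 by (intros EE; inversion EE; lia). rewrite !Q2 by (first [discriminate|cbn [snd]; right; lia]). apply K2. lia.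
  - sp. split; [split; auto|]. sp. intros; lia. }
 intros c s' _ (-> & A & _ & K). auto.
Qed.

Lemma str_len i k : (i < t)%nat -> (length (str i k) <= n)%nat.
Proof.
 intros Hi. assert (E : length (nth i Ss []) = n) by (rewrite Forall_forall in HS; apply HS, nth_In; lia).
 unfold stream. rewrite length_skipn. lia.
Qed.

Lemma str_r i k r B' : (i < t)%nat -> str i k = repeat 0 (N.to_nat r) ++ B' -> r <= N.of_nat n.
Proof.
 intros Hi E. pose proof (str_len i k Hi). rewrite E, length_app, repeat_length in H. lia.
Qed.

Lemma vr_W k s i : STR k s -> (i < t)%nat -> env s (vr i) <= N.of_nat n.
Proof. intros [_ H] Hi. destruct (H i Hi) as (B' & E & _). eapply str_r; eauto. Qed.

(** The ways in which a look-up with gain [g] can end. Except at the end of the input or if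
    [b <= g], the next single step has to supply the missing gain. In the last case [b - x] bits
    were read from a stream without a pending run, gaining twice their number, and the next token
    has more than [x] bits: together at least [2 * b - x >= b]. *)
Definition stalled (g : N) (k : nat) (s : vst) : Prop :=
 k = n \/ b <= g \/ 2 ^ b <= nth k T 0 \/ (2 ^ b <= env s qg /\ forall i, (i < t)%nat -> 2 ^ b <= env s (vr i)) \/
 exists i f X rem' x, (i < t)%nat /\ env s (vr i) = 0 /\ f <= 1 /\ 0 < X /\
  skipn (N.to_nat (env s (qp i))) (bs i) = token f X ++ rem' /\ x < toklen X /\ x <= b /\ 2 * b <= g + 2 * x.

(** The table entry describes a simulation from the truncated data in the key; reading it as a
    [Phase] with the cut-off zeros as [D] makes it a statement about the actual run. *)
Lemma FAST_spec k E s : QS k E s ->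
 wp (FAST t G R) (fun c s' => exists k' E' g, (k <= k')%nat /\ QS k' E' s' /\ PG g s E s' E' /\
   N.of_nat c * b <= g /\ stalled g k' s') s.
Proof.
 intros [Hk HqS HI HR HO]. unfold FAST. pose proof HnW as HnW. pose proof (pow2_pos beta) as Hpb. pose proof beta_pos as Hbe.
 assert (Hbe2 : 2 <= 2 ^ beta) by (change 2 with (2 ^ 1) at 1; apply N.pow_le_mono_r; lia).
 pose proof (of_run sq_lt k Hk) as Hsqk.
 apply wp_seq. eapply wp_mono; [apply (LOADS_spec k s HI HR)|]. intros c1 s1 F1 (-> & L1).
 assert (K1 : forall v, fst v <> 51%nat -> v <> qx -> env s1 v = env s v).
 { intros v Hv1 Hv2. apply (fv F1). apply modv_fors. intros i Hi. apply LOADWIN_keep; auto. intros ->. apply Hv1. reflexivity. }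
 assert (C1 : forall k a, cm s1 k a = cm s k a).
 { intros k0 a. apply (fc F1). apply modc_fors. intros i Hi. unfold LOADWIN. cbn [modc]. rewrite modc_fors; reflexivity. }
 assert (D1 : forall A i j, dm s1 A i j = dm s A i j).
 { intros A i j. apply (fa F1). apply moda_fors. intros i' Hi. unfold LOADWIN. cbn [moda]. rewrite moda_fors; reflexivity. }
 assert (HI1 : SI s1).
 { eapply SI_ext; [exact HI|..]; other K1. }
 apply wp_seq. eapply wp_mono.
 { apply (KEY_spec s1 HI1). intros i Hi. split; [apply L1; auto|].
  rewrite K1 by vlia. pose proof (vr_W k s i HR Hi). lia. }
 intros c2 s2 F2 (-> & Hkey & L2).
 assert (K2 : forall v, fst v <> 51%nat -> fst v <> 94%nat -> v <> qx -> v <> vkey -> env s2 v = env s v).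
 { intros v Hv1 Hv2 Hv3 Hv4. rewrite (fv F2); [apply K1; auto|]. unfold KEY. cbn [modv].
  rewrite modv_fors by (intros; destruct v as [v1 v2]; cbn [fst] in *; keep). destruct (peqb_spec v vkey); [congruence|reflexivity]. }
 assert (C2 : forall k a, cm s2 k a = cm s k a).
 { intros k0 a. rewrite (fc F2); [apply C1|]. unfold KEY. cbn [modc]. rewrite modc_fors; reflexivity. }
 assert (D2 : forall A i j, dm s2 A i j = dm s A i j).
 { intros A i j. rewrite (fa F2); [apply D1|]. unfold KEY. cbn [moda]. rewrite moda_fors; reflexivity. }
 assert (HI2 : SI s2).
 { eapply SI_ext; [exact HI|..]; other K2. }
 assert (HR2 : STR k s2).
 { eapply STR_ext; [exact HR|other K2]. }
 assert (HO2 : OUT k E s2).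
 { eapply OUT_ext; [exact HO|..]; other K2. }
 set (key := env s2 vkey) in *.
 destruct (si_en _ HI2 (sq k) key Hsqk Hkey) as (c & nn & (j & S1 & S2 & S3 & S4 & S5 & S6 & S7 & _) & T1 & T2 & T3 & T4 & T5 & T6 & T7).
 set (c0 := init_c t b (sq k) key) in *.
 set (rm := fun i => N.min (env s (vr i)) (2 ^ beta - 1)).
 set (D := fun i => env s (vr i) - rm i).
 set (rem0 := fun i => skipn (N.to_nat (env s (qp i))) (bs i)).
 assert (L3 : forall i, (i < t)%nat -> env s2 (qmin i) = rm i /\ wmatch b (fldV t b i key) (rem0 i) /\ fldr t b i key = rm i).
 { intros i Hi. destruct (L2 i Hi) as (E1 & E2 & E3). rewrite K1 in E1 by vlia.
  split; [exact E1|]. split; [|rewrite E3; exact E1]. specialize (L1 i Hi).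
  replace MM with (b + (MM - b)) in L1 at 1 by lia. apply wmatch_split in L1 as (G1 & G2 & _).
  rewrite E2. split; auto. }
 assert (HP0 : Phase t n Ss T sq k D rem0 rm (fun _ => b) c0 k).
 { constructor; auto.
  - intros i Hi. destruct (L3 i Hi) as (_ & G1 & G2). destruct (st_B _ _ HR i Hi) as (B' & B1 & B2).
   cbn [wr wV wm init_c c0]. rewrite N.sub_diag. cbn [N.to_nat skipn]. exists B'. rewrite G2.
   split; [rewrite B1; f_equal; f_equal; f_equal; unfold D, rm; lia|]. split; [exact B2|]. split; [exact G1|].
   unfold D, rm. lia.
  - intros i Hi. reflexivity.
  - intros i Hi. cbn. rewrite N.sub_diag. cbn. lia.
  - intros i Hi. cbn [wr wm init_c c0]. destruct (L3 i Hi) as (_ & _ & ->). lia.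
  - rewrite Nat.sub_diag. cbn. split; [lia|]. sp. intros []; auto. }
 pose proof (of_run phase_steps b k D rem0 rm (fun _ => b) c0 k j c S1 HP0) as HP.
 pose proof (fuel_init W t b HWbig Hb HWb c0 ltac:(intros; reflexivity)) as Hfi.
 (* A run with hidden zeros has the visible length [2 ^ beta - 1], which exceeds the fuel and thus
    the number [j] of steps. *)
 specialize (HP ltac:(intros i Hi; destruct (L3 i Hi) as (_ & _ & G2); cbn [wr init_c c0]; rewrite G2; unfold D, rm; lia)).
 set (k' := (k + j)%nat) in *.
 assert (Hk' : (k <= k' <= n)%nat) by apply HP.
 assert (Hrn : forall i, (i < t)%nat -> wr c i + D i <= N.of_nat n).
 { intros i Hi. destruct (ph_SR _ _ _ _ _ _ _ _ _ _ _ _ HP i Hi) as (B' & B1 & _). eapply str_r; eauto. }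
 assert (Hplen : forall i, (i < t)%nat -> env s (qp i) + (b - wm c i) <= N.of_nat (length (bs i))).
 { intros i Hi. pose proof (ph_len _ _ _ _ _ _ _ _ _ _ _ _ HP i Hi) as Hl. unfold rem0 in Hl. rewrite length_skipn in Hl.
  pose proof (st_p _ _ HR i Hi) as (G1 & _). lia. }
 apply wp_seq. eapply wp_mono.
 { apply (ADVS_spec _ _ (fun i => b - wm c i) (fun i => wr c i + D i) s2 HI2).
  - intros i Hi. apply HR2. auto.
  - intros i s' Hi (A1 & A2 & _) A3. cbn [eval eop].
   rewrite !A2, (A1 vb), (A1 vS), (A1 vkey) by vlia.
   rewrite (si_b _ HI2). rewrite (K2 vS), HqS by vlia.
   fold key. destruct (T7 i Hi) as [T8 T9]. rewrite T9. sp.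
   apply wp_set. vs. sp. rewrite A3, !A2, (A1 vS), (A1 vkey), (A1 (qmin i)) by vlia.
   rewrite (K2 vS), HqS, (K2 (vr i)) by vlia. fold key. rewrite T8.
   destruct (L3 i Hi) as (-> & _). fold (D i). specialize (Hrn i Hi). rewrite N.mod_small; lia.
  - intros i v Hi Hv. cbn [modv]. destruct (peqb_spec v (vr i)); congruence.
  - reflexivity.
  - reflexivity.
  - intros i Hi. lia.
  - intros i Hi. rewrite K2 by vlia. pose proof (Hplen i Hi). pose proof (HLS i Hi). lia. }
 intros c3 s3 _ (-> & (A1 & A2 & A4) & A3).
 do 6 apply wp_set_seq. vs. rewrite (A1 vS), (A1 vkey), !A2 by vlia.
 rewrite (K2 vS), HqS by vlia. fold key. rewrite T1, T2, T3, T4, T5, T6.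
 set (s4 := upd _ _ _).
 assert (K4 : forall v, fst v <> 51%nat -> fst v <> 94%nat -> v <> qx -> v <> vkey -> ~ (91 <= fst v <= 93)%nat -> fst v <> 50%nat ->
  ~ (30 <= fst v <= 36)%nat -> env s4 v = env s v).
 { intros [v1 v2] V1 V2 V3 V4 V5 V6 V7. unfold s4. cbn [upd env fst] in *.
  distinct_vars (v1, v2).
  rewrite A1 by auto. apply K2; auto. }
 assert (Q4 : forall v, (91 <= fst v <= 93)%nat \/ fst v = 50%nat -> env s4 v = env s3 v).
 { intros [v1 v2] V1. unfold s4. cbn [upd env fst] in *.
  distinct_vars (v1, v2). auto. }
 assert (HI4 : SI s4).
 { eapply SI_ext; [exact HI|..]; intros; try (apply K4; cbn [fst]; first [lia|discriminate|intros EE; inversion EE; lia]).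
  - destruct H as [H|[H|H]]; [| |apply K4; cbn [fst]; first [lia|intros EE; inversion EE; lia]].
   + apply K4; cbn [fst]; first [lia|intros EE; inversion EE; lia].
   + subst. unfold s4. vs. rewrite A1 by vlia. apply K2; vlia.
  - unfold s4. cbn [upd dm]. rewrite A2. auto.
  - unfold s4. cbn [upd cm]. rewrite A4. auto. }
 assert (HR4 : STR k' s4).
 { constructor; intros i Hi; rewrite !Q4 by (cbn [fst]; lia); destruct (A3 i Hi) as (G1 & G2 & G3 & G4);
   rewrite K2 in G1 by vlia.
  - split; [rewrite G1; apply Hplen; auto|auto].
  - rewrite G1, G4. destruct (ph_SR _ _ _ _ _ _ _ _ _ _ _ _ HP i Hi) as (B' & B1 & B2 & _). exists B'. split; [exact B1|].
   rewrite <- B2. unfold rem0. rewrite skipn_skipn. f_equal. lia. }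
 assert (HO4 : OUT k E s4).
 { eapply OUT_ext; [exact HO|..].
  - intros; apply K4; cbn [fst]; first [lia|discriminate|intros EE; inversion EE; lia].
  - intros. unfold s4. cbn [upd cm]. rewrite A4. auto. }
 assert (V4 : env s4 vF = wF c /\ env s4 vz0 = wz0 c /\ env s4 vo = wo c /\ env s4 vol = wol c /\ env s4 vz = wz c /\ env s4 vS = wS c).
 { unfold s4. vs. auto 10. }
 destruct V4 as (V4a & V4b & V4c & V4d & V4e & V4f). clearbody s4.
 eapply wp_mono.
 { apply (APPLY_spec s4 E k k' HI4 Hk' HO4); rewrite ?V4a, ?V4b, ?V4c, ?V4d, ?V4e.
  - apply HP.
  - unfold k'. lia.
  - unfold k'. lia.
  - lia. }
 intros c5 s5 F5 (E' & O1 & O2 & O3 & O4 & O5). rewrite V4a, V4b, V4d in O3. rewrite V4a, V4e in O4, O5.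
 assert (K5 : forall v, ~ (20 < fst v < 24)%nat -> (fst v < 95)%nat -> env s5 v = env s4 v).
 { intros [v1 v2] V1 V2. cbn [fst] in *. apply (fv F5). unfold APPLY, APPZ, LOG. cbn [modv].
  rewrite APPEND_keep by (cbn [fst]; lia). keep. }
 assert (M5 : env s5 qM = env s4 qM /\ env s5 qMw = env s4 qMw).
 { split; apply (fv F5); unfold APPLY, APPZ, LOG; cbn [modv]; rewrite APPEND_keep by (cbn [fst]; lia); reflexivity. }
 destruct M5 as [M5 M6].
 assert (D5 : forall A i j, dm s5 A i j = dm s4 A i j).
 { intros. apply (fa F5), store_free_moda. unfold APPLY, APPZ, APPEND. cbn. rewrite store_free_fors; reflexivity. }
 assert (C5 : forall i a, (i < t)%nat -> cm s5 i a = cm s4 i a).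
 { intros i a Hi. apply (fc F5). unfold APPLY, APPZ, APPEND. cbn. rewrite modc_fors; [reflexivity|]. intros _ _.
  unfold FLUSH. cbn. destruct (Nat.eqb_spec i t); [lia|reflexivity]. }
 assert (HQ5 : QS k' E' s5).
 { constructor; auto; try lia.
  - rewrite K5 by (cbn [fst]; lia). rewrite V4f. apply HP.
  - eapply SI_ext; eauto. intros; apply K5; cbn [fst]; lia.
  - eapply STR_ext; eauto. intros; apply K5; cbn [fst]; lia. }
 set (e := N.of_nat (length E') - N.of_nat (length E)).
 assert (Hstream : forall i, (i < t)%nat -> env s5 (qp i) = env s (qp i) + (b - wm c i) /\ env s5 (vr i) = wr c i + D i).
 { intros i Hi. rewrite !K5, !Q4 by (cbn [fst]; lia). destruct (A3 i Hi) as (-> & _ & _ & ->).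
  rewrite K2 by vlia. auto. }
 assert (Hpot : forall i, (i < t)%nat -> 2 * env s (qp i) + runlen (env s5 (vr i)) <= 2 * env s5 (qp i) + runlen (env s (vr i))).
 { intros i Hi. destruct (Hstream i Hi) as [-> ->]. pose proof (ph_pot _ _ _ _ _ _ _ _ _ _ _ _ HP i Hi) as Hp.
  pose proof (proj1 (S7 i Hi)). replace (rm i + D i) with (env s (vr i)) in Hp by (unfold D, rm; lia). lia. }
 assert (Hgen : forall g, g <= e -> PG g s E s5 E').
 { intros g Hg. apply PG_intro with (d := fun _ => 0) (j := e).
  - intros i Hi. specialize (Hpot i Hi). lia.
  - unfold e. lia.
  - lia. }
 destruct (Nat.eq_dec k' n) as [Hkn|Hkn].
 { exists k', E', e. split; [lia|]. sp. split; [apply Hgen; lia|]. split; [unfold e; cbn [Nat.add]; lia|]. left. auto. }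
 destruct S3 as [S3|[S3|(S3 & S3')]].
 - destruct (of_run phase_stuck b k D rem0 rm (fun _ => b) c k' HP S3 ltac:(lia))
   as [(i & f & X & rem' & Hi & G1 & G2 & G3 & G4 & G5 & G6)|GG].
  (* The blocked stream has no pending run left, so nothing is subtracted from the doubled count of
     its bits. *)
  + exists k', E', (2 * (b - wm c i) + e). split; [lia|]. sp. split.
   { apply PG_intro with (d := fun i' => if Nat.eqb i' i then 2 * (b - wm c i) else 0) (j := e).
    - intros i' Hi'. destruct (Nat.eqb_spec i' i) as [->|]; [|specialize (Hpot i' Hi'); lia].
     destruct (Hstream i Hi) as [-> ->]. rewrite G1, G2. change (runlen (0 + 0)) with 0. lia.
    - unfold e. lia.
    - pose proof (nsum_ge t (fun i' => if Nat.eqb i' i then 2 * (b - wm c i) else 0) i Hi) as Hn. cbv beta in Hn.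
     rewrite Nat.eqb_refl in Hn. lia. }
   split; [unfold e; cbn [Nat.add]; lia|]. right. right. right. right. exists i, f, X, rem', (wm c i).
   destruct (Hstream i Hi) as [-> ->]. pose proof (proj1 (S7 i Hi)). sp. split; [lia|]. sp. sp.
   split; [|lia]. rewrite <- G5. unfold rem0. rewrite skipn_skipn. f_equal. lia.
  + exists k', E', e. split; [lia|]. sp. split; [apply Hgen; lia|]. split; [unfold e; cbn [Nat.add]; lia|].
   right. right. left. auto.
 (* At least [b > 0] bits were produced, so the phase output contains a nonzero symbol and the bits
    are indeed appended. *)
 - assert (HF : wF c <> 0).
  { intros HF. destruct (ph_out _ _ _ _ _ _ _ _ _ _ _ _ HP) as (_ & GG & _). specialize (GG HF). lia. }
  specialize (O3 HF).
  exists k', E', e. split; [lia|]. sp. split; [apply Hgen; lia|]. split; [unfold e; cbn [Nat.add]; lia|].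
  right. left. unfold e. lia.
 - exists k', E', e. split; [lia|]. sp. split; [apply Hgen; lia|]. split; [unfold e; cbn [Nat.add]; lia|].
  right. right. right. left. split.
  + destruct (N.eq_dec (wF c) 0) as [HF|HF]; [rewrite (O4 HF)|rewrite (O5 HF)]; lia.
  + intros i Hi. destruct (Hstream i Hi) as [_ ->]. specialize (S3' i Hi). lia.
Qed.

Lemma skipn_zeros k e : (k + e <= n)%nat -> (forall m, (m < e)%nat -> nth (k + m) T 0 = 0) ->
 skipn k T = repeat 0 e ++ skipn (k + e) T.
Proof.
 intros Hk Hz. rewrite <- (firstn_skipn e (skipn k T)) at 1. rewrite skipn_skipn. f_equal; [|f_equal; lia].
 apply nth_ext with 0 0.
 - rewrite length_firstn, length_skipn, repeat_length. lia.
 - intros m Hm. rewrite length_firstn, length_skipn in Hm. rewrite nth_firstn.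
  destruct (Nat.ltb_spec m e); [|lia]. rewrite nth_skipn, Hz, nth_repeat by lia. auto.
Qed.

Lemma zero_input k s m i : STR k s -> (k <= n)%nat -> (i < t)%nat -> N.of_nat m < env s (vr i) ->
 (k + m < n)%nat /\ nth (k + m) (nth i Ss []) 0 = 0.
Proof.
 intros HR Hk Hi Hm. destruct (st_B _ _ HR i Hi) as (B' & E & _).
 assert (EL : length (nth i Ss []) = n) by (rewrite Forall_forall in HS; apply HS, nth_In; lia).
 unfold stream in E. split.
 - apply (f_equal (@length N)) in E. rewrite length_skipn, length_app, repeat_length in E. lia.
 - rewrite <- nth_skipn, E, app_nth1 by (rewrite repeat_length; lia). apply nth_repeat.
Qed.

Lemma zero_step k : (k < n)%nat -> (forall i, (i < t)%nat -> nth k (nth i Ss []) 0 = 0) ->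
 gz W (tr_step Tr) t q (sq k) = sq (S k) /\ (oz W (tr_step Tr) t (sq k) = 0 <-> nth k T 0 = 0).
Proof.
 intros Hk Hz.
 assert (E : map (fun S => nth k S 0) Ss = repeat 0 t).
 { apply nth_ext with 0 0; [rewrite length_map, repeat_length; auto|]. intros i Hi. rewrite length_map in Hi.
  rewrite (nth_indep _ 0 (nth k [] 0)) by (rewrite length_map; auto). rewrite (map_nth (fun S => nth k S 0)), nth_repeat. apply Hz. lia. }
 pose proof (Hsq k Hk) as Hs. rewrite E in Hs. unfold gz, oz. rewrite Hs. cbn [fst snd].
 pose proof (of_run sq_lt (S k) Hk) as H1.
 pose proof (of_run T_lt k Hk) as H2.
 pose proof HsW. pose proof HqW1. rewrite !N.mod_small by lia.
 destruct (N.ltb_spec (sq (S k)) q); [|lia]. split; auto. destruct (N.eqb_spec (nth k T 0) 0); split; auto; lia.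
Qed.

(** The three causes for the end of the jump are: an empty run, in which case nothing is skipped; a
    run with one zero left; a nonzero next output. In the latter two the following step finishes a
    run, of an input or of the output, that contains the whole skipped stretch, and its token pays
    for the jump. *)
Lemma SKIP_spec k E s : QS k E s -> (k < n)%nat ->
 wp (SKIP t) (fun c s' => exists e, (k + e < n)%nat /\ QS (k + e) E s' /\
  (forall i, (i < t)%nat -> env s' (qp i) = env s (qp i) /\ env s (vr i) = env s' (vr i) + N.of_nat e) /\
  env s' qg = env s qg + N.of_nat e /\ (forall m, (m < e)%nat -> nth (k + m) T 0 = 0) /\
  ((exists i, (i < t)%nat /\ env s (vr i) = 0) \/ (exists i, (i < t)%nat /\ env s' (vr i) = 1) \/ nth (k + e) T 0 <> 0) /\
  N.of_nat c * b <= 2 * N.log2 (N.of_nat e) + 2 * b) s.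
Proof.
 intros HQ Hkn. pose proof HQ as [Hk HqS HI HR HO]. unfold SKIP. apply wp_set_seq, wp_seq. pose proof HnW as HnW.
 set (s0 := upd s jX (env s (vr 0%nat))).
 assert (K0 : forall v, v <> jX -> env s0 v = env s v) by (intros v Hv; unfold s0; cbn [upd env]; destruct (peqb_spec v jX); congruence).
 eapply wp_mono.
 { apply wp_fors with (s := s0) (I := fun j a s' => a = 0%nat /\ (forall v, v <> jX -> env s' v = env s v) /\
   (forall i, (i < j)%nat -> env s' jX <= env s (vr i)) /\ exists i, (i < t)%nat /\ env s' jX = env s (vr i)).
  - intros j a s1 Hj (-> & K1 & M1 & (i0 & Hi0 & M2)). apply wp_if; vs; rewrite K1 by discriminate;
    destruct (N.ltb_spec (env s (vr j)) (env s1 jX)) as [Hlt|Hge]; try lia; intros _.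
   + apply wp_set. vs. rewrite K1 by discriminate. sp. split.
    { intros v Hv. destruct (peqb_spec v jX); [congruence|auto]. }
    split; [|exists j; auto]. intros i Hi. destruct (Nat.eq_dec i j) as [->|]; [lia|]. specialize (M1 i ltac:(lia)). lia.
   + apply wp_skip. sp. sp. split; [|exists i0; auto].
    intros i Hi. destruct (Nat.eq_dec i j) as [->|]; [auto|]. apply M1. lia.
  - sp. sp. split; [intros; lia|]. exists 0%nat. split; [lia|]. reflexivity. }
 intros c1 s1 F1 (-> & K1 & M1 & (i0 & Hi0 & M2)).
 assert (D1 : forall A i j, dm s1 A i j = dm s A i j).
 { intros. rewrite (fa F1); [reflexivity|]. rewrite moda_fors; reflexivity. }
 assert (C1 : forall k a, cm s1 k a = cm s k a).
 { intros. rewrite (fc F1); [reflexivity|]. rewrite modc_fors; reflexivity. }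
 assert (HI1 : SI s1) by (eapply SI_ext; [exact HI|..]; other K1).
 apply wp_if; vs; rewrite M2; intros Hm.
 2:{ apply wp_skip. exists 0%nat. rewrite Nat.add_0_r, N.add_0_r. sp. split.
   { constructor; auto.
    - rewrite K1; auto. discriminate.
    - eapply STR_ext; [exact HR|other K1].
    - eapply OUT_ext; [exact HO|..]; other K1. }
   split; [intros i Hi; rewrite !K1 by discriminate; split; auto; lia|]. split; [apply K1; discriminate|].
   split; [intros; lia|]. split; [left; exists i0; auto|]. lia. }
 set (mn := env s (vr i0)) in *.
 assert (Hmn : forall i, (i < t)%nat -> mn <= env s (vr i)) by (intros i Hi; rewrite <- M2; apply M1; auto).
 pose proof (vr_W k s i0 HR Hi0) as HmnW. fold mn in HmnW.
 assert (HbW : b <= W) by lia.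
 pose proof (of_run sq_lt k Hk) as Hsqk.
 do 2 apply wp_set_seq. vs. rewrite M2, (K1 vS), HqS by discriminate.
 set (s2 := upd _ _ _). apply wp_seq. eapply wp_mono.
 { apply (JUMP_spec w W (tr_step Tr) b q (gz W (tr_step Tr) t q) (oz W (tr_step Tr) t) HWbig Hb HbW HqW s (si_jd _ HI) s2 (sq k)).
  - intros A i j. unfold s2. cbn [upd dm]. auto.
  - unfold s2. vs. rewrite K1 by discriminate. apply HI.
  - unfold s2. vs. auto.
  - auto.
  - unfold s2. vs. lia. }
 intros c3 s3 F3 (eN & J1 & J2 & J3 & J4 & J5 & J6).
 assert (EX : env s2 jX = mn - 1) by (unfold s2; vs; auto). rewrite EX in *.
 set (e := N.to_nat eN) in *. assert (Ee : eN = N.of_nat e) by (unfold e; lia).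
 assert (Hz : forall m i, (m <= e)%nat -> (i < t)%nat -> (k + m < n)%nat /\ nth (k + m) (nth i Ss []) 0 = 0).
 { intros m i Hme Hi. apply (zero_input k s m i HR Hk Hi). specialize (Hmn i Hi). lia. }
 assert (Hit : forall m, (m <= e)%nat -> Nat.iter m (gz W (tr_step Tr) t q) (sq k) = sq (k + m)%nat).
 { induction m as [|m IH]; intros Hme; [rewrite Nat.add_0_r; reflexivity|]. rewrite Nat.add_succ_r.
  transitivity (gz W (tr_step Tr) t q (sq (k + m)%nat)); [exact (f_equal (gz W (tr_step Tr) t q) (IH ltac:(lia)))|].
  apply zero_step; [apply (Hz m 0%nat); lia|]. intros i Hi. apply (Hz m i); lia. }
 assert (Hoz : forall m, (m <= e)%nat -> oz W (tr_step Tr) t (Nat.iter m (gz W (tr_step Tr) t q) (sq k)) = 0 <-> nth (k + m) T 0 = 0).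
 { intros m Hme. rewrite Hit by auto. apply zero_step; [apply (Hz m 0%nat); lia|]. intros i Hi. apply (Hz m i); lia. }
 assert (Hken : (k + e < n)%nat) by (apply (Hz e 0%nat); lia).
 assert (HT0 : forall m, (m < e)%nat -> nth (k + m) T 0 = 0) by (intros m Hme; apply Hoz; [lia|apply J4; auto]).
 assert (K3 : forall v, ~ (60 <= fst v <= 69)%nat -> env s3 v = env s v).
 { intros [v1 v2] Hv. cbn [fst] in Hv. rewrite (fv F3) by (unfold JUMP, HORNER, TREE; keep).
  unfold s2. cbn [upd env]. distinct_vars (v1, v2).
  apply K1. intros EE; inversion EE; lia. }
 apply wp_set_seq, wp_seq. vs. eapply wp_mono.
 { apply wp_fors with (I := fun j a s' => a = 0%nat /\ (forall v, fst v <> 50%nat -> fst v <> 30%nat -> env s' v = env s3 v) /\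
   env s' vS = sq (k + e)%nat /\ (forall i, (j <= i < t)%nat -> env s' (vr i) = env s (vr i)) /\
   (forall i, (i < j)%nat -> env s' (vr i) = env s (vr i) - eN)).
  - intros j a s4 Hj (-> & L1 & L2 & L3 & L4). apply wp_set. vs. rewrite (L1 jE), J1, L3 by (cbn [fst]; lia).
   sp. split; [|split; [|split]].
   + intros v V1 V2. destruct (peqb_spec v (vr j)) as [->|]; [cbn [fst] in V1; lia|auto].
   + auto.
   + intros i Hi. neqs. apply L3. lia.
   + intros i Hi. destruct (Nat.eqb_spec i j) as [->|]; auto. apply L4. lia.
  - vs. sp. split; [|split; [|split]].
   + intros v V1 V2. destruct (peqb_spec v vS) as [->|]; [cbn [fst] in V2; lia|auto].
   + rewrite J2. apply Hit. lia.
   + intros i Hi. apply K3. cbn [fst]. lia.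
   + intros; lia. }
 intros c4 s4 F4 (-> & L1 & L2 & _ & L4). apply wp_set. vs.
 assert (K4 : forall v, ~ (60 <= fst v <= 69)%nat -> fst v <> 50%nat -> fst v <> 30%nat -> env s4 v = env s v).
 { intros v V1 V2 V3. rewrite L1 by auto. apply K3; auto. }
 assert (D4 : forall A i j, dm s4 A i j = dm s A i j).
 { intros. rewrite (fa F4) by (rewrite moda_fors; reflexivity). cbn [upd dm]. rewrite (fa F3) by reflexivity. unfold s2. cbn [upd dm]. apply D1. }
 assert (C4 : forall k a, cm s4 k a = cm s k a).
 { intros. rewrite (fc F4) by (rewrite modc_fors; reflexivity). cbn [upd cm]. rewrite (fc F3) by reflexivity. unfold s2. cbn [upd cm]. apply C1. }
 pose proof (ou_g _ _ _ HO) as Hg0.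
 rewrite (K4 qg), (L1 jE), J1 by (cbn [fst]; lia). rewrite N.mod_small by lia.
 exists e. sp. rewrite Ee in *. split; [|split; [|split; [auto|split; [auto|]]]].
 - constructor; vs.
  + lia.
  + auto.
  + eapply SI_ext; [exact HI|..]; vs; try (intros; first [apply D4|apply C4|apply K4; cbn [fst]; lia]).
   intros k0 j Hj. destruct (peqb_spec (k0, j) qg) as [EE|]; [inversion EE; lia|]. apply K4; cbn [fst]; lia.
  + constructor; intros i Hi; vs.
   * rewrite !K4 by (cbn [fst]; lia). apply HR; auto.
   * rewrite L4, K4 by (cbn [fst]; lia). destruct (st_B _ _ HR i Hi) as (B' & B1 & B2). exists B'. split; [|auto].
    unfold stream in *. replace (k + e)%nat with (e + k)%nat by lia. rewrite <- skipn_skipn, B1.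
    specialize (Hmn i Hi). rewrite skipn_app, repeat_length.
    replace (e - N.to_nat (env s (vr i)))%nat with 0%nat by lia. cbn [skipn].
    replace (N.to_nat (env s (vr i))) with (e + N.to_nat (env s (vr i) - N.of_nat e))%nat by lia.
    rewrite repeat_app, skipn_app, repeat_length, Nat.sub_diag, skipn_all2 by (rewrite repeat_length; lia). reflexivity.
  + constructor; vs.
   * rewrite (ou_T _ _ _ HO), (skipn_zeros k e) by (auto; lia). rewrite senc_from_zeros. reflexivity.
   * lia.
   * pose proof (ou_A _ _ _ HO) as [B1 B2 B3 B4 B5]. constructor; vs; rewrite ?K4 by (cbn [fst]; lia); auto.
    intros. rewrite C4. auto.
   * rewrite K4 by (cbn [fst]; lia). apply HO.
 - intros i Hi. vs. rewrite L4, K4 by (cbn [fst]; lia). specialize (Hmn i Hi). split; auto. lia.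
 - split; [|exact J6 || (rewrite !Nat.add_0_l, ?Nat.add_0_r; exact J6)].
  right. destruct J5 as [J5|J5].
  + left. exists i0. vs. rewrite L4 by auto. fold mn. split; [auto|lia].
  + right. intros E0. apply J5, Hoz; auto.
Qed.

(** The cost bound is the sum of [2 * b + g] for the jump, [g] for the step and [g] for appending
    the output. The final implications answer the cases of [stalled] one by one. *)
Lemma SLOW_spec k E s : QS k E s -> (k < n)%nat ->
 wp (SLOW t G R) (fun c s' => exists k' E' g, (k < k')%nat /\ QS k' E' s' /\ PG g s E s' E' /\
   N.of_nat c * b <= 2 * b + 3 * g /\
   (forall i f X rem', (i < t)%nat -> env s (vr i) = 0 -> f <= 1 -> 0 < X ->
    skipn (N.to_nat (env s (qp i))) (bs i) = token f X ++ rem' -> toklen X <= g) /\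
   (2 ^ b <= nth k T 0 -> b <= g) /\
   (2 ^ b <= env s qg -> (forall i, (i < t)%nat -> 2 ^ b <= env s (vr i)) -> b <= g)) s.
Proof.
 intros HQ Hkn. unfold SLOW. pose proof HnW as HnW. pose proof HMW as HMW. pose proof HsW as HsW. pose proof HqW1 as HqW1.
 apply wp_seq. eapply wp_mono; [apply (SKIP_spec k E s HQ Hkn)|].
 intros c1 s1 F1 (e & Hke & HQ1 & Z1 & Z2 & Z3 & Z4 & Z5). set (k1 := (k + e)%nat) in *.
 pose proof HQ1 as [Hk1 HqS1 HI1 HR1 HO1].
 apply wp_seq. eapply wp_mono; [apply (LOADS_spec k1 s1 HI1 HR1)|]. intros c2 s2 F2 (-> & L2).
 assert (K2 : forall v, fst v <> 51%nat -> v <> qx -> env s2 v = env s1 v).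
 { intros v Hv1 Hv2. apply (fv F2). apply modv_fors. intros i Hi. apply LOADWIN_keep; auto. intros ->. apply Hv1. reflexivity. }
 assert (C2 : forall k a, cm s2 k a = cm s1 k a).
 { intros k0 a. apply (fc F2). apply modc_fors. intros i Hi. unfold LOADWIN. cbn [modc]. rewrite modc_fors; reflexivity. }
 assert (D2 : forall A i j, dm s2 A i j = dm s1 A i j).
 { intros A i j. apply (fa F2). apply moda_fors. intros i' Hi. unfold LOADWIN. cbn [moda]. rewrite moda_fors; reflexivity. }
 apply wp_seq. eapply wp_mono.
 { apply wp_fors with (I := fun j a s' => a = 0%nat /\ (forall v, fst v <> 52%nat -> env s' v = env s2 v) /\
   (forall A i j, dm s' A i j = dm s2 A i j) /\ (forall k a, cm s' k a = cm s2 k a) /\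
   (forall i, (i < j)%nat -> env s' (vm i) = MM)).
  - intros j a s3 Hj (-> & M1 & M2 & M3 & M4). apply wp_set. vs.
   rewrite M1 by (cbn [fst]; lia). rewrite K2 by vlia. rewrite (si_M _ HI1).
   sp. split; [|split; [auto|split; [auto|]]].
   + intros v V1. destruct (peqb_spec v (vm j)) as [->|]; [cbn [fst] in V1; lia|auto].
   + intros i Hi. destruct (Nat.eqb_spec i j) as [->|]; auto. apply M4. lia.
  - sp. sp. sp. sp. intros; lia. }
 intros c3 s3 _ (-> & M1 & M2 & M3 & M4).
 assert (K3 : forall v, fst v <> 51%nat -> fst v <> 52%nat -> v <> qx -> env s3 v = env s1 v).
 { intros v V1 V2 V3. rewrite M1 by auto. apply K2; auto. }
 do 5 apply wp_set_seq. vs. set (s4 := upd _ _ _).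
 assert (K4 : forall v, fst v <> 51%nat -> fst v <> 52%nat -> v <> qx -> ~ (32 <= fst v <= 36)%nat -> env s4 v = env s1 v).
 { intros [v1 v2] V1 V2 V3 V4. unfold s4. cbn [upd env fst] in *.
  distinct_vars (v1, v2).
  apply K3; auto. }
 assert (V4 : forall i, (i < t)%nat -> env s4 (vV i) = env s2 (vV i) /\ env s4 (vm i) = MM /\ env s4 (vr i) = env s1 (vr i)).
 { intros i Hi. split; [|split].
  - unfold s4. vs. apply M1. cbn [fst]. lia.
  - unfold s4. vs. apply M4; auto.
  - apply K4; vlia. }
 assert (O4 : env s4 vF = 0 /\ env s4 vz0 = 0 /\ env s4 vo = 0 /\ env s4 vol = 0 /\ env s4 vz = 0) by (unfold s4; vs; auto).
 destruct O4 as (O4a & O4b & O4c & O4d & O4e).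
 assert (HI4 : SI s4).
 { eapply SI_ext; [exact HI1|..]; try (other K4); intros; unfold s4; cbn [upd dm cm]; rewrite ?M2, ?M3; auto. }
 assert (D4 : forall A i j, dm s4 A i j = dm s1 A i j) by (intros; unfold s4; cbn [upd dm]; rewrite M2; auto).
 assert (C4 : forall k a, cm s4 k a = cm s1 k a) by (intros; unfold s4; cbn [upd cm]; rewrite M3; auto).
 clearbody s4.
 set (rem0 := fun i => skipn (N.to_nat (env s1 (qp i))) (bs i)).
 assert (HP0 : Phase t n Ss T sq k1 (fun _ => 0) rem0 (fun i => env s1 (vr i)) (fun _ => MM) (wc_of s4) k1).
 { constructor; auto.
  - cbn. rewrite K4 by vlia. auto.
  - intros i Hi. cbn. destruct (V4 i Hi) as (-> & -> & ->). rewrite N.sub_diag. cbn [N.to_nat skipn].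
   destruct (st_B _ _ HR1 i Hi) as (B' & B1 & B2). exists B'. rewrite N.add_0_r. split; [exact B1|]. split; [exact B2|].
   split; [apply L2; auto|auto].
  - intros i Hi. cbn. destruct (V4 i Hi) as (_ & -> & _). lia.
  - intros i Hi. cbn. destruct (V4 i Hi) as (_ & -> & _). lia.
  - intros i Hi. cbn [wr wm wc_of]. destruct (V4 i Hi) as (_ & -> & ->). lia.
  - rewrite Nat.sub_diag. cbn. rewrite O4a, O4c, O4d, O4e. cbn. split; [lia|]. sp. intros []; auto. }
 apply wp_seq. eapply wp_mono.
 { apply (STEP_spec w W (tr_step Tr) t b HWbig ltac:(lia) MM s4). destruct HI4. repeat split; auto.
  - rewrite (proj1 (V4 i H)), (proj1 (proj2 (V4 i H))). apply L2. auto.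
  - rewrite (proj1 (proj2 (V4 i H))). lia.
  - rewrite O4c, O4d. reflexivity.
  - rewrite O4d, O4e. cbn [runlen N.eqb]. lia. }
 intros c5 s5 F5 [(Hav & HWS & Hc5)|(_ & Hst & _)].
 (* The step cannot fail here: windows of [MM] bits hold every token of the inputs, and every output
    symbol is below [2 ^ MM]. *)
 2:{ exfalso. destruct (of_run phase_stuck MM k1 _ rem0 _ _ _ k1 HP0 Hst Hke)
    as [(i & f & X & rem' & Hi & G1 & G2 & G3 & G4 & G5 & G6)|GG].
  - destruct (ph_SR _ _ _ _ _ _ _ _ _ _ _ _ HP0 i Hi) as (B' & B1 & B2 & B3 & _).
   rewrite G1 in B1. cbn [N.add N.to_nat repeat app] in B1. cbn [wc_of wm wV] in *. rewrite (proj1 (proj2 (V4 i Hi))) in *.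
   rewrite G5 in B3. pose proof (decode_incomplete _ _ f X rem' G3 G4 B3 G6) as Hnone. rewrite <- G5, B2 in B3.
   assert (HBn : B' <> []).
   { intros ->. apply (proj1 (stream_nil t sigma q Tr W n Ss T sq Ht HsW HqW1 HSs HS HT Hs0 i k1 Hi)) in B1. lia. }
   assert (Hbd : forall x f' B'', B' <> [] -> f' <= 1 -> 0 < x -> x <= 2 ^ B -> senc B' = token f' x ++ senc B'' -> False).
   { intros x f' B'' _ Hf' Hx Hxb Es. rewrite Es in B3.
    assert (toklen x <= MM). { transitivity (2 * B + 2); auto. pose proof (runlen_le_exp x B Hxb). unfold runlen in H. destruct (N.eqb_spec x 0); lia. }
    destruct (decode_complete _ _ _ _ _ Hf' Hx B3 H) as (V2 & Hsome & _). congruence. }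
   assert (HlenB : N.of_nat (length B') <= N.of_nat n).
   { rewrite <- B1. pose proof (str_len i k1 Hi). lia. }
   assert (HinB : Forall (fun a => a < sigma) B').
   { rewrite <- B1. assert (Hf : Forall (fun a => a < sigma) (nth i Ss [])) by (rewrite Forall_forall in HS; apply HS, nth_In; lia).
    unfold stream. rewrite <- (firstn_skipn k1) in Hf. apply Forall_app in Hf. tauto. }
   pose proof (senc_tokens B') as Htk. remember (senc B') as sB eqn:EsB. destruct Htk as [|u B'' Hu|x B'' Hx].
   + congruence.
   + apply (Hbd u 1 B''); auto; try lia. inversion HinB; subst. lia.
   + apply (Hbd x 0 B''); auto; try lia. rewrite length_app, repeat_length in HlenB. lia.
  - pose proof (of_run T_lt k1 Hke).
   assert (2 ^ B <= 2 ^ MM) by (apply N.pow_le_mono_r; lia). lia. }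
 destruct (of_run phase_step MM k1 _ rem0 _ _ _ k1 _ HP0 HWS ltac:(auto)) as (_ & HP & HdT).
 assert (K5 : forall v, (fst v < 10)%nat \/ (39 < fst v < 50)%nat \/ (56 < fst v)%nat \/ fst v = 31%nat -> env s5 v = env s4 v).
 { intros v Hv. apply (fv F5). apply STEP_keep. auto. }
 assert (D5 : forall A i j, dm s5 A i j = dm s1 A i j) by (intros; rewrite (fa F5) by apply STEP_moda; auto).
 assert (C5 : forall k a, cm s5 k a = cm s1 k a).
 { intros. rewrite (fc F5); [apply C4|]. unfold STEP. cbn [modc]. rewrite !modc_fors; reflexivity. }
 assert (Hvm : forall i, (i < t)%nat -> env s5 (vm i) <= MM) by (intros i Hi; apply (ph_m _ _ _ _ _ _ _ _ _ _ _ _ HP i Hi)).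
 assert (Hplen : forall i, (i < t)%nat -> env s1 (qp i) + (MM - env s5 (vm i)) <= N.of_nat (length (bs i))).
 { intros i Hi. pose proof (ph_len _ _ _ _ _ _ _ _ _ _ _ _ HP i Hi) as Hl. cbn [wm wc_of] in Hl. unfold rem0 in Hl. rewrite length_skipn in Hl.
  pose proof (st_p _ _ HR1 i Hi) as (G1 & _). lia. }
 assert (HI5 : SI s5).
 { eapply SI_ext; [exact HI4|..]; intros; rewrite ?D5, ?D4, ?C5, ?C4; auto; apply K5; cbn [fst]; lia. }
 assert (Kb : forall i, env s5 (qp i) = env s1 (qp i) /\ env s5 (qh i) = env s1 (qh i) /\ env s5 (ql i) = env s1 (ql i)).
 { intros i. rewrite !K5 by (cbn [fst]; lia). rewrite !K4 by vlia. auto. }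
 assert (Hst5 : forall i, (i < t)%nat -> next1 (env s1 (vr i)) (env s2 (vV i)) MM <> None /\
   exists u, next1 (env s1 (vr i)) (env s2 (vV i)) MM = Some (u, env s5 (vr i), env s5 (vV i), env s5 (vm i))).
 { intros i Hi. destruct HWS as (u & Hs & _). specialize (Hs i Hi). cbn [wr wV wm wc_of] in Hs.
  destruct (V4 i Hi) as (E1 & E2 & E3). rewrite E1, E2, E3 in Hs. split; [congruence|exists (u i); auto]. }
 apply wp_seq. eapply wp_mono with (Q := fun c s6 => c = 0%nat /\ Ag s5 s6 /\ forall i, (i < t)%nat ->
  env s6 (qp i) = env s5 (qp i) + (MM - env s5 (vm i)) /\ env s6 (qp i) = env s6 (qh i) * w + env s6 (ql i) /\
  env s6 (ql i) < w /\ env s6 (vr i) = env s5 (vr i)).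
 { apply (ADVS_spec _ _ (fun i => MM - env s5 (vm i)) (fun i => env s5 (vr i)) s5 HI5).
  - intros i Hi. destruct (Kb i) as (-> & -> & ->). apply HR1; auto.
  - intros i s' Hi (A1 & A2 & _) A3. cbn [eval eop]. rewrite (A1 qM), (A1 (vm i)) by vlia.
   rewrite (si_M _ HI5). sp. apply wp_skip. auto.
  - reflexivity.
  - reflexivity.
  - reflexivity.
  - intros; lia.
  - intros i Hi. destruct (Kb i) as (-> & _). pose proof (Hplen i Hi). pose proof (HLS i Hi). lia. }
 intros c6 s6 _ (-> & (A1 & A2 & A4) & A3).
 assert (HI6 : SI s6).
 { eapply SI_ext; [exact HI5|..]; other A1. }
 assert (HR6 : STR (S k1) s6).
 { constructor; intros i Hi; destruct (A3 i Hi) as (G1 & G2 & G3 & G4); rewrite (proj1 (Kb i)) in G1.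
  - split; [rewrite G1; apply Hplen; auto|auto].
  - rewrite G1, G4. destruct (ph_SR _ _ _ _ _ _ _ _ _ _ _ _ HP i Hi) as (B' & B1 & B2 & _). exists B'.
   cbn [wr wc_of wm] in *. rewrite N.add_0_r in B1. split; [exact B1|].
   rewrite <- B2. unfold rem0. rewrite skipn_skipn. f_equal. lia. }
 assert (HO6 : OUT k1 E s6).
 { eapply OUT_ext; [exact HO1|..].
  - intros c i Hc. rewrite A1, K5, K4 by (cbn [fst]; first [lia|intros EE; inversion EE; lia]). auto.
  - intros. rewrite A4, C5. auto. }
 assert (X6 : forall v, (30 <= fst v <= 36)%nat -> env s6 v = env s5 v).
 { intros v Hv. apply A1; [lia|lia|]. intros ->. cbn [fst] in Hv. lia. }
 assert (Hout1 : env s5 vz0 <= 1 /\ env s5 vz <= 1 /\ env s5 vol <= 2 * B + 2 /\ env s5 vz0 = 0 /\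
   (nth k1 T 0 <> 0 -> env s5 vF <> 0 /\ 2 * N.log2 (nth k1 T 0) + 2 <= env s5 vol)).
 { destruct HWS as (u & Hs & HS' & HY & Hout).
  assert (HYT : dout t (tr_step Tr) W (wc_of s4) u = nth k1 T 0).
  { rewrite <- HdT. unfold dout. cbn [wS wc_of]. f_equal. f_equal. f_equal. apply map_ext_in. intros i Hi. apply in_seq in Hi.
   destruct (symbols_sound t sigma q Tr W n Ss T sq Ht HsW HqW1 HSs HS HT Hs0 (wc_of s4) k1 u _ _ _ (fun _ => 0) _ ltac:(lia) Hs ltac:(auto)
    (ph_SR _ _ _ _ _ _ _ _ _ _ _ _ HP0)) as [_ Hu]. apply Hu. lia. }
  rewrite HYT in Hout. cbn [wF wz0 wo wol wz wc_of] in Hout. rewrite O4a, O4b, O4c, O4d, O4e in Hout. unfold out_step in Hout.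
  destruct (N.eqb_spec (nth k1 T 0) 0) as [E0|E0].
  - injection Hout as E1 E2 E3 E4 E5. rewrite E2, E4, E5. repeat split; try lia; congruence.
  - cbn [N.eqb] in Hout. injection Hout as E1 E2 E3 E4 E5. rewrite E1, E2, E4, E5.
   pose proof (of_run T_lt k1 Hke) as HTl.
   assert (nth k1 T 0 < 2 ^ B) by lia. apply toklen_lim in H; auto. unfold toklen in *. repeat split; lia. }
 destruct Hout1 as (X1 & X2 & X3 & X4 & X5).
 eapply wp_mono.
 { apply (APPLY_spec s6 E k1 (S k1) HI6 ltac:(lia) HO6); rewrite !X6 by (cbn [fst]; lia).
  - apply HP.
  - lia.
  - lia.
  - lia. }
 intros c7 s7 F7 (E' & P1 & P2 & P3 & P4 & P5). rewrite (X6 vF), (X6 vz0), (X6 vol) in P3 by (cbn [fst]; lia).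
 assert (K7 : forall v, ~ (20 < fst v < 24)%nat -> (fst v < 95)%nat -> env s7 v = env s6 v).
 { intros [v1 v2] V1 V2. cbn [fst] in *. apply (fv F7). unfold APPLY, APPZ, LOG. cbn [modv].
  rewrite APPEND_keep by (cbn [fst]; lia). keep. }
 assert (M7 : env s7 qM = env s6 qM /\ env s7 qMw = env s6 qMw).
 { split; apply (fv F7); unfold APPLY, APPZ, LOG; cbn [modv]; rewrite APPEND_keep by (cbn [fst]; lia); reflexivity. }
 destruct M7 as [M7a M7b].
 assert (D7 : forall A i j, dm s7 A i j = dm s6 A i j).
 { intros. apply (fa F7), store_free_moda. unfold APPLY, APPZ, APPEND. cbn. rewrite store_free_fors; reflexivity. }
 assert (C7 : forall i a, (i < t)%nat -> cm s7 i a = cm s6 i a).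
 { intros i a Hi. apply (fc F7). unfold APPLY, APPZ, APPEND. cbn. rewrite modc_fors; [reflexivity|]. intros _ _.
  unfold FLUSH. cbn. destruct (Nat.eqb_spec i t); [lia|reflexivity]. }
 assert (HQ7 : QS (S k1) E' s7).
 { constructor; auto; try lia.
  - rewrite K7, X6 by (cbn [fst]; lia). apply HP.
  - eapply SI_ext; [exact HI6|..]; other K7.
  - eapply STR_ext; [exact HR6|other K7]. }
 set (el := N.of_nat (length E') - N.of_nat (length E)).
 assert (Hel : N.of_nat (length E) + el = N.of_nat (length E')) by (unfold el; lia).
 assert (Hs7 : forall i, (i < t)%nat -> env s7 (qp i) = env s (qp i) + (MM - env s5 (vm i)) /\ env s7 (vr i) = env s5 (vr i)).
 { intros i Hi. rewrite !K7 by (cbn [fst]; lia). destruct (A3 i Hi) as (-> & _ & _ & ->). rewrite (proj1 (Kb i)), (proj1 (Z1 i Hi)). auto. }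
 set (gi := fun i => 2 * env s7 (qp i) + runlen (env s (vr i)) - (2 * env s (qp i) + runlen (env s7 (vr i)))).
 assert (Hgi : forall i, (i < t)%nat -> 2 * env s (qp i) + runlen (env s7 (vr i)) + gi i = 2 * env s7 (qp i) + runlen (env s (vr i)) /\
   MM - env s5 (vm i) <= gi i).
 { intros i Hi. destruct (Hs7 i Hi) as [E1 E2]. unfold gi. rewrite E1, E2. destruct (Hst5 i Hi) as (_ & u & Hn).
  apply next1_pot in Hn; [|apply L2; auto]. pose proof (runlen_mono (env s1 (vr i)) (env s (vr i)) ltac:(pose proof (proj2 (Z1 i Hi)); lia)).
  specialize (Hvm i Hi). lia. }
 set (g := nsum t gi + el).
 assert (Hgig : forall i, (i < t)%nat -> gi i <= g) by (intros i Hi; pose proof (nsum_ge t gi i Hi); unfold g; lia).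
 assert (HPG : PG g s E s7 E').
 { apply PG_intro with (d := gi) (j := el); [|lia|unfold g; lia]. intros i Hi. pose proof (proj1 (Hgi i Hi)). lia. }
 (* This run had [e + 1] zeros before the jump and is empty after the step, so the length of its
    token, subtracted so far, is set free. *)
 assert (Hend : forall i, (i < t)%nat -> env s1 (vr i) = 1 -> runlen (N.of_nat e + 1) <= g).
 { intros i Hi H1. destruct (Hst5 i Hi) as (_ & u & Hn). rewrite H1 in Hn. cbn in Hn. injection Hn as _ E2 _ E4.
  destruct (Hs7 i Hi) as [E5 E6]. pose proof (proj1 (Hgi i Hi)) as Hgi1. rewrite E5, E6, <- E2, <- E4 in Hgi1.
  rewrite (proj2 (Z1 i Hi)), H1 in Hgi1. change (runlen 0) with 0 in Hgi1. specialize (Hgig i Hi).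
  rewrite (N.add_comm 1) in Hgi1. lia. }
 (* A nonzero output symbol completes the pending output run, including the skipped zeros, so both
    its token and the literal are written. *)
 assert (Htok : nth k1 T 0 <> 0 -> runlen (env s qg + N.of_nat e) <= g /\ 2 * N.log2 (nth k1 T 0) + 2 <= g).
 { intros H1. destruct (X5 H1) as [HF Hl]. specialize (P3 HF). rewrite A1, K5, K4, Z2, X4, N.add_0_r in P3 by vlia.
  unfold g. lia. }
 exists (S k1), E', g. split; [lia|]. sp. sp. split; [|split; [|split]].
 - assert (HJ : 2 * N.log2 (N.of_nat e) <= g).
  { destruct (Nat.eq_dec e 0) as [->|He]; [cbn; lia|]. destruct Z4 as [(i & Hi & H1)|[(i & Hi & H1)|H1]].
   - pose proof (proj2 (Z1 i Hi)). lia.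
   - specialize (Hend i Hi H1). unfold runlen in Hend. destruct (N.eqb_spec (N.of_nat e + 1) 0); [lia|]. unfold toklen in Hend.
    pose proof (N.log2_le_mono (N.of_nat e) (N.of_nat e + 1) ltac:(lia)). lia.
   - destruct (Htok H1) as [H2 _]. unfold runlen in H2. destruct (N.eqb_spec (env s qg + N.of_nat e) 0); [lia|]. unfold toklen in H2.
    pose proof (N.log2_le_mono (N.of_nat e) (env s qg + N.of_nat e) ltac:(lia)). lia. }
  assert (HSt : N.of_nat c5 * b <= g).
  { assert (Hol : env s5 vol <= el).
   { destruct (N.eq_dec (env s5 vF) 0) as [HF|HF].
    - destruct (ph_out _ _ _ _ _ _ _ _ _ _ _ _ HP) as (_ & GG & _). cbn [wF wol wc_of] in GG. specialize (GG HF). lia.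
    - specialize (P3 HF). lia. }
   assert (Hsum : nsum t (fun i => env s4 (vm i)) <= nsum t (fun i => env s5 (vm i) + gi i)).
   { apply nsum_le. intros i Hi. rewrite (proj1 (proj2 (V4 i Hi))). pose proof (proj2 (Hgi i Hi)). lia. }
   rewrite nsum_add in Hsum. cbv beta in Hsum. unfold g. change (nsum t (fun i => gi i)) with (nsum t gi) in Hsum. lia. }
  assert (HA : N.of_nat c7 * b <= g) by (unfold g; lia).
  rewrite !Nat2N.inj_add. lia.
 (* An empty run forbids any skipping, so the step decodes precisely this token. *)
 - intros i f X rem' Hi H1 Hf HX Htk. pose proof (proj2 (Z1 i Hi)) as H2. assert (He : e = 0%nat) by lia.
  assert (Hr1 : env s1 (vr i) = 0) by lia.
  destruct (Hst5 i Hi) as (Hnn & u & Hn). rewrite Hr1 in Hn, Hnn. unfold next1 in Hn, Hnn. cbn [N.eqb] in Hn, Hnn.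
  pose proof (L2 i Hi) as Hwm. rewrite (proj1 (Z1 i Hi)), Htk in Hwm.
  destruct (N.lt_ge_cases MM (toklen X)) as [Hlt|Hge].
  { rewrite (decode_incomplete _ _ _ _ _ Hf HX Hwm Hlt) in Hnn. congruence. }
  destruct (decode_complete _ _ _ _ _ Hf HX Hwm Hge) as (V2 & Hd & _). rewrite Hd in Hn.
  assert (Em : env s5 (vm i) = MM - toklen X) by (destruct (f =? 0); injection Hn; auto).
  pose proof (proj2 (Hgi i Hi)). specialize (Hgig i Hi). lia.
 (* Skipped positions have output zero, so the large symbol is produced by the step itself. *)
 - intros HY. assert (He : e = 0%nat).
  { destruct (Nat.eq_dec e 0); auto. specialize (Z3 0%nat ltac:(lia)). rewrite Nat.add_0_r in Z3. pose proof (pow2_pos b). lia. }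
  unfold k1 in *. subst e. rewrite Nat.add_0_r in *. pose proof (pow2_pos b). destruct (Htok ltac:(lia)) as [_ H2].
  apply N.log2_le_mono in HY. rewrite N.log2_pow2 in HY by lia. lia.
 - intros Hg Hr. pose proof (pow2_pos b). destruct Z4 as [(i & Hi & H1)|[(i & Hi & H1)|H1]].
  + specialize (Hr i Hi). lia.
  + specialize (Hend i Hi H1). specialize (Hr i Hi). rewrite (proj2 (Z1 i Hi)), H1, N.add_comm in Hr. apply pow2_le_runlen in Hr. lia.
  + destruct (Htok H1) as [H2 _]. assert (H3 : 2 ^ b <= env s qg + N.of_nat e) by lia. apply pow2_le_runlen in H3. lia.
Qed.

Lemma MORE_spec k E s : QS k E s -> (eval W s MORE = 0 <-> k = n).
Proof.
 intros [Hk _ [_ _ _ _ _ _ Hln _ _ _ _ _] HR _]. cbn [eval eop]. rewrite Hln by lia. destruct (st_B _ _ HR 0%nat ltac:(lia)) as (B' & B1 & B2).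
 destruct (st_p _ _ HR 0%nat ltac:(lia)) as (P1 & _). pose proof (vr_W k s 0%nat HR ltac:(lia)) as Hr.
 pose proof HnW as HnW. pose proof HsW as HsW. pose proof HqW1 as HqW1.
 pose proof (stream_nil t sigma q Tr W n Ss T sq Ht HsW HqW1 HSs HS HT Hs0 0 k ltac:(lia)) as Hnil.
 assert (H2 : 2 <= 2 ^ W) by (change 2 with (2 ^ 1) at 1; apply N.pow_le_mono_r; lia).
 assert (Hskip : skipn (N.to_nat (env s (qp 0%nat))) (bs 0) = [] <-> env s (qp 0%nat) = N.of_nat (length (bs 0))).
 { split; intros H.
  - apply (f_equal (@length bool)) in H. rewrite length_skipn in H. cbn in H. lia.
  - apply skipn_all2. lia. }
 split.
 - intros H. destruct (N.ltb_spec (env s (qp 0%nat)) (N.of_nat (length (bs 0)))) as [Hlt|Hge].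
  + destruct (N.eq_dec (1 + env s (vr 0%nat)) (2 ^ W)) as [E1|E1]; [lia|]. rewrite N.mod_small in H by lia. lia.
  + rewrite N.add_0_l, N.mod_small in H by lia. rewrite H in B1. cbn in B1.
   assert (senc B' = []) by (rewrite <- B2; apply Hskip; lia).
   apply senc_eq_nil in H0.
   assert (k >= n)%nat by (apply Hnil; congruence). lia.
 - intros ->. assert (E1 : str 0 n = []) by (apply Hnil; lia). rewrite E1 in B1.
  assert (Hr0 : env s (vr 0%nat) = 0 /\ B' = []).
  { destruct (N.to_nat (env s (vr 0%nat))) eqn:Er; [|discriminate]. cbn in B1. split; [lia|auto]. }
  destruct Hr0 as [-> ->]. cbn in B2. apply Hskip in B2. rewrite B2, N.ltb_irrefl. reflexivity.
Qed.

(** In units of [b], a round costs at most [3 * b + g1 + 3 * g2] and gains [g1 + g2 >= b]; the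
    factor 7 covers this. A look-up that reaches the end may gain nothing, which is why [3 * b] is
    granted once when [k = n]. *)
Lemma QLOOP_spec s : QS 0 [] s -> (forall i, (i < t)%nat -> env s (vr i) = 0) ->
 wp (QLOOP t G R) (fun c s' => exists E, QS n E s' /\
  N.of_nat c * b <= 7 * (nsum t (fun i => 2 * N.of_nat (length (bs i))) + N.of_nat (length (senc T))) + 3 * b) s.
Proof.
 intros HQ0 Hr0. unfold QLOOP.
 set (tot2 := nsum t (fun i => 2 * N.of_nat (length (bs i))) + N.of_nat (length (senc T))).
 assert (Hbound : forall k E s', QS k E s' -> Pp s' E <= tot2).
 { intros k E s' [_ _ _ HR HO]. unfold Pp, tot2. apply N.add_le_mono.
  - apply nsum_le. intros i Hi. destruct (st_p _ _ HR i Hi) as (H & _). lia.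
  - rewrite (ou_T _ _ _ HO), length_app. lia. }
 apply wp_while_bound with (L := S (N.to_nat (7 * tot2))) (I := fun a s' => exists k E, QS k E s' /\
   N.of_nat a * b + 7 * Pr s' <= 7 * Pp s' E + (if Nat.eqb k n then 3 * b else 0)).
 - intros a s1 (k & E & HQ & Hc) Hm.
  assert (Hkn : (k < n)%nat).
  { assert (k <> n) by (intros E0; apply Hm, (MORE_spec k E s1 HQ); auto). pose proof (qs_k _ _ _ HQ). lia. }
  destruct (Nat.eqb_spec k n); [lia|].
  split.
  { pose proof (Hbound k E s1 HQ). assert (N.of_nat a <= N.of_nat a * b) by (clear - Hb; nia). lia. }
  apply wp_seq. eapply wp_mono; [apply (FAST_spec k E s1 HQ)|].
  intros c1 s2 _ (k1 & E1 & g1 & Hk1 & HQ1 & HG1 & Hc1 & Hst). unfold PG in HG1.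
  apply wp_if; intros Hm2.
  + assert (Hkn1 : (k1 < n)%nat).
   { assert (k1 <> n) by (intros E0; apply Hm2, (MORE_spec k1 E1 s2 HQ1); auto). pose proof (qs_k _ _ _ HQ1). lia. }
   eapply wp_mono; [apply (SLOW_spec k1 E1 s2 HQ1 Hkn1)|].
   intros c2 s3 _ (k2 & E2 & g2 & Hk2 & HQ2 & HG2 & Hc2 & G1 & G2 & G3). unfold PG in HG2.
   exists k2, E2. sp.
   assert (Hgain : b <= g1 + g2).
   { destruct Hst as [Hst|[Hst|[Hst|[(Hst1 & Hst2)|(i & f & X & rem' & x & Hi & H1 & H2 & H3 & H4 & H5 & H6 & H7)]]]].
    - lia.
    - lia.
    - specialize (G2 Hst). lia.
    - specialize (G3 Hst1 Hst2). lia.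
    - specialize (G1 i f X rem' Hi H1 H2 H3 H4). lia. }
   rewrite Nat2N.inj_succ, !Nat2N.inj_add. destruct (Nat.eqb k2 n); lia.
  + apply wp_skip. apply (MORE_spec k1 E1 s2 HQ1) in Hm2. subst k1. exists n, E1. sp.
   rewrite Nat.eqb_refl, Nat2N.inj_succ, !Nat2N.inj_add. lia.
 - intros a s1 (k & E & HQ & Hc) Hm. apply (MORE_spec k E s1 HQ) in Hm. subst k. exists E. sp.
  rewrite Nat.eqb_refl in Hc. pose proof (Hbound n E s1 HQ). lia.
 - exists 0%nat, []. sp. unfold Pp, Pr. destruct HQ0 as [_ _ _ HR _].
  assert (Hr : nsum t (fun i => runlen (env s (vr i))) <= nsum t (fun _ => 0)).
  { apply nsum_le. intros i Hi. rewrite Hr0 by auto. reflexivity. }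
  rewrite nsum_const, N.mul_0_r in Hr. lia.
Qed.

Lemma QINIT_spec s : dm s (aP 0%nat) 0 0 = w -> dm s (aP 1%nat) 0 0 = b -> dm s (aP 2%nat) 0 0 = beta ->
 dm s (aP 3%nat) 0 0 = tr_init Tr -> (forall i, (i < t)%nat -> env s (qln i) = N.of_nat (length (bs i))) ->
 lg2ok b s -> (forall a k, a < q -> k < 2 ^ tot -> entry W (tr_step Tr) t b s a k) ->
 jump_data b q (gz W (tr_step Tr) t q) (oz W (tr_step Tr) t) s ->
 (forall i a, (i < t)%nat -> cm s i a < 2 ^ w) ->
 (forall i x, (i < t)%nat -> (x < length (bs i))%nat -> bitat w s i (N.of_nat x) = nth x (bs i) false) ->
 wp (QINIT t G) (fun c s' => c = 0%nat /\ QS 0 [] s' /\ forall i, (i < t)%nat -> env s' (vr i) = 0) s.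
Proof.
 intros P0 P1 P2 P3 P4 P5 P6 P7 P8 P9. unfold QINIT. do 5 apply wp_set_seq. apply wp_seq. vs. rewrite P0, P1, P2, P3.
 set (s1 := upd _ _ _). pose proof HMW as HMW.
 assert (K1 : forall i, env s1 (qln i) = env s (qln i)) by reflexivity.
 assert (V1 : env s1 vw = w /\ env s1 vb = b /\ env s1 vbe = beta /\ env s1 vS = tr_init Tr /\ env s1 qM = 0) by (unfold s1; vs; auto).
 assert (D1 : dm s1 = dm s /\ cm s1 = cm s) by (split; reflexivity). destruct D1 as [D1 C1]. destruct V1 as (V1 & V2 & V3 & V4 & V5). clearbody s1.
 eapply wp_mono.
 { apply wp_fors with (I := fun j a s' => a = 0%nat /\ (forall v, v <> qM -> env s' v = env s1 v) /\ dm s' = dm s1 /\ cm s' = cm s1 /\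
   env s' qM = N.of_nat j * w).
  - intros j a s2 Hj (-> & M1 & M2 & M3 & M4). apply wp_set. vs. rewrite (M1 vw), M4, V1 by discriminate.
   assert ((N.of_nat j + 1) * w <= MM) by (apply N.mul_le_mono_r; lia).
   rewrite N.mod_small by lia. sp. split; [|split; [auto|split; [auto|lia]]].
   intros v Hv. destruct (peqb_spec v qM); [congruence|auto].
  - auto. }
 intros c2 s2 _ (-> & M1 & M2 & M3 & M4). do 7 apply wp_set_seq. vs. rewrite M4, (M1 vw), V1 by discriminate.
 rewrite (N.mod_small (MM + w)) by nia. set (s3 := upd _ _ _).
 assert (K3 : forall v, fst v <> 95%nat -> fst v <> 96%nat -> fst v <> 31%nat -> env s3 v = env s1 v).
 { intros [v1 v2] E1 E2 E3. unfold s3. cbn [upd env fst] in *.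
  distinct_vars (v1, v2).
  apply M1. intros EE. inversion EE. lia. }
 assert (V6 : env s3 qM = MM /\ env s3 qMw = MM + w /\ env s3 vlim = MM /\ env s3 qg = 0 /\ env s3 qA = 0 /\ env s3 qC = 0 /\
  env s3 qO = 0 /\ env s3 qL = 0) by (unfold s3; vs; auto 10).
 assert (D3 : dm s3 = dm s /\ cm s3 = cm s) by (split; cbn [s3 upd dm cm]; congruence).
 destruct D3 as [D3 C3]. clearbody s3. eapply wp_mono.
 { apply wp_fors with (I := fun j a s' => a = 0%nat /\ (forall v, ~ (91 <= fst v <= 93)%nat -> fst v <> 50%nat -> env s' v = env s3 v) /\
   dm s' = dm s3 /\ cm s' = cm s3 /\ forall i, (i < j)%nat -> env s' (qp i) = 0 /\ env s' (qh i) = 0 /\ env s' (ql i) = 0 /\ env s' (vr i) = 0).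
  - intros j a s4 Hj (-> & N1 & N2 & N3 & N4). do 3 apply wp_set_seq. apply wp_set. vs.
   sp. split; [|split; [auto|split; [auto|]]].
   + intros [v1 v2] E1 E2. cbn [fst] in *.
    distinct_vars (v1, v2). auto.
   + intros i Hi. destruct (Nat.eqb_spec i j) as [->|]; auto. apply N4. lia.
  - sp. sp. sp. sp. intros; lia. }
 intros c4 s4 _ (-> & N1 & N2 & N3 & N4). sp. destruct V6 as (Q1 & Q2 & Q3 & Q4 & Q5 & Q6 & Q7 & Q8).
 split; [|intros i Hi; apply N4; auto]. constructor.
 - lia.
 - rewrite N1, K3, V4 by (cbn [fst]; lia). auto.
 - constructor; intros; try (rewrite N1 by (cbn [fst]; lia); auto; rewrite K3 by (cbn [fst]; lia); auto).
  + rewrite K1. auto.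
  + intros v Hv. rewrite N2, D3. apply P5; auto.
  + eapply entry_ext; [eauto..| |apply P6; auto]. intros. rewrite N2, D3. auto.
  + eapply jump_data_ext with (s := s); eauto; [nia|]. intros. rewrite N2, D3. auto.
  + rewrite N3, C3. auto.
  + unfold bitat. rewrite N3, C3. apply P9; auto.
 - constructor; intros i Hi; destruct (N4 i Hi) as (G1 & G2 & G3 & G4); [rewrite G1, G2, G3; lia|].
  rewrite G1, G4. exists (str i 0). split; reflexivity.
 - constructor; rewrite ?N1 by (cbn [fst]; lia); rewrite ?Q4, ?Q6; try lia; auto.
  constructor; rewrite ?N1 by (cbn [fst]; lia); rewrite ?Q5, ?Q6, ?Q7, ?Q8; cbn; auto; try lia.
Qed.

(** Beyond the main loop, the final output run is encoded, at a cost charged to its own token: hence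
    8 instead of 7. The last, partial word is stored left-aligned. *)
Lemma QUERY_spec s : dm s (aP 0%nat) 0 0 = w -> dm s (aP 1%nat) 0 0 = b -> dm s (aP 2%nat) 0 0 = beta ->
 dm s (aP 3%nat) 0 0 = tr_init Tr -> (forall i, (i < t)%nat -> env s (qln i) = N.of_nat (length (bs i))) ->
 lg2ok b s -> (forall a k, a < q -> k < 2 ^ tot -> entry W (tr_step Tr) t b s a k) ->
 jump_data b q (gz W (tr_step Tr) t q) (oz W (tr_step Tr) t) s ->
 (forall i a, (i < t)%nat -> cm s i a < 2 ^ w) ->
 (forall i x, (i < t)%nat -> (x < length (bs i))%nat -> bitat w s i (N.of_nat x) = nth x (bs i) false) ->
 wp (QUERY t G R) (fun c s' =>
  N.of_nat c * b <= 8 * (nsum t (fun i => 2 * N.of_nat (length (bs i))) + N.of_nat (length (senc T))) + 3 * b /\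
  env s' qL = N.of_nat (length (senc T)) /\
  forall x, (x < length (senc T))%nat -> bitat w s' t (N.of_nat x) = nth x (senc T) false) s.
Proof.
 intros P0 P1 P2 P3 P4 P5 P6 P7 P8 P9. unfold QUERY. apply wp_seq. eapply wp_mono; [apply QINIT_spec; auto|].
 intros c1 s1 _ (-> & HQ & Hr). apply wp_seq. eapply wp_mono; [apply (QLOOP_spec s1 HQ Hr)|].
 intros c2 s2 _ (E & HQ2 & Hc2). pose proof HQ2 as [_ _ HI2 _ [O1 O2 O3 O4]]. pose proof HnW as HnW.
 rewrite skipn_all2 in O1 by lia. cbn [senc_from] in O1.
 assert (HL : N.of_nat (length E) + runlen (env s2 qg) = N.of_nat (length (senc T))).
 { rewrite <- zrt_length, O1, length_app. lia. }
 apply wp_seq. destruct HI2. eapply wp_mono.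
 { apply (APPZ_spec w W (tr_step Tr) t G R HWbig Hw HWG E s2 b (env s2 qg)); auto; try lia.
  transitivity (2 * B + 2); [|lia]. apply runlen_le_exp. lia. }
 intros c3 s3 F3 (A3 & C3 & Hc3). rewrite <- O1 in A3. destruct A3 as [A1 A2 A4 A5 A6].
 assert (Hcost : N.of_nat (0 + (c2 + (c3 + 0))) * b <= 8 * (nsum t (fun i => 2 * N.of_nat (length (bs i))) + N.of_nat (length (senc T))) + 3 * b) by lia.
 assert (Hvw : env s3 vw = w).
 { rewrite (fv F3); auto. unfold APPZ, LOG. cbn [modv]. rewrite APPEND_keep by (cbn [fst]; lia). reflexivity. }
 apply wp_if; intros HC; cbn [eval] in HC.
 - apply wp_cell. split; [exact Hcost|]. vs. sp. rewrite Hvw.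
  set (c := env s3 qC) in *. set (a := env s3 qA) in *. set (o := env s3 qO) in *.
  assert (Hlt : a * 2 ^ (w - c) < 2 ^ w).
  { apply N.lt_le_trans with (2 ^ c * 2 ^ (w - c)); [apply N.mul_lt_mono_pos_r; [apply pow2_pos|auto]|].
   rewrite <- N.pow_add_r. apply N.pow_le_mono_r; lia. }
  assert (2 ^ w <= 2 ^ W) by (apply N.pow_le_mono_r; [lia|clear - HWG; nia]).
  rewrite (N.mod_small (a * 2 ^ (w - c)) (2 ^ W)) by lia. rewrite (N.mod_small _ (2 ^ w)) by lia.
  intros x Hx. unfold bitat. vs. destruct (N.lt_ge_cases (N.of_nat x) (o * w)) as [Hlo|Hge].
  + assert (N.of_nat x / w < o) by (apply N.Div0.div_lt_upper_bound; lia).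
   destruct (N.eqb_spec (N.of_nat x / w) o); [lia|]. apply A5. auto.
  + assert (E1 : N.of_nat x / w = o) by (symmetry; apply N.div_unique with (r := N.of_nat x - o * w); lia).
   assert (E2 : N.of_nat x mod w = N.of_nat x - o * w) by (symmetry; apply N.mod_unique with (q := o); lia).
   rewrite E1, E2, N.eqb_refl. rewrite N.mul_pow2_bits_high by lia.
   replace x with (N.to_nat (o * w) + (x - N.to_nat (o * w)))%nat at 2 by lia.
   rewrite <- nth_skipn, A4. rewrite nth_bits by lia. f_equal. lia.
 - apply wp_skip. split; [exact Hcost|]. sp. intros x Hx. apply A5. lia.
Qed.
End Query.

(** * Preprocessing *)

Notation pN := (82%nat, 0%nat).
Notation pI := (82%nat, 1%nat).
Notation pK := (82%nat, 2%nat).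
Notation pT := (82%nat, 3%nat).

(* [b] is chosen such that [2 ^ (scale * b)] bounds both [NN], up to a constant factor, and the size of the tables. *)
Definition scale (t : nat) : nat := t * (t + 7) + t + 6.

Definition BITS (t : nat) : stmt :=
 vb <- E1 ;; pK <- cst (scale t) ;;
 SWhile ($pN >>! $pK) (vb <- ($vb +! E1) ;; pK <- ($pK +! cst (scale t))).

Definition SIZES (t : nat) : stmt :=
 vbe <- E0 ;; fors (t + 6) (fun _ => vbe <- ($vbe +! $vb)) ;;
 pT <- E0 ;; fors (t * (t + 7)) (fun _ => pT <- ($pT +! $vb)) ;;
 vX <- (E1 <<! $vb) ;; vkn <- (E1 <<! $pT) ;; vlim <- $vb.

Definition LOGS : stmt :=
 SSt aLG E1 E0 E0 ;; gI <- (E1 +! E1) ;;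
 SWhile ($gI <! $vX) (SSt aLG ($gI) E0 (aLG[:$gI >>! E1:] +! E1) ;; gI <- ($gI +! E1)).

Definition PRE (t : nat) : stmt :=
 BITS t ;; SIZES t ;; LOGS ;; GRAPH t ;; BUILD t ;;
 SSt (aP 0%nat) E0 E0 ($vw) ;; SSt (aP 1%nat) E0 E0 ($vb) ;; SSt (aP 2%nat) E0 E0 ($vbe) ;; SSt (aP 3%nat) E0 E0 ($pI).

Lemma GRAPH_keep t v : (fst v < 60)%nat \/ fst v = 82%nat -> modv (GRAPH t) v = false.
Proof.
 destruct v as [k j]. cbn [fst]. intros. unfold GRAPH, NEXTS, JTAB, COLOR, TREES, WALK, CYCLE, NZROOT, POPS, PUSH. keep.
Qed.

Lemma GRAPH_moda t A : fst A = 1%nat -> moda (GRAPH t) A = false.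
Proof.
 destruct A as [k j]. cbn [fst]. intros ->. reflexivity.
Qed.

Lemma EXTRACT_keep' t v : v <> vkk -> ~ (50 <= fst v <= 52)%nat -> modv (EXTRACT t) v = false.
Proof. destruct v as [k j]. cbn [fst]. intros. unfold EXTRACT. cbn [modv]. rewrite modv_fors by (intros; keep). keep. Qed.

Lemma BUILD_keep t v : (fst v < 10)%nat \/ fst v = 46%nat \/ fst v = 82%nat -> modv (BUILD t) v = false.
Proof.
 intros Hv. unfold BUILD. cbn [modv]. rewrite EXTRACT_keep', SIM_keep by (try (intros ->; cbn [fst] in Hv); lia).
 unfold STORE. cbn [modv]. rewrite modv_fors by reflexivity. destruct v as [k j]. cbn [fst] in Hv. keep.
Qed.

Lemma BUILD_moda t A : (fst A < 20)%nat -> moda (BUILD t) A = false.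
Proof.
 intros HA. unfold BUILD. cbn [moda]. rewrite SIM_moda. unfold EXTRACT, STORE. cbn [moda]. rewrite !moda_fors.
 - destruct A as [k j]. cbn [fst] in HA.
  repeat match goal with |- context [peqb ?u ?x] => let EE := fresh in destruct (peqb_spec u x) as [EE|]; [inversion EE; lia|] end. reflexivity.
 - intros i Hi. destruct A as [k j]. cbn [fst moda] in *.
  repeat match goal with |- context [peqb ?u ?x] => let EE := fresh in destruct (peqb_spec u x) as [EE|]; [inversion EE; lia|] end. reflexivity.
 - reflexivity.
Qed.

Lemma pre_cost q NN P Z A B t n1 n2 n3 n4 : 1 <= q -> 1 <= NN -> 1 <= P -> Z <= P * NN -> A <= Z * (3 * t + 21) -> B <= Z ->
 n1 <= NN -> n2 <= B -> n3 <= q * (8 + 4 * B) -> n4 <= q * (1 + A) -> n1 + n2 + n3 + n4 <= P * (3 * t + 40) * (q * NN).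
Proof.
 intros Hq HN HP HZ HA HB H1 H2 H3 H4. set (Y := P * NN) in *.
 assert (HNY : NN <= Y) by (rewrite <- (N.mul_1_l NN); apply N.mul_le_mono_r; auto).
 assert (HqY : Y <= q * Y) by (rewrite <- (N.mul_1_l Y) at 1; apply N.mul_le_mono_r; auto).
 assert (E1 : 1 + A <= Y * (3 * t + 22)).
 { assert (Z * (3 * t + 21) <= Y * (3 * t + 21)) by (apply N.mul_le_mono_r; auto). lia. }
 apply (N.mul_le_mono_l _ _ q) in E1.
 assert (E2 : q * (8 + 4 * B) <= q * (Y * 12)) by (apply N.mul_le_mono_l; lia).
 replace (P * (3 * t + 40) * (q * NN)) with (q * (Y * (3 * t + 22)) + q * (Y * 12) + 6 * (q * Y)) by (unfold Y; ring).
 lia.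
Qed.

Section Pre.
Context (w W : N) (delta : N -> list N -> N * N) (t c : nat) (q NN : N).
Hypothesis HWbig : 64 * W <= 2 ^ W.
Hypothesis Hw : 1 <= w.
Hypothesis Hq0 : 0 < q.
Hypothesis Hqc : q <= 2 ^ (N.of_nat c * w).
Hypothesis HNN : 2 <= NN <= 2 ^ w.
Hypothesis HWK : (24 * N.of_nat (scale t) + N.of_nat c + 24) * w <= W.
Notation wp := (wp w W delta).
Notation K := (N.of_nat (scale t)).

(** The lower bound on [2 ^ (K * b)] makes [b] at least of order [lg NN], as queries require. The
    upper bound limits the work on the tables, and [b <= NN] relates to the time for finding [b] by
    trial. *)
Definition b_ok (b : N) : Prop := 1 <= b <= w + 1 /\ NN < 2 ^ (K * b) /\ 2 ^ (K * b) <= 2 ^ K * NN /\ b <= NN.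

Lemma scale_pos : 6 <= K.
Proof. unfold scale. lia. Qed.

Lemma BITS_spec s : env s pN = NN ->
 wp (BITS t) (fun n s' => b_ok (env s' vb) /\ N.of_nat n <= NN) s.
Proof.
 intros HN. pose proof scale_pos as HK. assert (HKW : K * w <= W) by nia.
 assert (HpW : 2 ^ w <= 2 ^ W) by (apply N.pow_le_mono_r; nia).
 assert (HK2 : K < 2 ^ W) by nia.
 unfold BITS. do 2 apply wp_set_seq. rewrite eval_cst by auto. pose proof w_lt_pow as Hwp. specialize (Hwp w Hw).
 apply wp_while with (m := fun s' => N.to_nat (w + 2 - env s' vb))
  (I := fun a s' => env s' pN = NN /\ env s' pK = K * env s' vb /\ env s' vb = N.of_nat a + 1 /\
    (a = 0%nat \/ 2 ^ (K * N.of_nat a) <= NN)).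
 - intros a s1 (E1 & E2 & E3 & E4) Hc. vredh Hc. rewrite E1, E2, E3 in Hc. rewrite div_pow_zero in Hc.
  assert (Hle : 2 ^ (K * (N.of_nat a + 1)) <= 2 ^ w) by lia.
  assert (Hkw : K * (N.of_nat a + 1) <= w) by (apply N.pow_le_mono_r_iff in Hle; lia).
  assert (Haw : N.of_nat a + 1 <= w) by (clear - HK Hkw; nia).
  assert (HKw : K <= K * w /\ w <= K * w) by (clear - HK Hw; nia).
  apply wp_set_seq, wp_set. vs. rewrite eval_cst by auto. rewrite E1, E2, E3.
  rewrite !N.mod_small by lia. repeat split; auto; try lia. right. replace (N.of_nat (S (a + 0))) with (N.of_nat a + 1) by lia. lia.
 - intros a s1 (E1 & E2 & E3 & E4) Hc. vredh Hc. rewrite E1, E2 in Hc. apply div_pow_zero in Hc. unfold b_ok.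
  rewrite E3 in *. assert (Ha : N.of_nat a <= w /\ 2 ^ (K * (N.of_nat a + 1)) <= 2 ^ K * NN /\ N.of_nat a + 1 <= NN).
  { destruct E4 as [->|E4].
   - rewrite N.mul_1_r. split; [lia|]. split; [pose proof (pow2_pos K); nia|lia].
   - assert (HaK : K * N.of_nat a <= w) by (apply (N.pow_le_mono_r_iff 2); lia).
    split; [nia|]. split.
    + rewrite N.mul_add_distr_l, N.mul_1_r, N.pow_add_r, (N.mul_comm (2 ^ K)). apply N.mul_le_mono_r. auto.
    + assert (N.of_nat a < 2 ^ N.of_nat a) by (apply N.pow_gt_lin_r; lia).
     assert (2 ^ N.of_nat a <= 2 ^ (K * N.of_nat a)) by (apply N.pow_le_mono_r; nia). lia. }
  destruct Ha as (Ha1 & Ha2 & Ha3). repeat split; auto; lia.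
 - vs. rewrite N.mul_1_r. auto.
Qed.

Lemma SIZES_spec s b : env s vb = b -> b_ok b ->
 wp (SIZES t) (fun n s' => n = 0%nat /\ env s' vbe = run_bits t b /\ env s' vX = 2 ^ b /\ env s' vkn = 2 ^ key_bits t b /\ env s' vlim = b) s.
Proof.
 intros Hb (Hb1 & _). pose proof scale_pos as HK. unfold SIZES. apply wp_set_seq, wp_seq.
 assert (HKb : K * b <= W) by nia. assert (HKe : K = N.of_nat (t * (t + 7)) + N.of_nat (t + 6)) by (unfold scale; lia).
 eapply wp_mono.
 { apply wp_fors with (I := fun j a s' => a = 0%nat /\ env s' vb = b /\ env s' vbe = N.of_nat j * b).
  - intros j a s1 Hj (-> & E1 & E2). apply wp_set. vs. rewrite E1, E2.
   assert ((N.of_nat j + 1) * b <= K * b) by (apply N.mul_le_mono_r; lia). rewrite N.mod_small by lia. repeat split; auto. lia.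
  - auto. }
 intros n1 s1 _ (-> & E1 & E2). apply wp_set_seq, wp_seq. eapply wp_mono.
 { apply wp_fors with (I := fun j a s' => a = 0%nat /\ env s' vb = b /\ env s' vbe = env s1 vbe /\ env s' pT = N.of_nat j * b).
  - intros j a s2 Hj (-> & F1 & F2 & F3). apply wp_set. vs. rewrite F1, F3.
   assert ((N.of_nat j + 1) * b <= K * b) by (apply N.mul_le_mono_r; lia). rewrite N.mod_small by lia. repeat split; auto. lia.
  - auto. }
 intros n2 s2 _ (-> & F1 & F2 & F3). do 2 apply wp_set_seq. apply wp_set. vs. rewrite F1, F2, F3, E2.
 assert (Htot : N.of_nat (t * (t + 7)) * b = key_bits t b) by (unfold key_bits, fld_bits, run_bits; rewrite Nat2N.inj_mul; lia).
 rewrite !N.mul_1_l, Htot. assert (key_bits t b < K * b) by (rewrite <- Htot; nia). assert (b < K * b) by nia.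
 rewrite !N.mod_small by (apply N.pow_lt_mono_r; lia). repeat split; auto. unfold run_bits. lia.
Qed.

Lemma LOGS_spec s b : env s vX = 2 ^ b -> 1 <= b -> b <= W -> 2 * 2 ^ b <= 2 ^ W ->
 wp LOGS (fun n s' => lg2ok b s' /\ N.of_nat n <= 2 ^ b) s.
Proof.
 intros HX Hb HbW HpW. assert (H2 : 2 <= 2 ^ b) by (change 2 with (2 ^ 1) at 1; apply N.pow_le_mono_r; lia).
 unfold LOGS. apply wp_st_seq, wp_set_seq.
 apply wp_while with (m := fun s' => N.to_nat (2 ^ b - env s' gI)) (I := fun a s' => env s' vX = 2 ^ b /\
   2 <= env s' gI <= 2 ^ b /\ N.of_nat a + 2 = env s' gI /\ forall v, 0 < v < env s' gI -> dm s' aLG v 0 = N.log2 v).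
 - intros a s1 (E1 & E2 & E3 & E4) Hc. vredh Hc. rewrite E1 in Hc. destruct (N.ltb_spec (env s1 gI) (2 ^ b)) as [Hlt|]; [|lia].
  apply wp_st_seq, wp_set. vs. set (i := env s1 gI) in *. change (2 ^ 1) with 2.
  assert (Hh : 0 < i / 2 < i) by (split; [apply N.div_str_pos; lia|apply N.div_lt; lia]).
  assert (Hlog : N.log2 i = N.log2 (i / 2) + 1).
  { pose proof (log2_div i 1) as Hl. change (2 ^ 1) with 2 in Hl.
   assert (1 <= N.log2 i) by (apply (N.log2_le_mono 2 i); lia). rewrite Hl by auto. lia. }
  assert (N.log2 i < W) by (apply N.log2_lt_pow2; lia).
  rewrite E4 by lia. rewrite (N.mod_small (i + 1)) by lia. rewrite (N.mod_small (N.log2 (i / 2) + 1)) by lia.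
  split; [|lia]. sp. split; [lia|]. split; [lia|].
  intros v Hv. destruct (N.eqb_spec v i) as [->|]; [cbn [N.eqb andb]; lia|]. cbn [andb]. apply E4. lia.
 - intros a s1 (E1 & E2 & E3 & E4) Hc. vredh Hc. rewrite E1 in Hc. destruct (N.ltb_spec (env s1 gI) (2 ^ b)) as [|Hge]; [lia|].
  split; [|lia]. intros v Hv. apply E4. lia.
 - vs. rewrite N.mod_small by lia. sp. split; [lia|]. split; [lia|].
  intros v Hv. assert (v = 1) as -> by lia. reflexivity.
Qed.

Definition pre_const : N := 2 ^ K * (3 * N.of_nat t + 40).

Lemma PRE_spec s : env s vw = w -> env s pN = NN -> env s vq = q ->
 wp (PRE t) (fun n s' => exists b, b_ok b /\ lg2ok b s' /\
  (forall a k, a < q -> k < 2 ^ key_bits t b -> entry W delta t b s' a k) /\ jump_data b q (gz W delta t q) (oz W delta t) s' /\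
  dm s' (aP 0%nat) 0 0 = w /\ dm s' (aP 1%nat) 0 0 = b /\ dm s' (aP 2%nat) 0 0 = run_bits t b /\ dm s' (aP 3%nat) 0 0 = env s pI /\
  N.of_nat n <= pre_const * (q * NN)) s.
Proof.
 intros Hvw HvN Hvq. pose proof scale_pos as HK. unfold PRE. apply wp_seq. eapply wp_mono; [apply (BITS_spec s HvN)|].
 intros n1 s1 F1 (Hb & C1). set (b := env s1 vb) in *. pose proof Hb as (Hb1 & Hb2 & Hb3 & Hb4).
 assert (HKe : K = N.of_nat (t * (t + 7)) + N.of_nat (t + 6)) by (unfold scale; lia).
 assert (HKb : K * b <= 2 * (K * w)) by nia.
 (* The number of keys times the bound on the steps of one phase is exactly [2 ^ (K * b)]; this is
    the origin of [scale]. *)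
 assert (Htot : key_bits t b + run_bits t b = K * b) by (unfold key_bits, fld_bits, run_bits; nia).
 assert (HbK : b < K * b) by (clear - HK Hb1; nia).
 assert (HWb : 4 * b + 2 * run_bits t b + key_bits t b + 16 <= W) by (pose proof (N.le_0_l (N.of_nat c * w)); lia).
 assert (HbW : b <= W) by lia.
 assert (HqW : 4 * (q * 2 ^ b) <= 2 ^ W).
 { transitivity (2 ^ (2 + (N.of_nat c * w + b))); [|apply N.pow_le_mono_r; lia].
  rewrite !N.pow_add_r. change (2 ^ 2) with 4. apply N.mul_le_mono_l, N.mul_le_mono_r. auto. }
 assert (HqW1 : q + 1 < 2 ^ W).
 { assert (q * 2 <= q * 2 ^ b) by (apply N.mul_le_mono_l, (N.pow_le_mono_r 2 1 b); lia). lia. }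
 assert (HbpW : 2 * 2 ^ b <= 2 ^ W) by (rewrite <- N.pow_succ_r'; apply N.pow_le_mono_r; lia).
 apply wp_seq. eapply wp_mono; [apply (SIZES_spec s1 b eq_refl Hb)|]. intros n2 s2 F2 (-> & S1 & S2 & S3 & S4).
 apply wp_seq. eapply wp_mono; [apply (LOGS_spec s2 b S2); lia|]. intros n3 s3 F3 (L3 & C3).
 assert (K3 : forall v, v <> gI -> env s3 v = env s2 v).
 { intros v Hv. apply (fv F3). unfold LOGS. cbn [modv]. destruct (peqb_spec v gI); [congruence|reflexivity]. }
 assert (K2 : forall v, fst v = 1%nat \/ fst v = 2%nat \/ fst v = 46%nat -> env s2 v = env s1 v).
 { intros [v1 v2] Hv. cbn [fst] in Hv. apply (fv F2). unfold SIZES. cbn [modv]. rewrite !modv_fors by (intros; keep). keep. }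
 assert (E1 : env s1 vw = w /\ env s1 vq = q /\ env s1 pI = env s pI) by (rewrite !(fv F1) by reflexivity; auto).
 destruct E1 as (E1 & E2 & E3).
 assert (E4 : env s3 vw = w /\ env s3 vq = q /\ env s3 pI = env s pI /\ env s3 vb = b).
 { rewrite !K3 by discriminate. rewrite !K2 by (cbn [fst]; lia). repeat split; auto.
  rewrite (fv F2); auto. unfold SIZES. cbn [modv]. rewrite !modv_fors; reflexivity. }
 destruct E4 as (E4 & E5 & E6 & E7).
 apply wp_seq. eapply wp_mono.
 { apply (GRAPH_spec w W delta t b q HWbig); auto; try lia. unfold params. rewrite E5, E7, (K3 vX), S2 by discriminate. auto. }
 intros n4 s4 F4 (J4 & C4).
 assert (K4 : forall v, (fst v < 60)%nat \/ fst v = 82%nat -> env s4 v = env s3 v) by (intros; apply (fv F4), GRAPH_keep; auto).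
 assert (L4 : lg2ok b s4) by (eapply lg2ok_frame; [exact L3|exact F4|apply GRAPH_moda; auto]).
 apply wp_seq. eapply wp_mono.
 { apply (BUILD_spec w W delta t b HWbig ltac:(lia) HWb s4); rewrite ?K4 by (cbn [fst]; lia); rewrite ?(K3 vbe), ?(K3 vlim), ?(K3 vX), ?(K3 vkn) by discriminate; auto.
  rewrite E5. auto. }
 intros n5 s5 F5 (T5 & C5). rewrite K4, E5 in T5, C5 by (cbn [fst]; lia).
 assert (K5 : forall v, (fst v < 10)%nat \/ fst v = 46%nat \/ fst v = 82%nat -> env s5 v = env s3 v).
 { intros v Hv. rewrite (fv F5) by (apply BUILD_keep; auto). apply K4. lia. }
 do 3 apply wp_st_seq. apply wp_st. vs. rewrite (K5 vw), (K5 vb), (K5 vbe), (K5 pI) by (cbn [fst]; lia).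
 rewrite E4, E6, E7, (K3 vbe), S1 by discriminate. set (s6 := updm _ _ _ _ _).
 assert (D6 : forall A i j, fst A <> 30%nat -> dm s6 A i j = dm s5 A i j).
 { intros [A1 A2] i j HA. cbn [fst] in HA. unfold s6. cbn [updm dm].
  repeat match goal with |- context [peqb (A1, A2) ?x] => destruct (peqb_spec (A1, A2) x) as [EE|]; [inversion EE; lia|] end. reflexivity. }
 exists b. sp. split.
 { intros v Hv. rewrite D6 by discriminate. rewrite (fa F5) by (apply BUILD_moda; cbn [fst]; lia). apply L4; auto. }
 split.
 { intros a k Ha Hk. eapply entry_ext; [eauto..| |apply (T5 a k Ha Hk)]; [lia|]. intros. apply D6. lia. }
 split.
 { eapply jump_data_ext with (s := s4); eauto; [lia|]. intros. rewrite D6 by lia. apply (fa F5), BUILD_moda. lia. }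
 split; [reflexivity|]. split; [reflexivity|]. split; [reflexivity|]. split; [reflexivity|].
 clearbody s6. unfold pre_const, KC in *. pose proof (pow2_pos (key_bits t b)) as Pt.
 assert (P1 : 2 ^ key_bits t b * (1 + 2 ^ run_bits t b * (3 * N.of_nat t + 20)) <= 2 ^ (K * b) * (3 * N.of_nat t + 21)).
 { rewrite <- Htot, N.pow_add_r. pose proof (pow2_pos (run_bits t b)) as Pb.
  rewrite <- N.mul_assoc. apply N.mul_le_mono_l. clear - Pb. set (x := 2 ^ run_bits t b) in *. clearbody x. lia. }
 assert (P2 : 2 ^ b <= 2 ^ (K * b)) by (apply N.pow_le_mono_r; lia).
 pose proof (pow2_pos K) as PK. set (Z := 2 ^ (K * b)) in *. set (P := 2 ^ K) in *. set (A := 2 ^ key_bits t b * (1 + 2 ^ run_bits t b * (3 * N.of_nat t + 20))) in *.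
 set (Bp := 2 ^ b) in *. clearbody Z P A Bp.
 rewrite !Nat2N.inj_add. pose proof (pre_cost q NN P Z A Bp (N.of_nat t) (N.of_nat n1) (N.of_nat n3) (N.of_nat n4) (N.of_nat n5)) as HC.
 specialize (HC ltac:(lia) ltac:(lia) ltac:(lia) Hb3 P1 P2 C1 C3 C4 C5). lia.
Qed.
End Pre.

(** * Raw programs *)

Lemma low_reg w st r l x : get_num w st (r :: l) = x -> x < 2 ^ w -> regs st r = x.
Proof. cbn [get_num]. intros E Hx. pose proof (pow2_pos w). assert (get_num w st l = 0) by nia. lia. Qed.

Lemma cnum_same w t0 m m' A i k a : (forall j b, (t0 < j)%nat -> m' j b = m j b) -> cnum w t0 m' A i k a = cnum w t0 m A i k a.
Proof.
 intros H. revert i. induction k as [|k IH]; intros i; cbn [cnum]; auto. rewrite H, IH by (unfold DA; lia). auto.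
Qed.

Section Glue.
Context (w : N) (Hw : 1 <= w) (delta : N -> list N -> N * N) (tau t c K' : nat).
Notation nw := (num_words c).
Notation B0 := ((t + 5) * nw)%nat.
Notation t0 := (t + 2)%nat.
Notation vregs := (vregs B0 K').
Notation rwp := (rwp w delta tau).

(** Variables are wider than the blocks of the input convention; the upper words have to be
    cleared. *)
Definition copy_in (v : var) (j : nat) : prog := Seq (p_zero (vregs v)) (p_move (firstn nw (vregs v)) (block c j)).
Fixpoint copies (l : list (var * nat)) : prog :=
 match l with [] => Skip | (v, j) :: l' => Seq (copy_in v j) (copies l') end.

Hypothesis HK : (nw <= K K')%nat.

Lemma block_lt j r : (j < t + 5)%nat -> In r (block c j) -> (r < B0)%nat.
Proof. intros Hj Hr. apply in_seq in Hr. nia. Qed.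

Lemma vregs_ge v r : In r (vregs v) -> (B0 + 10 <= r)%nat.
Proof. intros H. apply (vb_in w Hw) in H as (x & _ & ->); auto. lia. Qed.

Lemma firstn_incl {A} k (l : list A) : incl (firstn k l) l.
Proof. intros x Hx. rewrite <- (firstn_skipn k l). apply in_app_iff. auto. Qed.

Lemma copy_in_spec v j st : (j < t + 5)%nat -> rwf w st ->
 rwp (copy_in v j) (fun st' => rwf w st' /\ mem st' = mem st /\ get_num w st' (vregs v) = get_num w st (block c j) /\
  forall r, ~ In r (vregs v) -> regs st' r = regs st r) st.
Proof.
 intros Hj Hf. unfold copy_in. apply (rwp_seq w Hw). pose proof (vb_nodup w Hw delta B0 K' v) as Hnd.
 eapply rwp_mono; [|apply (p_zero_spec w Hw delta tau B0); auto]. intros st1 ((F1 & M1 & _) & Z1 & R1).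
 rewrite <- (firstn_skipn nw (vregs v)) in Hnd. pose proof (NoDup_app_remove_r _ _ Hnd) as Hnd1.
 assert (Hlen : length (firstn nw (vregs v)) = nw) by (rewrite length_firstn, vb_len; lia).
 eapply rwp_mono; [|apply (p_move_spec w Hw delta tau B0); auto].
 2:{ rewrite Hlen. unfold block. rewrite length_seq. auto. }
 2:{ intros r Hr Hr2. apply firstn_incl, vregs_ge in Hr2. apply block_lt in Hr; lia. }
 intros st2 ((F2 & M2 & _) & Z2 & R2). sp. split; [congruence|]. split.
 - rewrite <- (firstn_skipn nw (vregs v)) in Z1 |- *. rewrite get_num_app in Z1 |- * by auto.
  rewrite Z2. rewrite (get_num_ext w st1 st2 (skipn nw (vregs v))).
  + rewrite (get_num_ext w st st1 (block c j)).
   * pose proof (pow2_pos (w * N.of_nat (length (firstn nw (vregs v))))). nia.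
   * intros r Hr. apply R1. intros Hr2. apply vregs_ge in Hr2. apply block_lt in Hr; lia.
  + intros r Hr. apply R2. intros Hr2. exact (NoDup_app_disj _ _ r Hnd Hr Hr2).
 - intros r Hr. rewrite R2, R1; auto. intros Hr2. apply Hr, (firstn_incl nw), Hr2.
Qed.

Lemma copies_spec l : forall st, Forall (fun vj => (snd vj < t + 5)%nat) l -> NoDup (map fst l) -> rwf w st ->
 rwp (copies l) (fun st' => rwf w st' /\ mem st' = mem st /\
  (forall v j, In (v, j) l -> get_num w st' (vregs v) = get_num w st (block c j)) /\
  forall r, (forall v, In v (map fst l) -> ~ In r (vregs v)) -> regs st' r = regs st r) st.
Proof.
 induction l as [|[v j] l IH]; intros st Hl Hnd Hf; cbn [copies].
 - apply rwp_skip. sp. sp. split; [intros ? ? []|auto].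
 - inversion Hl as [|? ? Hj Hl']; subst. cbn [map fst snd] in *. apply NoDup_cons_iff in Hnd as [Hn Hnd].
  apply (rwp_seq w Hw). eapply rwp_mono; [|apply copy_in_spec; auto]. intros st1 (F1 & M1 & Z1 & R1).
  eapply rwp_mono; [|apply IH; auto]. intros st2 (F2 & M2 & Z2 & R2).
  sp. split; [congruence|]. split.
  + intros v' j' [E|Hin].
   * inversion E; subst. rewrite <- Z1. apply get_num_ext. intros r Hr. apply R2. intros v2 Hv2 Hr2.
    assert (v' <> v2) by (intros ->; auto). apply (vb_disj w Hw B0 K' v' v2 H r); auto.
   * rewrite (Z2 _ _ Hin). apply get_num_ext. intros r Hr. apply R1. intros Hr2. apply vregs_ge in Hr2.
    rewrite Forall_forall in Hl'. apply Hl' in Hin. apply block_lt in Hr; auto. lia.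
  + intros r Hr. rewrite R2, R1; auto; intros; apply Hr; simpl; auto.
Qed.

(** The registers of a query are arbitrary and do not reveal the word length, on which even the
    multiword arithmetic depends. So the preprocessing leaves [w] in cell 0 of array [t0]; the empty
    address denotes 0. *)
Definition PREP : prog :=
 Seq (Op Or (RW B0) 0%nat 0%nat) (Seq (Const (ZR B0) 0)
  (Seq (copies [(vw, 0%nat); (pN, 1%nat); (vq, 3%nat); (pI, 4%nat)])
   (Seq (cs B0 t0 K' (PRE t)) (Write t0 [] (RW B0))))).

Definition ANSWER (G R : nat) : prog :=
 Seq (Read (RW B0) t0 []) (Seq (Const (ZR B0) 0)
  (Seq (copies (map (fun i => (qln i, i)) (seq 0 t)))
   (Seq (cs B0 t0 K' (QUERY t G R)) (p_move (block c 0) (firstn nw (vregs qL)))))).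

Definition vst_of (dm0 : darr -> N -> N -> N) (st : state) : vst :=
 {| env := fun v => get_num w st (vregs v); dm := dm0; cm := mem st |}.

Lemma rep_vst_of dm0 st : rwf w st -> mwf w (mem st) -> regs st (RW B0) = w -> regs st (ZR B0) = 0 ->
 (forall A i j, i < 2 ^ VW w K' -> dm0 A i j = cnum w t0 (mem st) A 0 (K K') (i + 2 ^ VW w K' * j)) ->
 rep w B0 t0 K' (vst_of dm0 st) st.
Proof. intros. repeat split; auto. Qed.

Lemma PREP_spec (Q : nat -> vst -> Prop) st NN q i0 : wf_state w st -> get_num w st (block c 0) = w ->
 get_num w st (block c 1) = NN -> get_num w st (block c 3) = q -> get_num w st (block c 4) = i0 -> cells_ok t0 (PRE t) = true ->
 (forall s, env s vw = w -> env s pN = NN -> env s vq = q -> env s pI = i0 -> wp w (VW w K') delta (PRE t) Q s) ->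
 exists T st' n s', exec w delta tau PREP st T st' /\ Q n s' /\
  (T <= 4 + plen tau (copies [(vw, 0%nat); (pN, 1%nat); (vq, 3%nat); (pI, 4%nat)]) + ccost tau B0 t0 K' (PRE t) * (1 + n))%nat /\
  mem st' t0 0 = w /\
  forall A i j, i < 2 ^ VW w K' -> dm s' A i j = cnum w t0 (mem st') A 0 (K K') (i + 2 ^ VW w K' * j).
Proof.
 intros [Hrf Hmf] E0 E1 E3 E4 Hok Hwp. pose proof (w_lt_pow w Hw) as Hww.
 (* As [w < 2 ^ w], the lowest word of block 0 already is the word length. *)
 assert (Hr0 : regs st 0%nat = w).
 { assert (Hbl : block c 0 = 0%nat :: seq 1 (2 * c + 1)) by (unfold block, num_words; rewrite Nat.add_succ_r; reflexivity).
  rewrite Hbl in E0. eapply low_reg; eauto. }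
 set (st1 := set_reg st (RW B0) (eval_binop w Or (regs st 0%nat) (regs st 0%nat))).
 set (st2 := set_reg st1 (ZR B0) (0 mod 2 ^ w)).
 assert (Hv1 : eval_binop w Or (regs st 0%nat) (regs st 0%nat) = w) by (cbn [eval_binop]; rewrite N.lor_diag; auto).
 assert (Hrf2 : rwf w st2).
 { unfold st2, st1. apply rwf_set; [apply rwf_set; [auto|rewrite Hv1; auto]|rewrite N.Div0.mod_0_l; apply pow2_pos]. }
 assert (Hreg : forall r, (r < B0)%nat -> regs st2 r = regs st r).
 { intros r Hr. unfold st2, st1, RW, ZR. cbn [set_reg regs]. destruct (Nat.eqb_spec r (B0 + 1)); [lia|]. destruct (Nat.eqb_spec r B0); [lia|auto]. }
 destruct (copies_spec [(vw, 0%nat); (pN, 1%nat); (vq, 3%nat); (pI, 4%nat)] st2) as (T3 & st3 & X3 & C3 & Hrf3 & M3 & G3 & R3); auto.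
 { repeat constructor; cbn; lia. }
 { repeat constructor; cbn; intuition discriminate. }
 assert (Hb : forall j, (j < t + 5)%nat -> get_num w st2 (block c j) = get_num w st (block c j)).
 { intros j Hj. apply get_num_ext. intros r Hr. apply Hreg. eapply block_lt; eauto. }
 assert (Hsp : forall r, (r < B0 + 10)%nat -> regs st3 r = regs st2 r).
 { intros r Hr. apply R3. intros v _ Hin. apply vregs_ge in Hin. lia. }
 set (s3 := vst_of (fun A i j => cnum w t0 (mem st3) A 0 (K K') (i + 2 ^ VW w K' * j)) st3).
 assert (HR3 : rep w B0 t0 K' s3 st3).
 { apply rep_vst_of; auto.
  - intros k a. rewrite M3. apply Hmf.
  - rewrite Hsp by (unfold RW; lia). unfold st2, st1, RW, ZR. cbn [set_reg regs]. destruct (Nat.eqb_spec B0 (B0 + 1)); [lia|].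
   rewrite Nat.eqb_refl. apply Hv1.
  - rewrite Hsp by (unfold ZR; lia). unfold st2, ZR. cbn [set_reg regs]. rewrite Nat.eqb_refl. apply N.Div0.mod_0_l. }
 assert (Hs3 : env s3 vw = w /\ env s3 pN = NN /\ env s3 vq = q /\ env s3 pI = i0).
 { cbn [s3 vst_of env]. rewrite (G3 vw 0%nat), (G3 pN 1%nat), (G3 vq 3%nat), (G3 pI 4%nat) by (cbn; auto 6).
  rewrite !Hb by lia. auto. }
 destruct Hs3 as (V1 & V2 & V3 & V4).
 destruct (Hwp s3 V1 V2 V3 V4) as (n & s4 & Hrun & HQ).
 destruct (compile_correct w Hw delta tau B0 t0 K' _ _ _ _ Hrun st3 HR3 Hok) as (T4 & st4 & X4 & C4 & HR4 & _).
 destruct HR4 as (_ & _ & HW4 & _ & _ & HD4 & _).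
 set (st5 := set_mem st4 t0 (get_num w st4 []) (regs st4 (RW B0))).
 exists (1 + (1 + (T3 + (T4 + 1))))%nat, st5, n, s4. split.
 { unfold PREP. econstructor; [constructor|]. econstructor; [constructor|]. econstructor; [exact X3|]. econstructor; [exact X4|].
  constructor. }
 sp. split; [lia|]. split.
 { unfold st5. cbn [set_mem mem]. rewrite Nat.eqb_refl. cbn. auto. }
 intros A i j Hi. rewrite (HD4 A i j Hi). symmetry. apply cnum_same. intros k a Hk. unfold st5. cbn [set_mem mem].
 destruct (Nat.eqb_spec k t0); [lia|reflexivity].
Qed.

Lemma ANSWER_spec G R (Q : nat -> vst -> Prop) dm0 (lens : nat -> N) st : wf_state w st -> mem st t0 0 = w ->
 (forall A i j, i < 2 ^ VW w K' -> dm0 A i j = cnum w t0 (mem st) A 0 (K K') (i + 2 ^ VW w K' * j)) ->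
 (forall i, (i < t)%nat -> get_num w st (block c i) = lens i) ->
 cells_ok t0 (QUERY t G R) = true -> store_free (QUERY t G R) = true ->
 (forall s, dm s = dm0 -> (forall i, (i < t)%nat -> env s (qln i) = lens i) -> (forall k a, (k < t0)%nat -> cm s k a = mem st k a) ->
   wp w (VW w K') delta (QUERY t G R) Q s) ->
 (forall n s, Q n s -> env s qL < 2 ^ (w * N.of_nat nw)) ->
 exists T st' n s', exec w delta tau (ANSWER G R) st T st' /\ Q n s' /\
  (T <= 2 + plen tau (copies (map (fun i => (qln i, i)) (seq 0 t))) + ccost tau B0 t0 K' (QUERY t G R) * (1 + n) +
    plen tau (p_move (block c 0) (firstn nw (vregs qL))))%nat /\
  get_num w st' (block c 0) = env s' qL /\ (forall k a, (k < t0)%nat -> mem st' k a = cm s' k a) /\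
  forall k a, (t0 <= k)%nat -> mem st' k a = mem st k a.
Proof.
 intros [Hrf Hmf] Hw0 Hdm Hlen Hok Hsf Hwp HQL. pose proof (w_lt_pow w Hw) as Hww.
 set (st1 := set_reg st (RW B0) (mem st t0 (get_num w st []))).
 set (st2 := set_reg st1 (ZR B0) (0 mod 2 ^ w)).
 assert (Hv1 : mem st t0 (get_num w st []) = w) by auto.
 assert (Hrf2 : rwf w st2).
 { unfold st2, st1. apply rwf_set; [apply rwf_set; [auto|rewrite Hv1; auto]|rewrite N.Div0.mod_0_l; apply pow2_pos]. }
 assert (Hreg : forall r, (r < B0)%nat -> regs st2 r = regs st r).
 { intros r Hr. unfold st2, st1, RW, ZR. cbn [set_reg regs]. destruct (Nat.eqb_spec r (B0 + 1)); [lia|]. destruct (Nat.eqb_spec r B0); [lia|auto]. }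
 destruct (copies_spec (map (fun i => (qln i, i)) (seq 0 t)) st2) as (T3 & st3 & X3 & C3 & Hrf3 & M3 & G3 & R3); auto.
 { apply Forall_map, Forall_forall. intros i Hi. apply in_seq in Hi. cbn. lia. }
 { rewrite map_map. cbn [fst]. apply FinFun.Injective_map_NoDup; [|apply seq_NoDup]. intros x y E. inversion E. auto. }
 assert (Hb : forall j, (j < t + 5)%nat -> get_num w st2 (block c j) = get_num w st (block c j)).
 { intros j Hj. apply get_num_ext. intros r Hr. apply Hreg. eapply block_lt; eauto. }
 assert (Hsp : forall r, (r < B0 + 10)%nat -> regs st3 r = regs st2 r).
 { intros r Hr. apply R3. intros v _ Hin. apply vregs_ge in Hin. lia. }
 assert (M3' : mem st3 = mem st) by (rewrite M3; reflexivity).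
 set (s3 := vst_of dm0 st3).
 assert (HR3 : rep w B0 t0 K' s3 st3).
 { apply rep_vst_of; auto.
  - intros k a. rewrite M3'. apply Hmf.
  - rewrite Hsp by (unfold RW; lia). unfold st2, st1, RW, ZR. cbn [set_reg regs]. destruct (Nat.eqb_spec B0 (B0 + 1)); [lia|].
   rewrite Nat.eqb_refl. apply Hv1.
  - rewrite Hsp by (unfold ZR; lia). unfold st2, ZR. cbn [set_reg regs]. rewrite Nat.eqb_refl. apply N.Div0.mod_0_l.
  - rewrite M3'. auto. }
 destruct (Hwp s3) as (n & s4 & Hrun & HQ).
 { reflexivity. }
 { intros i Hi. cbn [s3 vst_of env]. rewrite (G3 (qln i) i).
  - rewrite Hb by lia. auto.
  - apply in_map_iff. exists i. split; auto. apply in_seq. lia. }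
 { intros k a Hk. cbn [s3 vst_of cm]. rewrite M3'. auto. }
 destruct (compile_correct w Hw delta tau B0 t0 K' _ _ _ _ Hrun st3 HR3 Hok) as (T4 & st4 & X4 & C4 & HR4 & F4).
 specialize (F4 Hsf). pose proof HR4 as (Hrf4 & _ & HW4 & _ & HV4 & _ & HC4).
 assert (Hlen4 : length (firstn nw (vregs qL)) = nw) by (rewrite length_firstn, vb_len; lia).
 destruct (p_move_spec w Hw delta tau B0 (block c 0) (firstn nw (vregs qL)) st4) as (T5 & st5 & X5 & C5 & (F5 & M5 & _) & G5 & _); auto.
 { unfold block. rewrite length_seq. auto. }
 { apply seq_NoDup. }
 { intros r Hr Hr2. apply firstn_incl, vregs_ge in Hr. apply block_lt in Hr2; lia. }
 exists (1 + (1 + (T3 + (T4 + T5))))%nat, st5, n, s4. split.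
 { unfold ANSWER. econstructor; [constructor|]. econstructor; [constructor|]. econstructor; [exact X3|]. econstructor; [exact X4|exact X5]. }
 sp. split; [lia|]. split; [|split].
 (* The output length fits into [nw] words, so the upper words of the variable vanish and copying
    the lower ones loses nothing. *)
 - rewrite G5. specialize (HQL n s4 HQ). specialize (HV4 qL). rewrite <- HV4 in HQL |- *.
  assert (EV : get_num w st4 (vregs qL) = get_num w st4 (firstn nw (vregs qL)) + 2 ^ (w * N.of_nat nw) * get_num w st4 (skipn nw (vregs qL))).
  { rewrite <- (firstn_skipn nw (vregs qL)) at 1. rewrite get_num_app, Hlen4 by auto. reflexivity. }
  rewrite EV in HQL |- *. pose proof (pow2_pos (w * N.of_nat nw)).
  assert (get_num w st4 (skipn nw (vregs qL)) = 0) by nia. nia.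
 - intros k a Hk. rewrite M5. symmetry. apply HC4. auto.
 - intros k a Hk. rewrite M5, F4, M3' by auto. auto.
Qed.
End Glue.

(** * Syntactic side conditions and final estimates *)

Lemma cells_ok_query t G R : cells_ok (t + 2) (QUERY t G R) = true.
Proof.
 assert (Ht : Nat.ltb t (t + 2) = true) by (apply Nat.ltb_lt; lia).
 assert (Hcst : forall k, cells_ok_e (t + 2) (cst k) = true) by (induction k; cbn; auto; rewrite IHk; auto).
 assert (HA : cells_ok (t + 2) (APPEND t R) = true).
 { unfold APPEND. cbn [cells_ok cells_ok_e andb]. apply cells_ok_fors. intros. unfold FLUSH. cbn [cells_ok cells_ok_e andb]. rewrite Ht. reflexivity. }
 assert (HL : cells_ok (t + 2) (fors t (LOADWIN G)) = true).
 { apply cells_ok_fors. intros i Hi. unfold LOADWIN. cbn [cells_ok cells_ok_e andb]. rewrite cells_ok_fors; [reflexivity|].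
  intros j Hj. cbn [cells_ok cells_ok_e andb]. rewrite Hcst, (proj2 (Nat.ltb_lt i (t + 2))) by lia. reflexivity. }
 assert (HV : forall e p, (forall i, cells_ok_e (t + 2) (e i) = true) -> (forall i, cells_ok (t + 2) (p i) = true) ->
   cells_ok (t + 2) (ADVS t G e p) = true).
 { intros e p He Hp. apply cells_ok_fors. intros i Hi. unfold ADV. cbn [cells_ok cells_ok_e andb]. rewrite He, Hp, cells_ok_fors; reflexivity. }
 assert (HP : cells_ok (t + 2) (APPLY t R) = true).
 { unfold APPLY, APPZ, LOG. cbn [cells_ok cells_ok_e andb]. rewrite HA. reflexivity. }
 unfold QUERY, QINIT, QLOOP, FAST, SLOW, SKIP, KEY, APPZ, STEP. cbn [cells_ok cells_ok_e andb].
 rewrite HL, HP, HA, !HV, !cells_ok_fors by (intros; cbn; reflexivity). cbn [cells_ok cells_ok_e andb]. rewrite ?Ht. reflexivity.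
Qed.

Lemma store_free_query t G R : store_free (QUERY t G R) = true.
Proof.
 assert (HA : store_free (APPEND t R) = true) by (unfold APPEND; cbn [store_free andb]; apply store_free_fors; reflexivity).
 assert (HL : store_free (fors t (LOADWIN G)) = true).
 { apply store_free_fors. intros i Hi. unfold LOADWIN. cbn [store_free andb]. rewrite store_free_fors; reflexivity. }
 assert (HV : forall e p, (forall i, store_free (p i) = true) -> store_free (ADVS t G e p) = true).
 { intros e p Hp. apply store_free_fors. intros i Hi. unfold ADV. cbn [store_free andb]. rewrite Hp, store_free_fors; reflexivity. }
 assert (HP : store_free (APPLY t R) = true).
 { unfold APPLY, APPZ, LOG. cbn [store_free andb]. rewrite HA. reflexivity. }
 unfold QUERY, QINIT, QLOOP, FAST, SLOW, SKIP, KEY, APPZ, STEP. cbn [store_free andb].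
 rewrite HL, HP, HA, !HV, !store_free_fors by (intros; reflexivity). reflexivity.
Qed.

Lemma cells_ok_pre t : cells_ok (t + 2) (PRE t) = true.
Proof.
 assert (Hcst : forall k, cells_ok_e (t + 2) (cst k) = true) by (induction k; cbn; auto; rewrite IHk; auto).
 unfold PRE, BITS, SIZES, BUILD, EXTRACT, SIM, STEP, CHECK, STORE. cbn [cells_ok cells_ok_e andb].
 rewrite !Hcst, !cells_ok_fors by (intros; cbn; reflexivity). reflexivity.
Qed.

Lemma runlen_le x : runlen x <= 2 * x.
Proof.
 unfold runlen. destruct (N.eqb_spec x 0); [lia|]. unfold toklen.
 assert (N.log2 x < x) by (apply N.log2_lt_lin; lia). lia.
Qed.

(** A run token has at most two bits per zero of its run, and a literal at most [2 * B] bits; each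
    symbol can be charged separately. *)
Lemma senc_from_length B A : Forall (fun u => u < 2 ^ B) A -> forall z,
 N.of_nat (length (senc_from z A)) <= 2 * z + (2 * B + 2) * N.of_nat (length A).
Proof.
 induction 1 as [|u A Hu HA IH]; intros z; cbn [senc_from].
 - pose proof (runlen_le z). rewrite zrt_length. lia.
 - cbn [length]. destruct (N.eqb_spec u 0) as [->|Hu0]; [specialize (IH (z + 1)); lia|].
  rewrite !length_app, !Nat2N.inj_add, zrt_length, literal_token_eq, token_length by lia. specialize (IH 0).
  pose proof (runlen_le z). pose proof (toklen_lim u B Hu Hu0). lia.
Qed.

Lemma nsum_list {X} (f : list X -> nat) (l : list (list X)) : f [] = 0%nat ->
 nsum (length l) (fun i => N.of_nat (f (nth i l []))) = N.of_nat (list_sum (map f l)).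
Proof.
 intros Hf. induction l as [|a l IH] using rev_ind; [reflexivity|].
 rewrite length_app, Nat.add_1_r. cbn [nsum]. rewrite map_app, list_sum_app.
 rewrite app_nth2, Nat.sub_diag by lia. cbn [nth map list_sum fold_right].
 rewrite <- (nsum_ext (length l) (fun i => N.of_nat (f (nth i l [])))) by (intros i Hi; rewrite app_nth1; auto).
 rewrite IH. lia.
Qed.

Lemma big_width W : 10 <= W -> 64 * W <= 2 ^ W.
Proof.
 intros H. replace W with (W - 10 + 10) at 2 by lia. rewrite N.pow_add_r. change (2 ^ 10) with 1024.
 pose proof (N.pow_gt_lin_r 2 (W - 10) ltac:(lia)). lia.
Qed.

Lemma lg_bounds (NN k : N) : 2 <= NN -> NN < 2 ^ k -> (0 < lg (INR (N.to_nat NN)) <= INR (N.to_nat k))%R.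
Proof.
 intros H2 Hk. unfold lg. assert (Hln2 : (0 < ln 2)%R) by (rewrite <- ln_1; apply ln_increasing; lra).
 assert (HR2 : (2 <= INR (N.to_nat NN))%R) by (apply (le_INR 2); lia).
 rewrite Rmax_right by lra. split.
 - apply Rdiv_lt_0_compat; auto. rewrite <- ln_1. apply ln_increasing; lra.
 - assert (Hle : (INR (N.to_nat NN) <= 2 ^ N.to_nat k)%R).
  { rewrite <- (pow_INR 2). apply le_INR.
   replace (2 ^ N.to_nat k)%nat with (N.to_nat (2 ^ k)) by (rewrite N2Nat.inj_pow; reflexivity). lia. }
  apply Rmult_le_reg_r with (ln 2); auto. unfold Rdiv. rewrite Rmult_assoc, Rinv_l, Rmult_1_r by lra.
  transitivity (ln (2 ^ N.to_nat k)); [|rewrite ln_pow by lra; lra].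
  destruct Hle as [Hlt| ->]; [left; apply ln_increasing; lra|lra].
Qed.

Lemma linear_cost a c p n Z : 1 <= Z -> n <= p * Z -> a + c * (1 + n) <= (a + c + c * p) * Z.
Proof.
 intros HZ Hn. assert (c * n <= c * (p * Z)) by (apply N.mul_le_mono_l; auto).
 assert (a + c <= (a + c) * Z) by (rewrite <- (N.mul_1_r (a + c)) at 1; apply N.mul_le_mono_l; auto). lia.
Qed.

Theorem corollary6p15 :
 forall t c tau : nat, (1 <= t)%nat ->
 exists (preprocess query : prog) (C : nat),
 forall (w sigma q NN : N) (M : transducer t sigma q),
  sigma <= 2 ^ (N.of_nat c * w) ->
  q <= 2 ^ (N.of_nat c * w) ->
  2 <= NN <= 2 ^ w ->
 forall st : state, preprocessing_input c w NN M st ->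
 exists (T1 : nat) (st1 : state),
  exec w (tr_step M) tau preprocess st T1 st1 /\
  N.of_nat T1 <= N.of_nat C * (q * NN) /\
  forall (n : nat) (Ss : list (list N)) (T : list N),
   N.of_nat n <= 2 ^ (N.of_nat c * w) ->
   length Ss = t ->
   Forall (fun S => length S = n /\ Forall (fun a => a < sigma) S) Ss ->
   produces M n Ss T ->
  forall st2 : state, query_input t c w (map senc Ss) st1 st2 ->
  exists (T2 : nat) (st3 : state),
   exec w (tr_step M) tau query st2 T2 st3 /\
   (INR T2 <= INR C *
     (1 + INR (length (senc T) + total_length (map senc Ss))
       / lg (INR (N.to_nat NN))))%R /\
   query_output t c w (senc T) st1 st3.
Proof.
 intros t c tau Ht.
 (* With [B = c * w], a window of [2 * c + 2] words holds any token. A single append has at most one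
    such window, or [3 * b + 2 * run_bits t b + 4] bits from the table, which with [b <= 2 * w] is
    at most [(4 * t + 34) * w]; [R] words cover both. Registers of [K' + 1] words hold a key
    together with the other fields and a window next to the output buffer. *)
 set (K' := (24 * scale t + 4 * c + 8 * t + 200)%nat). set (G := num_words c). set (R := (2 * c + 4 * t + 40)%nat).
 set (B0 := ((t + 5) * num_words c)%nat).
 set (cp := ccost tau B0 (t + 2) K' (PRE t)). set (cq := ccost tau B0 (t + 2) K' (QUERY t G R)).
 set (lp := plen tau (copies t c K' [(vw, 0%nat); (pN, 1%nat); (vq, 3%nat); (pI, 4%nat)])).
 set (lq := (plen tau (copies t c K' (map (fun i => (qln i, i)) (seq 0 t))) +
  plen tau (p_move (block c 0) (firstn (num_words c) (vregs B0 K' qL))))%nat).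
 set (C1 := (4 + lp + cp + cp * N.to_nat (pre_const t))%nat).
 set (C2 := (2 + lq + 4 * cq + 16 * cq * scale t)%nat).
 exists (PREP t c K'), (ANSWER t c K' G R), (C1 + C2)%nat.
 intros w sigma q NN M Hsig Hq HNN st (Hwf & E0 & E1 & _ & E3 & E4).
 assert (Hw : 1 <= w).
 { destruct (N.eq_dec w 0) as [->|]; [|lia]. rewrite N.pow_0_r in HNN. lia. }
 set (W := VW w K'). assert (HW : W = w * (N.of_nat K' + 1)) by (unfold W, VW, K; lia).
 assert (HKe : N.of_nat K' = 24 * N.of_nat (scale t) + 4 * N.of_nat c + 8 * N.of_nat t + 200) by (unfold K'; lia).
 assert (HsK : N.of_nat (scale t) = N.of_nat (t * (t + 7)) + N.of_nat t + 6) by (unfold scale; lia).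
 set (P := N.of_nat (t * (t + 7))) in *. set (tN := N.of_nat t) in *. set (cN := N.of_nat c) in *.
 assert (HWe : W = 24 * (P * w) + 32 * (tN * w) + 4 * (cN * w) + 345 * w) by (rewrite HW, HKe, HsK; ring).
 assert (HWbig : 64 * W <= 2 ^ W) by (apply big_width; lia).
 assert (HK : (num_words c <= K K')%nat) by (unfold num_words, K, K'; lia).
 assert (HWK : (24 * N.of_nat (scale t) + cN + 24) * w <= W) by (rewrite HsK; lia).
 assert (Hq0 : 0 < q) by (pose proof (tr_init_lt _ _ _ M); lia).
 assert (HGe : N.of_nat G * w = 2 * (cN * w) + 2 * w) by (unfold G, num_words, cN; lia).
 assert (HRe : N.of_nat R * w = 2 * (cN * w) + 4 * (tN * w) + 40 * w) by (unfold R, cN, tN; lia).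
 destruct (PREP_spec w Hw (tr_step M) tau t c K' HK
  (fun n s' => exists b, b_ok w t NN b /\ lg2ok b s' /\
    (forall a k, a < q -> k < 2 ^ key_bits t b -> entry W (tr_step M) t b s' a k) /\
    jump_data b q (gz W (tr_step M) t q) (oz W (tr_step M) t) s' /\
    dm s' (aP 0%nat) 0 0 = w /\ dm s' (aP 1%nat) 0 0 = b /\ dm s' (aP 2%nat) 0 0 = run_bits t b /\
    dm s' (aP 3%nat) 0 0 = tr_init M /\ N.of_nat n <= pre_const t * (q * NN))
  st NN q (tr_init M) Hwf E0 E1 E3 E4 (cells_ok_pre t)) as (T1 & st1 & n1 & s1 & X1 & HQ1 & HT1 & Hm1 & Hd1).
 { intros s V1 V2 V3 V4. rewrite <- V4. apply (PRE_spec w W (tr_step M) t c q NN HWbig Hw Hq0 Hq HNN HWK s V1 V2 V3). }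
 destruct HQ1 as (b & (Hb1 & Hb2 & _ & _) & D1 & D2 & D3 & D4 & D5 & D6 & D7 & Hn1).
 exists T1, st1. split; [exact X1|]. split.
 { fold B0 cp lp in HT1. assert (HZ : 1 <= q * NN) by (rewrite <- (N.mul_1_l 1); apply N.mul_le_mono; lia).
  apply (N.le_trans _ (N.of_nat C1 * (q * NN))); [|apply N.mul_le_mono_r; lia].
  pose proof (linear_cost (4 + N.of_nat lp) (N.of_nat cp) _ _ _ HZ Hn1) as HC.
  replace (N.of_nat C1) with (4 + N.of_nat lp + N.of_nat cp + N.of_nat cp * pre_const t) by (unfold C1; lia). lia. }
 intros n Ss T Hn HSs HS (HT & sq & Hs0 & Hsq) st2 (Hwf2 & Hsd & Hin).
 set (B := cN * w) in *.
 assert (Hb3 : b <= 2 * w) by lia.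
 assert (Hbeta : run_bits t b = tN * b + 6 * b) by (unfold run_bits, tN; lia).
 assert (Htot : key_bits t b = P * b) by (unfold key_bits, fld_bits, run_bits, P; rewrite Nat2N.inj_mul; lia).
 assert (HPb : P * b <= P * (2 * w)) by (apply N.mul_le_mono_l; auto).
 assert (Htb : tN * b <= tN * (2 * w)) by (apply N.mul_le_mono_l; auto).
 clearbody P tN. rewrite (N.mul_assoc P), (N.mul_comm P 2), <- N.mul_assoc in HPb. rewrite (N.mul_assoc tN), (N.mul_comm tN 2), <- N.mul_assoc in Htb.
 assert (HWb : 4 * b + 2 * run_bits t b + key_bits t b + 16 <= W) by (rewrite Hbeta, Htot; lia).
 assert (HqW : 4 * (q * 2 ^ b) <= 2 ^ W).
 { transitivity (2 ^ (2 + (cN * w + b))); [|apply N.pow_le_mono_r; lia].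
  rewrite !N.pow_add_r. change (2 ^ 2) with 4. apply N.mul_le_mono_l, N.mul_le_mono_r. auto. }
 assert (HMW : N.of_nat G * w + w + 1 <= W) by lia.
 assert (Hlen : forall i, (i < t)%nat -> nth i (map senc Ss) [] = senc (nth i Ss [])).
 { intros i Hi. apply (map_nth senc Ss [] i). }
 (* The length of an input is handed over in a block of [G] words, which bounds it by
    [2 ^ (G * w)]. *)
 assert (HLS : forall i, (i < t)%nat -> N.of_nat (length (senc (nth i Ss []))) + N.of_nat G * w + w < 2 ^ W).
 { intros i Hi. destruct (Hin i Hi) as [El _]. rewrite Hlen in El by auto. rewrite <- El.
  pose proof (get_num_lt w Hw st2 (block c i) (proj1 Hwf2)) as Hl. unfold block in Hl at 2. rewrite length_seq in Hl. fold G in Hl.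
  rewrite (N.mul_comm w) in Hl. pose proof (N.pow_gt_lin_r 2 (N.of_nat G * w + w) ltac:(lia)) as Hp.
  assert (2 ^ (N.of_nat G * w) <= 2 ^ (N.of_nat G * w + w)) by (apply N.pow_le_mono_r; lia).
  assert (2 ^ (N.of_nat G * w + w + 1) <= 2 ^ W) by (apply N.pow_le_mono_r; lia). rewrite (N.pow_add_r 2 (N.of_nat G * w + w) 1) in H0. lia. }
 assert (HsigT : Forall (fun u => u < 2 ^ B) T).
 { apply Forall_nth. intros i d Hi. rewrite (nth_indep _ d 0) by auto.
  assert (HsW : sigma <= 2 ^ W) by (transitivity (2 ^ B); [auto|apply N.pow_le_mono_r; lia]).
  assert (HqW1 : q <= 2 ^ W).
  { apply (N.le_trans _ (q * 2 ^ b)); [|lia]. rewrite <- (N.mul_1_r q) at 1. apply N.mul_le_mono_l, pow2_1. }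
  pose proof (T_lt t sigma q M W n Ss T sq Ht HsW HqW1 HSs HS HT Hs0 Hsq i ltac:(lia)). lia. }
 (* At most [2 * B + 2] bits for each of at most [2 ^ B] symbols amount to at most [2 ^ (2 * B + 1)]
    bits, below the capacity of a block of [2 * c + 2] words. *)
 assert (HLT : N.of_nat (length (senc T)) < 2 ^ (w * N.of_nat (num_words c))).
 { pose proof (senc_from_length B T HsigT 0) as Hl. fold (senc T) in Hl. rewrite HT in Hl.
  assert (HB1 : B + 1 <= 2 ^ B) by (pose proof (N.pow_gt_lin_r 2 B ltac:(lia)); lia).
  assert ((2 * B + 2) * N.of_nat n <= 2 * 2 ^ B * 2 ^ B) by (apply N.mul_le_mono; lia).
  assert (2 * 2 ^ B * 2 ^ B = 2 ^ (1 + B + B)) by (rewrite !N.pow_add_r; reflexivity).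
  assert (2 ^ (1 + B + B) < 2 ^ (w * N.of_nat (num_words c))) by (apply N.pow_lt_mono_r; [lia|]; fold G; rewrite (N.mul_comm w), HGe; fold B; lia). lia. }
 destruct (ANSWER_spec w Hw (tr_step M) tau t c K' HK G R
  (fun m s' => N.of_nat m * b <= 8 * (nsum t (fun i => 2 * N.of_nat (length (senc (nth i Ss [])))) + N.of_nat (length (senc T))) + 3 * b /\
    env s' qL = N.of_nat (length (senc T)) /\
    forall x, (x < length (senc T))%nat -> bitat w s' t (N.of_nat x) = nth x (senc T) false)
  (dm s1) (fun i => N.of_nat (length (senc (nth i Ss [])))) st2 Hwf2)
  as (T2 & st3 & m & s3 & X3 & (Hm & HL & Hbits) & HT2 & Hout & Hcm & Hkeep).
 { rewrite Hsd by lia. auto. }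
 { intros A i j Hi. rewrite Hd1 by auto. symmetry. apply cnum_same. intros k a Hk. apply Hsd. lia. }
 { intros i Hi. rewrite <- Hlen by auto. apply Hin; auto. }
 { apply cells_ok_query. }
 { apply store_free_query. }
 { intros s Hs1 Hs2 Hs3.
  eapply (QUERY_spec t sigma q M w W n Ss T sq G R b B Ht HSs HS HT Hs0 Hsq HWbig Hw); auto; try (rewrite Hs1; auto; fail).
  - rewrite !N.mul_add_distr_r, HGe, HRe. lia.
  - lia.
  - rewrite HGe. fold B. lia.
  - rewrite HGe. lia.
  - rewrite HGe, HRe. lia.
  - rewrite Hbeta, HRe. lia.
  - eapply N.lt_le_trans; [exact HLT|]. apply N.pow_le_mono_r; [lia|]. fold G. lia.
  - intros v Hv. rewrite Hs1. apply D1; auto.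
  - intros a k Ha Hk. eapply entry_ext; [exact HWbig|lia|exact HWb| |apply (D2 a k Ha Hk)]. intros. rewrite Hs1. auto.
  - eapply jump_data_ext with (s := s1); eauto; try lia. intros. rewrite Hs1. auto.
  - intros i a Hi. rewrite Hs3 by lia. apply Hwf2.
  - intros i x Hi Hx. unfold bitat. rewrite Hs3 by lia. destruct (Hin i Hi) as [_ Hbm]. rewrite Hlen in Hbm by auto. apply Hbm. auto. }
 { intros k s (_ & -> & _). auto. }
 exists T2, st3. split; [exact X3|]. split; [|split; [|split]].
 - assert (Hsum : nsum t (fun i => 2 * N.of_nat (length (senc (nth i Ss [])))) = 2 * N.of_nat (total_length (map senc Ss))).
  { rewrite nsum_mul, <- HSs at 1. rewrite (nsum_list (fun S => length (senc S))) by reflexivity.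
   unfold total_length. rewrite map_map. reflexivity. }
  rewrite Hsum in Hm. set (L := (length (senc T) + total_length (map senc Ss))%nat).
  assert (Hm2 : N.of_nat m * b <= 16 * N.of_nat L + 3 * b) by (unfold L; lia).
  destruct (lg_bounds NN (N.of_nat (scale t) * b) ltac:(lia) Hb2) as [Hlg0 Hlg1].
  set (l := lg (INR (N.to_nat NN))) in *.
  assert (HmR : (INR m * INR (N.to_nat b) <= 16 * INR L + 3 * INR (N.to_nat b))%R).
  { assert (Hnat : (m * N.to_nat b <= 16 * L + 3 * N.to_nat b)%nat) by lia.
   apply le_INR in Hnat. rewrite plus_INR, !mult_INR in Hnat. cbn [INR] in Hnat. lra. }
  replace (N.to_nat (N.of_nat (scale t) * b)) with (scale t * N.to_nat b)%nat in Hlg1 by lia. rewrite mult_INR in Hlg1.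
  assert (Hb0 : (1 <= INR (N.to_nat b))%R) by (apply (le_INR 1); lia).
  set (bR := INR (N.to_nat b)) in *. set (kR := INR (scale t)) in *. set (LR := INR L) in *.
  assert (HLR : (0 <= LR)%R) by apply pos_INR.
  (* The choice of [b] gives [l <= kR * bR], which turns the number of bits divided by [b] into a
     constant times their number divided by [lg NN]. The 16 is 8 times the weight 2 of input
     bits. *)
  assert (HmR2 : (INR m <= 16 * kR * (LR / l) + 3)%R).
  { assert (Hlb : (LR / bR <= kR * (LR / l))%R).
   { apply Rmult_le_reg_r with (bR * l)%R; [nra|].
    replace (LR / bR * (bR * l))%R with (LR * l)%R by (field; lra).
    replace (kR * (LR / l) * (bR * l))%R with (LR * (kR * bR))%R by (field; lra). apply Rmult_le_compat_l; auto. }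
   assert (Hmb : (INR m <= 16 * (LR / bR) + 3)%R).
   { apply Rmult_le_reg_r with bR; [lra|]. replace ((16 * (LR / bR) + 3) * bR)%R with (16 * LR + 3 * bR)%R by (field; lra). auto. }
   lra. }
  assert (HT2R : (INR T2 <= 2 + INR lq + INR cq * (1 + INR m))%R).
  { assert (Hnat : (T2 <= 2 + lq + cq * (1 + m))%nat) by (unfold lq, cq, B0; lia).
   apply le_INR in Hnat. rewrite !plus_INR, mult_INR, plus_INR in Hnat. cbn [INR] in Hnat. lra. }
  assert (HC : (INR (C1 + C2) = INR C1 + (2 + INR lq + 4 * INR cq + 16 * INR cq * kR))%R).
  { unfold C2, kR. rewrite !plus_INR, !mult_INR. cbn [INR]. lra. }
  rewrite HC. pose proof (pos_INR C1). pose proof (pos_INR lq). pose proof (pos_INR cq) as Hcq. assert (0 <= kR)%R by apply pos_INR.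
  assert (Hx : (0 <= LR / l)%R) by (apply Rmult_le_pos; [auto|left; apply Rinv_0_lt_compat; auto]).
  set (x := (LR / l)%R) in *.
  assert (INR cq * (1 + INR m) <= INR cq * (16 * kR * x + 4))%R by (apply Rmult_le_compat_l; [auto|lra]).
  assert (0 <= INR cq * kR)%R by (apply Rmult_le_pos; auto).
  assert (0 <= (INR C1 + (2 + INR lq + 4 * INR cq)) * x)%R by (apply Rmult_le_pos; lra).
  nra.
 - intros k a Hk. rewrite Hkeep, Hsd by lia. auto.
 - rewrite Hout. auto.
 - intros x Hx. rewrite Hcm by lia. apply Hbits. auto.
Qed.
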